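(* Let $\Gamma_\tau<\mathrm{SA}(\mathbb A^{d+1})$ be an affine deformation of a subgroup $\Gamma<\mathrm{SL}(\mathbb V^{d+1})$ dividing a proper open convex cone $\mathcal C\subset\mathbb V^{d+1}$, and work in the coordinates described in the context. Let $K=K_s$ be a $\tau$-convex domain with support function $s:\Omega^*\to\mathbb R$, and let $f:\Omega^*\to\mathbb R$ be a continuous $\Gamma$-equivariant function (so that $f/\omega_{\mathcal C}$ is $\Gamma$-invariant). Then $$\frac{\mathrm{covol}(K_{s+tf})-\mathrm{covol}(K)}{t}\xrightarrow[t\to0]{}\int_{\Omega^*/\Gamma}\frac{f}{\omega_{\mathcal C}}\,\mathrm d\mathrm A(K/\Gamma_\tau).$$
   Context: Setting: $d\ge2$; $\mathbb V^{d+1}$ is an oriented $(d+1)$-dimensional real vector space with a linear volume form; $\mathbb A^{d+1}$ is the real affine space with translation space $\mathbb V^{d+1}$, with the induced volume measure $\mathrm{vol}$. $\mathrm{SL}(\mathbb V^{d+1})$ and $\mathrm{SA}(\mathbb A^{d+1})$ are the groups of volume preserving linear, resp. affine, automorphisms. A convex cone is proper if it is non-empty and its closure contains no entire line. $\mathcal C^*=\mathrm{int}\{\varphi\in(\mathbb V^{d+1})^*:\varphi(v)\le0\ \forall v\in\mathcal C\}$. A point $[\varphi]\in\mathbb P(\mathcal C^* )$ is identified with $\ker\varphi$, regarded as a direction of affine hyperplanes. A convex domain is a non-empty open convex set; a supporting hyperplane of it is an affine hyperplane $H$ with $H\cap K=\emptyset$, $H\cap\partial K\ne\emptyset$. A $\mathcal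 C$-convex domain is a convex domain $K\subset\mathbb A^{d+1}$ with $K+\mathcal C=K$ whose set of directions of supporting hyperplanes contains $\mathbb P(\mathcal C^* )$ and is contained in $\overline{\mathbb P(\mathcal C^* )}$. Coordinates and affine sphere: fix an origin and a positively oriented unit-volume basis so that $\mathbb A^{d+1}\simeq\mathbb V^{d+1}\simeq\mathbb R^{d+1}$ and $\mathcal C=\{t(x,1):x\in\Omega,t>0\}$ with $\Omega\subset\mathbb R^d$ bounded open convex containing $0$. Then $\mathcal C^*=\{t(y,-1):y\in\Omega^*,t>0\}$ with $\Omega^*=\{y:x\cdot y<1\ \forall x\in\overline\Omega\}$, and $\mathbb P(\mathcal C^* )\simeq\Omega^*$. Let $\omega_{\mathcal C}:\Omega^*\to(-\infty,0)$ be the unique smooth convex function with $\det\mathrm{Hess}\,\omega=(-\omega)^{-d-2}$ in $\Omega^*$ and $\omega|_{\partial\Omega^*}=0$, and $N_{\Sigma_{\mathcal C}}(y)=(\nabla\omega_{\mathcal C}(y),\nabla\omega_{\mathcal C}(y)\cdot y-\omega_{\mathcal C}(y))$, which parametrises the Cheng--Yau affine sphere $\Sigma_{\mathcal C}$. The support function of a $\mathcal C$-convex domain $K$ is the convex function $s_K(y)=\sup_{X\in K}X\cdot(y,-1)$, $y\in\Omega^*$. Area measure: for a $\mathcal C$-convex domain $K$ and Borel $b\subseteq\mathbb P(\mathcal C^* )$, let $\mathcal N_\varepsilon(K)(b)$ be the set of points $P+tN_{\Sigma_{\mathcal C}}[\varphi]$ with $[\varphi]\in b$, $t\in(0,\varepsilon)$,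 and $P\in\partial K$ a point at which $K$ has a supporting hyperplane of direction $[\varphi]$; $V_\varepsilon(K)(b)=\mathrm{vol}(\mathcal N_\varepsilon(K)(b))$. There are unique Radon measures $S_i(K)$ on $\mathbb P(\mathcal C^* )$ with $V_\varepsilon(K)=\frac1{d+1}\sum_{i=0}^d\varepsilon^{d+1-i}\binom{d+1}iS_i(K)$ for all $\varepsilon>0$; $\mathrm A(K)=S_d(K)$. Groups: $\Gamma$ divides $\mathcal C$ if it preserves $\mathcal C$ and acts freely, properly discontinuously and cocompactly on $\mathbb P(\mathcal C)$; then it acts so on $\mathbb P(\mathcal C^* )\simeq\Omega^*$ via $\gamma*[\varphi]=[\varphi\circ\gamma^{-1}]$. An affine deformation is a subgroup $\Gamma_\tau<\mathrm{SA}(\mathbb A^{d+1})$ such that taking linear parts is an isomorphism $\Gamma_\tau\to\Gamma$; in coordinates $\Gamma_\tau=\{X\mapsto\gamma X+\tau(\gamma):\gamma\in\Gamma\}$. A $\tau$-convex domain is a $\Gamma_\tau$-invariant $\mathcal C$-convex domain. A function $g:\Omega^*\to\mathbb R$ is $\tau$-equivariant if $g(y)=\frac{\omega_{\mathcal C}(y)}{\omega_{\mathcal C}(\gamma^{-1}*y)}g(\gamma^{-1}*y)+\tau(\gamma)\cdot(y,-1)$ for all $y\in\Omega^*,\gamma\in\Gamma$; $\Gamma$-equivariant means this with $\tau=0$. Support functions of $\tau$-convex domains are $\tau$-equivariant. There is a continuous function $g_\tau$ on $\partial\Omega^*$ such that every continuous $\tau$-equivariant function extends continuously to $\overline{\Omega^*}$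 by $g_\tau$. For a continuous $\tau$-equivariant $g$ (so extended), $K_g=\{X\in\mathbb R^{d+1}:X\cdot(y,-1)<g(y)\ \forall y\in\overline{\Omega^*}\}$, which is a $\tau$-convex domain whose support function is the convex hull of $g$; $K_{s_K}=K$. There is a $\tau$-convex domain $D_\tau$ containing all others, on which $\Gamma_\tau$ acts freely and properly discontinuously. The covolume $\mathrm{covol}(K)$ of a $\tau$-convex domain $K$ is the volume (for the volume induced by $\mathrm{vol}$) of the complement of $K/\Gamma_\tau$ in $D_\tau/\Gamma_\tau$. $\mathrm A(K/\Gamma_\tau)$ is the finite measure on $\Omega^*/\Gamma$ to which the $\Gamma$-invariant measure $\mathrm A(K)$ descends. *)

(* Defs.v *)
From mathcomp Require Import all_boot all_order all_algebra.
From mathcomp Require Import all_classical all_reals all_analysis.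

Set Implicit Arguments.
Unset Strict Implicit.
Unset Printing Implicit Defensive.

Import Order.TTheory GRing.Theory Num.Theory.
Import numFieldNormedType.Exports.

Local Open Scope classical_set_scope.
Local Open Scope ring_scope.

Section euclidean.
Variables (R : realType) (n : nat).
Implicit Types (x y : 'cV[R]_n) (A : set 'cV[R]_n) (f : 'cV[R]_n -> R).

Definition dot x y : R := \sum_i x i 0 * y i 0.

Definition boundary A : set 'cV[R]_n := closure A `\` A°.

Definition convex_domain A : Prop :=
  [/\ A !=set0, open A & convex_set (A : set (convex_lmodType 'cV[R]_n))].

Definition borel : Type := g_sigma_algebraType (@open 'cV[R]_n).

Definition borel_set A : Prop := (@open 'cV[R]_n).-sigma.-measurable A.

(* n-dimensional Lebesgue (outer) measure, from countable covers by boxes. *)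
Definition box x y : set 'cV[R]_n := [set z | forall i, x i 0 <= z i 0 <= y i 0].

Definition vol A : \bar R :=
  ereal_inf [set (\sum_(k <oo) (\prod_i ((b k).2 i 0 - (b k).1 i 0))%:E)%E | b in
    [set b : ('cV[R]_n * 'cV[R]_n)^nat |
      (forall k i, (b k).1 i 0 <= (b k).2 i 0) /\
      A `<=` \bigcup_k box (b k).1 (b k).2]].

Definition basis_vec (i : 'I_n) : 'cV[R]_n := delta_mx i 0.

Definition gradient f y : 'cV[R]_n := \col_i 'D_(basis_vec i) f y.

Definition hessian f y : 'M[R]_n :=
  \matrix_(i, j) 'D_(basis_vec j) ('D_(basis_vec i) f) y.

Fixpoint iter_derive f (vs : seq 'cV[R]_n) : 'cV[R]_n -> R :=
  if vs is v :: vs' then 'D_v (iter_derive f vs') else f.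

Definition smooth_on A f : Prop :=
  forall vs y, A y -> differentiable (iter_derive f vs) y.

(* Continuous extension of a function from an open set to its closure. *)
Definition extend A f y : R :=
  if pselect (A y) then f y else lim (f z @[z --> within A (nbhs y)]).

End euclidean.

Section quotient.
Variables (R : realType) (n : nat) (I : Type).
Local Notation V := 'cV[R]_n.
Variables (G : set I) (act : I -> V -> V).

Definition group_orbit (x : V) : set V := [set act g x | g in G].

(* X / G, as a set of orbits. *)
Definition quotient_set (X : set V) : set (set V) := group_orbit @` X.

(* When X is Borel, the generating family is already a sigma-algebra: the
   quotient of the Borel sigma-algebra of X. *)
Definition quotient_space (X : set V) : Type :=
  g_sigma_algebraType
    [set B : set (set V) | borel_set (X `&` group_orbit @^-1` B)].

(* The measure mu on X descends to nu on X / G: the projection X -> X / G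
   carries mu to nu on every Borel set on which it is injective. *)
Definition descends (X : set V) (mu : set V -> \bar R)
    (nu : set (quotient_space X) -> \bar R) : Prop :=
  forall B : set V, borel_set B -> B `<=` X -> set_inj B group_orbit ->
    nu (group_orbit @` B) = mu B.

(* The function on orbits induced by a G-invariant function. *)
Definition quotient_fun (h : V -> R) (o : set V) : R := h (xget 0 o).

End quotient.

Section groups.
Variables (R : realType) (n : nat).
Local Notation V := 'cV[R]_n.

Definition SL_subgroup (G : set 'M[R]_n) : Prop :=
  [/\ forall g, G g -> \det g = 1,
      G 1%:M,
      forall g h, G g -> G h -> G (g *m h) &
      forall g, G g -> G (invmx g)].

(* The pair (A, v) stands for the affine map X |-> A X + v. *)
Definition affmap : Type := ('M[R]_n * V)%type.

Definition aff_act (g : affmap) (X : V) : V := g.1 *m X + g.2.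

Definition SA_subgroup (G : set affmap) : Prop :=
  [/\ forall g, G g -> \det g.1 = 1,
      G (1%:M, 0),
      forall g h, G g -> G h -> G (g.1 *m h.1, g.1 *m h.2 + g.2) &
      forall g, G g -> G (invmx g.1, - (invmx g.1 *m g.2))].

Definition affine_deformation (Gt : set affmap) (G : set 'M[R]_n) : Prop :=
  SA_subgroup Gt /\ set_bij Gt G fst.

End groups.

Section cone_convex.
Variables (R : realType) (n : nat).
Local Notation V := 'cV[R]_n.
Implicit Types (C K H : set V) (phi : V).

(* Covectors are identified with vectors through the dot product. *)
Definition dual_cone C : set V := [set phi | forall v, C v -> dot phi v <= 0]°.

(* A subset of the projective space is represented by the set of all nonzero
   representatives of its points. *)
Definition proj C : set V :=
  [set phi | phi != 0 /\ exists2 a : R, a != 0 & C (a *: phi)].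

Definition hyperplane phi (c : R) : set V := [set X | dot phi X = c].

Definition supporting K H : Prop :=
  H `&` K = set0 /\ H `&` boundary K !=set0.

Definition directions K : set V :=
  [set phi | phi != 0 /\ exists c, supporting K (hyperplane phi c)].

Definition cone_convex C K : Prop :=
  [/\ convex_domain K,
      [set X + v | X in K & v in C] = K,
      proj (dual_cone C) `<=` directions K &
      directions K `<=` closure (proj (dual_cone C))].

Definition tau_convex C (Gt : set (affmap R n)) K : Prop :=
  cone_convex C K /\ forall g, Gt g -> aff_act g @` K = K.

Definition greatest_tau_convex C (Gt : set (affmap R n)) D : Prop :=
  tau_convex C Gt D /\ forall K, tau_convex C Gt K -> K `<=` D.

(* nu is the volume measure of D / Gt. *)
Definition covolume (Gt : set (affmap R n)) D
    (nu : set (quotient_space Gt (@aff_act R n) D) -> \bar R) K : \bar R :=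
  nu (quotient_set Gt (@aff_act R n) D `\` quotient_set Gt (@aff_act R n) K).

End cone_convex.

Section coordinates.
Variables (R : realType) (d : nat).
Local Notation V := 'cV[R]_(d + 1).
Implicit Types (O K : set 'cV[R]_d) (g : 'M[R]_(d + 1)).

Definition lift1 (x : 'cV[R]_d) (c : R) : V := col_mx x c%:M.

Definition cone O : set V :=
  [set v | exists x t, [/\ O x, 0 < t & v = t *: lift1 x 1]].

Definition dual_domain O : set 'cV[R]_d :=
  [set y | forall x, closure O x -> dot x y < 1].

Definition last_coord (v : V) : R := (dsubmx v) 0 0.

(* Action on P(C) in the chart x |-> [(x, 1)]. *)
Definition proj_act g (x : 'cV[R]_d) : 'cV[R]_d :=
  let v := g *m lift1 x 1 in (last_coord v)^-1 *: usubmx v.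

(* Action [phi] |-> [phi \o g^-1] on P(C^* ) in the chart y |-> [(y, -1)]. *)
Definition dual_act g (y : 'cV[R]_d) : 'cV[R]_d :=
  let w := (invmx g)^T *m lift1 y (-1) in (- last_coord w)^-1 *: usubmx w.

Definition divides (G : set 'M[R]_(d + 1)) O : Prop :=
  [/\ forall g, G g -> mulmx g @` cone O = cone O,
      forall g x, G g -> O x -> proj_act g x = x -> g = 1%:M,
      forall Q, compact Q -> Q `<=` O ->
        finite_set [set g | G g /\ (proj_act g @` Q) `&` Q !=set0] &
      exists Q, [/\ compact Q, Q `<=` O &
        O `<=` \bigcup_(g in G) (proj_act g @` Q)]].

(* Os stands for the dual domain of the cone. *)
Variable Os : set 'cV[R]_d.

Definition cheng_yau (omega : 'cV[R]_d -> R) : Prop :=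
  [/\ smooth_on Os omega,
      convex_function (Os : set (convex_lmodType 'cV[R]_d)) omega,
      forall y, Os y -> omega y < 0 /\
        \det (hessian omega y) = (- omega y) ^- (d + 2) &
      {within closure Os, continuous omega} /\
      forall y, boundary Os y -> omega y = 0].

Definition tau_equivariant (omega : 'cV[R]_d -> R) (G : set 'M[R]_(d + 1))
    (tau : 'M[R]_(d + 1) -> V) (f : 'cV[R]_d -> R) : Prop :=
  forall g y, G g -> Os y ->
    f y = omega y / omega (dual_act (invmx g) y) * f (dual_act (invmx g) y)
          + dot (tau g) (lift1 y (-1)).

Definition support_fun (K : set V) (y : 'cV[R]_d) : R :=
  sup [set dot X (lift1 y (-1)) | X in K].

Definition domain_of (f : 'cV[R]_d -> R) : set V :=
  [set X | forall y, closure Os y -> dot X (lift1 y (-1)) < extend Os f y].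

Variable omega : 'cV[R]_d -> R.

Definition affine_normal (y : 'cV[R]_d) : V :=
  lift1 (gradient omega y) (dot (gradient omega y) y - omega y).

Definition normal_nbhd (K : set V) (e : R) (b : set 'cV[R]_d) : set V :=
  [set X | exists P y t,
    [/\ b y, 0 < t < e, boundary K P,
        supporting K (hyperplane (lift1 y (-1)) (dot (lift1 y (-1)) P)) &
        X = P + t *: affine_normal y]].

(* Radon measures on the open set Os are encoded as Borel measures on the
   ambient space, of which only the restriction to Os is ever used. *)
Definition steiner_measures (K : set V)
    (S : 'I_d.+1 -> {measure set (borel R d) -> \bar R}) : Prop :=
  (forall i Q, compact Q -> Q `<=` Os -> (S i Q < +oo)%E) /\
  (forall (e : R) b, 0 < e -> borel_set b -> b `<=` Os ->
    vol (normal_nbhd K e b) =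
    (((d.+1)%:R^-1)%:E * \sum_(i < d.+1)
      (e ^+ (d.+1 - i) * 'C(d.+1, i)%:R)%:E * S i b)%E).

Definition area_measure (K : set V) (A : {measure set (borel R d) -> \bar R})
    : Prop :=
  exists2 S, steiner_measures K S & A = S ord_max.

End coordinates.

(* Main.v *)
(* Write xi(y) = (y, -1) and let s be the support function of K. For X in D_tau
   let M(X) be the set of the y maximizing (X.xi(y) - s(y)) / |omega(y)|. For X in
   K it consists of the unique y such that X = P + t N(y) with P in the boundary
   of K and y the direction of a supporting hyperplane at P; outside of K it is a
   single point up to a null set. As M is equivariant, a Borel fundamental domain
   b of Gamma in Omega^* gives covol(K') = vol((D_tau \ K') /\ M^-1(b)).

   K_{s+tf} is the epigraph of F_t(x) = max_y (x.y - s(y) - t f(y)), and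
   F_t(x) = F_0(x) - t f(y(x)) + o(t) for almost all x, where y(x) is the
   maximizer for t = 0. If the boundary of b is negligible, Fubini's theorem and
   dominated convergence yield -int f(y(x)) 1_b(y(x)) dx as the derivative of the
   covolume. The same computation with f = omega and sets c other than b gives
   the first order term of V_eps(K)(c), so that A(K) is the image under x |-> y(x)
   of -omega(y(x)) dx, and the derivative is the integral of f / omega over b.

   For the continuity of s up to the boundary: s - C omega is concave at a
   definite scale, so s is bounded above by the minimum principle on chords;
   moving this bound by the group gives affine functions above s that are close
   to s near a given boundary point. *)

(* The equivariance of [omega] is derived, by a maximum principle for the Monge-Ampere equation, and
   the invariance of the area measure is read off from [descends], since a set and its translate
   have the same image in the quotient. Two maximizers are in play because each lacks something. M
   is equivariant, so it cuts out a fundamental domain, but it does not give heights; y(x) gives the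
   derivative of the height, but is tied to the chart. They meet on the boundary of K: over a point
   x whose unique maximizer y is in Omega^*, M of the boundary point is {y}, and semicontinuity of M
   then tells whether the points between two nearby graphs belong to M^-1(b). There is a threat of
   circularity: the derivative requires a boundary that is negligible for the image of the Lebesgue
   measure, and this image is compared with A(K) by the same derivative. It is avoided because,
   among uncountably many disjoint sets, all but countably many are null: this provides the radii of
   the cells that make up b, null for A(K), and those of the thickenings of compact sets, null for
   the image, from which the two measures are identified on Borel sets. *)
Require Import Defs.
From HB Require Import structures.
From mathcomp Require Import all_boot all_order all_algebra.
From mathcomp Require Import all_classical all_reals all_analysis measurable_realfun.
From mathcomp Require Import ring lra.
Import Order.TTheory GRing.Theory Num.Theory.
Import numFieldNormedType.Exports.
Local Open Scope classical_set_scope.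
Local Open Scope ring_scope.

Set Implicit Arguments.
Unset Strict Implicit.
Unset Printing Implicit Defensive.


(* [lra] reads every hypothesis of the context, so the relevant ones are first
   moved to the goal and the other ones are dropped. *)
Ltac lra_goal :=
  repeat match goal with
  | H : is_true _ |- _ => clear H
  | H : _ /\ _ |- _ => clear H
  | H : @eq _ _ _ |- _ => clear H
  end; lra.

(** * Column vectors and the affine chart *)

Section vectors.
Context {R : realType} {n : nat}.
Implicit Types (x y z : 'cV[R]_n) (a c : R).

Lemma dotC x y : dot x y = dot y x.
Proof. by apply: eq_bigr => i _; rewrite mulrC. Qed.

Lemma dotDl x y z : dot (x + y) z = dot x z + dot y z.
Proof. by rewrite -big_split; apply: eq_bigr => i _; rewrite mxE mulrDl. Qed.

Lemma dotZl a x y : dot (a *: x) y = a * dot x y.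
Proof. by rewrite /dot mulr_sumr; apply: eq_bigr => i _; rewrite mxE mulrA. Qed.

Lemma dotDr x y z : dot x (y + z) = dot x y + dot x z.
Proof. by rewrite dotC dotDl !(dotC x). Qed.

Lemma dotZr a x y : dot x (a *: y) = a * dot x y.
Proof. by rewrite dotC dotZl dotC. Qed.

Lemma dotNl x y : dot (- x) y = - dot x y.
Proof. by rewrite -scaleN1r dotZl mulN1r. Qed.

Lemma dotNr x y : dot x (- y) = - dot x y.
Proof. by rewrite dotC dotNl dotC. Qed.

Lemma dotBl x y z : dot (x - y) z = dot x z - dot y z.
Proof. by rewrite dotDl dotNl. Qed.

Lemma dotBr x y z : dot x (y - z) = dot x y - dot x z.
Proof. by rewrite dotDr dotNr. Qed.

Lemma dot0l x : dot 0 x = 0.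
Proof. by rewrite -(scale0r 0) dotZl mul0r. Qed.

Lemma dot0r x : dot x 0 = 0.
Proof. by rewrite dotC dot0l. Qed.

Definition dotE := (dotDl, dotDr, dotBl, dotBr, dotZl, dotZr, dotNl, dotNr,
  dot0l, dot0r).

Lemma dot_ge0 x : 0 <= dot x x.
Proof. by apply: sumr_ge0 => i _; rewrite -expr2 sqr_ge0. Qed.

Lemma dot_eq0 x : dot x x = 0 -> x = 0.
Proof.
move=> /eqP; rewrite psumr_eq0; last by move=> i _; rewrite -expr2 sqr_ge0.
move=> /allP h; apply/matrixP => i j; rewrite ord1 mxE.
by have := h i (mem_index_enum _); rewrite mulf_eq0 orbb => /eqP.
Qed.

Lemma dot_gt0 x : x != 0 -> 0 < dot x x.
Proof.
by move=> x0; rewrite lt_neqAle dot_ge0 andbT eq_sym; apply: contra x0 => /eqP/dot_eq0 ->.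
Qed.

Lemma dot_basis x (i : 'I_n) : dot x (basis_vec R i) = x i 0.
Proof.
rewrite /dot (bigD1 i)//= mxE !eqxx mulr1 big1 ?addr0// => j /negbTE ji.
by rewrite mxE ji mulr0.
Qed.

Lemma norm_coord x (i : 'I_n) : `|x i 0| <= `|x|.
Proof.
rewrite (_ : `|x| = mx_norm x)// mx_normrE; apply/bigmax_geP; right => /=.
by exists (i, 0).
Qed.

Lemma norm_leP x c : 0 <= c -> (forall i, `|x i 0| <= c) -> `|x| <= c.
Proof.
move=> c0 h; rewrite (_ : `|x| = mx_norm x)// mx_normrE; apply/bigmax_leP; split => //.
by case=> i j _ /=; rewrite ord1.
Qed.

Lemma dot_le x y : `|dot x y| <= n%:R * `|x| * `|y|.
Proof.
apply: le_trans (ler_norm_sum _ _ _) _.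
apply: (@le_trans _ _ (\sum_(i < n) (`|x| * `|y|))).
  by apply: ler_sum => i _; rewrite normrM ler_pM// norm_coord.
by rewrite sumr_const card_ord -mulrA mulr_natl.
Qed.

Lemma cvg_coordP {T : Type} {F : set_system T} {FF : Filter F}
    (f : T -> 'cV[R]_n) (l : 'cV[R]_n) :
  (forall i, f t i 0 @[t --> F] --> l i 0) -> f t @[t --> F] --> l.
Proof.
move=> h; apply/cvgrPdist_le => e e0.
have H : \forall t \near F, forall i : 'I_n, `|l i 0 - f t i 0| <= e.
  apply: filter_forall => i; have /cvgrPdist_le := h i; exact.
near=> t; apply: norm_leP; first exact: ltW.
by move=> i; rewrite !mxE; move: i; near: t.
Unshelve. all: by end_near. Qed.

Lemma cvg_coord {T : Type} {F : set_system T} {FF : Filter F}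
    (f : T -> 'cV[R]_n) (l : 'cV[R]_n) i :
  f t @[t --> F] --> l -> f t i 0 @[t --> F] --> l i 0.
Proof. by move=> h; apply: (cvg_comp f (fun M : 'cV[R]_n => M i 0) h); exact: coord_continuous. Qed.

Lemma cvg_dot {T : Type} {F : set_system T} {FF : Filter F}
    (f g : T -> 'cV[R]_n) (l m : 'cV[R]_n) :
  f t @[t --> F] --> l -> g t @[t --> F] --> m ->
  dot (f t) (g t) @[t --> F] --> dot l m.
Proof.
move=> fl gm; apply: cvg_big; first by apply: add_continuous.
by move=> i _; apply: cvgM; apply: cvg_coord.
Qed.

Lemma dot_continuousl y : continuous (fun x => dot x y).
Proof.
by move=> x; apply: (@cvg_dot _ (nbhs x) (nbhs_filter x) id (fun=> y)); [exact: cvg_id|exact: cvg_cst].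
Qed.

Lemma dot_continuousr x : continuous (fun y => dot x y).
Proof.
by move=> y; apply: (@cvg_dot _ (nbhs y) (nbhs_filter y) (fun=> x) id); [exact: cvg_cst|exact: cvg_id].
Qed.

(** [bounded_closed_compact] is applied to row vectors; transposition carries the result over. *)
Lemma cV_compact (A : set 'cV[R]_n) : bounded_set A -> closed A -> compact A.
Proof.
move=> bA cA.
have trc : continuous (fun v : 'rV[R]_n => v^T : 'cV[R]_n).
  move=> v; apply: (@cvg_coordP _ (nbhs v) (nbhs_filter v)) => i.
  rewrite mxE (_ : (fun t : 'rV[R]_n => _) = fun t => t 0 i).
    exact: coord_continuous.
  by apply/funext => t; rewrite mxE.
have -> : A = (fun v : 'rV[R]_n => v^T) @` [set v : 'rV[R]_n | A v^T].
  apply/seteqP; split => [x Ax|x [v Av <-]//].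
  by exists x^T; rewrite /= trmxK.
apply: continuous_compact; first exact: continuous_subspaceT.
apply: bounded_closed_compact.
  move: bA => [M [Mr h]]; exists M; split => // r Mr' v /= /(h r Mr').
  move=> hv; rewrite (_ : `|v| = mx_norm v)// mx_normrE; apply/bigmax_leP; split => /=.
    exact: le_trans hv.
  case=> i j _ /=; rewrite ord1; apply: le_trans hv.
  by have := norm_coord v^T j; rewrite mxE.
exact: (closed_comp (f := fun v : 'rV[R]_n => v^T)).
Qed.

Lemma bounded_setP (A : set 'cV[R]_n) c :
  (forall x, A x -> `|x| <= c) -> bounded_set A.
Proof.
move=> h; exists c; split; first exact: num_real.
by move=> r cr x /h; move/le_trans; apply; exact: ltW.
Qed.

Lemma bounded_setE (A : set 'cV[R]_n) :
  bounded_set A -> exists2 c : R, 0 < c & forall x, A x -> `|x| <= c.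
Proof.
move=> [M [Mr h]]; exists (`|M| + 1); first by rewrite ltr_wpDl.
by move=> x Ax; apply: h => //; rewrite (le_lt_trans (ler_norm _))// ltrDl.
Qed.

Lemma compact_boundedE (A : set 'cV[R]_n) :
  compact A -> exists2 c : R, 0 < c & forall x, A x -> `|x| <= c.
Proof. by move=> /compact_bounded /bounded_setE. Qed.

Lemma closureE_ball (A : set 'cV[R]_n) x :
  closure A x <-> forall e : R, 0 < e -> exists2 y, A y & `|x - y| < e.
Proof.
split => [h e e0|h B /nbhs_ballP[e /= e0 eB]].
  have [y [Ay]] := h _ (nbhsx_ballx x e e0).
  by rewrite -ball_normE; exists y.
have [y Ay xy] := h e e0; exists y; split => //; apply: eB.
by rewrite -ball_normE.
Qed.

Lemma openE_ball (A : set 'cV[R]_n) x : open A -> A x ->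
  exists2 e : R, 0 < e & forall y, `|x - y| < e -> A y.
Proof.
move=> oA Ax; have /nbhs_ballP[e /= e0 eB] := open_nbhs_nbhs (conj oA Ax).
by exists e => // y xy; apply: eB; rewrite -ball_normE.
Qed.

Lemma open_ballE (A : set 'cV[R]_n) :
  (forall x, A x -> exists2 e : R, 0 < e & forall y, `|x - y| < e -> A y) -> open A.
Proof.
move=> h; rewrite openE => x Ax; have [e e0 he] := h x Ax.
by apply/nbhs_ballP; exists e => // y; rewrite -ball_normE; exact: he.
Qed.

Lemma interiorE_ball (A : set 'cV[R]_n) x :
  A° x <-> exists2 e : R, 0 < e & forall y, `|x - y| < e -> A y.
Proof.
split => [/nbhs_ballP[e /= e0 eA]|[e e0 eA]].
  by exists e => // y xy; apply: eA; rewrite -ball_normE.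
by apply/nbhs_ballP; exists e => // y; rewrite -ball_normE; exact: eA.
Qed.

Lemma convex_setP (A : set 'cV[R]_n) :
  convex_set (A : set (convex_lmodType 'cV[R]_n)) <->
  forall x y a, A x -> A y -> 0 <= a <= 1 -> A (a *: x + (1 - a) *: y).
Proof.
split => [cA x y a Ax Ay /andP[a0 a1]|h x y l].
  pose p := @Itv01 R a a0 a1.
  have := cA x y p (mem_set Ax) (mem_set Ay).
  by move/set_mem.
move=> /set_mem Ax /set_mem Ay; apply/mem_set.
by apply: h => //; apply/andP; split.
Qed.

Lemma convex_functionP (A : set 'cV[R]_n) (f : 'cV[R]_n -> R) :
  convex_function (A : set (convex_lmodType 'cV[R]_n)) f <->
  forall x y a, A x -> A y -> 0 <= a <= 1 ->
    f (a *: x + (1 - a) *: y) <= a * f x + (1 - a) * f y.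
Proof.
split => [cA x y a Ax Ay /andP[a0 a1]|h l x y].
  exact: (cA (@Itv01 R a a0 a1) x y (mem_set Ax) (mem_set Ay)).
move=> /set_mem Ax /set_mem Ay.
by apply: h => //; apply/andP; split.
Qed.

End vectors.

Section matrices.
Context {R : realType}.

Lemma dot_mulmx {m n : nat} (M : 'M[R]_(m, n)) x y :
  dot (M *m x) y = dot x (M^T *m y).
Proof.
have dotE' k (a b : 'cV[R]_k) : dot a b = (a^T *m b) 0 0.
  by rewrite mxE; apply: eq_bigr => i _; rewrite mxE.
by rewrite !dotE' trmx_mul -mulmxA.
Qed.

Lemma cvg_mulmx {m n : nat} (M : 'M[R]_(m, n)) {T : Type} {F : set_system T}
    {FF : Filter F} (f : T -> 'cV[R]_n) (l : 'cV[R]_n) :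
  f t @[t --> F] --> l -> M *m f t @[t --> F] --> M *m l.
Proof.
move=> fl; apply: cvg_coordP => i; rewrite !mxE.
rewrite (_ : (fun t => _) = fun t => \sum_j M i j * f t j 0); last first.
  by apply/funext => t; rewrite mxE.
apply: cvg_big; first exact: add_continuous.
by move=> j _; apply: cvgM; [exact: cvg_cst|exact: cvg_coord].
Qed.

Lemma cvg_usubmx {m n : nat} {T : Type} {F : set_system T}
    {FF : Filter F} (f : T -> 'cV[R]_(m + n)) (l : 'cV[R]_(m + n)) :
  f t @[t --> F] --> l -> usubmx (f t) @[t --> F] --> usubmx l.
Proof.
move=> fl; apply: cvg_coordP => i; rewrite mxE.
rewrite (_ : (fun t => _) = fun t => f t (lshift n i) 0); last first.
  by apply/funext => t; rewrite mxE.
exact: cvg_coord.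
Qed.

End matrices.

Section lift.
Context {R : realType} {d : nat}.
Implicit Types (x y : 'cV[R]_d) (X : 'cV[R]_(d + 1)).

Lemma dot_lift x y a b : dot (lift1 x a) (lift1 y b) = dot x y + a * b.
Proof.
rewrite /dot big_split_ord /= big_ord1; congr (_ + _).
  by apply: eq_bigr => i _; rewrite !col_mxEu.
by rewrite !col_mxEd !mxE.
Qed.

Lemma lift1_last X : X = lift1 (usubmx X) (last_coord X).
Proof. by rewrite /lift1 /last_coord -mx11_scalar vsubmxK. Qed.

Lemma usubmx_lift x a : usubmx (lift1 x a) = x.
Proof. by rewrite /lift1 col_mxKu. Qed.

Lemma last_lift x a : last_coord (lift1 x a) = a.
Proof. by rewrite /last_coord /lift1 col_mxKd mxE. Qed.

Lemma lift1D x y a b : lift1 x a + lift1 y b = lift1 (x + y) (a + b).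
Proof. by rewrite /lift1 add_col_mx raddfD. Qed.

Lemma lift1Z c x a : c *: lift1 x a = lift1 (c *: x) (c * a).
Proof. by rewrite /lift1 scale_col_mx scale_scalar_mx. Qed.

Lemma lift1N x a : - lift1 x a = lift1 (- x) (- a).
Proof. by rewrite -scaleN1r lift1Z scaleN1r mulN1r. Qed.

Lemma lift1_inj x y a b : lift1 x a = lift1 y b -> x = y /\ a = b.
Proof.
by move=> h; split; [rewrite -(usubmx_lift x a) h usubmx_lift|rewrite -(last_lift x a) h last_lift].
Qed.

Lemma last_coordE X : last_coord X = X (rshift d ord0) 0.
Proof. by rewrite /last_coord mxE. Qed.

Lemma cvg_lift {T : Type} {F : set_system T} {FF : Filter F}
    (f : T -> 'cV[R]_d) (g : T -> R) l m :
  f t @[t --> F] --> l -> g t @[t --> F] --> m ->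
  lift1 (f t) (g t) @[t --> F] --> lift1 l m.
Proof.
move=> fl gm; apply: cvg_coordP => i; rewrite -(splitK i).
case: (fintype.split i) => j /=.
  rewrite col_mxEu (_ : (fun t => _) = fun t => f t j 0).
    exact: cvg_coord.
  by apply/funext => t; rewrite col_mxEu.
rewrite col_mxEd !mxE ord1 (_ : (fun t => _) = g); first by rewrite mulr1n.
by apply/funext => t; rewrite col_mxEd !mxE mulr1n.
Qed.

Lemma cvg_last {T : Type} {F : set_system T} {FF : Filter F}
    (f : T -> 'cV[R]_(d + 1)) l :
  f t @[t --> F] --> l -> last_coord (f t) @[t --> F] --> last_coord l.
Proof.
move=> h; rewrite last_coordE (_ : (fun t => _) = fun t => f t (rshift d ord0) 0).
  exact: cvg_coord.
by apply/funext => t; rewrite last_coordE.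
Qed.

Lemma norm_lift x a c : 0 <= c -> `|x| <= c -> `|a| <= c -> `|lift1 x a| <= c.
Proof.
move=> c0 xc ac; apply: norm_leP => // i; rewrite -(splitK i).
case: (fintype.split i) => j /=.
  by rewrite col_mxEu (le_trans (norm_coord _ _)).
by rewrite col_mxEd !mxE ord1 mulr1n.
Qed.

Lemma norm_usubmx X : `|usubmx X| <= `|X|.
Proof. by apply: norm_leP => // i; rewrite mxE norm_coord. Qed.

Lemma norm_last X : `|last_coord X| <= `|X|.
Proof. by rewrite last_coordE norm_coord. Qed.

End lift.

(** * The volume as a Borel measure *)

Section vol_outer.
Context {R : realType} {n : nat}.
Local Notation V := 'cV[R]_n.
Implicit Types (A B : set V) (b : (V * V)^nat).

Definition boxvol (p : V * V) : R := \prod_i (p.2 i 0 - p.1 i 0).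

Definition box_cover A b : Prop :=
  (forall k i, (b k).1 i 0 <= (b k).2 i 0) /\
  A `<=` \bigcup_k box (b k).1 (b k).2.

Lemma boxvol_ge0 (p : V * V) : (forall i, p.1 i 0 <= p.2 i 0) -> 0 <= boxvol p.
Proof. by move=> h; apply: prodr_ge0 => i _; rewrite subr_ge0. Qed.

Lemma boxvolE_ge0 A b k : box_cover A b -> (0 <= (boxvol (b k))%:E)%E.
Proof. by move=> [h _]; rewrite lee_fin boxvol_ge0. Qed.

Lemma vol_le A b : box_cover A b ->
  (vol A <= \sum_(k <oo) (boxvol (b k))%:E)%E.
Proof. by move=> h; apply: ereal_inf_lbound; exists b. Qed.

Lemma vol_ge A (x : \bar R) :
  (forall b, box_cover A b -> (x <= \sum_(k <oo) (boxvol (b k))%:E)%E) ->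
  (x <= vol A)%E.
Proof. by move=> h; apply: le_ereal_inf_tmp => _ [b hb <-]; exact: h. Qed.

Lemma vol_ge0 A : (0 <= vol A)%E.
Proof.
apply: vol_ge => b hb; apply: nneseries_ge0 => k _ _.
exact: boxvolE_ge0 hb.
Qed.

Lemma le_vol : {homo @vol R n : A B / A `<=` B >-> (A <= B)%E}.
Proof.
move=> A B AB; apply: vol_ge => b [h1 h2]; apply: vol_le; split => //.
exact: subset_trans AB h2.
Qed.

Lemma vol_sigma_subadditive : sigma_subadditive (@vol R n).
Proof.
move=> A; have [[i ioo]|] := pselect (exists i, vol (A i) = +oo%E).
  rewrite (eseries_pinfty _ _ ioo) ?leey// => k _.
  by rewrite -ltNye (lt_le_trans _ (vol_ge0 _)).
rewrite -forallNE => Aoo.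
apply/lee_addgt0Pr => e e0.
apply: (le_trans _ (epsilon_trick _ _ (ltW e0))); last by move=> k; exact: vol_ge0.
pose P k b := box_cover (A k) b /\
  (\sum_(j <oo) (boxvol (b j))%:E <= vol (A k) + (e / (2 ^ k.+1)%:R)%:E)%E.
have [G PG] : {G : ((V * V)^nat)^nat & forall k, P k (G k)}.
  apply: (@choice _ _ P) => k; rewrite /P.
  have en1 : 0 < e / (2 ^ k.+1)%:R by rewrite divr_gt0// ltr0n expn_gt0.
  have fA : vol (A k) \is a fin_num.
    by rewrite ge0_fin_numE ?vol_ge0// ltey; apply/eqP; exact: Aoo.
  have /= := lb_ereal_inf_adherent en1 fA.
  move=> [x [b hb <-] xS]; exists b; split; first exact: hb.
  exact: ltW.
pose F (p : nat * nat) : \bar R := (boxvol (G p.1 p.2))%:E.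
have F0 p : (0 <= F p)%E by apply: boxvolE_ge0; exact: (PG p.1).1.
have /card_esym/ppcard_eqP[f] := card_nat2.
apply: (@le_trans _ _ (\esum_(i in setT) F i)%E).
  apply: (@le_trans _ _ (\sum_(k <oo) F (f k))%E).
    apply: (@vol_le _ (fun k => G (f k).1 (f k).2)); split.
      by move=> k i; exact: (PG (f k).1).1.1.
    move=> t [i _] /((PG i).1.2) [j _ ?].
    by exists (f^-1%FUN (i, j)) => //=; rewrite invK ?inE.
  rewrite (nneseries_esumT (a := fun k => F (f k))) => [|k]; last exact: F0.
  by rewrite (reindex_esum [set: nat] [set: nat * nat] f).
have -> : (\esum_(i in [set: nat * nat]) F i =
    \sum_(i <oo) \sum_(j <oo) F (i, j))%E.
  rewrite nneseries_esumT; last by move=> i; apply: nneseries_ge0 => j _ _; exact: F0.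
  rewrite (eq_esum (b := fun i => \esum_(j in [set: nat]) F (i, j))); last first.
    by move=> i _; rewrite (nneseries_esumT (a := fun j => F (i, j))).
  rewrite esum_esum//.
  rewrite (_ : _ `*`` _ = setT); last by apply/seteqP; split.
  by apply: eq_esum; case.
apply: lee_nneseries => [i _ _|i _]; first by apply: nneseries_ge0 => j _ _; exact: F0.
exact: (PG i).2.
Qed.

(** The hypothesis matters: in dimension 0 a box has volume 1, the empty product, and a cover is an
    infinite sequence of boxes. *)
Lemma vol_set0 : (0 < n)%N -> vol (@set0 V) = 0%E.
Proof.
move=> n0; apply/eqP; rewrite eq_le vol_ge0 andbT.
have c : box_cover (@set0 V) (fun=> (0, 0)) by split.
rewrite (le_trans (vol_le c))// eseries0// => i _ _.
by rewrite /boxvol (bigD1 (Ordinal n0))//= subrr mul0r.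
Qed.

(** The positivity of the dimension is an argument, so that the outer measure structure, which
    depends on it, can be attached to this name. *)
Definition vol_outer (n0 : (0 < n)%N) : set V -> \bar R := @vol R n.

HB.instance Definition _ (n0 : (0 < n)%N) :=
  isOuterMeasure.Build R V (vol_outer n0) (vol_set0 n0) vol_ge0 le_vol
    vol_sigma_subadditive.

Lemma boxvol_split (p : V * V) (m : R) (i : 'I_n) :
  let r := \col_j (if j == i then m else p.2 j 0) in
  let l := \col_j (if j == i then m else p.1 j 0) in
  boxvol (p.1, r) + boxvol (l, p.2) = boxvol p.
Proof.
move=> r l; rewrite /boxvol (bigD1 i)//= [X in _ + X](bigD1 i)//= [RHS](bigD1 i)//=.
rewrite !mxE !eqxx.
set P := \prod_(_ < _ | _) _; set Q := \prod_(_ < _ | _) _.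
set S := \prod_(_ < _ | _) _.
have -> : P = S by apply: eq_bigr => j /negbTE ji; rewrite mxE ji.
have -> : Q = S by apply: eq_bigr => j /negbTE ji; rewrite mxE ji.
ring.
Qed.

Definition halfspace (i : 'I_n) (c : R) : set V := [set x | x i 0 <= c].

(** Each box of a cover is cut by the hyperplane into two boxes whose volumes add up, so a cover of
    [X] yields covers of both parts at no extra cost. *)
Lemma halfspace_caratheodory (n0 : (0 < n)%N) i c :
  (vol_outer n0).-caratheodory (halfspace i c).
Proof.
apply: (@le_caratheodory_measurable _ _ (vol_outer n0)) => X; apply: vol_ge => b [bl bX].
(* [m k] is [c] clamped to the side of the box, so both pieces are boxes, one of them flat, even
   when the hyperplane misses the box. *)
pose m k := Order.max ((b k).1 i 0) (Order.min c ((b k).2 i 0)).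
have m1 k : (b k).1 i 0 <= m k by rewrite le_max lexx.
have m2 k : m k <= (b k).2 i 0 by rewrite ge_max bl ge_min lexx orbT.
pose r k : V := \col_j (if j == i then m k else (b k).2 j 0).
pose l k : V := \col_j (if j == i then m k else (b k).1 j 0).
have h1 : box_cover (X `&` halfspace i c) (fun k => ((b k).1, r k)).
  split=> [k j|x [/bX [k _ xb] xc]] /=.
    by rewrite mxE; case: eqP => [->|_].
  exists k => // j; rewrite mxE; have /andP[x1 x2] := xb j; rewrite x1.
  by case: eqP x2 => [-> x2|_ ->//]; rewrite le_max le_min xc x2 orbT.
have h2 : box_cover (X `&` ~` halfspace i c) (fun k => (l k, (b k).2)).
  split=> [k j|x [/bX [k _ xb] /negP xc]] /=.
    by rewrite mxE; case: eqP => [->|_].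
  exists k => // j; rewrite mxE; have /andP[x1 x2] := xb j; rewrite x2 andbT.
  case: eqP x1 => [-> x1|_ ->//]; rewrite ge_max x1 ge_min /=.
  by rewrite -ltNge in xc; rewrite (ltW xc).
apply: le_trans (leeD (vol_le h1) (vol_le h2)) _.
rewrite -nneseriesD; [|by move=> k _ _; exact: (boxvolE_ge0 k h1)|by move=> k _ _; exact: (boxvolE_ge0 k h2)].
apply: lee_nneseries => [k _ _|k _].
  by rewrite adde_ge0// ?(boxvolE_ge0 k h1) ?(boxvolE_ge0 k h2).
by rewrite -EFinD boxvol_split.
Qed.

(** An open set is a countable union of boxes with rational corners; the boxes are half-open because
    these are intersections of differences of halfspaces. *)
Lemma open_sigma_halfspace A : open A ->
  <<s [set B | exists i c, B = halfspace i c] >> A.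
Proof.
set H := [set B | _] => oA.
pose q2 (a : 'cV[rat]_n) : V := \col_i ratr (a i 0).
pose bx (p : 'cV[rat]_n * 'cV[rat]_n) : set V :=
  [set x | forall i, q2 p.1 i 0 < x i 0 <= q2 p.2 i 0].
pose I := [set p | bx p `<=` A].
have -> : A = \bigcup_(p in I) bx p.
  apply/seteqP; split => [x Ax|x [p Ip]]; last exact: Ip.
  have [e e0 he] := openE_ball oA Ax.
  have e20 : 0 < e / 2 by rewrite divr_gt0.
  have lo i : {q : rat | x i 0 - e / 2 < ratr q < x i 0}.
    apply/cid; have /rat_in_itvoo[q] : x i 0 - e / 2 < x i 0 by rewrite gtrBl.
    by rewrite in_itv /= => h; exists q.
  have hi i : {q : rat | x i 0 < ratr q < x i 0 + e / 2}.
    apply/cid; have /rat_in_itvoo[q] : x i 0 < x i 0 + e / 2 by rewrite ltrDl.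
    by rewrite in_itv /= => h; exists q.
  exists (\col_i sval (lo i), \col_i sval (hi i)) => /=.
    move=> y /= hy; apply: he.
    apply: (@le_lt_trans _ _ (e / 2)); last by rewrite ltr_pdivrMr// ltr_pMr// ltr1n.
    apply: norm_leP => [|i]; first exact: ltW.
    have := hy i; rewrite !mxE; have /= := svalP (lo i); have /= := svalP (hi i).
    move=> /andP[a1 a2] /andP[a3 a4] /andP[a5 a6].
    rewrite ler_norml; apply/andP; split; lra.
  move=> i; rewrite !mxE; have /= := svalP (lo i); have /= := svalP (hi i).
  by move=> /andP[a1 _] /andP[_ a4]; rewrite a4 ltW.
pose S := g_sigma_algebraType H.
suff : @measurable _ S (\bigcup_(p in I) bx p) by [].
have mb p : @measurable _ S (bx p).
  have -> : bx p = \bigcap_(i in [set: 'I_n])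
      (halfspace i (q2 p.2 i 0) `\` halfspace i (q2 p.1 i 0)).
    apply/seteqP; split => [x hx i _|x hx i].
      have /andP[h1 h2] := hx i; split => //=.
      by rewrite /halfspace /=; apply/negP; rewrite -ltNge.
    have [/= h1 /negP] := hx i Logic.I.
    by rewrite /halfspace /= -ltNge h1 => ->.
  apply: fin_bigcap_measurable => // i _.
  by apply: measurableD; apply: sub_sigma_algebra; exists i; eexists.
rewrite bigcup_mkcond; apply: countable_bigcupT_measurable => //.
by move=> p; case: ifP.
Qed.

End vol_outer.

Lemma subr_cvec_continuous {R : realType} {n : nat} (v : 'cV[R]_n) :
  continuous (fun x : 'cV[R]_n => x - v).
Proof. by move=> x; apply: (@continuousB _ _ _ id (fun=> v)) => //; exact: cst_continuous. Qed.

Section vol_measure.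
Context {R : realType} {n : nat} (n0 : (0 < n)%N).
Local Notation V := 'cV[R]_n.
Implicit Types (A B : set V) (x y v w : V).

Lemma borel_caratheodory A : borel_set A -> (vol_outer n0).-caratheodory A.
Proof.
pose T := caratheodory_type (@vol_outer R n n0).
have sT : sigma_algebra setT ((vol_outer n0).-caratheodory : set (set V)).
  exact: (@sigma_algebra_measurable _ T).
apply: smallest_sub => // B oB.
apply: (smallest_sub sT) (open_sigma_halfspace oB).
by move=> _ [i [c ->]]; exact: halfspace_caratheodory.
Qed.

Definition lebn (_ : (0 < n)%N) : set (borel R n) -> \bar R := @vol R n.

Lemma lebn_semi_sigma_additive : semi_sigma_additive (lebn n0).
Proof.
move=> F mF tF mUF.
pose T := caratheodory_type (@vol_outer R n n0).
apply: (@caratheodory_measure_sigma_additive R _ (vol_outer n0) F) => //.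
  by move=> i; apply: borel_caratheodory; exact: mF.
exact: borel_caratheodory.
Qed.

HB.instance Definition _ := isMeasure.Build _ _ R (lebn n0) (vol_set0 n0) (@vol_ge0 R n)
  lebn_semi_sigma_additive.

Lemma lebn_box x y : (forall i, x i 0 <= y i 0) ->
  (vol (box x y) <= (\prod_i (y i 0 - x i 0))%:E)%E.
Proof.
move=> xy.
pose b k : V * V := if k is 0%N then (x, y) else (0, 0).
have hb : box_cover (box x y) b.
  split => [[|k] i|z zb]//=; exists 0%N => //.
apply: le_trans (vol_le hb) _.
rewrite (@nneseries_recl R xpredT)// => [|k _]; last exact: (boxvolE_ge0 k hb).
rewrite /= eseries_cond eseries0 ?adde0// => -[|k] _ _ //=.
by rewrite /boxvol (bigD1 (Ordinal n0))//= subrr mul0r.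
Qed.

Lemma closed_borel A : closed A -> borel_set A.
Proof.
move=> cA; rewrite -(setCK A); apply: (@measurableC _ (borel R n)).
by apply: sub_sigma_algebra; exact: closed_openC.
Qed.

Lemma open_borel A : open A -> borel_set A.
Proof. by move=> oA; apply: sub_sigma_algebra. Qed.

Lemma closed_box x y : closed (@box R n x y).
Proof.
have -> : box x y = \bigcap_i ((fun z : V => z i 0) @^-1` `[x i 0, y i 0]%classic).
  by apply/seteqP; split => [z h i _|z h i]; have := h i; rewrite /= in_itv /=; apply.
apply: closed_bigI => i _; apply: closed_comp; last exact: interval_closed.
by move=> z _; exact: coord_continuous.
Qed.

Definition cube (k : R) : set V := box (const_mx (- k)) (const_mx k).

Lemma cubeE k x : 0 <= k -> cube k x <-> `|x| <= k.
Proof.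
move=> k0; split => [h|h i].
  by apply: norm_leP => // i; have := h i; rewrite !mxE -ler_norml.
by rewrite !mxE -ler_norml (le_trans (norm_coord _ _)).
Qed.

Lemma cube_vol k : 0 <= k -> (vol (cube k) < +oo)%E.
Proof.
move=> k0; apply: le_lt_trans (ltry _); apply: lebn_box => i.
by rewrite !mxE ge0_cp.
Qed.

Lemma vol_bounded A : bounded_set A -> (vol A < +oo)%E.
Proof.
move=> /bounded_setE[c c0 Ac]; apply: le_lt_trans (cube_vol (ltW c0)).
by apply: le_vol => x /Ac xc; apply/cubeE => //; exact: ltW.
Qed.

Lemma cube_cover : \bigcup_k cube k%:R = [set: V].
Proof.
apply/seteqP; split => // x _; 
exists (Num.bound `|x|) => //; apply/cubeE => //.
by apply/ltW; apply: le_lt_trans (ler_norm _) _; rewrite ?normr_id archi_boundP.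
Qed.

Lemma cube_borel k : borel_set (cube k).
Proof. by apply: closed_borel; exact: closed_box. Qed.

Lemma lebn_sigma_finite : sigma_finite setT (lebn n0).
Proof.
exists (fun k => cube k%:R); first by rewrite cube_cover.
by move=> k; split; [exact: cube_borel|exact: cube_vol].
Qed.

HB.instance Definition _ := Measure_isSigmaFinite.Build _ _ R (lebn n0) lebn_sigma_finite.

Lemma vol_translate A v : vol [set x + v | x in A] = vol A.
Proof.
have le B w : (vol [set (x + w)%R | x in B] <= vol B)%E.
  apply: vol_ge => b [b1 b2].
  pose b' k := ((b k).1 + w, (b k).2 + w).
  have hb : box_cover [set x + w | x in B] b'.
    split => [k i|_ [x /b2[k _ xk] <-]]; first by rewrite !mxE lerD2r.
    by exists k => // i; rewrite !mxE !lerD2r; exact: xk.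
  apply: le_trans (vol_le hb) _; rewrite le_eqVlt; apply/orP; left; apply/eqP.
  apply: eq_eseriesr => k _; congr (_%:E); apply: eq_bigr => i _.
  by rewrite !mxE; ring.
apply/eqP; rewrite eq_le le /=.
have {1}-> : A = [set x - v | x in [set x + v | x in A]].
  apply/seteqP; split => [x Ax|_ [_ [x Ax <-] <-]]; last by rewrite addrK.
  by exists (x + v); [exists x|rewrite addrK].
exact: le.
Qed.

(* Infinitely many disjoint translates of a bounded set fit in a bounded set. *)
Lemma vol0_translates A e : borel_set A -> bounded_set A ->
  (forall x a b, A (x + a *: e) -> A (x + b *: e) -> a = b) -> vol A = 0%E.
Proof.
move=> mA bA inj.
have [->|A0] := eqVneq A set0; first by rewrite vol_set0.
have [c c0 Ac] := bounded_setE bA.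
pose h (k : nat) : R := k.+1%:R^-1.
pose T k := [set x + h k *: e | x in A].
have hinj k l : h k = h l -> k = l.
  by move=> /invr_inj /eqP; rewrite eqr_nat => /eqP[].
have TE k : T k = (fun x => x - h k *: e) @^-1` A.
  apply/seteqP; split => [_ [x Ax <-]|x Ax] /=; first by rewrite addrK.
  by exists (x - h k *: e) => //; rewrite subrK.
have mT k : borel_set (T k).
  have := @measurability _ _ (borel R n) (borel R n) setT (fun x => x - h k *: e) _ erefl.
  move=> H; rewrite TE -[X in borel_set X]setTI; apply: H => //.
  move=> _ [B oB <-]; apply: sub_sigma_algebra; rewrite setTI; move: oB; apply: open_comp.
  by move=> x _; exact: subr_cvec_continuous.
have tT : trivIset setT T.
  apply/trivIsetP => k l _ _ kl; apply/seteqP; split => // x [].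
  rewrite !TE /= -!scaleNr => a1 a2; case/eqP: kl; apply: hinj.
  by apply: oppr_inj; exact: inj a1 a2.
have bT : \bigcup_k T k `<=` cube (c + `|e|).
  move=> _ [k _ [x Ax <-]]; apply/cubeE; first by rewrite addr_ge0// ltW.
  apply: le_trans (ler_normD _ _) _; apply: lerD; first exact: Ac.
  rewrite normrZ ger0_norm ?invr_ge0// ler_piMl// invf_le1// ler1n//.
have vT k : lebn n0 (T k) = vol A by exact: vol_translate.
have lfin : (lebn n0 (\bigcup_k T k) < +oo)%E.
  by apply: le_lt_trans (le_vol bT) _; apply: cube_vol; rewrite addr_ge0// ltW.
have mUT : borel_set (\bigcup_k T k) by exact: (@bigcupT_measurable _ (borel R n)).
have sumT := @measure_semi_bigcup _ _ _ (lebn n0) T mT tT mUT.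
have sum_le N : (\sum_(0 <= k < N) vol A <= lebn n0 (\bigcup_k T k))%E.
  rewrite sumT (eq_bigr (fun k => lebn n0 (T k))) => [|k _]; last by rewrite vT.
  by apply: nneseries_lim_ge => k *; exact: vol_ge0.
have fA : vol A \is a fin_num by rewrite ge0_fin_numE ?vol_ge0// vol_bounded.
have fL : lebn n0 (\bigcup_k T k) \is a fin_num by rewrite ge0_fin_numE// vol_ge0.
move: sum_le fA (vol_ge0 A); rewrite -(fineK fL); case: (vol A) => // a sum_le _.
rewrite lee_fin le_eqVlt => /orP[/eqP<-//|a0].
have := sum_le (Num.bound (fine (lebn n0 (\bigcup_k T k)) / a)).
rewrite sumEFin lee_fin big_const_nat subn0 iter_addr_0 -mulr_natr leNgt.
move=> /negP[]; rewrite mulrC -ltr_pdivrMr//.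
by apply: archi_boundP; apply: divr_ge0; [apply: fine_ge0; exact: vol_ge0|exact: ltW].
Qed.

End vol_measure.

(** * Fubini's theorem *)

(** Serves two measures with equal finite totals: an inequality on a set forces the opposite one on
    its complement. *)
Lemma adde_le_compl {R : realType} (a b a' b' : \bar R) :
  (0 <= a)%E -> (0 <= a')%E -> (0 <= b)%E -> (a + a' = b + b')%E -> (b <= a)%E ->
  (a + a' < +oo)%E -> (a' <= b')%E.
Proof.
case: a => [a||]//; case: a' => [a'||]//; case: b => [b||]//; case: b' => [b'||]//=;
  rewrite ?leey// => _ _ _ [] e; rewrite !lee_fin => ba _; lra.
Qed.

Section fubini.
Context {R : realType}.

Lemma measurable_lift1 {n : nat} :
  measurable_fun setT (fun p : borel R n * measurableTypeR R => lift1 p.1 p.2 : borel R (n + 1)).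
Proof.
pose T := (borel R n * measurableTypeR R)%type.
pose f (p : T) : 'cV[R]_(n + 1) := lift1 p.1 p.2.
rewrite -/f.
have sT : sigma_algebra setT [set A : set 'cV[R]_(n + 1) | measurable (f @^-1` A)].
  split => [|A /= mA|F mF] /=.
  - by rewrite preimage_set0.
  - by rewrite setTD preimage_setC; exact: measurableC.
  - by rewrite preimage_bigcup; exact: bigcupT_measurable.
move=> _ Y mY; rewrite setTI; apply: (smallest_sub sT) mY => B oB.
apply: (smallest_sub sT) (open_sigma_halfspace oB) => _ [i [c ->]] /=.
have mi : measurable (`]-oo, c]%classic : set (measurableTypeR R)).
  exact: measurable_itv.
rewrite -(splitK i); case: (fintype.split i) => j /=.
  have -> : f @^-1` halfspace (lshift 1 j) c = halfspace j c `*` setT.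
    by apply/seteqP; split => [[x z]|[x z] []]; rewrite /halfspace /f /= col_mxEu.
  apply: measurableX => //; apply: closed_borel.
  rewrite (_ : halfspace j c = (fun x : 'cV[R]_n => x j 0) @^-1` `]-oo, c]%classic).
    apply: closed_comp; last exact: lray_closed.
    by move=> z _; exact: coord_continuous.
  by apply/seteqP; split => x; rewrite /halfspace /= in_itv.
have -> : f @^-1` halfspace (rshift n j) c = setT `*` `]-oo, c]%classic.
  by apply/seteqP; split => [[x z]|[x z] []]; rewrite /halfspace /f /= in_itv /= col_mxEd !mxE !ord1 mulr1n.
exact: measurableX.
Qed.

Lemma box_lift {n : nat} (x y : 'cV[R]_(n + 1)) :
  (fun p : 'cV[R]_n * R => lift1 p.1 p.2) @^-1` box x y =
  box (usubmx x) (usubmx y) `*` `[last_coord x, last_coord y]%classic.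
Proof.
apply/seteqP; split => [[u v] /= h|[u v] /= [h1 h2] i].
  split => /= [i|].
    by have := h (lshift 1 i); rewrite col_mxEu !mxE.
  by have := h (rshift n ord0); rewrite col_mxEd !last_coordE in_itv /= !mxE mulr1n.
rewrite -(splitK i); case: (fintype.split i) => j /=.
  by rewrite col_mxEu; have := h1 j; rewrite !mxE.
by rewrite col_mxEd !mxE !ord1 mulr1n; move: h2; rewrite /= in_itv /= !last_coordE.
Qed.

Section step.
Context {n : nat} (n0 : (0 < n)%N).
Hypothesis boxE : forall x y : 'cV[R]_n, (forall i, x i 0 <= y i 0) ->
  vol (box x y) = (boxvol (x, y))%:E.

Let f (p : borel R n * measurableTypeR R) : borel R (n + 1) := lift1 p.1 p.2.
(** The candidate for the volume in dimension n + 1; the section shows that it is [vol], starting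
    from the volume of boxes in dimension n. *)
Definition lift_measure : set (borel R (n + 1)) -> \bar R :=
  pushforward (product_measure1 (lebn n0) (@lebesgue_measure R)) f.

Lemma lift_measure_sigma_additive : semi_sigma_additive lift_measure.
Proof.
move=> F mF tF mUF; rewrite /lift_measure /pushforward preimage_bigcup.
apply: (@measure_semi_sigma_additive _ _ _ (product_measure1 (lebn n0) (@lebesgue_measure R))).
- by move=> i; rewrite -[X in measurable X]setTI; exact: measurable_lift1.
- apply/trivIsetP => i j _ _ ij; rewrite -preimage_setI.
  by move/trivIsetP: tF => ->//; rewrite preimage_set0.
- by rewrite -preimage_bigcup -[X in measurable X]setTI; exact: measurable_lift1.
Qed.

HB.instance Definition _ := isMeasure.Build _ _ R lift_measure
  (measure0 (product_measure1 (lebn n0) (@lebesgue_measure R)))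
  (fun A => measure_ge0 (product_measure1 (lebn n0) (@lebesgue_measure R)) _)
  lift_measure_sigma_additive.

Lemma lift_measure_box (x y : 'cV[R]_(n + 1)) : (forall i, x i 0 <= y i 0) ->
  lift_measure (box x y) = (boxvol (x, y))%:E.
Proof.
move=> xy; rewrite /lift_measure /pushforward /f.
have -> := box_lift x y; rewrite product_measure1E; last first.
- exact: measurable_itv.
- by apply: closed_borel; exact: closed_box.
rewrite /= /lebn boxE => [|i]; last by rewrite !mxE xy.
rewrite lebesgue_measure_itv /= lte_fin -EFinB.
have le : last_coord x <= last_coord y by rewrite !last_coordE.
have -> : (if last_coord x < last_coord y then (last_coord y - last_coord x)%:E else 0%E)
    = (last_coord y - last_coord x)%:E.
  by move: le; rewrite le_eqVlt => /orP[/eqP ->|->//]; rewrite ltxx subrr.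
rewrite -EFinM /boxvol big_split_ord big_ord1 /= !last_coordE; congr (_ * _)%:E.
by apply: eq_bigr => i _; rewrite !mxE.
Qed.

Lemma lift_measure_le E : borel_set E -> (lift_measure E <= vol E)%E.
Proof.
move=> mE; apply: vol_ge => b [b1 b2].
have mb k : borel_set (box (b k).1 (b k).2) by apply: closed_borel; exact: closed_box.
apply: le_trans (measure_sigma_subadditive lift_measure mb mE b2) _.
rewrite le_eqVlt; apply/orP; left; apply/eqP; apply: eq_eseriesr => k _.
by apply: etrans (lift_measure_box (b1 k)) _; case: (b k).
Qed.

(** The upper bound is a cover by one box. The lower bound, usually a compactness argument on
    covers, comes from [lift_measure_le], since the product measure is already countably
    subadditive. *)
Lemma vol_box_lift (x y : 'cV[R]_(n + 1)) : (forall i, x i 0 <= y i 0) ->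
  vol (box x y) = (boxvol (x, y))%:E.
Proof.
move=> xy; apply/eqP; rewrite eq_le -{2}(lift_measure_box xy) lift_measure_le.
  by rewrite andbT lebn_box// addn1.
by apply: closed_borel; exact: closed_box.
Qed.

(** [lift_measure] is at most [vol] on [E] and on its complement in a cube, and both give the cube
    the same finite value, so both inequalities are equalities. Then the cubes increase. *)
Lemma vol_lift E : borel_set E -> vol E = lift_measure E.
Proof.
move=> mE; have n1 : (0 < n + 1)%N by rewrite addn1.
have cE (k : R) : 0 <= k -> vol (@cube R (n + 1) k) = lift_measure (cube k).
  by move=> k0; rewrite /cube lift_measure_box ?vol_box_lift// => i; rewrite !mxE ge0_cp.
have bE (k : nat) : lebn n1 (E `&` cube k%:R) = lift_measure (E `&` cube k%:R).
  have mc := @cube_borel R (n + 1) k%:R.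
  have mEc : borel_set (E `&` cube k%:R) by exact: (@measurableI _ (borel R (n + 1))).
  have mcE : borel_set (cube k%:R `\` E) by exact: (@measurableD _ (borel R (n + 1))).
  apply/eqP; rewrite eq_le [X in _ && X]lift_measure_le// andbT.
  have f1 : (lebn n1 (@cube R (n + 1) k%:R) < +oo)%E by exact: cube_vol.
  have e1 := measureDI (lebn n1) mc mE.
  have e2 := measureDI lift_measure mc mE.
  have := cE _ (ler0n _ k); rewrite -[vol _]/(lebn n1 _) e1 e2 => e3.
  have l1 := lift_measure_le mcE.
  rewrite setIC.
  apply: (adde_le_compl _ _ _ e3 l1) => //; rewrite -e1; exact: f1.
have cv (m : {measure set (borel R (n + 1)) -> \bar R}) :
    m (E `&` cube k%:R) @[k --> \oo] --> m E.
  have UE : \bigcup_k (E `&` cube k%:R) = E.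
    by rewrite -setI_bigcupr cube_cover setIT.
  rewrite -{2}UE; apply: nondecreasing_cvg_mu.
  - by move=> k; apply: measurableI => //; exact: cube_borel.
  - by rewrite UE.
  - move=> k l kl; apply/subsetPset => x [Ex xk]; split => //.
    have /cubeE xk' := xk; apply/cubeE => //; apply: le_trans (xk' _) _ => //.
    by rewrite ler_nat.
have h1 := cv (lebn n1); have h2 := cv lift_measure.
have e : (fun k => lebn n1 (E `&` cube k%:R)) = (fun k => lift_measure (E `&` cube k%:R)).
  exact/funext.
rewrite e in h1.
rewrite -(cvg_lim _ h2)//; apply/esym.
exact: (@cvg_lim _ _ _ _ _ _ _ h1).
Qed.

End step.

(** The induction starts in dimension 1, where a cover by boxes is a cover by intervals and is
    compared with [lebesgue_measure]. *)
Lemma vol_box {n : nat} (x y : 'cV[R]_n) : (0 < n)%N ->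
  (forall i, x i 0 <= y i 0) -> vol (box x y) = (boxvol (x, y))%:E.
Proof.
elim: n x y => // n IH; case: n IH => [_|n IH] x y _ xy; last first.
  by move: x y xy; rewrite -(addn1 n.+1) => x y xy; apply: (vol_box_lift (n := n.+1)) => // u v; exact: IH.
apply/eqP; rewrite eq_le lebn_box//=; apply: vol_ge => b [b1 b2].
pose c (t : R) : 'cV[R]_1 := const_mx t.
pose I k := `[(b k).1 0 0, (b k).2 0 0]%classic : set (measurableTypeR R).
have leb k : lebesgue_measure (I k) = ((b k).2 0 0 - (b k).1 0 0)%:E.
  rewrite lebesgue_measure_itv /= lte_fin -EFinB.
  by have := b1 k 0; rewrite le_eqVlt => /orP[/eqP ->|->//]; rewrite ltxx subrr.
have lx : lebesgue_measure (`[x 0 0, y 0 0]%classic : set (measurableTypeR R)) = (y 0 0 - x 0 0)%:E.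
  rewrite lebesgue_measure_itv /= lte_fin -EFinB.
  by have := xy 0; rewrite le_eqVlt => /orP[/eqP ->|->//]; rewrite ltxx subrr.
rewrite /boxvol big_ord1 -lx.
have cov : `[x 0 0, y 0 0]%classic `<=` \bigcup_k I k.
  move=> t; rewrite /= in_itv /= => ht.
  have /b2[k _ hk] : box x y (c t) by move=> i; rewrite !ord1 mxE.
  by exists k => //; have := hk 0; rewrite mxE /I /= in_itv.
apply: le_trans (measure_sigma_subadditive lebesgue_measure _ _ cov) _.
- by move=> k; exact: measurable_itv.
- exact: measurable_itv.
rewrite le_eqVlt; apply/orP; left; apply/eqP; apply: eq_eseriesr => k _.
by rewrite /boxvol big_ord1; exact: leb.
Qed.

Lemma vol_fubini {n : nat} (n0 : (0 < n)%N) (E : set 'cV[R]_(n + 1)) :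
  borel_set E ->
  vol E = (\int[lebn n0]_x lebesgue_measure [set z : measurableTypeR R | E (lift1 x z)])%E.
Proof.
move=> mE; rewrite (vol_lift n0 (fun x y => vol_box n0) mE).
apply: eq_integral => x _ /=; congr lebesgue_measure.
by apply/seteqP; split => z; rewrite /xsection /= inE.
Qed.

Lemma measurable_section {n : nat} (E : set 'cV[R]_(n + 1)) (x : 'cV[R]_n) :
  borel_set E -> measurable [set z : measurableTypeR R | E (lift1 x z)].
Proof.
move=> mE.
have := @measurable_xsection _ _ (borel R n) _ _ x (measurable_lift1 measurableT mE).
by rewrite setTI; congr measurable; apply/seteqP; split => z; rewrite /xsection /= inE.
Qed.

Lemma measurable_section_fun {n : nat} (E : set 'cV[R]_(n + 1)) :
  borel_set E ->
  measurable_fun [set: borel R n]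
    ((fun x => lebesgue_measure [set z : measurableTypeR R | E (lift1 x z)]) :
      borel R n -> \bar R).
Proof.
move=> mE.
have mE' := measurable_lift1 measurableT mE; rewrite setTI in mE'.
have := @measurable_fun_xsection _ _ _ _ R (@lebesgue_measure R) _ mE'.
congr measurable_fun; apply/funext => x /=; congr lebesgue_measure.
by apply/seteqP; split => z; rewrite /xsection /= inE.
Qed.

End fubini.

(** * Positive semidefinite matrices *)

Section quadratic_forms.
Context {R : realFieldType}.

Definition qform {n : nat} (A : 'M[R]_n) (v : 'cV[R]_n) : R := (v^T *m A *m v) 0 0.

Lemma qform_block {n : nat} (a : R) (r : 'rV[R]_n) (M : 'M[R]_n) t x :
  qform (block_mx a%:M r r^T M) (col_mx t%:M x) =
  a * t ^+ 2 + 2 * t * (r *m x) 0 0 + qform M x.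
Proof.
rewrite /qform tr_col_mx mul_row_block mul_row_col tr_scalar_mx !mulmxDl.
have -> : x^T *m r^T = (r *m x)^T by rewrite trmx_mul.
rewrite -!scalar_mxM mul_mx_scalar mul_scalar_mx -scalemxAl.
rewrite !mxE eqxx mulr1n.
set u := \sum_j _; set w := \sum_j _; ring.
Qed.

Definition schur {n : nat} (a : R) (r : 'rV[R]_n) (M : 'M[R]_n) : 'M[R]_n :=
  M - a^-1 *: (r^T *m r).

Lemma det_schur {n : nat} (a : R) (r : 'rV[R]_n) (M : 'M[R]_n) : a != 0 ->
  \det (block_mx a%:M r r^T M) = a * \det (schur a r M).
Proof.
move=> a0.
have -> : block_mx a%:M r r^T M =
    block_mx 1%:M 0 (a^-1 *: r^T) 1%:M *m block_mx a%:M r 0 (schur a r M).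
  rewrite mulmx_block !mul1mx !mul0mx !addr0 -scalemxAl.
  by rewrite mul_mx_scalar scalerA mulVf// scale1r -scalemxAl /schur addrC subrK.
by rewrite det_mulmx det_lblock !det1 det_ublock det_scalar expr1 !mul1r.
Qed.

Lemma qform_schur {n : nat} (a : R) (r : 'rV[R]_n) (M : 'M[R]_n) x :
  qform (schur a r M) x = qform M x - a^-1 * (r *m x) 0 0 ^+ 2.
Proof.
rewrite /qform /schur mulmxBr mulmxBl [LHS]mxE [X in _ + X]mxE; congr (_ - _).
rewrite -scalemxAr -scalemxAl mxE; congr (_ * _).
have -> : x^T *m (r^T *m r) *m x = (r *m x)^T *m (r *m x).
  by rewrite trmx_mul !mulmxA.
by rewrite mxE big_ord1 mxE expr2.
Qed.

Lemma qform_block_schur {n : nat} (a : R) (r : 'rV[R]_n) (M : 'M[R]_n) t x : a != 0 ->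
  qform (block_mx a%:M r r^T M) (col_mx t%:M x) =
  a * (t + a^-1 * (r *m x) 0 0) ^+ 2 + qform (schur a r M) x.
Proof. by move=> a0; rewrite qform_block qform_schur; field. Qed.

Lemma schur_sym {n : nat} (a : R) (r : 'rV[R]_n) (M : 'M[R]_n) : M^T = M ->
  (schur a r M)^T = schur a r M.
Proof. by move=> sM; rewrite /schur linearB linearZ /= trmx_mul trmxK sM. Qed.

Lemma block_sym {n : nat} (A : 'M[R]_(1 + n)) : A^T = A ->
  A = block_mx (A 0 0)%:M (ursubmx A) (ursubmx A)^T (drsubmx A).
Proof.
move=> sA; rewrite -{1}[A]submxK; congr block_mx.
  by rewrite [LHS]mx11_scalar; congr (_%:M); rewrite !mxE; congr (A _ _); apply/val_inj.
by rewrite trmx_ursub sA.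
Qed.

(** The form of a Schur complement is the minimum of the whole form over the first coordinate.
    Minima keep the order of the forms, so induction applies to the complements; the other factor of
    the determinant is the corner entry, also ordered. *)
Lemma det_le_qform {n : nat} (A B : 'M[R]_n) : A^T = A -> B^T = B ->
  (forall v, v != 0 -> 0 < qform B v) -> (forall v, qform B v <= qform A v) ->
  0 < \det B <= \det A.
Proof.
elim: n A B => [|n IH] A B sA sB B0 BA; first by rewrite !det_mx00 ltr01 lexx.
move: A B sA sB B0 BA; rewrite -[n.+1]/(1 + n)%N => A B sA sB.
have sM : (drsubmx A)^T = drsubmx A by rewrite trmx_drsub sA.
have sN : (drsubmx B)^T = drsubmx B by rewrite trmx_drsub sB.
rewrite (block_sym sA) (block_sym sB).
move: (A 0 0) (B 0 0) (ursubmx A) (ursubmx B) (drsubmx A) (drsubmx B) sM sN.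
move=> a b r q M N sM sN B0 BA.
have b0 : 0 < b.
  have := B0 (col_mx 1%:M 0); rewrite qform_block /qform !mulmx0 mxE expr1n !mulr1 mulr0 !addr0.
  apply; apply/eqP => /(congr1 usubmx); rewrite col_mxKu => /matrixP /(_ 0 0).
  by rewrite !mxE => /eqP; rewrite oner_eq0.
have ab : b <= a.
  have := BA (col_mx 1%:M 0); rewrite !qform_block /qform !mulmx0 mxE expr1n.
  by rewrite !mulr1 !mulr0 !addr0.
have a0 := lt_le_trans b0 ab.
have nz : forall x : 'cV[R]_n, x != 0 -> forall t, col_mx (t%:M : 'M[R]_1) x != 0.
  move=> x x0 t; apply: contra x0 => /eqP /(congr1 dsubmx).
  by rewrite col_mxKd => ->; apply/eqP/matrixP => i j; rewrite !mxE.
have /andP[d0 d1] : 0 < \det (schur b q N) <= \det (schur a r M).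
  apply: IH; [exact: schur_sym|exact: schur_sym|move=> x x0|move=> x].
    have := B0 _ (nz x x0 (- (b^-1 * (q *m x) 0 0))).
    by rewrite qform_block_schur ?gt_eqF// addNr expr0n mulr0 add0r.
  have := BA (col_mx (- (a^-1 * (r *m x) 0 0))%:M x).
  rewrite [X in _ <= X]qform_block_schur ?gt_eqF// addNr expr0n mulr0 add0r.
  apply: le_trans; rewrite qform_block_schur ?gt_eqF// lerDr.
  by rewrite mulr_ge0 ?sqr_ge0// ltW.
rewrite !det_schur ?gt_eqF// mulr_gt0//= ler_pM// ltW//.
Qed.

(** Along [v + s *: w] with [w = A *m v] the form is 2 s |w|^2 + s^2 q(w), which is negative for a
    small negative s unless w is 0. The witness is s = - b / (c + 1), where the 1 covers the case
    q(w) = 0. *)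
Lemma psd_kernel {n : nat} (A : 'M[R]_n) v : A^T = A -> (forall w, 0 <= qform A w) ->
  qform A v = 0 -> A *m v = 0.
Proof.
move=> sA A0 qv; pose w := A *m v.
have bE : (w^T *m A *m v) 0 0 = \sum_i w i 0 ^+ 2.
  by rewrite -mulmxA mxE; apply: eq_bigr => i _; rewrite mxE expr2.
have cE' (u : 'cV[R]_n) : (v^T *m A *m u) 0 0 = (u^T *m A *m v) 0 0.
  have -> : v^T *m A *m u = (u^T *m A *m v)^T by rewrite !trmx_mul trmxK sA mulmxA.
  by rewrite mxE.
have cE := cE' w.
have expand s : qform A (v + s *: w) =
    2 * s * (w^T *m A *m v) 0 0 + s ^+ 2 * qform A w.
  have trE : (v + s *: w)^T = v^T + s *: w^T by apply/matrixP => i j; rewrite !mxE.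
  rewrite /qform trE !mulmxDl !mulmxDr -!scalemxAl -!scalemxAr.
  move: qv; rewrite /qform; move: cE.
  move: (v^T *m A *m v) (v^T *m A *m w) (w^T *m A *m v) (w^T *m A *m w).
  by move=> x1 x2 x3 x4 e1 e2; rewrite !mxE e1 e2; ring.
set b := (w^T *m A *m v) 0 0 in bE expand; set c := qform A w in expand.
have c0 : 0 <= c by exact: A0.
have b0 : b = 0.
  apply/eqP; case: (eqVneq b 0) => // bn0.
  have := A0 (v + - (b / (c + 1)) *: w); rewrite expand.
  have c1 : 0 < c + 1 by rewrite ltr_wpDl.
  have -> : 2 * - (b / (c + 1)) * b + (- (b / (c + 1))) ^+ 2 * c =
      - ((b / (c + 1)) ^+ 2 * (c + 2)) by field; rewrite gt_eqF.
  rewrite oppr_ge0 leNgt mulr_gt0// ?ltr_wpDl//.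
  by rewrite exprn_even_gt0//= mulf_neq0// invr_neq0// gt_eqF.
move/eqP: b0; rewrite bE psumr_eq0; last by move=> i _; rewrite sqr_ge0.
move=> /allP h; apply/matrixP => i j; rewrite ord1 [RHS]mxE.
by have := h i (mem_index_enum _); rewrite sqrf_eq0 => /eqP.
Qed.

Lemma psd_det_pos {n : nat} (A : 'M[R]_n) v : A^T = A -> (forall w, 0 <= qform A w) ->
  \det A != 0 -> v != 0 -> 0 < qform A v.
Proof.
move=> sA A0 dA v0; rewrite lt_neqAle A0 andbT eq_sym; apply: contra dA => /eqP qv.
apply/det0P; exists v^T; first by rewrite trmx_eq0.
by apply: trmx_inj; rewrite trmx_mul trmxK sA psd_kernel// trmx0.
Qed.

End quadratic_forms.

(** * Second derivatives *)

Section calculus.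
Context {R : realType} {n : nat}.
Implicit Types (f : 'cV[R]_n -> R) (x y v w : 'cV[R]_n) (e r s t : R).

Lemma differentiable_near f x : differentiable f x ->
  forall e : R, 0 < e -> exists2 r : R, 0 < r & forall h, `|h| < r ->
    `|f (x + h) - f x - 'd f x h| <= e * `|h|.
Proof.
move=> df e e0; have /eqaddoP /(_ e e0) := diff_locally df.
move=> /nbhs_ballP[r /= r0 H]; exists r => // h hr.
have := H h; rewrite -ball_normE /= sub0r normrN => /(_ hr).
by rewrite /= !fctE /= [h + x]addrC opprD addrA.
Qed.

Lemma is_derive_line f x v (t : R) : differentiable f (x + t *: v) ->
  is_derive t 1 (fun s => f (x + s *: v)) ('D_v f (x + t *: v)).
Proof.
move=> df; have dv := diff_derivable (v := v) df.
have E : (fun h : R => h^-1 *: (((fun s => f (x + s *: v)) \o shift t) (h *: 1) - f (x + t *: v)))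
    = (fun h : R => h^-1 *: ((f \o shift (x + t *: v)) (h *: v) - f (x + t *: v))).
  apply/funext => h /=; congr (_ *: (f _ - _)).
  by rewrite [h *: 1]mulr1 scalerDl addrCA.
by apply: DeriveDef; rewrite /derivable /derive /= E.
Qed.

Lemma is_derive_line0 f x v : differentiable f x ->
  is_derive (0 : R) 1 (fun s => f (x + s *: v)) ('D_v f x).
Proof.
move=> df; have x0 : x + 0 *: v = x by rewrite scale0r addr0.
by rewrite -[in 'D_v f _]x0; apply: is_derive_line; rewrite x0.
Qed.

Lemma derive_sum f y v : differentiable f y ->
  'D_v f y = \sum_i v i 0 * 'D_(basis_vec R i) f y.
Proof.
move=> df; rewrite deriveE//.
have {1}-> : v = \sum_i v i 0 *: basis_vec R i.
  apply/matrixP => j k; rewrite ord1 summxE (bigD1 j)//= !mxE !eqxx mulr1 big1 ?addr0//.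
  by move=> i /negbTE ij; rewrite !mxE eq_sym ij mulr0.
rewrite linear_sum; apply: eq_bigr => i _.
by rewrite linearZ /= deriveE.
Qed.

Lemma is_derive_continuous (a b : R) (g dg : R -> R) :
  (forall t, t \in `[a, b] -> is_derive t 1 g (dg t)) ->
  {within `[a, b], continuous g}.
Proof.
by move=> h; apply: derivable_within_continuous => t tab; have [] := h t tab.
Qed.

Lemma mean_value0 (g dg : R -> R) (t : R) :
  (forall s : R, `|s| <= `|t| -> is_derive s 1 g (dg s)) ->
  exists2 s, `|s| <= `|t| & g t - g 0 = dg s * t.
Proof.
move=> h; have [t0|t0|->] := ltgtP t 0; last 1 first.
- by exists 0; rewrite ?normr0// !subrr mulr0.
- have hd (s : R) : s \in `[t, 0] -> is_derive s 1 g (dg s).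
    rewrite in_itv /= => /andP[ts s0]; apply: h.
    by rewrite !ler0_norm ?lerN2// (le_trans ts).
  have cg := is_derive_continuous hd.
  have H := @MVT_segment R g dg t 0 (ltW t0).
  have [s] := H (fun s sI => hd s (subset_itv_oo_cc sI)) cg.
  rewrite in_itv /= => /andP[ts s0] E; exists s.
    by rewrite !ler0_norm ?lerN2// (le_trans ts).
  by apply: oppr_inj; rewrite opprB E sub0r mulrN.
- have hd (s : R) : s \in `[0, t] -> is_derive s 1 g (dg s).
    rewrite in_itv /= => /andP[s0 st]; apply: h.
    by rewrite !ger0_norm ?(le_trans s0).
  have cg := is_derive_continuous hd.
  have H := @MVT_segment R g dg 0 t (ltW t0).
  have [s] := H (fun s sI => hd s (subset_itv_oo_cc sI)) cg.
  rewrite in_itv /= => /andP[s0 st] E; exists s; last by rewrite E subr0.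
  by rewrite !ger0_norm ?(le_trans s0).
Qed.

(** [dg] is assumed differentiable at 0 only. The derivative of the remainder [G] is o(t), and the
    mean value theorem turns this into o(t^2) for [G] itself. *)
Lemma taylor2 (g dg : R -> R) (c r : R) : 0 < r ->
  (forall t : R, `|t| < r -> is_derive t 1 g (dg t)) -> is_derive (0 : R) 1 dg c ->
  forall e : R, 0 < e -> exists2 r' : R, 0 < r' & forall t, `|t| < r' ->
    `|g t - (g 0 + dg 0 * t + c / 2 * t ^+ 2)| <= e * t ^+ 2.
Proof.
move=> r0 hg hc e e0.
have dc : differentiable dg 0 by apply/derivable1_diffP; case: hc.
have [r1 r10 H] : exists2 r1 : R, 0 < r1 & forall t : R, `|t| < r1 ->
    `|dg t - dg 0 - c * t| <= e * `|t|.
  have /eqaddoP /(_ e e0) := diff_locally dc.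
  move=> /nbhs_ballP[r1 /= r10 H]; exists r1 => // t tr.
  have := H t; rewrite -ball_normE /= sub0r normrN => /(_ tr).
  rewrite /= !fctE /= addr0 opprD addrA.
  have -> // : 'd dg 0 t = c * t.
  have -> : t = t *: (1 : R) by rewrite [RHS]mulr1.
  rewrite linearZ /= -deriveE//; case: hc => _ ->.
  by rewrite [t *: 1]mulr1 [RHS]mulrC.
pose G t := g t - (g 0 + dg 0 * t + c / 2 * t ^+ 2).
have dG (t : R) : `|t| < r -> is_derive t 1 G (dg t - dg 0 - c * t).
  move=> tr; have ig := hg t tr.
  pose P (z : R) := g 0 + dg 0 * z + c / 2 * z ^+ 2.
  have iP : is_derive t 1 P (dg 0 + c * t).
    apply/is_derive1_caratheodory; exists (fun z => dg 0 + c / 2 * (z + t)).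
    split; [by move=> z; rewrite /P; ring| |by field].
    apply: cvgD; first exact: cvg_cst.
    by apply: cvgM; [exact: cvg_cst|apply: cvgD; [exact: cvg_id|exact: cvg_cst]].
  have -> : dg t - dg 0 - c * t = dg t - (dg 0 + c * t) by rewrite opprD addrA.
  exact: (is_deriveB ig iP).
have G0 : G 0 = 0 by rewrite /G !mulr0 expr0n mulr0 !addr0 subrr.
exists (Order.min r r1); first by rewrite lt_min r0.
move=> t; rewrite lt_min => /andP[tr tr1]; rewrite -/(G t).
have [s st E] := @mean_value0 G (fun s => dg s - dg 0 - c * s) t
  (fun s st => dG s (le_lt_trans st tr)).
have -> : G t = G t - G 0 by rewrite G0 subr0.
rewrite E normrM -[t ^+ 2]real_normK ?num_real// expr2 mulrA ler_wpM2r//.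
by apply: le_trans (H s (le_lt_trans st tr1)) _; rewrite ler_pM2l.
Qed.

(** Adding the expansions at t and - t removes the linear term, so its coefficient [b] is
    arbitrary. *)
Lemma second_order_le0 (b c r : R) (h : R -> R) : 0 < r ->
  (forall t, `|t| < r -> h t <= 0) ->
  (forall e : R, 0 < e -> exists2 r' : R, 0 < r' & forall t, `|t| < r' ->
    `|h t - (b * t + c * t ^+ 2)| <= e * t ^+ 2) -> c <= 0.
Proof.
move=> r0 h0 H; rewrite leNgt; apply/negP => c0.
have c20 : 0 < c / 2 by rewrite divr_gt0.
have [r' r'0 Hr] := H _ c20.
pose t := Order.min r r' / 2.
have t0 : 0 < t by rewrite divr_gt0// lt_min r0.
have : `|t| < Order.min r r'.
  by rewrite gtr0_norm// /t ltr_pdivrMr// ltr_pMr ?lt_min ?r0// ltr1n.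
rewrite lt_min => /andP[tr tr'].
have tNr : `|- t| < r by rewrite normrN.
have tNr' : `|- t| < r' by rewrite normrN.
have := Hr t tr'; have := Hr (- t) tNr'; have := h0 _ tr; have := h0 _ tNr.
have : 0 < c * t ^+ 2 by rewrite mulr_gt0// exprn_gt0.
rewrite sqrrN !ler_norml mulrN.
set u := b * t; set w := t ^+ 2 => p h1 h2 /andP[h3 _] /andP[h4 _].
have e1 : c / 2 * w = (c * w) / 2 by ring.
rewrite e1 in h3 h4; set cw := c * w in p h3 h4; lra.
Qed.

(* Second differences: both mixed derivatives are the limit of
   [f (y + h v + h w) - f (y + h v) - f (y + h w) + f y] over [h ^ 2]. *)
Lemma second_difference f y v w r : 0 < r ->
  (forall z, `|z - y| < r -> differentiable f z) ->
  differentiable ('D_v f) y ->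
  forall e : R, 0 < e -> exists2 r' : R, 0 < r' & forall h, `|h| < r' ->
   `|f (y + h *: v + h *: w) - f (y + h *: v) - f (y + h *: w) + f y
     - h ^+ 2 * 'D_w ('D_v f) y| <= e * h ^+ 2.
Proof.
move=> r0 df ddf e e0.
have [C CE] : exists C, C = `|v| + `|w| + 1 by eexists.
have C0 : 0 < C by rewrite CE ltr_wpDl// addr_ge0.
have e10 : 0 < e / (C + C) by rewrite divr_gt0// addr_gt0.
have [r1 r10 H1] := differentiable_near ddf e10.
exists (Order.min (r / C) (r1 / C)); first by rewrite lt_min !divr_gt0.
move=> h; rewrite lt_min !ltr_pdivlMr// => /andP[hr hr1].
pose g s := f (y + h *: w + s *: v) - f (y + s *: v).
have nb (s a : R) : `|s| <= `|h| -> `|a| <= `|h| -> `|a *: w + s *: v| <= `|h| * C.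
  move=> sh ah; apply: le_trans (ler_normD _ _) _; rewrite !normrZ CE !mulrDr mulr1.
  apply: (@le_trans _ _ (`|h| * `|w| + `|h| * `|v|)); first by rewrite lerD// ler_wpM2r.
  by rewrite [X in _ <= X + _]addrC lerDl.
have dg (s : R) : `|s| <= `|h| -> is_derive s 1 g
    ('D_v f (y + h *: w + s *: v) - 'D_v f (y + s *: v)).
  move=> sh; apply: is_deriveB; apply: is_derive_line; apply: df.
    have -> : y + h *: w + s *: v - y = h *: w + s *: v.
      by rewrite -[y + _ + _]addrA [y + (_ + _)]addrC addrK.
    by rewrite (le_lt_trans _ hr)// nb.
  rewrite [y + _]addrC addrK; apply: le_lt_trans hr.
  by have := nb s 0 sh; rewrite normr0 scale0r add0r; apply.
have [s sh E] := mean_value0 dg.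
have -> : f (y + h *: v + h *: w) - f (y + h *: v) - f (y + h *: w) + f y = g h - g 0.
  by rewrite /g scale0r !addr0 [y + h *: v + _]addrAC; ring.
have DE : 'D_w ('D_v f) y = 'd ('D_v f) y w by exact: deriveE.
rewrite E DE.
have n1 : `|h *: w + s *: v| < r1 by rewrite (le_lt_trans _ hr1)// nb.
have n2 : `|s *: v| < r1.
  by apply: le_lt_trans hr1; have := nb s 0 sh; rewrite normr0 scale0r add0r; apply.
have L1 : 'd ('D_v f) y (h *: w + s *: v) =
  h * 'd ('D_v f) y w + s * 'd ('D_v f) y v by rewrite linearD !linearZ.
have L2 : 'd ('D_v f) y (s *: v) = s * 'd ('D_v f) y v by rewrite linearZ.
have := H1 _ n1; have := H1 _ n2; rewrite L1 L2 [y + (h *: w + _)]addrA.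
have -> : ('D_v f (y + h *: w + s *: v) - 'D_v f (y + s *: v)) * h - h ^+ 2 * 'd ('D_v f) y w
  = h * (('D_v f (y + h *: w + s *: v) - 'D_v f y - (h * 'd ('D_v f) y w + s * 'd ('D_v f) y v))
     - ('D_v f (y + s *: v) - 'D_v f y - s * 'd ('D_v f) y v)) by ring.
move=> a2 a1; rewrite normrM -[h ^+ 2]real_normK ?num_real// expr2 mulrCA ler_wpM2l//.
apply: le_trans (ler_normB _ _) _.
apply: (@le_trans _ _ (e / (C + C) * (`|h| * C) + e / (C + C) * (`|h| * C))).
  apply: lerD.
    by apply: le_trans a1 _; rewrite ler_pM2l// nb.
  apply: le_trans a2 _; rewrite ler_pM2l//.
  by have := nb s 0 sh; rewrite normr0 scale0r add0r; apply.
by rewrite le_eqVlt; apply/orP; left; apply/eqP; field; rewrite gt_eqF// addr_gt0.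
Qed.

Lemma derive_sym f y v w r : 0 < r ->
  (forall z, `|z - y| < r -> differentiable f z) ->
  differentiable ('D_v f) y -> differentiable ('D_w f) y ->
  'D_w ('D_v f) y = 'D_v ('D_w f) y.
Proof.
move=> r0 df dv dw; apply/eqP; rewrite -subr_eq0 -normr_le0.
apply/ler_addgt0Pr => e e0; rewrite add0r.
have e20 : 0 < e / 2 by rewrite divr_gt0.
have [r1 r10 H1] := second_difference w r0 df dv e20.
have [r2 r20 H2] := second_difference v r0 df dw e20.
pose h := (Order.min r1 r2) / 2.
have h0 : 0 < h by rewrite divr_gt0// lt_min r10.
have hr : `|h| < Order.min r1 r2.
  by rewrite gtr0_norm// /h ltr_pdivrMr// ltr_pMr ?lt_min ?r10// ltr1n.
move: hr; rewrite lt_min => /andP[/H1 + /H2].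
rewrite [y + h *: w + h *: v]addrAC.
set A := 'D_w _ y; set B := 'D_v _ y.
set F := f (y + h *: v + h *: w); set F1 := f (y + h *: v); set F2 := f (y + h *: w).
move=> b1 b2.
have : `|h ^+ 2 * (A - B)| <= e * h ^+ 2.
  have -> : h ^+ 2 * (A - B) = (F - F2 - F1 + f y - h ^+ 2 * B) - (F - F1 - F2 + f y - h ^+ 2 * A) by ring.
  apply: le_trans (ler_normB _ _) _.
  by apply: le_trans (lerD b2 b1) _; rewrite -mulrDl -splitr.
by rewrite normrM ger0_norm ?sqr_ge0// mulrC ler_pM2r// exprn_gt0.
Qed.

End calculus.

(** * Convex sets and the dual domain *)

Section convex_sets.
Context {R : realType} {n : nat}.
Implicit Types (A : set 'cV[R]_n) (x y z p q : 'cV[R]_n).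

Definition convexV A := forall x y (a : R), A x -> A y -> 0 <= a <= 1 ->
  A (a *: x + (1 - a) *: y).

Lemma closed_le_fun {T : topologicalType} (f : T -> R) c : continuous f ->
  closed [set x | f x <= c].
Proof. by move=> cf; apply: (closed_comp _ (@closed_le R c)) => x _; exact: cf. Qed.

Lemma subl_cvec_continuous x : continuous (fun y : 'cV[R]_n => x - y).
Proof. by move=> y; apply: (@continuousB _ _ _ (fun=> x) id) => //; exact: cst_continuous. Qed.

Lemma closed_ball_cV x (r : R) : closed [set y : 'cV[R]_n | `|x - y| <= r].
Proof.
apply: (@closed_le_fun _ (fun y : 'cV[R]_n => `|x - y|)) => y.
by apply: (continuous_comp (f := fun y => x - y)); [exact: subl_cvec_continuous|exact: norm_continuous].
Qed.

(** Projection to the closure: [p] is a nearest point, found by compactness among the points of the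
    closure no farther from [x] than [a0], and [x - p] is the normal. *)
Lemma separation A x : A !=set0 -> convexV A -> ~ closure A x ->
  exists phi c, (forall q, A q -> dot phi q <= c) /\ c < dot phi x.
Proof.
move=> [a0 Aa0] cA nx.
pose D q := dot (x - q) (x - q).
have Dc : continuous D.
  move=> q; apply: (@cvg_dot _ _ _ (nbhs q) (nbhs_filter q));
    exact: subl_cvec_continuous.
pose B := closure A `&` [set q | D q <= D a0].
have B0 : B !=set0 by exists a0; split => /=; [exact: subset_closure|].
have cB : closed B.
  apply: closedI; first exact: closed_closure.
  exact: closed_le_fun.
have coordD (v : 'cV[R]_n) i : v i 0 ^+ 2 <= dot v v.
  rewrite /dot (bigD1 i)//= -expr2 lerDl; apply: sumr_ge0 => j _.
  by rewrite -expr2 sqr_ge0.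
have kB : compact B.
  apply: cV_compact => //; apply: (@bounded_setP _ _ _ (`|x| + (1 + D a0))) => q [_ /= hq].
  have -> : q = x - (x - q) by rewrite subKr.
  apply: le_trans (ler_normB _ _) _; rewrite lerD2l.
  have D0 : 0 <= D a0 by exact: dot_ge0.
  apply: norm_leP => [|i]; first by rewrite addr_ge0.
  have h : (x - q) i 0 ^+ 2 <= D a0 by apply: le_trans (coordD _ i) hq.
  rewrite -(ler_pXn2r (n := 2))// ?nnegrE ?addr_ge0// real_normK ?num_real//.
  apply: le_trans h _; rewrite sqrrD expr1n mul1r; apply: (@le_trans _ _ (D a0 *+ 2)).
    by rewrite mulr2n lerDl.
  by rewrite addrAC lerDr addr_ge0 ?sqr_ge0.
have [p pB pmin] := compact_EVT_min B0 kB (continuous_subspaceT Dc).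
move: pB; rewrite inE => -[clp /= pa0].
have pmin' q : closure A q -> D p <= D q.
  move=> Aq; have [qa|/ltW qa] := leP (D q) (D a0); last exact: le_trans pa0 qa.
  by apply: pmin; rewrite inE.
have clconv q (a : R) : A q -> 0 <= a <= 1 -> closure A (a *: q + (1 - a) *: p).
  move=> Aq a01; apply/closureE_ball => e e0.
  have /closureE_ball/(_ e e0) [p' Ap' pp'] := clp.
  exists (a *: q + (1 - a) *: p'); first exact: cA.
  rewrite opprD addrACA subrr add0r -scalerBr normrZ.
  apply: le_lt_trans pp'; rewrite ler_piMl//.
  by move: a01 => /andP[a0' a1]; rewrite ger0_norm ?subr_ge0// gerBl.
exists (x - p), (dot (x - p) p); split => [q Aq|]; last first.
  rewrite -subr_gt0 -dotBr dot_gt0// subr_eq0; apply/eqP => xp.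
  by apply: nx; rewrite xp.
rewrite -subr_le0 -dotBr leNgt; apply/negP => h0.
pose c := dot (x - p) (q - p); pose m := dot (q - p) (q - p).
have c0 : 0 < c by [].
have m0 : 0 <= m by exact: dot_ge0.
(* At parameter [a] on the segment from [p] to [q] the squared distance changes by a (a m - 2 c),
   which is negative because a m <= c. *)
pose a := c / (c + m).
have cm0 : 0 < c + m by rewrite ltr_pwDl.
have a0' : 0 < a by rewrite divr_gt0.
have a1 : a <= 1 by rewrite ler_pdivrMr// mul1r lerDl.
have := pmin' _ (clconv q a Aq _); rewrite (ltW a0') a1 => /(_ isT).
have -> : D (a *: q + (1 - a) *: p) = D p - 2 * a * c + a ^+ 2 * m.
  have -> : a *: q + (1 - a) *: p = p + a *: (q - p).
    by rewrite scalerBl scale1r scalerBr addrCA.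
  rewrite /D opprD addrA /c /m; move: (x - p) (q - p) => u v.
  by rewrite !dotE (dotC v u); ring.
rewrite -subr_ge0 leNgt => /negP[].
have -> : D p - 2 * a * c + a ^+ 2 * m - D p = a * (a * m - 2 * c) by ring.
rewrite pmulr_rlt0// subr_lt0.
apply: (@le_lt_trans _ _ c); last by rewrite mulr_natl mulr2n ltrDr.
by rewrite /a mulrAC ler_pdivrMr// ler_pM2l// lerDr ltW.
Qed.

(** [x] is replaced by a close point [q] of [A]; the error is moved to [a], where the ball around
    [a] absorbs it after scaling by t / (1 - t). *)
Lemma open_convex_closure A a x (t : R) : open A -> convexV A -> A a -> closure A x ->
  0 <= t < 1 -> A (t *: x + (1 - t) *: a).
Proof.
move=> oA cA Aa clx /andP[t0 t1].
have [e e0 he] := openE_ball oA Aa.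
have s0 : 0 < 1 - t by rewrite subr_gt0.
have /closureE_ball/(_ _ (mulr_gt0 s0 e0)) [q Aq xq] := clx.
pose z := a + (t / (1 - t)) *: (x - q).
have Az : A z.
  apply: he; rewrite opprD addrA subrr sub0r normrN normrZ ger0_norm; last by rewrite divr_ge0// ltW.
  rewrite mulrAC ltr_pdivrMr// mulrC [e * _]mulrC.
  by apply: le_lt_trans xq; rewrite ler_piMr// ltW.
have E : t *: x + (1 - t) *: a = t *: q + (1 - t) *: z.
  rewrite /z scalerDr scalerA [(1 - t) * _]mulrC divfK ?gt_eqF// scalerBr.
  by apply/matrixP => i j; rewrite !mxE; ring.
by rewrite E; apply: cA => //; rewrite t0 ltW.
Qed.

End convex_sets.

Definition pointed_domain {R : realType} {d : nat} (Om : set 'cV[R]_d) : Prop :=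
  [/\ convex_domain Om, bounded_set Om & Om 0].

Section dual_domain_basics.
Context {R : realType} {d : nat} {Om : set 'cV[R]_d}.
Hypothesis HO : pointed_domain Om.
Let hO : convex_domain Om. Proof. by case: HO. Qed.
Let bO : bounded_set Om. Proof. by case: HO. Qed.
Let O0 : Om 0. Proof. by case: HO. Qed.
Let Os := dual_domain Om.
Implicit Types (x y z : 'cV[R]_d).

Lemma omega_convex : convexV Om.
Proof. by move: hO => [_ _ /convex_setP h] x y a; exact: h. Qed.

Lemma omega_open : open Om. Proof. by case: hO. Qed.

Lemma dual_domain0 : Os 0.
Proof. by move=> x _; rewrite dot0r ltr01. Qed.

Lemma dual_bound : exists2 b : R, 0 < b & forall y, Os y -> `|y| <= b.
Proof.
have [e e0 he] := openE_ball omega_open O0.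
exists (2 / e); first by rewrite divr_gt0.
move=> y Oy; apply: norm_leP => [|i]; first by rewrite divr_ge0// ltW.
pose s := Num.sg (y i 0) * (e / 2).
have sx : Om (s *: basis_vec R i).
  apply: he; rewrite sub0r normrN normrZ.
  apply: (@le_lt_trans _ _ (e / 2 * 1)); last by rewrite mulr1 ltr_pdivrMr// ltr_pMr// ltr1n.
  apply: ler_pM => //.
    rewrite normrM normr_sg (gtr0_norm (divr_gt0 e0 _))//.
    by case: (y i 0 != 0); rewrite ?mul1r ?mul0r// divr_ge0 ?ltW.
  by apply: norm_leP => // j; rewrite mxE eqxx andbT; case: (j == i); rewrite ?normr1 ?normr0.
have := Oy _ (subset_closure sx); rewrite dotZl dotC dot_basis /s.
rewrite mulrAC -normrEsg => h.
rewrite ler_pdivlMr//; have -> : `|y i 0| * e = `|y i 0| * (e / 2) * 2 by field.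
by move: h; set w := _ * (e / 2); lra.
Qed.

Lemma closure_bounded : exists2 b : R, 0 < b & forall x, closure Om x -> `|x| <= b.
Proof.
have [b b0 hb] := bounded_setE bO.
exists b => // x.
have cl : closed [set y : 'cV[R]_d | `|0 - y| <= b] by exact: closed_ball_cV.
have sub : Om `<=` [set y : 'cV[R]_d | `|0 - y| <= b].
  by move=> y /hb; rewrite /= sub0r normrN.
by move=> /(closureS sub); rewrite -(closure_id _).1//= sub0r normrN.
Qed.

(** Compactness of the closure turns the strict inequality into a uniform gap, which survives
    perturbations; conversely the gap only has to be checked on [Om]. *)
Lemma dual_gap y : Os y <-> exists2 e : R, 0 < e & forall x, Om x -> dot x y <= 1 - e.
Proof.
have cOm : compact (closure Om).
  have [b b0 hb] := closure_bounded.
  by apply: cV_compact; [exact: bounded_setP hb|exact: closed_closure].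
split => [Oy|[e e0 he] x clx].
  have ne : closure Om !=set0 by exists 0; exact: subset_closure.
  have [c + cm] := compact_EVT_max ne cOm (continuous_subspaceT (@dot_continuousl R d y)).
  rewrite inE => /Oy c1; exists (1 - dot c y); first by rewrite subr_gt0.
  by move=> x Ox; rewrite subKr; apply: cm; rewrite inE; exact: subset_closure.
apply: (@le_lt_trans _ _ (1 - e)); last by rewrite gtrBl.
have cl : closed [set x : 'cV[R]_d | dot x y <= 1 - e].
  by apply: closed_le_fun; exact: dot_continuousl.
by have := closureS (he : Om `<=` [set x | dot x y <= 1 - e]) clx; rewrite -(closure_id _).1.
Qed.

Lemma dual_open : open Os.
Proof.
have [b b0 hb] := bounded_setE bO.
apply: open_ballE => y /dual_gap [e e0 he].
pose c := d%:R * b + 1.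
have c0 : 0 < c by rewrite ltr_wpDl// mulr_ge0// ltW.
exists (e / 2 / c) => [|z yz]; first by rewrite !divr_gt0.
apply/dual_gap; exists (e / 2); first by rewrite divr_gt0.
move=> x Ox; have -> : z = y - (y - z) by rewrite subKr.
rewrite dotBr.
have h1 := he x Ox; have h2 := dot_le x (y - z).
have h3 : `|dot x (y - z)| <= e / 2.
  apply: le_trans h2 _; apply: (@le_trans _ _ (c * `|y - z|)).
    by rewrite ler_wpM2r// /c ler_wpDr// ler_wpM2l// hb.
  by rewrite mulrC -ler_pdivlMr// ltW.
move: h3; rewrite ler_norml => /andP[h3 _]; lra.
Qed.

Lemma dual_convex : convexV Os.
Proof.
move=> x y a Ox Oy /andP[a0 a1] z clz; rewrite dotDr !dotZr.
have := Ox z clz; have := Oy z clz.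
have : 0 <= 1 - a by rewrite subr_ge0.
by move: a0; rewrite le_eqVlt => /orP[/eqP <-|a0] b0 h1 h2; nra.
Qed.

Lemma closure_dual y : closure Os y <-> forall x, Om x -> dot x y <= 1.
Proof.
split => [cly x Ox|h].
  have cl : closed [set y : 'cV[R]_d | dot x y <= 1].
    by apply: closed_le_fun; exact: dot_continuousr.
  have sub : Os `<=` [set y | dot x y <= 1].
    by move=> z /(_ x (subset_closure Ox)) /ltW.
  by have := closureS sub cly; rewrite -(closure_id _).1.
apply/closureE_ball => e e0.
pose b := e + `|y| + 1; pose t := e / b.
have b0 : 0 < b by rewrite ltr_wpDl// addr_ge0// ltW.
have t0 : 0 < t by rewrite divr_gt0.
have t1 : t <= 1 by rewrite ler_pdivrMr// mul1r /b -addrA lerDl addr_ge0.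
exists ((1 - t) *: y).
  apply/dual_gap; exists t => // x Ox; rewrite dotZr.
  by rewrite ler_piMr ?subr_ge0// h.
rewrite scalerBl scale1r subKr normrZ gtr0_norm// /t mulrAC ltr_pdivrMr//.
by rewrite ltr_pM2l// /b addrAC ltrDr addr_gt0.
Qed.

Lemma closure_dual_lt x y : Om x -> closure Os y -> dot x y < 1.
Proof.
move=> Ox /closure_dual h.
have [e e0 he] := openE_ball omega_open Ox.
pose s := e / 2 / (`|x| + 1).
have s0 : 0 < s by rewrite !divr_gt0// ltr_wpDl.
have : Om ((1 + s) *: x).
  apply: he; rewrite scalerDl scale1r opprD addrA subrr sub0r normrN normrZ gtr0_norm//.
  rewrite /s mulrAC ltr_pdivrMr ?ltr_wpDl//.
  apply: (@le_lt_trans _ _ (e / 2 * (`|x| + 1))).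
    by rewrite ler_wpM2l ?lerDl// divr_ge0// ltW.
  by rewrite ltr_pM2r ?ltr_wpDl// ltr_pdivrMr// ltr_pMr// ltr1n.
move/h; rewrite dotZl => h1.
have [dxy|dxy] := leP (dot x y) 0; first by rewrite (le_lt_trans dxy).
by apply: lt_le_trans h1; rewrite mulrDl mul1r ltrDl mulr_gt0.
Qed.

Lemma closure_dual_scale y (t : R) : closure Os y -> 0 <= t < 1 -> Os (t *: y).
Proof.
move=> cly t01; have := open_convex_closure dual_open dual_convex dual_domain0 cly t01.
by rewrite scaler0 addr0.
Qed.

(** The slack [e] is spent on enlarging [x] to (1 + e) x. If this point were separated from [Om] at
    a level c', then phi / c' would be in the dual domain and the hypothesis would contradict (1 +
    e)(1 - e) <= 1. Hence (1 + e) x is in the closure, and [x], on the segment to the interior point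
    0, is in [Om]. *)
Lemma bipolar x (e : R) : 0 < e -> (forall y, Os y -> dot x y <= 1 - e) -> Om x.
Proof.
move=> e0 h.
pose x' := (1 + e) *: x.
have e10 : 0 < 1 + e by rewrite addr_gt0.
have cx : closure Om x'.
  apply: contrapT => /(separation (ex_intro _ 0 O0) omega_convex) [phi [c [h1 h2]]].
  have c0 : 0 <= c by have := h1 _ O0; rewrite dot0r.
  pose c' := (c + dot phi x') / 2.
  have cc' : c < c' by rewrite /c'; lra.
  have c'x : c' < dot phi x' by rewrite /c'; lra.
  have c'0 := le_lt_trans c0 cc'.
  have Oy : Os (c'^-1 *: phi).
    apply/dual_gap; exists (1 - c / c'); first by rewrite subr_gt0 ltr_pdivrMr// mul1r.
    move=> q Oq; rewrite subKr dotZr dotC mulrC ler_pM2r ?invr_gt0//; exact: h1.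
  have := h _ Oy; rewrite dotZr leNgt => /negP[].
  have : dot phi x' = (1 + e) * dot x phi by rewrite dotZr dotC.
  move=> E; rewrite E in c'x.
  rewrite mulrC ltr_pdivlMr//.
  rewrite -(ltr_pM2l e10); apply: le_lt_trans c'x.
  have -> : (1 + e) * ((1 - e) * c') = (1 - e ^+ 2) * c' by ring.
  by rewrite ger_pMl// gerBl sqr_ge0.
have -> : x = (1 + e)^-1 *: x' + (1 - (1 + e)^-1) *: 0.
  by rewrite scaler0 addr0 scalerA mulVf ?scale1r// gt_eqF.
apply: open_convex_closure => //; [exact: omega_open|exact: omega_convex|].
by rewrite invr_ge0 ltW//= invf_lt1// ltrDl.
Qed.

End dual_domain_basics.

(** * The action of the dividing group *)

Definition xi {R : realType} {d : nat} (y : 'cV[R]_d) : 'cV[R]_(d + 1) := lift1 y (-1).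

(** The automorphy factor of the dual action: [g^T] maps [xi y] to [lam g y] times [xi (act g y)].
    On the dual domain it equals omega(y) / omega(act g y), the factor in the definition of
    equivariance. *)
Definition lam {R : realType} {d : nat} (g : 'M[R]_(d + 1)) (y : 'cV[R]_d) : R :=
  - last_coord (g^T *m xi y).

(** The action of the inverse, so that [g^T] appears and no inverse matrix remains. It is a right
    action: [act (g *m h)] is [act h] after [act g]. *)
Definition act {R : realType} {d : nat} (g : 'M[R]_(d + 1)) (y : 'cV[R]_d) : 'cV[R]_d :=
  dual_act (invmx g) y.

Section action_basics.
Context {R : realType} {d : nat}.
Implicit Types (x y z : 'cV[R]_d) (g h : 'M[R]_(d + 1)) (X : 'cV[R]_(d + 1)) (a b c : R).

Lemma dot_xi x c y : dot (lift1 x c) (xi y) = dot x y - c.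
Proof. by rewrite dot_lift mulrN1. Qed.

Lemma dot_xiE X y : dot X (xi y) = dot (usubmx X) y - last_coord X.
Proof. by rewrite {1}(lift1_last X) dot_xi. Qed.

Lemma xi_inj a b y z : a *: xi y = b *: xi z -> a = b /\ (a != 0 -> y = z).
Proof.
rewrite !lift1Z !mulrN1 => /lift1_inj [h /oppr_inj ab]; split => // a0.
by move: h; rewrite -ab => /(congr1 ( *:%R a^-1)); rewrite !scalerA mulVf// !scale1r.
Qed.

Lemma xi_conv a y z : xi (a *: y + (1 - a) *: z) = a *: xi y + (1 - a) *: xi z.
Proof. by rewrite !lift1Z lift1D; congr lift1; ring. Qed.

Lemma xiD y z : xi (y + z) = xi y + lift1 z 0.
Proof. by rewrite lift1D addr0. Qed.

Lemma last_dot X : last_coord X = dot X (lift1 0 1).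
Proof. by rewrite {2}(lift1_last X) dot_lift dot0r mulr1 add0r. Qed.

Lemma act_xi g y : lam g y != 0 -> g^T *m xi y = lam g y *: xi (act g y).
Proof.
move=> l0; rewrite [LHS]lift1_last lift1Z mulrN1 /act /dual_act invmxK -/(lam g y).
by rewrite scalerA mulfV// scale1r /lam opprK.
Qed.

Lemma dot_act g X y : lam g y != 0 ->
  dot (g *m X) (xi y) = lam g y * dot X (xi (act g y)).
Proof. by move=> l0; rewrite dot_mulmx act_xi// dotZr. Qed.

Lemma lam_conv g a y z : lam g (a *: y + (1 - a) *: z) = a * lam g y + (1 - a) * lam g z.
Proof.
rewrite /lam xi_conv mulmxDr -!scalemxAr !last_dot dotDl !dotZl; ring.
Qed.

Lemma xi_continuous : continuous (@xi R d).
Proof.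
move=> y; apply: (@cvg_lift _ _ _ (nbhs y) (nbhs_filter y) id (fun=> -1)).
  exact: cvg_id.
exact: cvg_cst.
Qed.

Lemma lam_continuous g : continuous (lam g).
Proof.
move=> y.
have h := cvg_mulmx (FF := nbhs_filter y) (M := g^T) (@xi_continuous y).
exact: (cvgN (cvg_last (FF := nbhs_filter y) h)).
Qed.

Lemma act_cvg g y : lam g y != 0 -> act g z @[z --> y] --> act g y.
Proof.
move=> l0.
have -> : act g = fun z => (lam g z)^-1 *: usubmx (g^T *m xi z).
  by apply/funext => z; rewrite /act /dual_act invmxK.
have h := cvg_mulmx (FF := nbhs_filter y) (M := g^T) (@xi_continuous y).
exact: (cvgZ (cvgV l0 (@lam_continuous g y)) (cvg_usubmx (FF := nbhs_filter y) h)).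
Qed.

Lemma lam1 y : lam 1%:M y = 1.
Proof. by rewrite /lam trmx1 mul1mx last_lift opprK. Qed.

Lemma act1 y : act 1%:M y = y.
Proof.
have l1 : lam 1%:M y != 0 by rewrite lam1 oner_eq0.
have := act_xi l1; rewrite trmx1 mul1mx -[LHS]scale1r lam1.
by move=> /esym/xi_inj [_]; apply; exact: oner_neq0.
Qed.

Lemma act_comp g h y : lam g y != 0 -> lam h (act g y) != 0 ->
  lam (g *m h) y = lam g y * lam h (act g y) /\ act (g *m h) y = act h (act g y).
Proof.
move=> l0 l1.
have e : (g *m h)^T *m xi y = (lam g y * lam h (act g y)) *: xi (act h (act g y)).
  by rewrite trmx_mul -mulmxA act_xi// -scalemxAr act_xi// scalerA.
have lE : lam (g *m h) y = lam g y * lam h (act g y).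
  by rewrite /lam e lift1Z last_lift mulrN1 opprK.
have l2 : lam (g *m h) y != 0 by rewrite lE mulf_neq0.
by split => //; move: e; rewrite act_xi// => /xi_inj [_]; apply.
Qed.

End action_basics.

Definition dividing_group {R : realType} {d : nat} (G : set 'M[R]_(d + 1))
  (Om : set 'cV[R]_d) : Prop := SL_subgroup G /\ divides G Om.

Section action.
Context {R : realType} {d : nat} {Om : set 'cV[R]_d}.
Hypothesis HO : pointed_domain Om.
Let bO : bounded_set Om. Proof. by case: HO. Qed.
Let O0 : Om 0. Proof. by case: HO. Qed.
Context {G : set 'M[R]_(d + 1)}.
Hypothesis HG : dividing_group G Om.
Let hG : SL_subgroup G. Proof. by case: HG. Qed.
Let hdiv : divides G Om. Proof. by case: HG. Qed.
Let Os := dual_domain Om.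
Implicit Types (x y z : 'cV[R]_d) (g h : 'M[R]_(d + 1)).

Lemma G_unit g : G g -> g \in unitmx.
Proof. by case: hG => h _ _ _ /h; rewrite unitmxE => ->; exact: unitr1. Qed.

Lemma G_inv g : G g -> G (invmx g).
Proof. by case: hG => _ _ _; exact. Qed.

Lemma G_mul g h : G g -> G h -> G (g *m h).
Proof. by case: hG => _ _ h1 _; exact: h1. Qed.

Lemma G_1 : G 1%:M. Proof. by case: hG. Qed.

Lemma cone_mul g v : G g -> cone Om v -> cone Om (g *m v).
Proof. by move=> Gg cv; case: hdiv => h _ _ _; rewrite -(h _ Gg); exists v. Qed.

Lemma cone_lift x : Om x -> cone Om (lift1 x 1).
Proof. by move=> Ox; exists x, 1; rewrite scale1r. Qed.

(** [lam g y] is minus the pairing of [xi y] with the image of (0, 1) under [g]; this image is in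
    the open cone, where [xi y] is negative. *)
Lemma lam_gt0 g y : G g -> closure Os y -> 0 < lam g y.
Proof.
move=> Gg cly; have [x [t [Ox t0 e]]] := cone_mul Gg (cone_lift O0).
rewrite /lam last_dot dotC -dot_mulmx e lift1Z dot_xi dotZl mulr1 oppr_gt0 subr_lt0.
by rewrite gtr_pMr// (closure_dual_lt HO Ox cly).
Qed.

Lemma lam_neq0 g y : G g -> closure Os y -> lam g y != 0.
Proof. by move=> Gg cly; rewrite gt_eqF// lam_gt0. Qed.

Lemma act_closure g y : G g -> closure Os y -> closure Os (act g y).
Proof.
move=> Gg cly; apply/(closure_dual HO) => x Ox.
have [x' [t [Ox' t0 e]]] := cone_mul Gg (cone_lift Ox).
have := dot_act (lift1 x 1) (lam_neq0 Gg cly).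
rewrite e lift1Z !dot_xi dotZl mulr1 => h.
have : lam g y * (dot x (act g y) - 1) < 0.
  by rewrite -h subr_lt0 gtr_pMr// (closure_dual_lt HO Ox' cly).
by rewrite pmulr_rlt0 ?lam_gt0// subr_lt0 => /ltW.
Qed.

(** The gap of [y] is transported, not just the inequality. The image of (x, 1) is t (x', 1), and t
    is at least [C^-1] because 1 / t is the last coordinate of the preimage of (x', 1), where x'
    ranges over a bounded set. *)
Lemma act_Os g y : G g -> Os y -> Os (act g y).
Proof.
move=> Gg Oy; have cly := subset_closure Oy.
have /(dual_gap HO) [e e0 he] := Oy.
have [b b0 hb] := bounded_setE bO.
pose w := (invmx g)^T *m lift1 0 1.
pose C := (d + 1)%:R * (b + 1) * `|w| + 1.
have C0 : 0 < C by rewrite ltr_wpDl// !mulr_ge0// addr_ge0// ltW.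
apply/(dual_gap HO); exists (e / C / lam g y).
  by rewrite !divr_gt0 ?lam_gt0.
move=> x Ox.
have [x' [t [Ox' t0 E]]] := cone_mul Gg (cone_lift Ox).
have := dot_act (lift1 x 1) (lam_neq0 Gg cly).
rewrite E lift1Z !dot_xi dotZl mulr1 => H.
have tC : C^-1 <= t.
  have E2 : lift1 x 1 = t *: (invmx g *m lift1 x' 1).
    by rewrite scalemxAr -E mulmxA mulVmx ?mul1mx// G_unit.
  have := congr1 (@last_coord R d) E2; rewrite last_lift last_dot dotZl dot_mulmx -/w => E3.
  have h1 : dot (lift1 x' 1) w <= C.
    apply: le_trans (ler_norm _) _; apply: le_trans (dot_le _ _) _.
    rewrite /C ler_wpDr// ler_wpM2r// ler_wpM2l//.
    apply: norm_lift; first by rewrite addr_ge0// ltW.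
      by rewrite (le_trans (hb _ Ox'))// lerDl.
    by rewrite normr1 lerDr ltW.
  rewrite -(ler_pM2r C0) mulVf ?gt_eqF// {1}E3.
  by rewrite ler_pM2l.
have := he _ Ox'.
have l0 := lam_gt0 Gg cly.
move=> h1.
have h2 : t * (dot x' y - 1) <= C^-1 * - e.
  apply: (@le_trans _ _ (t * - e)); first by rewrite ler_pM2l//; lra.
  by rewrite !mulrN lerN2 ler_pM2r.
have : lam g y * (dot x (act g y) - 1) <= - (e / C).
  have -> : - (e / C) = C^-1 * - e by rewrite mulrN mulrC.
  by rewrite -H; apply: le_trans h2; rewrite mulrBr mulr1.
rewrite mulrC -ler_pdivlMr// => h3.
by move: h3; rewrite mulNr; lra.
Qed.

Lemma act_closureV g y : G g -> closure Os y -> act (invmx g) (act g y) = y /\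
  lam g y * lam (invmx g) (act g y) = 1.
Proof.
move=> Gg cly.
have [e1 e2] := act_comp (lam_neq0 Gg cly) (lam_neq0 (G_inv Gg) (act_closure Gg cly)).
by rewrite -e1 -e2 mulmxV ?G_unit// act1 lam1.
Qed.

Lemma act_closureVK g y : G g -> closure Os y -> act g (act (invmx g) y) = y.
Proof.
by move=> Gg cly; have [+ _] := act_closureV (G_inv Gg) cly; rewrite invmxK.
Qed.

Lemma act_mul g h y : G g -> G h -> closure Os y -> act (g *m h) y = act h (act g y).
Proof.
by move=> Gg Gh cly; have [_] := act_comp (lam_neq0 Gg cly) (lam_neq0 Gh (act_closure Gg cly)).
Qed.

End action.

(** * Equivariance of the Cheng-Yau potential *)

Section projective_maximum.
Context {R : realType}.
Implicit Types (g : R -> R) (p c l e r t : R).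

(* [t |-> (l0 + l1 t) g1 (t / (l0 + l1 t))] is the expression along a line of
   a function transported by a projective map. *)
Lemma projective_max (g0 g1 : R -> R) (p0 p1 c0 c1 l0 l1 r : R) : 0 < l0 -> 0 < r ->
  (forall e : R, 0 < e -> exists2 r' : R, 0 < r' & forall t, `|t| < r' ->
     `|g0 t - (g0 0 + p0 * t + c0 / 2 * t ^+ 2)| <= e * t ^+ 2) ->
  (forall e : R, 0 < e -> exists2 r' : R, 0 < r' & forall t, `|t| < r' ->
     `|g1 t - (g1 0 + p1 * t + c1 / 2 * t ^+ 2)| <= e * t ^+ 2) ->
  (forall t, `|t| < r ->
     (l0 + l1 * t) * g1 (t / (l0 + l1 * t)) - g0 t <= l0 * g1 0 - g0 0) ->
  c1 / l0 <= c0.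
Proof.
move=> l00 r0 T0 T1 mx.
suff : 2^-1 * (c1 / l0 - c0) <= 0 by rewrite pmulr_rle0 ?subr_le0.
pose h t := (l0 + l1 * t) * g1 (t / (l0 + l1 * t)) - g0 t - (l0 * g1 0 - g0 0).
apply: (@second_order_le0 _ (l1 * g1 0 + p1 - p0) _ r h) => //.
  by move=> t tr; rewrite subr_le0 mx.
move=> e e0.
have e30 : 0 < e / 3 by rewrite divr_gt0.
have [r1 r10 H0] := T0 _ e30.
have [r2 r20 H1] := T1 _ (mulr_gt0 e30 (divr_gt0 l00 (ltr0Sn R 1))).
pose m := `|l1| + 1; have m0 : 0 < m by rewrite ltr_wpDl.
pose q := `|c1| + 1; have q0 : 0 < q by rewrite ltr_wpDl.
(* [r3] keeps the denominator above l0 / 2, [r4] keeps t / L in the range of the expansion of [g1],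
   and [r5] absorbs the cubic term left by the factor 1 / L. *)
pose r3 := l0 / 2 / m; have r30 : 0 < r3 by rewrite !divr_gt0.
pose r4 := r2 * l0 / 2; have r40 : 0 < r4 by rewrite divr_gt0// mulr_gt0.
pose r5 := e / 3 * (l0 ^+ 2) / (m * q).
have r50 : 0 < r5 by rewrite divr_gt0 ?mulr_gt0// exprn_gt0.
exists (Order.min r1 (Order.min r3 (Order.min r4 r5))).
  by rewrite !lt_min r10 r30 r40 r50.
move=> t; rewrite !lt_min => /andP[t1 /andP[t3 /andP[t4 t5]]].
pose L := l0 + l1 * t.
have l1t : `|l1 * t| <= l0 / 2.
  rewrite normrM; apply: (@le_trans _ _ (m * `|t|)); first by rewrite ler_wpM2r// lerDl.
  by rewrite mulrC -ler_pdivlMr// ltW.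
have L0 : l0 / 2 <= L.
  by move: l1t; rewrite ler_norml /L => /andP[+ _]; lra.
have Lp : 0 < L by apply: lt_le_trans L0; rewrite divr_gt0.
have tL : `|t / L| < r2.
  rewrite normrM normfV (gtr0_norm Lp) ltr_pdivrMr//.
  apply: lt_le_trans t4 _; rewrite /r4 -mulrA ler_pM2l//.
have B1 := H1 _ tL; have B0 := H0 _ t1.
set X := g1 (t / L) - _ in B1; set Y := g0 t - _ in B0.
have -> : h t - ((l1 * g1 0 + p1 - p0) * t + 2^-1 * (c1 / l0 - c0) * t ^+ 2) =
    L * X - Y + - (c1 * l1 * t / (2 * L * l0)) * t ^+ 2.
  rewrite /h -/L /X /Y; move: (g1 (t / L)) => G.
  have Ln : l0 + l1 * t != 0 by rewrite gt_eqF.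
  by rewrite /L; field; rewrite Ln gt_eqF.
have b1 : `|L * X| <= e / 3 * t ^+ 2.
  rewrite normrM (gtr0_norm Lp); apply: le_trans (ler_wpM2l (ltW Lp) B1) _.
  have -> : L * (e / 3 * (l0 / 2) * (t / L) ^+ 2) = e / 3 * t ^+ 2 * ((l0 / 2) / L).
    by field; rewrite gt_eqF.
  apply: ler_piMr; first by apply: mulr_ge0; [exact: ltW|exact: sqr_ge0].
  by rewrite ler_pdivrMr// mul1r.
have b3 : `|- (c1 * l1 * t / (2 * L * l0)) * t ^+ 2| <= e / 3 * t ^+ 2.
  rewrite normrM (ger0_norm (sqr_ge0 t)) ler_wpM2r ?sqr_ge0// normrN.
  have dp : 0 < 2 * L * l0 by rewrite !mulr_gt0.
  rewrite normrM normfV (gtr0_norm dp) ler_pdivrMr// !normrM.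
  apply: (@le_trans _ _ (q * m * r5)).
    have c1q : `|c1| <= q by rewrite lerDl.
    have l1m : `|l1| <= m by rewrite lerDl.
    by apply: ler_pM; [rewrite mulr_ge0|exact: normr_ge0|apply: ler_pM|exact: ltW].
  have -> : q * m * r5 = e / 3 * l0 ^+ 2 by rewrite /r5; field; rewrite !gt_eqF.
  apply: ler_wpM2l; first exact: ltW.
  by rewrite expr2 ler_pM2r//; lra.
have -> : e * t ^+ 2 = e / 3 * t ^+ 2 + e / 3 * t ^+ 2 + e / 3 * t ^+ 2 by field.
apply: le_trans (ler_normD _ _) _; apply: lerD => //.
by apply: le_trans (ler_normB _ _) _; apply: lerD.
Qed.

End projective_maximum.

Section cheng_yau_regularity.
Context {R : realType} {d : nat} {Os : set 'cV[R]_d} {om : 'cV[R]_d -> R}.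
Hypothesis (oOs : open Os) (hom : cheng_yau Os om).
Implicit Types (y z v w : 'cV[R]_d).

Lemma om_diff y : Os y -> differentiable om y.
Proof. by case: hom => h _ _ _; exact: (h [::]). Qed.

Lemma om_diff1 y v : Os y -> differentiable ('D_v om) y.
Proof. by case: hom => h _ _ _; exact: (h [:: v]). Qed.

Lemma om_lt0 y : Os y -> om y < 0.
Proof. by case: hom => _ _ h _ /h []. Qed.

Lemma om_det y : Os y -> \det (hessian om y) = (- om y) ^- (d + 2).
Proof. by case: hom => _ _ h _ /h []. Qed.

Lemma om_convex x y (a : R) : Os x -> Os y -> 0 <= a <= 1 ->
  om (a *: x + (1 - a) *: y) <= a * om x + (1 - a) * om y.
Proof. by case: hom => _ /convex_functionP h _ _; exact: h. Qed.

Lemma om_continuous y : Os y -> {for y, continuous om}.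
Proof. by move=> Oy; apply: differentiable_continuous; exact: om_diff. Qed.

Lemma Os_line y v : Os y -> exists2 r : R, 0 < r & forall t, `|t| < r -> Os (y + t *: v).
Proof.
move=> Oy; have [e e0 he] := openE_ball oOs Oy.
exists (e / (`|v| + 1)); first by rewrite divr_gt0// ltr_wpDl.
move=> t; rewrite ltr_pdivlMr ?ltr_wpDl// => tv; apply: he.
rewrite opprD addrA subrr sub0r normrN normrZ; apply: le_lt_trans tv.
by rewrite ler_wpM2l// lerDl.
Qed.

Lemma hessian_sym y : Os y -> (hessian om y)^T = hessian om y.
Proof.
move=> Oy; have [e e0 he] := openE_ball oOs Oy.
apply/matrixP => i j; rewrite !mxE.
apply: (derive_sym e0); [|exact: om_diff1|exact: om_diff1].
by move=> z zy; apply: om_diff; apply: he; rewrite distrC.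
Qed.

Lemma hessianE y v : Os y -> 'D_v ('D_v om) y = qform (hessian om y) v.
Proof.
move=> Oy; have [e e0 he] := openE_ball oOs Oy.
have hd z : `|z - y| < e -> differentiable om z.
  by move=> zy; apply: om_diff; apply: he; rewrite distrC.
rewrite derive_sum; last exact: om_diff1.
rewrite /qform -mulmxA mxE; apply: eq_bigr => i _; rewrite [v^T _ _]mxE; congr (_ * _).
rewrite (derive_sym e0 hd); [|exact: om_diff1|exact: om_diff1].
rewrite derive_sum; last exact: om_diff1.
rewrite mxE; apply: eq_bigr => j _; rewrite mulrC mxE.
by congr (_ * _); apply: (derive_sym e0 hd); exact: om_diff1.
Qed.

Lemma om_taylor y v : Os y -> forall e : R, 0 < e ->
  exists2 r : R, 0 < r & forall t, `|t| < r ->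
  `|om (y + t *: v) - (om (y + 0 *: v) + 'D_v om y * t + qform (hessian om y) v / 2 * t ^+ 2)|
    <= e * t ^+ 2.
Proof.
move=> Oy; have [r r0 hr] := Os_line v Oy.
have := @taylor2 R (fun t => om (y + t *: v)) (fun t => 'D_v om (y + t *: v))
  (qform (hessian om y) v) r r0.
rewrite scale0r addr0; apply.
  by move=> t tr; apply: is_derive_line; apply: om_diff; exact: hr.
rewrite -hessianE; last exact: Oy.
exact: is_derive_line0 (om_diff1 v Oy).
Qed.

(** By midpoint convexity 2 om(y) - om(y + t v) - om(y - t v) is nonpositive, and its second order
    coefficient is minus the Hessian form. *)
Lemma hessian_psd y v : Os y -> 0 <= qform (hessian om y) v.
Proof.
move=> Oy; rewrite -oppr_le0.
have [r r0 hr] := Os_line v Oy.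
apply: (@second_order_le0 _ 0 _ r
  (fun t => 2 * om y - om (y + t *: v) - om (y + (- t) *: v))) => //.
  move=> t tr.
  have tr' : `|- t| < r by rewrite normrN.
  have := @om_convex _ _ (2^-1) (hr _ tr) (hr _ tr') _.
  have -> : 2^-1 *: (y + t *: v) + (1 - 2^-1) *: (y + - t *: v) = y.
    by apply/matrixP => i j; rewrite !mxE; field.
  by move=> h; have := h ltac:(lra); lra.
move=> e e0; have e20 : 0 < e / 2 by rewrite divr_gt0.
have [r1 r10 H] := om_taylor v Oy e20.
exists r1 => // t tr; have tr' : `|- t| < r1 by rewrite normrN.
have := H t tr; have := H _ tr'; rewrite scale0r addr0 sqrrN !ler_norml mul0r add0r.
set q := qform _ _; set w := t ^+ 2; set a := 'D_v om y.
have -> : a * - t = - (a * t) by ring.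
have -> : e / 2 * w = (e * w) / 2 by ring.
have -> : q / 2 * w = (q * w) / 2 by ring.
have -> : - q * w = - (q * w) by ring.
by set u := e * w; set s := q * w; set k := a * t => /andP[h1 h2] /andP[h3 h4]; apply/andP; split; lra.
Qed.

(** Convexity alone gives semidefiniteness; the Monge-Ampere equation excludes a kernel. *)
Lemma hessian_pd y v : Os y -> v != 0 -> 0 < qform (hessian om y) v.
Proof.
move=> Oy v0; apply: psd_det_pos => //.
- exact: hessian_sym.
- by move=> w; exact: hessian_psd.
- by rewrite om_det// invr_eq0 expf_neq0// oppr_eq0 lt_eqF// om_lt0.
Qed.

(** The boundary value 0 keeps these sets away from the boundary. They exhaust the dual domain, and
    one of them meets every orbit, so they serve as the compact sets of the whole development. *)
Lemma om_sublevel_compact (e : R) : compact (closure Os) -> 0 < e ->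
  compact [set y | Os y /\ om y <= - e].
Proof.
move=> cO e0; apply: (subclosed_compact _ cO); last by move=> y [/subset_closure].
have cw y : closure Os y -> om z @[z --> within (closure Os) (nbhs y)] --> om y.
  by case: hom => _ _ _ [/subspace_continuousP h _]; exact: h.
move=> y cly.
have cOy : closure Os y by apply: closureS cly => z [].
have omy : om y <= - e.
  rewrite leNgt; apply/negP => h.
  have e'0 : 0 < om y + e by rewrite -ltrBlDr sub0r.
  have /cvgrPdist_lt /(_ _ e'0) := cw y cOy; rewrite near_withinE => N.
  have [z [[Oz omz] zN]] := cly _ N.
  have := zN (subset_closure Oz); rewrite /= ltr_norml => /andP[_]; lra.
split => //; have [//|nOy] := pselect (Os y).
have : om y = 0.
  by case: hom => _ _ _ [_ h]; apply: h; split => // /interior_subset.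
by move=> h; move: omy; rewrite h lerNr oppr0 leNgt e0.
Qed.

(** The positive second order term gives strictness at a small t, and convexity along the segment
    carries it to [z]. *)
Lemma om_strict y z : Os y -> Os z -> z != y ->
  om y + 'D_(z - y) om y < om z.
Proof.
move=> Oy Oz zy; have v0 : z - y != 0 by rewrite subr_eq0.
have q0 := hessian_pd Oy v0; set q := qform _ _ in q0.
have e0 : 0 < q / 4 by rewrite divr_gt0.
have [r r0 H] := om_taylor (z - y) Oy e0.
pose t := Order.min (r / 2) 1.
have t0 : 0 < t by rewrite lt_min divr_gt0/=.
have t1 : t <= 1 by rewrite ge_min lexx orbT.
have tr : `|t| < r.
  rewrite gtr0_norm// (@le_lt_trans _ _ (r / 2))//; first by rewrite ge_min lexx.
  by rewrite ltr_pdivrMr// ltr_pMr// ltr1n.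
have := H t tr; rewrite scale0r addr0 -/q ler_norml => /andP[h _].
have := @om_convex z y t Oz Oy _; rewrite (ltW t0) t1 => /(_ isT).
have -> : t *: z + (1 - t) *: y = y + t *: (z - y).
  by apply/matrixP => i j; rewrite !mxE; ring.
move=> h2; set D := 'D_ _ _ _ in h *.
have h3 : t * (om y + D + q / 4 * t) <= t * om z.
  have -> : t * (om y + D + q / 4 * t) = om y + D * t + q / 2 * t ^+ 2 - q / 4 * t ^+ 2 - (1 - t) * om y by field.
  by move: h h2; set u := q / 4 * t ^+ 2; set w := q / 2 * t ^+ 2; set o := om (y + _); lra.
move: h3; rewrite ler_pM2l//; apply: lt_le_trans; rewrite ltrDl mulr_gt0//.
Qed.

Lemma om_tangent y z : Os y -> Os z -> om y + 'D_(z - y) om y <= om z.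
Proof.
move=> Oy Oz; have [->|zy] := eqVneq z y; last exact/ltW/om_strict.
by rewrite subrr deriveE ?linear0 ?addr0//; exact: om_diff.
Qed.

Lemma om_midpoint y z : Os y -> Os z -> z != y -> Os (2^-1 *: (y + z)) ->
  om (2^-1 *: (y + z)) < 2^-1 * (om y + om z).
Proof.
move=> Oy Oz zy Om; set m := 2^-1 *: _ in Om *.
have D v : 'D_(- v) om m = - 'D_v om m.
  by rewrite !deriveE ?linearN//; exact: om_diff.
have E : y - m = - (z - m) by apply/matrixP => i j; rewrite /m !mxE; field.
have zm : z != m.
  apply: contra zy => /eqP h; apply/eqP.
  by have : 2 *: z = 2 *: m by [rewrite -h]; rewrite /m scalerA mulfV// scale1r scaler_nat mulr2n => /addIr.
have h1 := om_strict Om Oz zm; have h2 := om_tangent Om Oy.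
by rewrite E D in h2; lra.
Qed.

End cheng_yau_regularity.

Section cheng_yau_equivariance.
Context {R : realType} {d : nat} {Om : set 'cV[R]_d} {G : set 'M[R]_(d + 1)}.
Hypothesis (HO : pointed_domain Om) (HG : dividing_group G Om).
Let Os := dual_domain Om.
Context {om : 'cV[R]_d -> R}.
Hypothesis hom : cheng_yau Os om.
Implicit Types (y z v : 'cV[R]_d) (g : 'M[R]_(d + 1)).

Let oOs : open Os := dual_open HO.

(** [act_diff g (act g y)] divided by [lam g y] is the differential of [act g] at [y]; the argument
    is the image point because the formula is simplest there. *)
Definition act_diff g z : 'M[R]_d :=
  ulsubmx g^T + z *m dlsubmx g^T.

Lemma dual_closure_compact : compact (closure Os).
Proof.
have [b b0 hb] := dual_bound HO; apply: cV_compact; last exact: closed_closure.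
have sub : Os `<=` [set y : 'cV[R]_d | `|0 - y| <= b].
  by move=> y /hb; rewrite /= sub0r normrN.
apply: (@bounded_setP _ _ _ b) => y /(closureS sub).
by rewrite -(closure_id _).1 /= ?sub0r ?normrN//; exact: closed_ball_cV.
Qed.

Lemma lam_act_line g y v (t : R) : lam g y != 0 ->
  let l := - last_coord (g^T *m lift1 v 0) in
  (lam g (y + t *: v) = lam g y + l * t) /\
  (lam g (y + t *: v) != 0 ->
   act g (y + t *: v) = act g y + (t / lam g (y + t *: v)) *: (act_diff g (act g y) *m v)).
Proof.
move=> l0 l.
have X : g^T *m xi (y + t *: v) = lam g y *: xi (act g y) + t *: (g^T *m lift1 v 0).
  have Z : lift1 (t *: v) 0 = t *: lift1 v 0 by rewrite lift1Z mulr0.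
  by rewrite xiD Z mulmxDr -scalemxAr act_xi.
have E1 : lam g (y + t *: v) = lam g y + l * t.
  by rewrite {1}/lam X !last_dot dotDl !dotZl -!last_dot last_lift /l; ring.
split => // l1.
have W : g^T *m lift1 v 0 = col_mx (ulsubmx g^T *m v) (dlsubmx g^T *m v).
  rewrite -{1}[g^T]submxK /lift1 mul_block_col.
  by rewrite (_ : 0%:M = 0) ?mulmx0 ?addr0//; apply/matrixP => i j; rewrite !mxE mul0rn.
have lE : dlsubmx g^T *m v = (- l)%:M.
  by rewrite /l W /last_coord col_mxKd opprK -mx11_scalar.
have Bv : act_diff g (act g y) *m v = usubmx (g^T *m lift1 v 0) - l *: act g y.
  by rewrite /act_diff mulmxDl -mulmxA lE mul_mx_scalar W col_mxKu scaleNr.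
have uZ a (w : 'cV[R]_(d + 1)) : usubmx (a *: w) = a *: usubmx w by rewrite linearZ.
have uD (w w' : 'cV[R]_(d + 1)) : usubmx (w + w') = usubmx w + usubmx w' by rewrite linearD.
have Bv' : usubmx (g^T *m lift1 v 0) = act_diff g (act g y) *m v + l *: act g y.
  by rewrite Bv subrK.
move: X; rewrite act_xi// => /(congr1 usubmx).
rewrite uD !uZ !usubmx_lift Bv'.
move: (act g (y + t *: v)) => w.
move=> /(congr1 ( *:%R (lam g (y + t *: v))^-1)); rewrite scalerA mulVf// scale1r => ->.
move: (act_diff g (act g y) *m v) (act g y) => b z; rewrite E1 in l1 *.
by apply/matrixP => i j; rewrite !mxE; field.
Qed.

(** [P u] has [xi u] as its last column, so [g^T *m P y] is [P z] times a block triangular matrix,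
    and both [P y] and [P z] have determinant -1. *)
Lemma det_act_diff g y : \det g = 1 -> lam g y != 0 ->
  \det (act_diff g (act g y)) = (lam g y)^-1.
Proof.
move=> dg l0; set z := act g y; set B := act_diff g z.
pose P (u : 'cV[R]_d) : 'M[R]_(d + 1) := block_mx 1%:M u 0 (-1)%:M.
have dP u : \det (P u) = -1 by rewrite det_ublock det1 det_scalar expr1 mul1r.
have E : g^T *m P y = P z *m block_mx B 0 (- dlsubmx g^T) (lam g y)%:M.
  have := act_xi l0; rewrite -{1}[g^T]submxK /xi /lift1 mul_block_col scale_col_mx.
  move=> /eq_col_mx [h1 h2].
  rewrite -{1}[g^T]submxK !mulmx_block !mulmx1 !mulmx0 !mul1mx !mul0mx !addr0 !add0r.
  congr block_mx.
  - by rewrite /B /act_diff mulmxN addrK.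
  - by rewrite h1 mul_mx_scalar.
  - by rewrite mul_scalar_mx scaleN1r opprK.
  - by rewrite h2 -scalar_mxM scale_scalar_mx mulrC.
have := congr1 (fun A => \det A) E.
rewrite !det_mulmx det_tr dg !dP mul1r det_lblock det_scalar expr1 mulN1r => /oppr_inj h.
by apply: (mulIf l0); rewrite mulVf.
Qed.

(** Maximum principle. At a positive maximum of [D] the Hessian of the transported function is at
    most that of [om], hence so is its determinant. By the Monge-Ampere equation for both functions,
    the transported function is then at most [om] at that point, a contradiction. *)
Lemma om_act_le g y : G g -> Os y -> lam g y * om (act g y) <= om y.
Proof.
move=> Gg Oy1; rewrite leNgt; apply/negP => gt.
pose D z := lam g z * om (act g z) - om z.
pose e := D y; have e0 : 0 < e by rewrite subr_gt0.
(* The first term of [D] is negative, so [D] reaches [e] only where [om] is below - e: the maximum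
   is sought on a compact set and nothing has to be known near the boundary. *)
pose S := [set z | Os z /\ om z <= - e].
have cS : compact S by apply: om_sublevel_compact; [exact: hom|exact: dual_closure_compact|].
have lp z : Os z -> 0 < lam g z by move=> Oz; exact: (lam_gt0 HO HG Gg (subset_closure Oz)).
have aO z : Os z -> Os (act g z) by move=> Oz; exact: (act_Os HO HG Gg Oz).
have big z : Os z -> e <= D z -> S z.
  move=> Oz h; split => //; have : lam g z * om (act g z) < 0.
    by rewrite pmulr_rlt0 ?lp// (om_lt0 hom (aO _ Oz)).
  by move: h; rewrite /D; lra.
have Sy : S y by apply: big.
have cD : {within S, continuous D}.
  have cz z : Os z -> D z' @[z' --> z] --> D z.
    move=> Oz; apply: (cvgB (FF := nbhs_filter z)); last exact: (om_continuous hom Oz).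
    apply: (cvgM (FF := nbhs_filter z)); first exact: lam_continuous.
    apply: (cvg_comp (act g) om); first exact: (act_cvg (lt0r_neq0 (lp _ Oz))).
    exact: om_continuous (aO _ Oz).
  by apply/subspace_continuousP => z [Oz _]; apply: cvg_within_filter; exact: cz.
have [y0 + mx] := compact_EVT_max (ex_intro _ y Sy) cS cD.
rewrite inE => -[Oy0 _].
have eD0 : e <= D y0 by apply: mx; rewrite inE.
have mx' z : Os z -> D z <= D y0.
  by move=> Oz; have [/ltW h|/(big _ Oz) Sz] := ltP (D z) e; [exact: le_trans h _|apply: mx; rewrite inE].
have l0 := lp _ Oy0; pose z0 := act g y0; have Oz0 := aO _ Oy0.
pose B := act_diff g z0.
have key v : qform (hessian om z0) (B *m v) / lam g y0 <= qform (hessian om y0) v.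
  have [r r0 hr] := Os_line oOs v Oy0.
  pose l := - last_coord (g^T *m lift1 v 0).
  apply: (@projective_max R (fun t => om (y0 + t *: v)) (fun t => om (z0 + t *: (B *m v)))
    ('D_v om y0) ('D_(B *m v) om z0) _ _ (lam g y0) l r) => //.
  - exact: (om_taylor oOs hom v Oy0).
  - exact: (om_taylor oOs hom (B *m v) Oz0).
  - move=> t tr; have Ot := hr t tr; have lt := lp _ Ot.
    have [e1 e2] := lam_act_line v t (lt0r_neq0 l0).
    rewrite !scale0r !addr0 -e1 -/z0 -/B -(e2 (lt0r_neq0 lt)).
    exact: mx'.
have dB : \det B = (lam g y0)^-1.
  by apply: (det_act_diff _ (lt0r_neq0 l0)); case: HG => -[h _ _ _] _; exact: h.
(* The Hessian of the transported function at [y0]. Its determinant has d factors 1 / lam from the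
   scaling and two from [B], together the power d + 2 of the equation. *)
pose H1 := (lam g y0)^-1 *: (B^T *m hessian om z0 *m B).
have qH1 v : qform H1 v = qform (hessian om z0) (B *m v) / lam g y0.
  by rewrite /qform /H1 -scalemxAr -scalemxAl mxE mulrC trmx_mul !mulmxA.
have /andP[_] : 0 < \det H1 <= \det (hessian om y0).
  apply: det_le_qform; [exact: (hessian_sym oOs hom Oy0)| | |by move=> v; rewrite qH1].
    by rewrite /H1 linearZ /= !trmx_mul trmxK (hessian_sym oOs hom Oz0) mulmxA.
  move=> v v0; rewrite qH1 divr_gt0//; apply: (hessian_pd oOs hom Oz0); apply: contra v0 => /eqP Bv.
  have uB : B \in unitmx by rewrite unitmxE dB unitfE invr_eq0 gt_eqF.
  by rewrite -[v]mul1mx -(mulVmx uB) -mulmxA Bv mulmx0.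
rewrite (om_det hom Oy0) /H1 detZ !det_mulmx det_tr (om_det hom Oz0) dB.
have Nz : 0 < - om z0 by rewrite oppr_gt0 (om_lt0 hom Oz0).
have Ny : 0 < - om y0 by rewrite oppr_gt0 (om_lt0 hom Oy0).
have -> : (lam g y0)^-1 ^+ d * ((lam g y0)^-1 * (- om z0) ^- (d + 2) * (lam g y0)^-1) =
   (lam g y0 * - om z0) ^- (d + 2).
  by rewrite exprMn invfM -!exprVn !exprD !expr2; ring.
have p1 := ltW Ny; have p2 := ltW (mulr_gt0 l0 Nz).
rewrite lef_pV2 ?posrE ?exprn_gt0 ?mulr_gt0//.
have /(ler_pXn2r (R := R)) -> : (0 < d + 2)%N by rewrite addn2.
  2,3: by rewrite nnegrE.
move=> h; move: (lt_le_trans e0 eD0); rewrite /D -/z0; move: h; rewrite mulrN; lra.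
Qed.

Lemma om_act g y : G g -> Os y -> om y = lam g y * om (act g y).
Proof.
move=> Gg Oy; apply/eqP; rewrite eq_le om_act_le// andbT.
have cly := subset_closure Oy.
have [e1 e2] := act_closureV HO HG Gg cly.
have := om_act_le (G_inv HG Gg) (act_Os HO HG Gg Oy); rewrite e1 => h.
have l0 := lam_gt0 HO HG Gg cly.
by have := ler_wpM2l (ltW l0) h; rewrite mulrA e2 mul1r.
Qed.

End cheng_yau_equivariance.

(** * The affine sphere *)

Section affine_normals.
Context {R : realType} {d : nat} {Om : set 'cV[R]_d} {G : set 'M[R]_(d + 1)}.
Hypothesis (HO : pointed_domain Om) (HG : dividing_group G Om).
Let Os := dual_domain Om.
Context {om : 'cV[R]_d -> R}.
Hypothesis hom : cheng_yau Os om.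
Let oOs : open Os := dual_open HO.
Let cOs : convexV Os := @dual_convex R d Om.
Let O0 : Os 0 := @dual_domain0 R d Om.
Implicit Types (y z v : 'cV[R]_d) (g : 'M[R]_(d + 1)) (X : 'cV[R]_(d + 1)).
Let N := affine_normal om.

Lemma normalE y z : Os y -> dot (N y) (xi z) = om y + 'D_(z - y) om y.
Proof.
move=> Oy; rewrite /N /affine_normal dot_xi derive_sum; last exact: (om_diff hom Oy).
have -> : \sum_i (z - y) i 0 * 'D_(basis_vec R i) om y = dot (gradient om y) (z - y).
  by apply: eq_bigr => i _; rewrite [gradient _ _ _ _]mxE mulrC.
by rewrite dotBr; ring.
Qed.

Lemma normal_eq y : Os y -> dot (N y) (xi y) = om y.
Proof.
by move=> Oy; rewrite normalE// subrr deriveE ?linear0 ?addr0//; exact: (om_diff hom Oy).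
Qed.

Lemma normal_le y z : Os y -> Os z -> dot (N y) (xi z) <= om z.
Proof. by move=> Oy Oz; rewrite normalE//; exact: (om_tangent oOs hom). Qed.

Lemma normal_lt y z : Os y -> Os z -> z != y -> dot (N y) (xi z) < om z.
Proof. by move=> Oy Oz zy; rewrite normalE//; exact: (om_strict oOs hom). Qed.

Lemma normal_uniq X y : Os y -> (forall z, Os z -> dot X (xi z) <= om z) ->
  dot X (xi y) = om y -> X = N y.
Proof.
move=> Oy le eq.
have D v : 'D_v om y = dot (usubmx X) v.
  have [r r0 hr] := Os_line oOs v Oy.
  have Xl t : dot X (xi (y + t *: v)) = om y + t * dot (usubmx X) v.
    rewrite xiD dotDr eq; congr (_ + _).
    by rewrite {1}(lift1_last X) dot_lift mulr0 addr0 dotZr.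
  have h1 t : t \in `]- r, r[ -> om (y + 0 *: v) + t * dot (usubmx X) v <= om (y + t *: v).
    by rewrite in_itv /= -ltr_norml scale0r addr0 -Xl => /hr /le.
  pose h t := t * dot (usubmx X) v - om (y + t *: v).
  have dh t : t \in `]- r, r[ -> is_derive t 1 h (dot (usubmx X) v - 'D_v om (y + t *: v)).
    rewrite in_itv /= -ltr_norml => /hr Ot.
    have H1 : is_derive t 1 (fun s : R => s * dot (usubmx X) v) (dot (usubmx X) v).
      by apply: is_derive_eq; rewrite scaler0 add0r /GRing.scale /= mulr1.
    have H2 := is_derive_line (om_diff hom Ot).
    exact: is_deriveB.
  have r2 : - r <= r by rewrite ge0_cp ?ltW.
  have z0 : 0 \in `]- r, r[ by rewrite in_itv /= oppr_lt0 r0.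
  have mx := @derive1_at_max _ h (- r) r 0 r2 _ z0 _.
  have : is_derive (0 : R) 1 h 0.
    apply: mx => t tr; first by have [] := dh t tr.
    by rewrite /h mul0r sub0r; move: (h1 t tr); lra.
  move=> [_ e1]; have := dh 0 z0; rewrite scale0r addr0 => -[_]; rewrite e1 => /esym/eqP.
  by rewrite subr_eq0 => /eqP.
have uX : usubmx X = gradient om y.
  apply/matrixP => i j; rewrite ord1 [RHS]mxE D; exact: (esym (dot_basis _ _)).
rewrite [LHS]lift1_last /N /affine_normal -uX; congr lift1.
by move: eq; rewrite dot_xiE => <-; rewrite opprB addrC subrK.
Qed.

Lemma normal_act g y : G g -> Os y -> g *m N (act g y) = N y.
Proof.
move=> Gg Oy; have l z (Oz : Os z) := lam_neq0 HO HG Gg (subset_closure Oz).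
have l0 z (Oz : Os z) := ltW (lam_gt0 HO HG Gg (subset_closure Oz)).
have aO z (Oz : Os z) := act_Os HO HG Gg Oz.
apply: normal_uniq => // [z Oz|].
  rewrite dot_act ?l// (om_act HO HG hom Gg Oz) ler_wpM2l ?l0// normal_le//; exact: aO.
by rewrite dot_act ?l// normal_eq -?(om_act HO HG hom Gg Oy)//; exact: aO.
Qed.

Lemma normal_last y : Os y -> - om 0 <= last_coord (N y).
Proof.
move=> Oy; have := normal_le Oy O0.
by rewrite dot_xiE dot0r sub0r => h; rewrite lerNl.
Qed.

Lemma normal_last_gt0 y : Os y -> 0 < last_coord (N y).
Proof.
move=> Oy; apply: lt_le_trans (normal_last Oy).
by rewrite oppr_gt0 (om_lt0 hom O0).
Qed.

(** The direction of the affine normal in the chart of the cone. It is an equivariant map from the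
    dual domain to [Om], through which freeness, properness and cocompactness, assumed on [Om], are
    brought to the dual domain. *)
Definition normal_dir y : 'cV[R]_d := (last_coord (N y))^-1 *: usubmx (N y).

Lemma normal_dirE y : Os y -> N y = last_coord (N y) *: lift1 (normal_dir y) 1.
Proof.
move=> Oy; rewrite lift1Z mulr1 /normal_dir scalerA mulfV ?gt_eqF ?normal_last_gt0//.
by rewrite scale1r -lift1_last.
Qed.

Lemma normal_continuous y : Os y -> {for y, continuous N}.
Proof.
move=> Oy.
have cg : gradient om z @[z --> nbhs y] --> gradient om y.
  apply: cvg_coordP => i.
  have -> : (fun z => gradient om z i 0) = 'D_(basis_vec R i) om.
    by apply/funext => z; rewrite mxE.
  by rewrite mxE; exact: (differentiable_continuous (om_diff1 hom (basis_vec R i) Oy)).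
apply: (cvg_lift (FF := nbhs_filter y) cg).
apply: (cvgB (FF := nbhs_filter y)); last exact: (om_continuous hom Oy).
exact: (cvg_dot (FF := nbhs_filter y) cg cvg_id).
Qed.

Lemma normal_dir_continuous y : Os y -> {for y, continuous normal_dir}.
Proof.
move=> Oy; have cN := normal_continuous Oy.
apply: (cvgZ (FF := nbhs_filter y)).
  apply: cvgV; first by rewrite gt_eqF ?normal_last_gt0.
  exact: (cvg_last (FF := nbhs_filter y) cN).
exact: (cvg_usubmx (FF := nbhs_filter y) cN).
Qed.

(** At a boundary point a limit would only give a weak inequality. Half way between [y] and [z] the
    tangent is strictly below [om], which is there at most half of om(y); solving for the value at
    [z] gives strictness. *)
Lemma normal_lt0 y z : Os y -> closure Os z -> dot (N y) (xi z) < 0.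
Proof.
move=> Oy cz; have [Oz|nOz] := pselect (Os z).
  by apply: le_lt_trans (normal_le Oy Oz) _; exact: (om_lt0 hom Oz).
pose m : 'cV[R]_d := (2^-1 : R) *: z + (1 - 2^-1) *: y.
have Om' : Os m.
  have h2 : 0 <= (2^-1 : R) < 1 by apply/andP; split; lra.
  exact: (open_convex_closure oOs cOs Oy cz h2).
have my : m != y.
  apply/eqP => e; apply: nOz; suff -> : z = y by [].
  have : (2^-1 : R) *: z = 2^-1 *: y.
    apply: (addIr ((1 - 2^-1) *: y)); rewrite -/m e -scalerDl.
    by rewrite (_ : 2^-1 + (1 - 2^-1) = 1) ?scale1r//; ring.
  by move=> /(congr1 ( *:%R 2)); rewrite !scalerA mulfV// !scale1r.
have le : om m <= (1 - 2^-1) * om y.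
  have cm : om (2^-1 *: z' + (1 - 2^-1) *: y) @[z' --> nbhs z] --> om m.
    apply: (cvg_comp (fun z' => 2^-1 *: z' + (1 - 2^-1) *: y) om); last exact: (om_continuous hom Om').
    apply: (cvgD (FF := nbhs_filter z)); last exact: cvg_cst.
    by apply: (cvgZr (FF := nbhs_filter z)); exact: cvg_id.
  rewrite leNgt; apply/negP => lt.
  have [z' [Oz' /= h]] := cz _ (cvgr_gt _ cm _ lt).
  have := om_convex hom Oz' Oy (a := 2^-1) ltac:(apply/andP; split; lra).
  by have := om_lt0 hom Oz'; move: h; rewrite /= ; lra.
have := normal_lt Oy Om' my; rewrite /m xi_conv dotDr !dotZr normal_eq// -/m.
by move: le; lra.
Qed.

Lemma normal_dir_Om y : Os y -> Om (normal_dir y).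
Proof.
move=> Oy; have L0 := normal_last_gt0 Oy.
have cf : {within closure Os, continuous (fun z => dot (N y) (xi z))}.
  apply: continuous_subspaceT => z.
  by apply: (continuous_comp (g := dot (N y))); [exact: xi_continuous|exact: dot_continuousr].
have ne : closure Os !=set0 by exists 0; apply: subset_closure; exact: O0.
have [z0 + mx] := compact_EVT_max ne (dual_closure_compact HO) cf.
rewrite inE => cz0; have lt0 := normal_lt0 Oy cz0.
apply: (bipolar HO (e := - dot (N y) (xi z0) / last_coord (N y))).
  by rewrite divr_gt0// oppr_gt0.
move=> z Oz; have := mx z (mem_set (subset_closure Oz)).
rewrite {1}(normal_dirE Oy) dotZl dot_xi -ler_pdivlMl// lerBlDl => h.
by apply: le_trans h _; rewrite mulrC mulNr opprK.
Qed.

Lemma normal_dir_act g y : G g -> Os y -> normal_dir y = proj_act g (normal_dir (act g y)).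
Proof.
move=> Gg Oy; have Oa := act_Os HO HG Gg Oy.
have := normal_act Gg Oy; rewrite {1}(normal_dirE Oa) -scalemxAr.
have L0 := normal_last_gt0 Oa; set L := last_coord _ in L0 *.
move=> e; rewrite /proj_act; set v := g *m _ in e *.
have -> : v = L^-1 *: N y by rewrite -e scalerA mulVf ?gt_eqF// scale1r.
have uZ a (w : 'cV[R]_(d + 1)) : usubmx (a *: w) = a *: usubmx w by rewrite linearZ.
rewrite uZ !last_dot dotZl -!last_dot scalerA invfM invrK /normal_dir.
by congr (_ *: _); rewrite mulrC mulrA mulVf ?mul1r// gt_eqF.
Qed.

Lemma act_free g y : G g -> Os y -> act g y = y -> g = 1%:M.
Proof.
move=> Gg Oy e; case: HG => _ [_ h _ _]; apply: (h _ (normal_dir y) Gg (normal_dir_Om Oy)).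
by rewrite {2}(normal_dir_act Gg Oy) e.
Qed.

Lemma act_proper Q : compact Q -> Q `<=` Os ->
  finite_set [set g | G g /\ exists2 y, Q y & Q (act g y)].
Proof.
move=> cQ QO; case: HG => _ [_ _ h _].
have cn : {within Q, continuous normal_dir}.
  apply/subspace_continuousP => y Qy; apply: cvg_within_filter.
  exact: (normal_dir_continuous (QO _ Qy)).
have cQ' := continuous_compact cn cQ.
apply: sub_finite_set (h _ cQ' _); last by move=> _ [y /QO Oy <-]; exact: normal_dir_Om.
move=> g [Gg [y Qy Qgy]]; split => //; exists (normal_dir y); split.
  by exists (normal_dir (act g y)); [exists (act g y)|rewrite -normal_dir_act//; exact: QO].
by exists y.
Qed.

(** The group moves [normal_dir y] to a point x of a compact subset of [Om]. There the normal is c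
    (x, 1) with c at least - om(0), and x . y' stays below 1 by a fixed gap, so om(y') = c (x . y' -
    1) is bounded away from 0. *)
Lemma act_cocompact : exists2 e : R, 0 < e &
  forall y, Os y -> exists2 g, G g & om (act g y) <= - e.
Proof.
case: HG => _ [_ _ _ [Q [cQ QO cov]]].
have o0 := om_lt0 hom O0.
have [q0 Qq0] : Q !=set0.
  have Om0 : Om 0 by case: HO.
  by have [g _ [x Qx _]] := cov _ Om0; exists x.
have [e e0 he] : exists2 e : R, 0 < e & forall x y, Q x -> Os y -> dot x y <= 1 - e.
  have cf : {within Q `*` closure Os, continuous (fun p : 'cV[R]_d * 'cV[R]_d => dot p.1 p.2)}.
    apply: continuous_subspaceT => p.
    by apply: (cvg_dot (FF := nbhs_filter p)); [exact: cvg_fst|exact: cvg_snd].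
  have [||p0 + mx] := compact_EVT_max _ _ cf.
  - by exists (q0, 0); split => //=; exact: subset_closure.
  - by apply: compact_setX => //; exact: (dual_closure_compact HO).
  rewrite inE => -[/QO Op cp].
  exists (1 - dot p0.1 p0.2); first by rewrite subr_gt0 (closure_dual_lt HO).
  move=> x y Qx Oy; rewrite opprB addrC subrK.
  by apply: (mx (x, y)); rewrite inE; split => //=; exact: subset_closure.
exists (- om 0 * e); first by rewrite mulr_gt0// oppr_gt0.
move=> y Oy; have [g Gg [x Qx xe]] := cov _ (normal_dir_Om Oy).
exists g => //; have Oa := act_Os HO HG Gg Oy.
have [x' [t [Ox' t0 e']]] := cone_mul HG Gg (cone_lift (QO _ Qx)).
have vE : g *m lift1 x 1 = t *: lift1 (normal_dir y) 1.
  suff <- : x' = normal_dir y by [].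
  by rewrite -xe /proj_act e' lift1Z last_lift usubmx_lift mulr1 scalerA mulVf ?gt_eqF// scale1r.
pose c := last_coord (N y) / t.
have NE : N (act g y) = c *: lift1 x 1.
  have gu := G_unit HG Gg.
  rewrite -[LHS](mulKmx gu) normal_act// normal_dirE// -[last_coord _](divfK (lt0r_neq0 t0)).
  by rewrite -scalerA -vE -scalemxAr mulKmx.
have := normal_eq Oa; rewrite NE dotZl dot_xi => <-.
have := normal_last Oa; rewrite NE lift1Z last_lift mulr1 => cl.
have := he _ _ Qx Oa => h.
have c0 : 0 <= c by apply: le_trans cl; rewrite oppr_ge0 ltW.
rewrite lerNr -mulrN opprB.
by apply: ler_pM => //; [rewrite oppr_ge0 ltW|exact: ltW|lra].
Qed.

End affine_normals.

(** * Convex functions *)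

Section convex_functions.
Context {R : realType} {n : nat}.
Implicit Types (A Q : set 'cV[R]_n) (x y z v : 'cV[R]_n) (s : 'cV[R]_n -> R).

Lemma cvg_withinP A s y (l : R) : s z @[z --> within A (nbhs y)] --> l <->
  forall e : R, 0 < e -> exists2 r : R, 0 < r &
    forall z, A z -> `|y - z| < r -> `|l - s z| < e.
Proof.
split => [/(cvgrPdist_lt (FF := within_filter A (nbhs_filter y))) h e /h|h].
  move=> /(interiorE_ball [set z | A z -> `|l - s z| < e]) [r r0 H].
  by exists r => // z Az zy; exact: H zy Az.
apply/(cvgrPdist_lt (FF := within_filter A (nbhs_filter y))) => e /h [r r0 H].
apply/(interiorE_ball [set z | A z -> `|l - s z| < e]).
by exists r => // z zy Az; exact: H Az zy.
Qed.

Lemma cvg_atP s y (l : R) : s z @[z --> nbhs y] --> l <->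
  forall e : R, 0 < e -> exists2 r : R, 0 < r & forall z, `|y - z| < r -> `|l - s z| < e.
Proof.
split => [/(cvgrPdist_lt (FF := nbhs_filter y)) h e /h|h].
  by move=> /(interiorE_ball [set z | `|l - s z| < e]).
apply/(cvgrPdist_lt (FF := nbhs_filter y)) => e /h H.
exact/(interiorE_ball [set z | `|l - s z| < e]).
Qed.

Definition convexF A s := forall x y (a : R), A x -> A y -> 0 <= a <= 1 ->
  s (a *: x + (1 - a) *: y) <= a * s x + (1 - a) * s y.

(** Induction on the number of coordinates that may differ from those of [y]. A point with one more
    free coordinate is the midpoint of [z1], where that coordinate is reset, and of a point on the
    axis, where [s] is bounded by two end values. *)
Lemma convex_bounded_above A s y : open A -> convexF A s -> A y ->
  exists r M : R, 0 < r /\ forall z, `|z - y| <= r -> A z /\ s z <= M.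
Proof.
move=> oA cs Ay; have [e e0 he] := openE_ball oA Ay.
suff H k : exists r M : R, 0 < r /\ forall z, `|z - y| <= r ->
    (forall i : 'I_n, (k <= i)%N -> z i 0 = y i 0) -> A z /\ s z <= M.
  have [r [M [r0 h]]] := H n; exists r, M; split => // z zr; apply: h => // i.
  by rewrite leqNgt ltn_ord.
elim: k => [|k [r [M [r0 IH]]]].
  exists 1, (s y); split => // z _ h.
  by have -> : z = y by apply/matrixP => i j; rewrite ord1 h.
have [kn|nk] := ltnP k n; last first.
  exists r, M; split => // z zr h; apply: IH => // i ki; apply: h.
  by have := leq_ltn_trans (leq_trans nk ki) (ltn_ord i); rewrite ltnn.
pose K := Ordinal kn; pose u : 'cV[R]_n := basis_vec R K.
pose p := Order.min (r / 2) (e / 4).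
have p0 : 0 < p by rewrite lt_min !divr_gt0.
have pr : 2 * p <= r by have : p <= r / 2 by [rewrite ge_min lexx]; lra.
have pe : 2 * p < e.
  have : p <= e / 4 by rewrite ge_min lexx orbT.
  by lra.
have Ac (c : R) : `|c| <= 2 * p -> A (y + c *: u).
  move=> cp; apply: he; rewrite opprD addrA subrr sub0r normrN.
  apply: le_lt_trans pe; apply: le_trans cp; apply: norm_leP => // i.
  rewrite !mxE normrM ler_piMr// eqxx andbT; case: (_ == _) => /=.
    by rewrite normr1.
  by rewrite normr0.
pose m := Order.max (s (y + (2 * p) *: u)) (s (y + - (2 * p) *: u)).
exists p, (2^-1 * M + 2^-1 * m); split => // z zp h.
pose c := z K 0 - y K 0.
have cp : `|c| <= p.
  by apply: le_trans zp; have := norm_coord (z - y) K; rewrite !mxE.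
pose z1 : 'cV[R]_n := \col_i (if i == K then y K 0 else y i 0 + 2 * (z i 0 - y i 0)).
have [Az1 s1] : A z1 /\ s z1 <= M.
  apply: IH => [|i ki].
    apply: norm_leP => [|i]; first exact: ltW.
    rewrite !mxE; case: eqP => [->|_]; first by rewrite subrr normr0 ltW.
    rewrite addrAC subrr add0r normrM gtr0_norm//; apply: le_trans pr.
    rewrite ler_pM2l//; apply: le_trans zp.
    by have := norm_coord (z - y) i; rewrite !mxE.
  rewrite mxE; case: eqP => [->//|/eqP iK].
  rewrite h ?subrr ?mulr0 ?addr0// ltn_neqAle ki andbT eq_sym.
  by apply: contra iK => /eqP e'; apply/eqP/val_inj.
have Az2 : A (y + (2 * c) *: u) by apply: Ac; rewrite normrM gtr0_norm// ler_pM2l.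
have s2 : s (y + (2 * c) *: u) <= m.
  pose a := (c + p) / (2 * p).
  have a01 : 0 <= a <= 1.
    move: cp; rewrite ler_norml => /andP[c1 c2].
    by apply/andP; split; [apply: divr_ge0; move: c1 p0; lra_goal|rewrite ler_pdivrMr; move: c2 p0; lra_goal].
  have Ap : A (y + (2 * p) *: u) by apply: Ac; rewrite ger0_norm; move: p0; lra_goal.
  have Am : A (y + - (2 * p) *: u) by apply: Ac; rewrite normrN ger0_norm; move: p0; lra_goal.
  have := cs _ _ _ Ap Am a01.
  have -> : a *: (y + (2 * p) *: u) + (1 - a) *: (y + - (2 * p) *: u) = y + (2 * c) *: u.
    by apply/matrixP => i j; rewrite !mxE /a; field; rewrite gt_eqF.
  move: a01 => /andP[a0 a1] hs; apply: le_trans hs _.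
  have m1 : s (y + (2 * p) *: u) <= m by rewrite le_max lexx.
  have m2 : s (y + - (2 * p) *: u) <= m by rewrite le_max lexx orbT.
  have -> : m = a * m + (1 - a) * m by ring.
  by apply: lerD; apply: ler_wpM2l; move: m1 m2 a0 a1; lra_goal.
have h2 : 0 <= (2^-1 : R) <= 1 by apply/andP; split; lra_goal.
have zE : (2^-1 : R) *: z1 + (1 - 2^-1) *: (y + (2 * c) *: u) = z.
  apply/matrixP => i j; rewrite ord1 !mxE eqxx andbT; case: eqP => [->|_] /=.
    by rewrite /c; field.
  by field.
have := cs _ _ _ Az1 Az2 h2; rewrite zE => le; split; last by move: le s1 s2; lra_goal.
by apply: he; rewrite distrC; apply: le_lt_trans zp _; move: p0 pe; lra_goal.
Qed.

(** The upper bound at the reflected point 2 y - z gives the lower bound at [z]. *)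
Lemma convex_bounded A s y : open A -> convexF A s -> A y ->
  exists r M : R, 0 < r /\ forall z, `|z - y| <= r -> A z /\ `|s z| <= M.
Proof.
move=> oA cs Ay; have [r [M [r0 h]]] := convex_bounded_above oA cs Ay.
exists r, (`|M| + 2 * `|s y|); split => // z zr; have [Az sz] := h z zr.
split => //; have [Az' sz'] : A (2 *: y - z) /\ s (2 *: y - z) <= M.
  apply: h; have -> : 2 *: y - z - y = - (z - y) by apply/matrixP => i j; rewrite !mxE; ring.
  by rewrite normrN.
have h2 : 0 <= (2^-1 : R) <= 1 by apply/andP; split; lra_goal.
have := cs _ _ _ Az Az' h2.
have -> : (2^-1 : R) *: z + (1 - 2^-1) *: (2 *: y - z) = y.
  by apply/matrixP => i j; rewrite !mxE; field.
have := ler_norm M; have := ler_norm (s y); have := ler_norm (- s y); rewrite normrN.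
by rewrite ler_norml => ? ? ? ?; apply/andP; split; lra.
Qed.

Lemma convex_continuous A s y : open A -> convexF A s -> A y -> {for y, continuous s}.
Proof.
move=> oA cs Ay; have [r [M [r0 h]]] := convex_bounded oA cs Ay.
have M0 : 0 <= M by have [_] := h y ltac:(by rewrite subrr normr0 ltW); apply: le_trans.
apply/cvg_atP => e e0.
pose a := Order.min 1 (e / (2 * M + 1) / 2).
have a0 : 0 < a by rewrite lt_min ltr01 !divr_gt0// ltr_wpDl// mulr_ge0.
have a1 : a <= 1 by rewrite ge_min lexx.
have ae : 2 * a * M < e.
  have : a <= e / (2 * M + 1) / 2 by rewrite ge_min lexx orbT.
  by rewrite !ler_pdivlMr ?ltr_wpDl ?mulr_ge0//; lra.
exists (a * r); first exact: mulr_gt0.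
move=> z; rewrite distrC => /ltW za.
pose w := a^-1 *: (z - y).
have wr : `|w| <= r by rewrite normrZ gtr0_norm ?invr_gt0// mulrC ler_pdivrMr// mulrC.
have [A1 s1] := h (y + w) ltac:(by rewrite addrAC subrr add0r).
have [A2 s2] := h (y - w) ltac:(by rewrite addrAC subrr add0r normrN).
have [A3 _] := h z ltac:(by apply: le_trans za _; rewrite ler_piMl// ltW).
have [_ s3] := h y ltac:(by rewrite subrr normr0 ltW).
have a01 : 0 <= a <= 1 by rewrite a1 ltW.
have E1 : a *: (y + w) + (1 - a) *: y = z.
  by apply/matrixP => i j; rewrite !mxE; field; rewrite gt_eqF.
have := cs _ _ _ A1 Ay a01; rewrite E1.
have b01 : 0 <= (1 + a)^-1 <= 1.
  have ap : 0 < 1 + a by rewrite addr_gt0.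
  by rewrite invr_ge0 (ltW ap) invf_le1// lerDl ltW.
have E2 : (1 + a)^-1 *: z + (1 - (1 + a)^-1) *: (y - w) = y.
  have an : 1 + a != 0 by rewrite gt_eqF ?addr_gt0.
  by apply/matrixP => i j; rewrite !mxE; field; rewrite an gt_eqF.
have := cs _ _ _ A3 A2 b01; rewrite E2.
have -> : (1 + a)^-1 * s z + (1 - (1 + a)^-1) * s (y - w) = (s z + a * s (y - w)) / (1 + a).
  by field; rewrite gt_eqF ?addr_gt0.
rewrite ler_pdivlMr ?addr_gt0// => i2 i1.
move: s1 s2 s3; rewrite !ler_norml => /andP[_ u1] /andP[_ u2] /andP[u3 u4].
have v1 : a * s (y + w) <= a * M by rewrite ler_wpM2l// ltW.
have v2 : a * s (y - w) <= a * M by rewrite ler_wpM2l// ltW.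
have v3 : a * (- M) <= a * s y by rewrite ler_wpM2l// ltW.
by move: v1 v2 v3 i1 i2 u1 u2 u3 u4 ae; rewrite ltr_norml => *; apply/andP; split; lra.
Qed.

(** One index i tending to infinity stands for both quantities, as the bound i and the radius 1 / i;
    the near covering property then provides a single i for the whole compact set. *)
Lemma compact_uniform Q (P : R -> 'cV[R]_n -> Prop) : compact Q ->
  (forall q, Q q -> exists r M : R, 0 < r /\ forall z, `|z - q| <= r -> P M z) ->
  (forall (M M' : R) z, M <= M' -> P M z -> P M' z) ->
  exists r M : R, 0 < r /\ forall q z, Q q -> `|z - q| <= r -> P M z.
Proof.
move=> /compact_near_coveringP cQ loc mono.
have := cQ R (pinfty_nbhs R) (fun i q => forall z, `|z - q| <= i^-1 -> P i z) _.
case.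
  move=> q /loc [r [M [r0 h]]].
  exists ([set z | `|z - q| <= r / 2], [set i | Order.max (2 / r) (Order.max M 1) < i]).
    split => /=.
      apply/(interiorE_ball [set z | `|z - q| <= r / 2]); exists (r / 2); first by rewrite divr_gt0.
      by move=> z /ltW; rewrite distrC.
    by exists (Order.max (2 / r) (Order.max M 1)); split => //; exact: num_real.
  move=> [q' i] /= [qq]; rewrite !gt_max => /andP[ir /andP[iM i1]] z zq.
  apply: mono (ltW iM) _; apply: h.
  have -> : z - q = (z - q') + (q' - q) by rewrite addrA subrK.
  apply: le_trans (ler_normD _ _) _.
  have : i^-1 <= r / 2.
    rewrite -[r / 2]invrK lef_pV2 ?posrE ?invf_div ?ltW//; first by rewrite (lt_trans ltr01).
    by rewrite divr_gt0.
  by move: zq qq => /=; lra.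
move=> M [_ h]; have M1 : M < `|M| + 1 by rewrite ltr_pwDr// ler_norm.
exists (`|M| + 1)^-1, (`|M| + 1); split; first by rewrite invr_gt0 ltr_wpDl.
by move=> q z Qq zq; exact: (h _ M1 q Qq z zq).
Qed.

End convex_functions.

(** * Boundary values of equivariant functions *)

Section equivariant_convex.
Context {R : realType} {d : nat} {Om : set 'cV[R]_d} {G : set 'M[R]_(d + 1)}.
Hypothesis (HO : pointed_domain Om) (HG : dividing_group G Om).
Let Os := dual_domain Om.
Context {om : 'cV[R]_d -> R}.
Hypothesis hom : cheng_yau Os om.
Let oOs : open Os := dual_open HO.
Let cOs : convexV Os := @dual_convex R d Om.
Let O0 : Os 0 := @dual_domain0 R d Om.
Implicit Types (y z v q w : 'cV[R]_d) (g : 'M[R]_(d + 1)) (X : 'cV[R]_(d + 1)).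

Definition equivariant (tau : 'M[R]_(d + 1) -> 'cV[R]_(d + 1)) (f : 'cV[R]_d -> R) :=
  forall g y, G g -> Os y -> f y = lam g y * f (act g y) + dot (tau g) (xi y).

Lemma om_ratio g y : G g -> Os y -> lam g y = om y / om (act g y).
Proof.
move=> Gg Oy; rewrite (om_act HO HG hom Gg Oy) mulfK// lt_eqF//.
exact: (om_lt0 hom (act_Os HO HG Gg Oy)).
Qed.

Lemma equivariantP tau f : tau_equivariant Os om G tau f <-> equivariant tau f.
Proof.
by split => h g y Gg Oy; have := h g y Gg Oy; rewrite (om_ratio Gg Oy).
Qed.

(** The projective map sends the line through [y] in direction [v] to a line through [act g y]. The
    quotient t / (l (1 + t c)) is the change of parameter, and [c] measures its deviation from an
    affine one. *)
Lemma act_line_inv g y v : G g -> Os y -> v != 0 ->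
  exists w (c l : R), [/\ w != 0, 0 < l & forall t : R, Os (act g y + t *: w) ->
    [/\ 0 < 1 + t * c, lam (invmx g) (act g y + t *: w) = l * (1 + t * c) &
     act (invmx g) (act g y + t *: w) = y + (t / (l * (1 + t * c))) *: v]].
Proof.
move=> Gg Oy v0; set q := act g y; have cly := subset_closure Oy.
have l0 := lam_neq0 HO HG Gg cly.
have Gi := G_inv HG Gg; have Oq : Os q := act_Os HO HG Gg Oy.
have gu := G_unit HG Gg.
have [i1 i2] := act_closureV HO HG Gg cly.
pose l := lam (invmx g) q.
have lp : 0 < l := lam_gt0 HO HG Gi (subset_closure Oq).
pose p := usubmx (g^T *m lift1 v 0); pose c := last_coord (g^T *m lift1 v 0).
have pc : g^T *m lift1 v 0 = lift1 p c := lift1_last _.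
pose w := p + c *: q.
have pE : lift1 w 0 = lift1 p c + c *: xi q.
  by rewrite lift1Z lift1D; congr lift1; ring.
have I : (invmx g)^T *m g^T = 1%:M by rewrite -trmx_mul mulmxV// trmx1.
have qE : (invmx g)^T *m xi q = l *: xi y.
  by rewrite act_xi ?i1// gt_eqF.
have wE : (invmx g)^T *m lift1 w 0 = lift1 v 0 + (c * l) *: xi y.
  by rewrite pE mulmxDr -pc mulmxA I mul1mx -scalemxAr qE scalerA.
exists w, c, l; split => //.
  apply: contra v0 => /eqP w0; move: wE.
  rewrite w0 (_ : lift1 0 0 = 0 :> 'cV[R]_(d + 1)); last first.
    by rewrite -[RHS](scale0r (lift1 0 0)) lift1Z scale0r mul0r.
  rewrite mulmx0 lift1Z lift1D => h.
  have : lift1 (v + (c * l) *: y) (0 + c * l * -1) = lift1 0 0.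
    by rewrite -h -[RHS](scale0r (lift1 0 0)) lift1Z scale0r mul0r || rewrite -h -[LHS](scale0r (lift1 0 0)) lift1Z scale0r mul0r.
  move=> /lift1_inj [h1 /eqP]; rewrite add0r mulrN1 oppr_eq0 => /eqP h2.
  by apply/eqP; rewrite -h1 h2 scale0r addr0.
move=> t Ot.
have E : (invmx g)^T *m xi (q + t *: w) = (l * (1 + t * c)) *: xi y + t *: lift1 v 0.
  have -> : xi (q + t *: w) = xi q + t *: lift1 w 0 by rewrite xiD lift1Z mulr0.
  rewrite mulmxDr -scalemxAr qE wE; move: (xi y) (lift1 v 0) => X Y.
  by apply/matrixP => i j; rewrite !mxE; ring.
have L : lam (invmx g) (q + t *: w) = l * (1 + t * c).
  rewrite /lam E lift1Z lift1Z lift1D last_lift; ring.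
have L0 := lam_gt0 HO HG Gi (subset_closure Ot); rewrite L in L0.
have L1 : 0 < 1 + t * c by move: L0; rewrite pmulr_rgt0.
split => //.
have := act_xi (lt0r_neq0 (lam_gt0 HO HG Gi (subset_closure Ot))); rewrite E L.
have -> : (l * (1 + t * c)) *: xi y + t *: lift1 v 0 =
    (l * (1 + t * c)) *: xi (y + (t / (l * (1 + t * c))) *: v).
  rewrite xiD scalerDr; congr (_ + _).
  by rewrite !lift1Z !mulr0 scalerA mulrC divfK// gt_eqF.
by move=> /esym/xi_inj [_]; apply; rewrite gt_eqF.
Qed.

Section bounded_above.
Variables (tau : 'M[R]_(d + 1) -> 'cV[R]_(d + 1)) (s : 'cV[R]_d -> R).
Hypotheses (cs : convexF Os s) (es : equivariant tau s).

(* [s - C om] is concave at a definite scale: one brings the point to a fixed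
   compact set by the group, where this follows from the strict convexity of
   [om]. *)
Lemma coarse_concave (e : R) : 0 < e ->
  exists2 C : R, 0 < C & forall y v, Os y -> v != 0 ->
    exists a t1 t2 : R, [/\ 0 <= a <= 1, 0 < t1, 0 < t2, a * t1 = (1 - a) * t2 &
      [/\ Os (y + t1 *: v), Os (y - t2 *: v), exists2 t3, t2 <= e * t3 & Os (y - t3 *: v) &
      a * (s (y + t1 *: v) - C * om (y + t1 *: v)) +
        (1 - a) * (s (y - t2 *: v) - C * om (y - t2 *: v)) < s y - C * om y]].
Proof.
move=> e0.
have [eta eta0 cc] := act_cocompact HO HG hom.
pose Q := [set y | Os y /\ om y <= - eta].
have cQ : compact Q := om_sublevel_compact hom (dual_closure_compact HO) eta0.
have [r [M [r0 hQ]]] : exists r M : R, 0 < r /\ forall q z, Q q -> `|z - q| <= r ->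
    Os z /\ `|s z| <= M.
  apply: (@compact_uniform _ _ Q (fun M z => Os z /\ `|s z| <= M)) => //.
    by move=> q [Oq _]; exact: (convex_bounded oOs cs Oq).
  by move=> M M' z MM [Oz sz]; split => //; exact: le_trans sz MM.
(* Steps up to [N] times t stay within the radius [r], as [p] is r / N. The value of [N] gives e N =
   2 + e, which makes [t2 <= e * t3] hold under the projective change of parameter. *)
pose N : R := 2 / e + 1; have N0 : 1 < N by rewrite ltrDr divr_gt0.
have Np : 0 < N by rewrite (lt_trans _ N0).
pose p := r / N; have p0 : 0 < p by rewrite divr_gt0.
pose S := [set v : 'cV[R]_d | `|v| = p].
have cS : compact S.
  apply: cV_compact; first by apply: (@bounded_setP _ _ _ p) => x ->.
  have -> : S = [set x | `|x| <= p] `&` [set x | - `|x| <= - p].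
    apply/seteqP; split => x; rewrite /S /= lerN2; first by move=> ->.
    by move=> [a b]; apply/le_anti/andP.
  by apply: closedI; apply: closed_le_fun => x; [exact: norm_continuous|apply: continuousN; exact: norm_continuous].
pose D (x : 'cV[R]_d * 'cV[R]_d) := 2^-1 * (om (x.1 + x.2) + om (x.1 - x.2)) - om x.1.
have pr : p <= r by rewrite ler_pdivrMr// ler_pMr// ltW.
have hQ' q v : Q q -> `|v| <= r -> Os (q + v) /\ `|s (q + v)| <= M.
  by move=> Qq vr; apply: (hQ q) => //; rewrite addrAC subrr add0r.
have inS q v : Q q -> S v -> [/\ Os q, Os (q + v) & Os (q - v)].
  move=> Qq Sv; have [Oq _] := Qq; split => //.
    by have [] := hQ' q v Qq ltac:(by rewrite Sv).
  by have [] := hQ' q (- v) Qq ltac:(by rewrite normrN Sv).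
have [k k0 hk] : exists2 k : R, 0 < k & forall q v, Q q -> S v -> k <= D (q, v).
  have [[[q0 v0] [Qq0 Sv0]]|ne] := pselect ((Q `*` S) !=set0); last first.
    by exists 1 => // q v Qq Sv; exfalso; apply: ne; exists (q, v).
  have cD : {within Q `*` S, continuous D}.
    apply/subspace_continuousP => -[q v] [/= Qq Sv]; apply: cvg_within_filter.
    have [Oq Op Om'] := inS q v Qq Sv.
    pose F := nbhs (q, v); have FF : Filter F := nbhs_filter (q, v).
    have f1 : x.1 @[x --> F] --> q by exact: cvg_fst.
    have f2 : x.2 @[x --> F] --> v by exact: cvg_snd.
    apply: (cvgB (FF := FF)); last by apply: (cvg_comp _ om f1); exact: (om_continuous hom Oq).
    apply: (cvgM (FF := FF)); first exact: cvg_cst.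
    apply: (cvgD (FF := FF)).
      by apply: (cvg_comp (fun x : 'cV[R]_d * 'cV[R]_d => x.1 + x.2) om (cvgD (FF := FF) f1 f2)); exact: (om_continuous hom Op).
    by apply: (cvg_comp (fun x : 'cV[R]_d * 'cV[R]_d => x.1 - x.2) om (cvgB (FF := FF) f1 f2)); exact: (om_continuous hom Om').
  have [[q v] + mn] := compact_EVT_min (ex_intro _ (q0, v0) (conj Qq0 Sv0)) (compact_setX cQ cS) cD.
  rewrite inE => -[/= Qq Sv]; exists (D (q, v)); last first.
    by move=> q' v' Qq' Sv'; apply: mn; rewrite inE.
  have [Oq Op Om'] := inS q v Qq Sv.
  have qE : 2^-1 *: (q + v + (q - v)) = q by apply/matrixP => i j; rewrite !mxE; field.
  have := om_midpoint oOs hom Op Om'; rewrite qE => /(_ _ Oq) h; rewrite /D /= subr_gt0 h//.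
  apply/eqP => /matrixP qv.
  have v00 : v = 0 by apply/matrixP => i j; move: (qv i j); rewrite !mxE; lra.
  by move: Sv; rewrite /S /= v00 normr0 => h0; move: p0; rewrite -h0 ltxx.
(* C k exceeds twice the bound of [s] near the compact set, so C times the midpoint defect of [om]
   outweighs any convexity of [s] there. *)
exists ((2 * `|M| + 1) / k); first by rewrite divr_gt0// ltr_wpDl// mulr_ge0.
set C := _ / k; move=> y v Oy v0.
have [g Gg omq] := cc y Oy; set q := act g y in omq.
have Oq : Os q := act_Os HO HG Gg Oy.
have Qq : Q q by [].
have [w [c [l [w0 lp line]]]] := act_line_inv Gg Oy v0; rewrite -/q in line.
have wn : 0 < `|w| by rewrite normr_gt0.
pose t := p / `|w|; have t0 : 0 < t by rewrite divr_gt0.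
have twS : S (t *: w) by rewrite /S /= normrZ gtr0_norm// divfK// gt_eqF.
have Ob (b : R) : `|b| <= N -> Os (q + (b * t) *: w).
  move=> bN; have [|] := hQ' q ((b * t) *: w) Qq => //.
  rewrite -scalerA normrZ twS.
  by apply: le_trans (ler_wpM2r (ltW p0) bN) _; rewrite mulrC divfK// gt_eqF.
have [Lp lamp actp] := line t ltac:(by have := Ob 1; rewrite mul1r normr1; apply; apply: ltW).
have [Lm lamm actm] := line (- t) ltac:(by have := Ob (-1); rewrite mulN1r normrN1; apply; apply: ltW).
have ONn : Os (q + (- N * t) *: w) by apply: Ob; rewrite normrN gtr0_norm.
have [LN _ actN] := line _ ONn.
have [LN' _ _] := line _ (Ob N ltac:(by rewrite gtr0_norm)).
have Gi := G_inv HG Gg; have [i1 _] := act_closureV HO HG Gg (subset_closure Oy).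
pose x := t * c; have xE : - t * c = - x by rewrite mulNr.
rewrite -/x in Lp lamp actp; rewrite xE in Lm lamm actm.
have xN : - N * t * c = - (N * x) by rewrite /x; ring.
have xN' : N * t * c = N * x by rewrite /x; ring.
rewrite xN in LN actN; rewrite xN' in LN'.
have Op : Os (q + t *: w) by have [] := inS _ _ Qq twS.
have Omn : Os (q + - t *: w) by have [] := inS _ _ Qq twS; rewrite scaleNr.
have dp : 0 < l * (1 + x) by exact: mulr_gt0.
have dm : 0 < l * (1 - x) by exact: mulr_gt0.
have dN : 0 < l * (1 - N * x) by exact: mulr_gt0.
have Nx : N * x < 1 by rewrite -subr_gt0.
have x1 : x < 1 by rewrite -subr_gt0.
have x2 : - 1 < x by rewrite -subr_gt0 opprK addrC.
have Oyp : Os (y + (t / (l * (1 + x))) *: v) by rewrite -actp; exact: (act_Os HO HG Gi Op).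
have ymE : y - (t / (l * (1 - x))) *: v = act (invmx g) (q + - t *: w).
  by rewrite actm mulNr scaleNr.
have Oym : Os (y - (t / (l * (1 - x))) *: v) by rewrite ymE; exact: (act_Os HO HG Gi Omn).
(* These weights are proportional to the factors l (1 + x) and l (1 - x) of the equivariance, so the
   midpoint inequality at [q] becomes one for a convex combination equal to [y]. *)
exists ((1 + x) / 2), (t / (l * (1 + x))), (t / (l * (1 - x))); split.
- by apply/andP; split; [apply: divr_ge0; [exact: ltW|exact: ler0n]|rewrite ler_pdivrMr; move: x1; lra_goal].
- exact: divr_gt0.
- exact: divr_gt0.
- by field; rewrite !gt_eqF.
split => //.
  exists (N * t / (l * (1 - N * x))); last first.
    have -> : y - (N * t / (l * (1 - N * x))) *: v = act (invmx g) (q + (- N * t) *: w).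
      by rewrite actN !mulNr scaleNr.
    exact: (act_Os HO HG Gi ONn).
  rewrite ler_pdivrMr// mulrA mulrAC ler_pdivlMr//.
  have -> : t * (l * (1 - N * x)) = (t * l) * (1 - N * x) by rewrite mulrA.
  have -> : e * (N * t) * (l * (1 - x)) = (t * l) * (e * N - e * (N * x)) by ring.
  have tl : 0 < t * l := mulr_gt0 t0 lp.
  rewrite (ler_pM2l tl).
  have eN : e * N = 2 + e by rewrite /N; field; rewrite gt_eqF.
  have : e * (N * x) <= e * 1 by rewrite ler_pM2l// ltW.
  by rewrite eN; move: LN'; lra_goal.
have [_ sq] := hQ q q Qq ltac:(by rewrite subrr normr0 ltW).
have [_ sp] := hQ' q (t *: w) Qq ltac:(by rewrite twS).
have [_ sm] := hQ' q (- t *: w) Qq ltac:(by rewrite scaleNr normrN twS).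
have kD := hk q (t *: w) Qq twS; rewrite /D /= -scaleNr in kD.
have eq := es Gi Oq; rewrite i1 in eq.
have ep := es Gi Op; rewrite lamp actp in ep.
have em := es Gi Omn; rewrite lamm -ymE in em.
have oq := om_act HO HG hom Gi Oq; rewrite i1 in oq.
have op := om_act HO HG hom Gi Op; rewrite lamp actp in op.
have omm := om_act HO HG hom Gi Omn; rewrite lamm -ymE in omm.
have lE : lam (invmx g) q = l.
  have [_ h _] := line 0 ltac:(by rewrite scale0r addr0).
  by move: h; rewrite scale0r addr0 mul0r addr0 mulr1.
rewrite lE in eq oq.
have T1 : dot (tau (invmx g)) (xi (q + t *: w)) + dot (tau (invmx g)) (xi (q + - t *: w)) =
    2 * dot (tau (invmx g)) (xi q).
  have lZ a : lift1 (a *: w) 0 = a *: lift1 w 0 by rewrite lift1Z mulr0.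
  by rewrite !xiD !lZ !dotDr !dotZr; ring.
have Ck : C * k = 2 * `|M| + 1 by rewrite /C divfK// gt_eqF.
have C0 : 0 < C by rewrite /C divr_gt0// ltr_wpDl// mulr_ge0.
have CD : C * k <= C * (2^-1 * (om (q + t *: w) + om (q + - t *: w)) - om q) by rewrite ler_pM2l.
have MM := ler_norm M.
rewrite -(ltr_pM2l lp).
move: ep em op omm; move: (s (y + _)) (s (y - _)) (om (y + _)) (om (y - _)) => sp' sm' op' om' ep em op omm.
have -> : l * ((1 + x) / 2 * (sp' - C * op') + (1 - (1 + x) / 2) * (sm' - C * om')) =
  2^-1 * (l * (1 + x) * sp' + l * (1 - x) * sm') - C * (2^-1 * (l * (1 + x) * op' + l * (1 - x) * om')).
  by field.
rewrite -op -omm.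
have -> : l * (s y - C * om y) = l * s y - C * (l * om y) by ring.
rewrite -oq.
move: CD sq sp sm; rewrite Ck !ler_norml; set A1 := om (q + _); set A2 := om (q + _); set A3 := om q.
have -> : C * (2^-1 * (A1 + A2) - A3) = C * (2^-1 * (A1 + A2)) - C * A3 by ring.
by move: eq ep em T1 MM; lra_goal.
Qed.

(** [h] is s - C om along the ray through [y], tilted. At a minimum [c] of [h] on [- dl, T], coarse
    concavity gives a smaller value at c + t1 or c - t2. The latter is still in the interval, so c +
    t1 has the smaller value and lies past [T]. This bounds [s] at c + t1, and convexity between 0
    and that point bounds s(y). *)
Lemma equivariant_bounded_above : exists R0 : R, forall y, Os y -> s y <= R0.
Proof.
have [r1 [M0 [r10 h1]]] := convex_bounded oOs cs O0.
have com : convexF Os om by move=> x y a; exact: (om_convex hom).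
have [r2 [M0' [r20 h2]]] := convex_bounded oOs com O0.
pose dl := Order.min r1 r2; have dl0 : 0 < dl by rewrite lt_min r10 r20.
have [b b0 hb] := dual_bound HO.
(* The backward step [t2] is at most e t3 and t3 is at most 2 b; this [e] makes it at most dl / 2,
   so it does not leave the interval. *)
pose e := dl / (4 * b); have e0 : 0 < e by rewrite divr_gt0// mulr_gt0.
have [C C0 hC] := coarse_concave e0.
pose M1 := `|M0| + C * `|M0'|.
pose p y := s y - C * om y.
have pM y : `|y| <= dl -> Os y /\ `|p y| <= M1.
  move=> yd; have [Oy sy] := h1 y ltac:(by rewrite subr0; apply: le_trans yd _; rewrite ge_min lexx).
  have [_ oy] := h2 y ltac:(by rewrite subr0; apply: le_trans yd _; rewrite ge_min lexx orbT).
  split => //; apply: le_trans (ler_normB _ _) _; rewrite normrM (gtr0_norm C0).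
  apply: lerD; first exact: le_trans sy (ler_norm _).
  by rewrite ler_pM2l//; exact: le_trans oy (ler_norm _).
(* The tilt is so steep that on the left of - dl / 2 the function [h] is at least h(0), so a minimum
   can be chosen away from the left end. *)
pose B := 4 * M1 / dl.
have M10 : 0 <= M1 by rewrite addr_ge0// mulr_ge0// ltW.
have B0 : 0 <= B by rewrite divr_ge0 ?mulr_ge0// ltW.
exists (M1 + B * b) => y Oy.
have [->|y0] := eqVneq y 0.
  have [_ s0] := h1 0 ltac:(by rewrite subrr normr0 ltW).
  apply: le_trans (ler_norm _) _; apply: le_trans s0 _; apply: le_trans (ler_norm _) _.
  by rewrite /M1 -addrA lerDl addr_ge0// mulr_ge0// ltW.
pose T := `|y|; have T0 : 0 < T by rewrite normr_gt0.
have [v [v1 yE]] : exists v : 'cV[R]_d, `|v| = 1 /\ y = T *: v.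
  exists (T^-1 *: y); split; first by rewrite normrZ gtr0_norm ?invr_gt0// mulVf ?gt_eqF.
  by rewrite scalerA mulfV ?scale1r ?gt_eqF.
have v0 : v != 0 by rewrite -normr_gt0 v1.
have Otv t : - dl <= t <= T -> Os (t *: v).
  move=> /andP[t1 t2]; have [t0|t0] := leP 0 t.
    have -> : t *: v = (t / T) *: y + (1 - t / T) *: 0.
      by rewrite scaler0 addr0 [in RHS]yE scalerA divfK ?gt_eqF.
    by apply: cOs => //; rewrite divr_ge0 ?ler_pdivrMr ?mul1r// ltW.
  have tn : `|t *: v| <= dl by rewrite normrZ v1 mulr1 ltr0_norm// lerNl.
  by case: (pM _ tn).
pose h t := p (t *: v) - B * t.
have ch : {within `[- dl, T], continuous h}.
  apply/subspace_continuousP => t; rewrite /= in_itv /= => /Otv Ot; apply: cvg_within_filter.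
  have ctv : z *: v @[z --> nbhs t] --> t *: v by apply: cvgZl; exact: cvg_id.
  apply: cvgB; last by apply: cvgM; [exact: cvg_cst|exact: cvg_id].
  apply: cvgB; first exact: (cvg_comp _ s ctv (convex_continuous oOs cs Ot)).
  apply: cvgM; first exact: cvg_cst.
  exact: (cvg_comp _ om ctv (om_continuous hom Ot)).
have dT : - dl <= T by rewrite (@le_trans _ _ 0) ?oppr_le0// ltW.
have [c0 cI mn0] := EVT_min dT ch.
have [c [/andP[c1 c2] mn]] : exists c, - (dl / 2) <= c <= T /\ forall t, t \in `[- dl, T] -> h c <= h t.
  have [lt|ge] := ltP c0 (- (dl / 2)); last first.
    by exists c0; split => //; move: cI; rewrite in_itv /= => /andP[_ ->]; rewrite ge.
  exists 0; split; first by rewrite oppr_le0 divr_ge0 ?ltW.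
  move=> t /mn0; apply: le_trans.
  move: cI; rewrite in_itv /= => /andP[l1 _].
  have c00 : c0 < 0 by apply: lt_trans lt _; rewrite oppr_lt0 divr_gt0.
  have [_ p1] := pM (c0 *: v) ltac:(by rewrite normrZ v1 mulr1 ltr0_norm// lerNl).
  have [_ p2] := pM 0 ltac:(by rewrite normr0 ltW).
  rewrite /h mulr0 subr0 scale0r.
  have : B * c0 <= B * - (dl / 2) by rewrite ler_wpM2l// ltW.
  have -> : B * - (dl / 2) = - (2 * M1) by rewrite /B; field; rewrite gt_eqF.
  by move: p1 p2; rewrite !ler_norml; lra_goal.
have Oc : Os (c *: v) by apply: Otv; rewrite c2 andbT; apply: le_trans c1; rewrite lerN2; move: dl0; lra_goal.
have [a [t1 [t2 [a01 t10 t20 atE H]]]] := hC _ v Oc v0.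
have [Oy1 Oy2 [u3 u23 Oy3] ltp] := H.
have /andP[a0 a1] := a01.
have t3b : u3 - c <= b.
  have := hb _ Oy3; rewrite -scalerBl normrZ v1 mulr1 => /ler_normlP [+ _]; lra_goal.
have cb : c <= b.
  by have := hb _ Oc; rewrite normrZ v1 mulr1; apply: le_trans; exact: ler_norm.
have t2d : t2 <= dl / 2.
  apply: le_trans u23 _; have : e * u3 <= e * (2 * b) by rewrite (ler_pM2l e0); move: t3b cb; lra_goal.
  by have -> : e * (2 * b) = dl / 2 by rewrite /e; field; rewrite gt_eqF.
rewrite -scalerDl -scalerBl -!/(p _) in ltp Oy1 Oy2 Oy3.
have hm : h c <= h (c - t2).
  by apply: mn; rewrite in_itv /=; apply/andP; split; move: c1 c2 t20 t2d dl0; lra_goal.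
have lt' : a * h (c + t1) + (1 - a) * h (c - t2) < h c.
  rewrite /h; have -> : a * (p ((c + t1) *: v) - B * (c + t1)) + (1 - a) * (p ((c - t2) *: v) - B * (c - t2)) =
     (a * p ((c + t1) *: v) + (1 - a) * p ((c - t2) *: v)) - B * c - B * (a * t1 - (1 - a) * t2) by ring.
  by rewrite atE subrr mulr0 subr0 ltrD2r.
have hm' : (1 - a) * h c <= (1 - a) * h (c - t2) by rewrite ler_wpM2l// subr_ge0.
have lt2 : a * h (c + t1) < a * h c by move: lt' hm'; lra_goal.
have ap : 0 < a by rewrite lt_neqAle a0 andbT; apply/eqP => e1; move: lt2; rewrite -e1 !mul0r ltxx.
rewrite ltr_pM2l// in lt2.
have Tt : T < c + t1.
  rewrite ltNge; apply/negP => le; have := mn (c + t1); rewrite in_itv /= le andbT => h0.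
  by have := h0 ltac:(move: c1 t10 dl0; lra_goal); rewrite leNgt lt2.
have h0 : h c <= M1.
  apply: le_trans (mn 0 _) _; first by rewrite in_itv /= oppr_le0 !ltW.
  rewrite /h scale0r mulr0 subr0.
  by have [_] := pM 0 ltac:(by rewrite normr0 ltW); apply: le_trans; exact: ler_norm.
have cb1 : c + t1 <= b.
  by have := hb _ Oy1; rewrite normrZ v1 mulr1; apply: le_trans; exact: ler_norm.
have s1 : s ((c + t1) *: v) <= M1 + B * b.
  have : B * (c + t1) <= B * b by rewrite ler_wpM2l.
  have o1 : C * om ((c + t1) *: v) <= 0 by rewrite pmulr_rle0// ltW// (om_lt0 hom Oy1).
  by move: lt2 h0 o1; rewrite /h /p; lra_goal.
have s0 : s 0 <= M1 + B * b.
  have [_ s0] := h1 0 ltac:(by rewrite subrr normr0 ltW).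
  apply: le_trans (ler_norm _) _; apply: le_trans s0 _; apply: le_trans (ler_norm _) _.
  by rewrite /M1 -addrA lerDl addr_ge0// mulr_ge0// ltW.
pose k := T / (c + t1); have ct0 : 0 < c + t1 by rewrite (lt_trans T0).
have k01 : 0 <= k <= 1 by rewrite divr_ge0 ?ler_pdivrMr ?mul1r// ltW.
have := cs Oy1 O0 k01; rewrite scaler0 addr0 scalerA divfK ?gt_eqF// -yE => /le_trans; apply.
move/andP: k01 => [k0 k1].
have -> : M1 + B * b = k * (M1 + B * b) + (1 - k) * (M1 + B * b) by ring.
by apply: lerD; apply: ler_wpM2l; rewrite ?subr_ge0.
Qed.

End bounded_above.

End equivariant_convex.

Section extension.
Context {R : realType} {d : nat}.
Implicit Types (A : set 'cV[R]_d) (y z : 'cV[R]_d) (h k : 'cV[R]_d -> R).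

(** On the boundary [extend] is a [lim], which is meaningful only if the limit exists; this
    predicate supplies the existence. *)
Definition extends A h := forall y, closure A y ->
  h z @[z --> within A (nbhs y)] --> extend A h y.

Lemma extend_in A h y : A y -> extend A h y = h y.
Proof. by rewrite /extend; case: pselect. Qed.

Lemma extend_out A h y (l : R) : ~ A y -> closure A y ->
  h z @[z --> within A (nbhs y)] --> l -> extend A h y = l.
Proof.
move=> nA cA hl; rewrite /extend; case: (pselect (A y)) => [//|?].
by apply: (cvg_lim (@norm_hausdorff _ R) (FF := within_nbhs_proper cA)).
Qed.

Lemma extendsP A h : (forall y, A y -> {for y, continuous h}) ->
  (forall y, ~ A y -> closure A y -> exists l : R, h z @[z --> within A (nbhs y)] --> l) ->
  extends A h.
Proof.
move=> ch bh y cA; have [Ay|nA] := pselect (A y).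
  by rewrite extend_in//; apply: cvg_within_filter; exact: ch.
by have [l hl] := bh y nA cA; rewrite (extend_out nA cA hl).
Qed.

Lemma extends_continuous A h y : extends A h -> closure A y ->
  extend A h z @[z --> within (closure A) (nbhs y)] --> extend A h y.
Proof.
move=> eh cy; apply/cvg_withinP => e e0; have e20 : 0 < e / 2 by rewrite divr_gt0.
have /cvg_withinP /(_ _ e20) [r r0 hr] := eh y cy.
exists r => // z cz zy; have /cvg_withinP /(_ _ e20) [r1 r10 hr1] := eh z cz.
have r20 : 0 < Order.min r1 (r - `|y - z|) by rewrite lt_min r10 subr_gt0.
have /closureE_ball /(_ _ r20) [w Aw] := cz; rewrite lt_min => /andP[w1 w2].
have h1 := hr1 w Aw w1.
have h2 : `|extend A h y - h w| < e / 2.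
  apply: hr => //; rewrite -(subrK z y) -addrA; apply: le_lt_trans (ler_normD _ _) _.
  by move: w2; lra.
rewrite -(subrK (h w) (extend A h y)) -addrA.
apply: le_lt_trans (ler_normD _ _) _; rewrite (distrC (h w)).
by rewrite [ltRHS]splitr (ltrD h2 h1).
Qed.

Lemma extends_perturb A h k : extends A h ->
  (forall y, A y -> {for y, continuous k}) ->
  (forall y, ~ A y -> closure A y -> k z @[z --> within A (nbhs y)] --> (0 : R)) ->
  extends A (fun y => h y + k y) /\ forall y, closure A y ->
    extend A (fun y => h y + k y) y = extend A h y + (if pselect (A y) then k y else 0).
Proof.
move=> eh ck bk.
have H y : closure A y -> h z + k z @[z --> within A (nbhs y)] -->
    extend A h y + (if pselect (A y) then k y else 0).
  move=> cy; have FF := within_filter A (nbhs_filter y).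
  apply: (cvgD (FF := FF)); first exact: eh.
  case: pselect => Ay; last exact: bk.
  by apply: cvg_within_filter; exact: ck.
have E y : closure A y ->
    extend A (fun y => h y + k y) y = extend A h y + (if pselect (A y) then k y else 0).
  move=> cy; have [Ay|nA] := pselect (A y).
    by rewrite !extend_in//; case: pselect.
  by apply: extend_out => //; have := H y cy; case: pselect.
by split => // y cy; rewrite E//; exact: H.
Qed.

End extension.

Section equivariant_extension.
Context {R : realType} {d : nat} {Om : set 'cV[R]_d} {G : set 'M[R]_(d + 1)}.
Hypothesis (HO : pointed_domain Om) (HG : dividing_group G Om).
Let Os := dual_domain Om.
Context {om : 'cV[R]_d -> R}.
Hypothesis hom : cheng_yau Os om.
Let oOs : open Os := dual_open HO.
Let cOs : convexV Os := @dual_convex R d Om.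
Let O0 : Os 0 := @dual_domain0 R d Om.
Implicit Types (y z v q w : 'cV[R]_d) (g : 'M[R]_(d + 1)) (X : 'cV[R]_(d + 1)).

Lemma om_boundary y : ~ Os y -> closure Os y -> om z @[z --> within Os (nbhs y)] --> (0 : R).
Proof.
move=> nO cy; case: hom => _ _ _ [/subspace_continuousP c b].
have <- : om y = 0 by apply: b; split => // /interior_subset.
apply/cvg_withinP => e e0; have /cvg_withinP /(_ e e0) [r r0 hr] := c y cy.
by exists r => // z Oz; apply: hr; exact: subset_closure.
Qed.

Lemma dominated_boundary k (U : R) : (forall y, Os y -> `|k y| <= U * `|om y|) ->
  forall y, ~ Os y -> closure Os y -> k z @[z --> within Os (nbhs y)] --> (0 : R).
Proof.
move=> kU y nO cy; apply/cvg_withinP => e e0.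
have V0 : 0 < `|U| + 1 by rewrite ltr_wpDl.
have /cvg_withinP /(_ _ (divr_gt0 e0 V0)) [r r0 hr] := om_boundary nO cy.
exists r => // z Oz zy; have := hr z Oz zy; rewrite !sub0r !normrN ltr_pdivlMr// mulrC.
apply: le_lt_trans; apply: le_trans (kU z Oz) _; apply: ler_wpM2r => //.
by apply: le_trans (ler_norm _) _; rewrite lerDl.
Qed.

(** f / om is invariant, and every orbit meets a compact sublevel set of [om], where [f] is
    bounded. *)
Lemma invariant_dominated f : (forall y, Os y -> {for y, continuous f}) ->
  equivariant (Om := Om) (G := G) (fun=> 0) f ->
  exists2 U : R, 0 < U & forall y, Os y -> `|f y| <= U * `|om y|.
Proof.
move=> cf ef; have [eta eta0 cc] := act_cocompact HO HG hom.
have cQ := om_sublevel_compact hom (dual_closure_compact HO) eta0.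
have cF : {within [set y | Os y /\ om y <= - eta], continuous f}.
  by apply/subspace_continuousP => y [Oy _]; apply: cvg_within_filter; exact: cf.
have [M M0 hM] : exists2 M : R, 0 < M & forall y, Os y -> om y <= - eta -> `|f y| <= M.
  have /compact_bounded [M [_ hM]] := continuous_compact cF cQ.
  exists (`|M| + 1); first by rewrite ltr_wpDl.
  move=> y Oy oy; apply: hM; first by rewrite ltr_pwDr// ler_norm.
  by exists y.
exists (M / eta); first exact: divr_gt0.
move=> y Oy; have [g Gg og] := cc y Oy; have Oa := act_Os HO HG Gg Oy.
have l0 := lam_gt0 HO HG Gg (subset_closure Oy).
rewrite (ef g y Gg Oy) dot0l addr0 normrM (gtr0_norm l0) (om_act HO HG hom Gg Oy).
rewrite normrM (gtr0_norm l0) mulrCA ler_pM2l//.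
apply: le_trans (hM _ Oa og) _; rewrite mulrAC ler_pdivlMr// ler_pM2l//.
by have oa := om_lt0 hom Oa; rewrite ltr0_norm//; lra.
Qed.

Variables (tau : 'M[R]_(d + 1) -> 'cV[R]_(d + 1)) (s : 'cV[R]_d -> R).
Hypotheses (cs : convexF Os s) (es : equivariant (Om := Om) (G := G) tau s).

(* Moving the value of [s] far out along a ray to the compact set and comparing
   with a constant there gives affine functions above [s] that are close to [s]
   near the boundary point. *)
Lemma equivariant_extends : extends Os s.
Proof.
apply: extendsP => [y Oy|y nO cy]; first exact: (convex_continuous oOs cs Oy).
have [R0 hR0] := equivariant_bounded_above HO HG hom cs es.
have [eta eta0 cc] := act_cocompact HO HG hom.
have cQ := om_sublevel_compact hom (dual_closure_compact HO) eta0.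
have cF : {within [set y | Os y /\ om y <= - eta], continuous s}.
  by apply/subspace_continuousP => z [Oz _]; apply: cvg_within_filter; exact: (convex_continuous oOs cs Oz).
have [M M0 hM] : exists2 M : R, 0 < M & forall y, Os y -> om y <= - eta -> `|s y| <= M.
  have /compact_bounded [M [_ hM]] := continuous_compact cF cQ.
  exists (`|M| + 1); first by rewrite ltr_wpDl.
  move=> z Oz oz; apply: hM; first by rewrite ltr_pwDr// ler_norm.
  by exists z.
pose C := (`|R0| + M) / eta; have C0 : 0 < C by rewrite divr_gt0// ltr_wpDl.
have FF := within_nbhs_proper cy.
suff /cauchy_cvg : cauchy (s z @[z --> within Os (nbhs y)]).
  by move=> /cvg_ex [l hl]; exists l.
apply: cauchy_exP => e e0.
pose e' := e / (2 * C + 3); have D0 : 0 < 2 * C + 3 by rewrite addr_gt0// mulr_gt0.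
have e'0 : 0 < e' by rewrite divr_gt0.
have [t [t2 t1 omt]] : exists t : R, [/\ 2^-1 <= t, t < 1 & `|om (t *: y)| < e'].
  have /cvg_withinP /(_ _ e'0) [r r0 hr] := om_boundary nO cy.
  pose a := Order.min (2^-1) (r / (`|y| + 1) / 2).
  have y1 : 0 < `|y| + 1 by rewrite ltr_wpDl.
  have a0 : 0 < a by rewrite lt_min invr_gt0 ltr0n !divr_gt0.
  have a2 : a <= 2^-1 by rewrite ge_min lexx.
  exists (1 - a); split; [move: a2; lra_goal|move: a0; lra_goal|].
  have O1 : Os ((1 - a) *: y) by apply: (closure_dual_scale HO cy); apply/andP; split; move: a0 a2; lra_goal.
  have := hr _ O1; rewrite sub0r normrN; apply.
  have -> : y - (1 - a) *: y = a *: y by rewrite scalerBl scale1r opprB addrC subrK.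
  rewrite normrZ gtr0_norm//; apply: (@le_lt_trans _ _ (a * (`|y| + 1))).
    by rewrite ler_pM2l// lerDl.
  rewrite -ltr_pdivlMr//; apply: (@le_lt_trans _ _ (r / (`|y| + 1) / 2)).
    by rewrite ge_min lexx orbT.
  by rewrite ltr_pdivrMr// ltr_pMr ?ltr1n// divr_gt0.
have t0 : 0 < t by move: t2; lra_goal.
have Ot : Os (t *: y) by apply: (closure_dual_scale HO cy); rewrite (ltW t0) t1.
have [g Gg og] := cc _ Ot.
pose W z := lam g z * R0 + dot (tau g) (xi z).
have sW z : Os z -> s z <= W z.
  move=> Oz; rewrite (es Gg Oz) lerD2r ler_pM2l; first exact: (hR0 _ (act_Os HO HG Gg Oz)).
  exact: (lam_gt0 HO HG Gg (subset_closure Oz)).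
have cW z : {for z, continuous W}.
  apply: (cvgD (FF := nbhs_filter z)).
    apply: (cvgM (FF := nbhs_filter z)); [exact: lam_continuous|exact: cvg_cst].
  apply: (cvg_dot (FF := nbhs_filter z)); [exact: cvg_cst|exact: xi_continuous].
have Wt : W (t *: y) = t * W y + (1 - t) * W 0.
  have -> : t *: y = t *: y + (1 - t) *: 0 by rewrite scaler0 addr0.
  by rewrite /W lam_conv xi_conv dotDr !dotZr; ring.
have Wle : W (t *: y) <= s (t *: y) + C * e'.
  have Oa := act_Os HO HG Gg Ot; have l0 := lam_gt0 HO HG Gg (subset_closure Ot).
  have lE := om_act HO HG hom Gg Ot.
  have lle : lam g (t *: y) <= e' / eta.
    rewrite ler_pdivlMr//; apply: le_trans (ltW omt); rewrite lE normrM (gtr0_norm l0).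
    by have oa := om_lt0 hom Oa; rewrite (ler_pM2l l0) (ltr0_norm oa); move: og; lra_goal.
  have -> : s (t *: y) + C * e' = W (t *: y) + (C * e' - lam g (t *: y) * (R0 - s (act g (t *: y)))).
    by rewrite (es Gg Ot) /W; ring.
  rewrite lerDl subr_ge0.
  have h1 : R0 - s (act g (t *: y)) <= `|R0| + M.
    apply: le_trans (ler_norm _) _; apply: le_trans (ler_normB _ _) _.
    by rewrite lerD2l; exact: hM.
  apply: (@le_trans _ _ (lam g (t *: y) * (`|R0| + M))); first by rewrite ler_pM2l.
  have -> : C * e' = (e' / eta) * (`|R0| + M) by rewrite /C; ring.
  by rewrite ler_pM2r// ltr_wpDl.
(* The center of the ball is the value at [y] of the line through the values of [s] at 0 and t y.
   Near [y], convexity keeps [s] above it and [W] keeps [s] below it, both up to a multiple of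
   [e']. *)
exists ((s (t *: y) - (1 - t) * s 0) / t); set x := _ / t.
have /cvg_atP /(_ _ e'0) [r1 r10 h1] := cW y.
have /cvg_atP /(_ _ e'0) [r2 r20 h2] := convex_continuous oOs cs Ot.
apply/(interiorE_ball [set z | Os z -> ball x e (s z)]).
exists (Order.min r1 r2); first by rewrite lt_min r10.
move=> z; rewrite lt_min => /andP[z1 z2] Oz; rewrite /ball /= .
have xE : t * x = s (t *: y) - (1 - t) * s 0 by rewrite /x mulrC divfK// gt_eqF.
have := h1 z z1; rewrite ltr_norml => /andP[k1 _].
have := h2 (t *: z); rewrite -scalerBr normrZ gtr0_norm// => /(_ _) k2.
have /k2 : t * `|y - z| < r2 by apply: le_lt_trans z2; rewrite ler_piMl// ltW.
rewrite ltr_norml => /andP[_ k3].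
have t01 : 0 <= t <= 1 by rewrite !ltW.
have k4 := cs Oz O0 t01; rewrite scaler0 addr0 in k4.
have k5 := sW z Oz; have k6 : (1 - t) * s 0 <= (1 - t) * W 0 by rewrite ler_wpM2l ?subr_ge0 ?sW// ltW.
have k7 : t * W y <= t * x + C * e' by rewrite xE; move: Wle Wt k6; lra_goal.
have k8 : W y <= x + 2 * C * e'.
  have h : C * e' <= t * (2 * C * e').
    have -> : t * (2 * C * e') = (2 * t) * (C * e') by ring.
    by apply: ler_peMl; [exact: mulr_ge0 (ltW C0) (ltW e'0)|move: t2; lra_goal].
  by rewrite -(ler_pM2l t0) [leRHS]mulrDr; move: k7 h; lra_goal.
have k9 : x - 2 * e' <= s z.
  have h : e' <= t * (2 * e').
    have -> : t * (2 * e') = (2 * t) * e' by ring.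
    by apply: ler_peMl; [exact: ltW|move: t2; lra_goal].
  by rewrite -(ler_pM2l t0) [leLHS]mulrBr; move: xE k4 k3 h; lra_goal.
have eE : e = 2 * C * e' + 3 * e' by rewrite /e'; field; rewrite gt_eqF.
have Ce : 0 < C * e' := mulr_gt0 C0 e'0.
rewrite -/(W z) in k1.
have k10 : W z <= x + (2 * C * e' + e') by move: k1 k8; lra_goal.
by rewrite eE ltr_norml; apply/andP; split; move: k9 k5 k10 Ce e'0; lra_goal.
Qed.

End equivariant_extension.

(** * Domains and support functions *)

Section domains.
Context {R : realType} {d : nat} {Om : set 'cV[R]_d}.
Hypothesis HO : pointed_domain Om.
Let Os := dual_domain Om.
Let oOs : open Os := dual_open HO.
Let cOs : convexV Os := @dual_convex R d Om.
Let O0 : Os 0 := @dual_domain0 R d Om.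
Implicit Types (y z q w : 'cV[R]_d) (X Y P v phi : 'cV[R]_(d + 1)) (c : R).

Definition up : 'cV[R]_(d + 1) := lift1 0 1.

Lemma dot_up y : dot up (xi y) = -1.
Proof. by rewrite dot_xi dot0l sub0r. Qed.

Lemma cone_dot v y : cone Om v -> closure Os y -> dot v (xi y) <= 0.
Proof.
move=> [x [t [Ox t0 ->]]] cy; rewrite dotZl dot_xi pmulr_rle0// subr_le0.
by move: cy => /(closure_dual HO); exact.
Qed.

(** The last coordinate of [phi] is nonpositive, by testing at (0, 1). If it were 0, the rest would
    vanish too because [Om] contains a ball around 0; otherwise it can be normalized to -1. *)
Lemma negative_on_cone phi : phi != 0 -> (forall v, cone Om v -> dot phi v <= 0) ->
  exists (a : R) y, [/\ 0 < a, closure Os y & phi = a *: xi y].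
Proof.
move=> p0 h; rewrite (lift1_last phi); set p := usubmx phi; set a := - last_coord phi.
have hx x : Om x -> dot p x <= a.
  move=> Ox; have := h _ (cone_lift Ox); rewrite {1}(lift1_last phi) dot_lift mulr1.
  by rewrite /a -lerBrDr sub0r.
have [_ _ Om0] := HO.
have a0 : 0 <= a by have := hx 0 Om0; rewrite dot0r.
have pa x : 0 < a -> Om x -> dot x (a^-1 *: p) <= 1.
  by move=> ap Ox; rewrite dotZr dotC ler_pdivrMl// mulr1 hx.
move: a0; rewrite le_eqVlt => /orP[/eqP a0|ap]; last first.
  exists a, (a^-1 *: p); split => //; first by apply/(closure_dual HO) => x; exact: pa.
  by rewrite lift1Z scalerA mulfV ?gt_eqF// scale1r mulrN1 /a opprK.
exfalso; move: p0; rewrite (lift1_last phi) -/p.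
have -> : last_coord phi = 0 by apply/eqP; rewrite -oppr_eq0 -/a -a0.
suff -> : p = 0.
  by rewrite (_ : lift1 0 0 = 0) ?eqxx// -[RHS](scale0r (lift1 0 0)) lift1Z scale0r mul0r.
have [e e0 he] := openE_ball (omega_open HO) Om0.
apply: dot_eq0; apply/eqP; rewrite eq_le dot_ge0 andbT.
pose t := e / (`|p| + 1); have p1 : 0 < `|p| + 1 by rewrite ltr_wpDl.
have t0 : 0 < t by rewrite divr_gt0.
have Ot : Om ((t / 2) *: p).
  apply: he; rewrite sub0r normrN normrZ gtr0_norm ?divr_gt0//.
  have -> : t / 2 * `|p| = e * (`|p| / (`|p| + 1)) / 2 by rewrite /t; ring.
  have : `|p| / (`|p| + 1) <= 1 by rewrite ler_pdivrMr// mul1r lerDl.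
  by rewrite -(ler_pM2l e0); lra.
by have := hx _ Ot; rewrite -a0 dotZr pmulr_rle0// divr_gt0.
Qed.

Lemma dual_cone_xi (a : R) y : 0 < a -> Os y -> dual_cone (cone Om) (a *: xi y).
Proof.
move=> a0 Oy; have [e e0 he] := openE_ball oOs Oy.
have [b b0 hb] := dual_bound HO.
pose r := Order.min (a / 2) (e * a / (4 * (b + 1))).
have b1 : 0 < b + 1 by rewrite addr_gt0.
apply/(@interiorE_ball _ _ _ (a *: xi y)); exists r.
  by rewrite lt_min !divr_gt0 ?mulr_gt0.
move=> phi; rewrite lt_min => /andP[h1 h2].
rewrite (lift1_last phi); set p := usubmx phi; set l := last_coord phi.
rewrite {1}(lift1_last phi) -/p -/l in h1; rewrite {1}(lift1_last phi) -/p -/l in h2.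
rewrite lift1Z lift1N lift1D in h1 h2.
have l2 : l <= - (a / 2).
  have := norm_last (lift1 (a *: y - p) (a * -1 - l)); rewrite last_lift.
  by move=> /le_lt_trans /(_ h1); rewrite ltr_norml => /andP[]; lra.
have pn := norm_usubmx (lift1 (a *: y - p) (a * -1 - l)); rewrite usubmx_lift in pn.
have ln := norm_last (lift1 (a *: y - p) (a * -1 - l)); rewrite last_lift in ln.
have l0 : 0 < - l by lra.
move=> v [x [t [Ox t0 ->]]] /=.
rewrite dotZr dot_lift mulr1 pmulr_rle0//.
have Op : Os ((- l)^-1 *: p).
  apply: he.
  have -> : y - (- l)^-1 *: p = (- l)^-1 *: ((a *: y - p) - (a + l) *: y).
    by apply/matrixP => i j; rewrite !mxE; field; rewrite -oppr_eq0 gt_eqF.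
  rewrite normrZ normfV (gtr0_norm l0) mulrC ltr_pdivrMr//.
  apply: le_lt_trans (ler_normB _ _) _; rewrite normrZ.
  have al : `|a + l| <= e * a / (4 * (b + 1)).
    by apply: ltW; apply: le_lt_trans h2; apply: le_trans ln; rewrite -normrN opprD mulrN1.
  have yb : `|y| <= b + 1 by apply: le_trans (hb y Oy) _; rewrite lerDl.
  have k1 : `|a + l| * `|y| <= e * a / 4.
    apply: (@le_trans _ _ (e * a / (4 * (b + 1)) * (b + 1))); first exact: ler_pM.
    by rewrite le_eqVlt; apply/orP; left; apply/eqP; field; rewrite gt_eqF.
  have k2 : `|a *: y - p| < e * a / 4.
    apply: le_lt_trans pn _; apply: lt_le_trans h2 _.
    rewrite ler_pM2l ?mulr_gt0// lef_pV2 ?posrE ?mulr_gt0//; lra.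
  have k3 : e * (a / 2) <= e * - l by rewrite ler_pM2l//; lra.
  by lra.
have : dot x ((- l)^-1 *: p) <= 1 by move: Op => /subset_closure /(closure_dual HO); exact.
by rewrite dotZr dotC ler_pdivrMl// mulr1; lra.
Qed.

Variable h : 'cV[R]_d -> R.
Hypothesis eh : extends Os h.
Let H := extend Os h.
Let Kh := domain_of Os h.

Let ne : closure Os !=set0. Proof. by exists 0; exact: subset_closure. Qed.

Lemma ext_within : {within closure Os, continuous H}.
Proof. by apply/subspace_continuousP => y cy; exact: extends_continuous. Qed.

Lemma gap_within X : {within closure Os, continuous (fun y => H y - dot X (xi y))}.
Proof.
apply/subspace_continuousP => y cy; have FF := within_filter (closure Os) (nbhs_filter y).
apply: (cvgB (FF := FF)); first exact: extends_continuous.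
apply: cvg_within_filter.
exact: (cvg_dot (FF := nbhs_filter y) (cvg_cst X) (@xi_continuous _ _ y)).
Qed.

Lemma ext_bounded : exists2 B : R, 0 < B & forall y, closure Os y -> `|H y| <= B.
Proof.
have /compact_bounded [M [_ hM]] := continuous_compact ext_within (dual_closure_compact HO).
exists (`|M| + 1); first by rewrite ltr_wpDl.
by move=> y cy; apply: hM; [rewrite ltr_pwDr// ler_norm|exists y].
Qed.

Lemma domain_gap X : Kh X ->
  exists2 e : R, 0 < e & forall y, closure Os y -> dot X (xi y) <= H y - e.
Proof.
move=> KX; have [y0 + mn] := compact_EVT_min ne (dual_closure_compact HO) (gap_within (X := X)).
rewrite inE => cy0; exists (H y0 - dot X (xi y0)); first by rewrite subr_gt0; exact: KX.
by move=> y cy; have := mn y (mem_set cy); lra.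
Qed.

Lemma xi_bound : exists2 b : R, 0 < b & forall y, closure Os y -> `|xi y| <= b.
Proof.
have cx : {within closure Os, continuous (@xi R d)} by apply: continuous_subspaceT; exact: xi_continuous.
have [b b0 hb] := compact_boundedE (continuous_compact cx (dual_closure_compact HO)).
by exists b => // y cy; apply: hb; exists y.
Qed.

Lemma domain_open : open Kh.
Proof.
apply: open_ballE => X KX; have [e e0 he] := domain_gap KX.
have [b b0 hb] := xi_bound.
have D0 : 0 < (d + 1)%:R * b :> R by rewrite mulr_gt0// ltr0n addn1.
exists (e / ((d + 1)%:R * b)); first exact: divr_gt0.
move=> Y XY y cy; rewrite -[Y](subrK X) dotDl.
have : dot (Y - X) (xi y) < e.
  apply: le_lt_trans (ler_norm _) _; apply: le_lt_trans (dot_le _ _) _.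
  apply: (@le_lt_trans _ _ ((d + 1)%:R * `|Y - X| * b)); first by rewrite ler_wpM2l ?mulr_ge0// hb.
  by rewrite mulrAC mulrC -ltr_pdivlMr// distrC.
by have := he y cy; rewrite -/H; lra.
Qed.

Lemma domain_convex : convexV Kh.
Proof.
move=> X Y a KX KY /andP[a0 a1] y cy; rewrite dotDl !dotZl -/H.
have := KX y cy; have := KY y cy; rewrite -/H => h1 h2.
move: a0; rewrite le_eqVlt => /orP[/eqP <-|a0]; first by rewrite mul0r add0r subr0 mul1r.
have := ltr_pM2l a0 (dot X (xi y)) (H y); rewrite h2 => h3.
have : (1 - a) * dot Y (xi y) <= (1 - a) * H y by rewrite ler_wpM2l ?subr_ge0// ltW.
by lra.
Qed.

Lemma domain_cone X v : Kh X -> cone Om v -> Kh (X + v).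
Proof.
move=> KX cv y cy; rewrite dotDl; have := KX y cy; have := cone_dot cv cy; lra.
Qed.

Lemma domain_up X (e : R) : 0 < e -> (forall y, closure Os y -> dot X (xi y) <= H y) ->
  Kh (X + e *: up).
Proof.
move=> e0 hX y cy; rewrite dotDl dotZl dot_up; have := hX y cy; rewrite -/H; lra.
Qed.

Lemma domain_nonempty : Kh !=set0.
Proof.
have [B B0 hB] := ext_bounded; exists ((B + 1) *: up) => y cy.
rewrite dotZl dot_up; have := hB y cy; rewrite ler_norml => /andP[+ _]; rewrite -/H; lra.
Qed.

(** [X] is seen as the affine function X . xi(z). A compact [Q] keeps a distance [r] to the
    complement of the dual domain, so a steep slope would break the upper bound at distance [r] from
    [y]. This is what bounds the points whose contact direction is in [Q]. *)
Lemma slope_bound (Q : set 'cV[R]_d) (B : R) : compact Q -> Q `<=` Os -> exists C : R,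
  forall X y, Q y -> - B <= dot X (xi y) -> (forall z, Os z -> dot X (xi z) <= B) -> `|X| <= C.
Proof.
move=> cQ QO.
have [r [M [r0 hr]]] : exists r M : R, 0 < r /\ forall q z, Q q -> `|z - q| <= r -> Os z.
  apply: (@compact_uniform _ _ Q (fun _ z => Os z)) => // q /QO Oq.
  have [e e0 he] := openE_ball oOs Oq; exists (e / 2), 0; split; first by rewrite divr_gt0.
  move=> z zq; apply: he; rewrite distrC; apply: le_lt_trans zq _.
  by rewrite ltr_pdivrMr// ltr_pMr// ltr1n.
have [b b0 hb] := dual_bound HO.
pose C1 := 2 * `|B| / r; have C10 : 0 <= C1 by rewrite divr_ge0 ?mulr_ge0// ltW.
exists (C1 + d%:R * C1 * b + `|B|) => X y Qy yB zB.
have Bn := ler_norm B.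
have x1 : `|usubmx X| <= C1.
  apply: norm_leP => // i; rewrite -dot_basis.
  have hs (e : R) : `|e| <= 1 -> Os (y + (e * r) *: basis_vec R i).
    move=> e1; apply: (hr y) => //; rewrite addrAC subrr add0r normrZ normrM (gtr0_norm r0).
    have : `|basis_vec R i| <= 1.
      apply: norm_leP => // j; rewrite !mxE eqxx andbT.
      by case: (_ == _) => /=; rewrite ?normr1 ?normr0.
    move=> v1; apply: (@le_trans _ _ (1 * r * 1)); last by rewrite mul1r mulr1.
    by apply: ler_pM => //; [rewrite mulr_ge0// ltW|rewrite ler_wpM2r// ltW].
  have e1 e : dot X (xi (y + (e * r) *: basis_vec R i)) = dot X (xi y) + e * r * dot (usubmx X) (basis_vec R i).
    by rewrite xiD dotDr {2}(lift1_last X) dot_lift mulr0 addr0 dotZr.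
  have := zB _ (hs 1 _); have := zB _ (hs (-1) _); rewrite !e1 normrN1 normr1 lexx.
  move=> /(_ isT) h1 /(_ isT) h2; rewrite ler_norml /C1; apply/andP; split.
    by rewrite -mulNr ler_pdivrMr//; lra.
  by rewrite ler_pdivlMr//; lra.
have z1 : `|last_coord X| <= d%:R * C1 * b + `|B|.
  have -> : last_coord X = dot (usubmx X) y - dot X (xi y) by rewrite dot_xiE; ring.
  apply: le_trans (ler_normB _ _) _; apply: lerD.
    apply: le_trans (dot_le _ _) _; apply: ler_pM; [by rewrite mulr_ge0|exact: normr_ge0|by rewrite ler_wpM2l|].
    exact: hb (QO _ Qy).
  by rewrite ler_norml; apply/andP; split; have := zB y (QO _ Qy); lra.
have dC : 0 <= d%:R * C1 * b by apply: mulr_ge0 (ltW b0); exact: mulr_ge0.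
rewrite (lift1_last X); apply: norm_lift.
- by rewrite !addr_ge0.
- by apply: le_trans x1 _; rewrite -addrA lerDl addr_ge0.
- by apply: le_trans z1 _; rewrite -addrA lerDr.
Qed.

(** [Kh] is open and unbounded, so the maximum is taken over its closed version, cut by the
    half-space where the pairing with [xi y] is at least its value at one point of [Kh]; this part
    is compact by [slope_bound]. *)
Lemma domain_contact y : Os y -> exists P, boundary Kh P /\ forall X, Kh X ->
  dot X (xi y) < dot P (xi y).
Proof.
move=> Oy; have [X0 KX0] := domain_nonempty.
have [B B0 hB] := ext_bounded.
pose m := dot X0 (xi y).
pose S := [set X | forall z, closure Os z -> dot X (xi z) <= H z] `&` [set X | dot X (- xi y) <= - m].
have cS : compact S.
  apply: cV_compact.
    have [C hC] := slope_bound (`|m| + B) (@compact_set1 _ y) (fun z (e : z = y) => eq_ind_r Os Oy e).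
    apply: (@bounded_setP _ _ _ C) => X [SX /=]; rewrite dotNr lerN2 => mX.
    apply: (hC X y) => //.
      by apply: le_trans mX; rewrite opprD; have := ler_norm (- m); rewrite normrN; lra.
    move=> z /subset_closure cz; apply: le_trans (SX z cz) _.
    by apply: le_trans (ler_norm _) _; apply: le_trans (hB z cz) _; rewrite lerDr.
  apply: closedI; last first.
    apply: closed_le_fun; exact: dot_continuousl.
  have -> : [set X | forall z, closure Os z -> dot X (xi z) <= H z] =
      \bigcap_(z in closure Os) [set X | dot X (xi z) <= H z] by [].
  by apply: closed_bigI => z _; apply: closed_le_fun; exact: dot_continuousl.
have SX0 : S X0 by split => [z cz|/=]; [exact/ltW/KX0|rewrite dotNr].
have cd : {within S, continuous (fun X => dot X (xi y))}.
  by apply: continuous_subspaceT; exact: dot_continuousl.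
have [P + mx] := compact_EVT_max (ex_intro _ X0 SX0) cS cd.
rewrite inE => -[SP mP].
have lt X : Kh X -> dot X (xi y) < dot P (xi y).
  move=> KX; have [e e0 he] := domain_gap KX.
  have : S (X - e *: up) \/ dot X (xi y) + e < m.
    have [h1|h1] := ltP (dot X (xi y) + e) m; [by right|left; split => [z cz|/=]].
      by rewrite dotBl dotZl dot_up; have := he z cz; rewrite -/H; lra.
    by rewrite dotNr lerN2 dotBl dotZl dot_up; lra.
  move=> [SX|Xm].
    by have := mx _ (mem_set SX); rewrite dotBl dotZl dot_up; lra.
  by move: mP; rewrite /= dotNr lerN2; lra.
exists P; split => //; split.
  apply/closureE_ball => e e0; exists (P + (e / 2) *: up).
    by apply: domain_up; rewrite ?divr_gt0.
  rewrite opprD addrA subrr sub0r normrN normrZ gtr0_norm ?divr_gt0//.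
  have u1 : `|up| <= 1 by apply: norm_lift => //; rewrite ?normr0 ?normr1.
  have e20 : 0 < e / 2 by rewrite divr_gt0.
  have := ler_wpM2l (ltW e20) u1; lra.
by move=> /interior_subset /lt; rewrite ltxx.
Qed.

Lemma domain_cone_convex : cone_convex (cone Om) Kh.
Proof.
split.
- split; [exact: domain_nonempty|exact: domain_open|].
  by apply/convex_setP => x y a; exact: domain_convex.
- apply/seteqP; split => [_ [X KX [v cv <-]]|X KX]; first exact: domain_cone.
  have [e e0 he] := domain_gap KX; have e20 : 0 < e / 2 by rewrite divr_gt0.
  exists (X - (e / 2) *: up).
    move=> y cy; rewrite dotBl dotZl dot_up; have := he y cy; rewrite -/H; lra.
  exists ((e / 2) *: up); last by rewrite subrK.
  by exists 0, (e / 2); split => //; case: HO.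
- move=> phi [p0 [a a0 da]]; split => //.
  have ap0 : a *: phi != 0 by rewrite scaler_eq0 negb_or a0.
  have [|b [y [b0 cy pE]]] := negative_on_cone ap0 _.
    by move=> v cv; have := interior_subset da; apply.
  have Oy : Os y.
    apply/(dual_gap HO); move: da => /(@interiorE_ball _ _ _ (a *: phi)) [e e0 he].
    exists (e / 2 / b); first by rewrite !divr_gt0.
    move=> x Ox.
    have := he (a *: phi + (e / 2) *: up) _ (lift1 x 1) (cone_lift Ox).
    rewrite opprD addrA subrr sub0r normrN normrZ gtr0_norm ?divr_gt0// => h1.
    have e20 : 0 < e / 2 by rewrite divr_gt0.
    have u1 : `|up| <= 1 by apply: norm_lift => //; rewrite ?normr0 ?normr1.
    have /h1 : e / 2 * `|up| < e by have := ler_wpM2l (ltW e20) u1; lra.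
    rewrite pE dotDl !dotZl dotC dot_xi dot_lift dot0l add0r !mulr1 dotC => h2.
    have : dot y x - 1 <= - (e / 2 / b).
      by rewrite -mulNr ler_pdivlMr//; lra.
    by rewrite dotC; lra.
  have [P [bP ltP]] := domain_contact Oy.
  have pE' : phi = (a^-1 * b) *: xi y by rewrite -scalerA -pE scalerA mulVf// scale1r.
  exists (a^-1 * b * dot P (xi y)); split.
    apply/seteqP; split => // X [/=]; rewrite /hyperplane /= pE' dotZl => /mulfI e KX.
    have := ltP X KX; rewrite dotC e ?ltxx// mulf_neq0 ?invr_eq0// gt_eqF//.
  by exists P; split => //; rewrite /hyperplane /= pE' dotZl dotC.
- move=> phi [p0 [c [dis _]]].
  suff [b [y [b0 cy pE]]] : exists (b : R) y, [/\ b != 0, closure Os y & phi = b *: xi y].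
    apply/closureE_ball => e e0; pose t := 1 - Order.min (2^-1) (e / (`|b| * (`|y| + 1)) / 2).
    have nb : 0 < `|b| by rewrite normr_gt0.
    have ny : 0 < `|y| + 1 by rewrite ltr_wpDl.
    have m0 : 0 < Order.min (2^-1) (e / (`|b| * (`|y| + 1)) / 2).
      by rewrite lt_min invr_gt0 ltr0n !divr_gt0// mulr_gt0.
    have m1 : Order.min (2^-1) (e / (`|b| * (`|y| + 1)) / 2) <= 2^-1 by rewrite ge_min lexx.
    have t01 : 0 <= t < 1 by rewrite /t; apply/andP; split; lra.
    have Ot := closure_dual_scale HO cy t01.
    have x0 z : xi z != 0.
      by apply/eqP => xz; have := dot_up z; rewrite xz dot0r => /eqP; rewrite eq_sym oppr_eq0 oner_eq0.
    exists (b *: xi (t *: y)).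
      split; first by rewrite scaler_eq0 negb_or b0 x0.
      exists b^-1; first by rewrite invr_eq0.
      by rewrite scalerA mulVf//; exact: dual_cone_xi.
    rewrite pE -scalerBr normrZ /xi lift1N lift1D subrr.
    have -> : y - t *: y = (1 - t) *: y by rewrite [RHS]scalerBl scale1r.
    have -> : 1 - t = Order.min (2^-1) (e / (`|b| * (`|y| + 1)) / 2) by rewrite /t; ring.
    set m := Order.min _ _ in m0 *.
    apply: (@le_lt_trans _ _ (`|b| * (m * (`|y| + 1)))).
      rewrite ler_pM2l//; have m2 : 0 <= m * (`|y| + 1) by apply: mulr_ge0; exact: ltW.
      apply: norm_lift => //; last by rewrite normr0.
      by rewrite normrZ gtr0_norm// ler_pM2l// lerDl.
    rewrite mulrCA -ltr_pdivlMr ?mulr_gt0//.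
    apply: (@le_lt_trans _ _ (e / (`|b| * (`|y| + 1)) / 2)); first by rewrite ge_min lexx orbT.
    by rewrite ltr_pdivrMr// ltr_pMr ?ltr1n// divr_gt0// mulr_gt0.
  have [X KX] := domain_nonempty.
  have nc Y : Kh Y -> dot phi Y != c.
    by move=> KY; apply/eqP => e; have : (hyperplane phi c `&` Kh) Y by []; rewrite dis.
  have line v t : cone Om v -> 0 < t -> Kh (X + t *: v).
    move=> [x [t' [Ox t0' ->]]] t0; apply: domain_cone => //.
    by exists x, (t * t'); rewrite scalerA mulr_gt0.
  (* The hyperplane misses [Kh], which contains the rays from [X] in all directions of the cone;
     hence [phi] has one sign on the cone, determined by the side on which [X] lies. *)
  have [lt|ge] := ltP (dot phi X) c.
    have [v cv|a [y [a0 cy ->]]] := negative_on_cone p0 _.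
      rewrite leNgt; apply/negP => v0.
      have t0 : 0 < (c - dot phi X) / dot phi v by rewrite divr_gt0// subr_gt0.
      have := nc _ (line v _ cv t0); rewrite dotDr dotZr divfK; last by rewrite gt_eqF.
      by rewrite addrC subrK eqxx.
    by exists a, y; split => //; rewrite gt_eqF.
  have gt : c < dot phi X by rewrite lt_neqAle ge andbT eq_sym nc.
  have np0 : - phi != 0 by rewrite oppr_eq0.
  have [v cv|a [y [a0 cy pE]]] := negative_on_cone np0 _.
    rewrite dotNl oppr_le0 leNgt; apply/negP => v0.
    have t0 : 0 < (c - dot phi X) / dot phi v by rewrite -mulrNN -invrN divr_gt0 ?oppr_gt0// subr_lt0.
    have := nc _ (line v _ cv t0); rewrite dotDr dotZr divfK; last by rewrite lt_eqF.
    by rewrite addrC subrK eqxx.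
  by exists (- a), y; rewrite scaleNr -pE opprK oppr_eq0 gt_eqF.
Qed.

End domains.

Section support.
Context {R : realType} {d : nat} {Om : set 'cV[R]_d} {G : set 'M[R]_(d + 1)}.
Hypothesis (HO : pointed_domain Om) (HG : dividing_group G Om).
Let Os := dual_domain Om.
Context {om : 'cV[R]_d -> R}.
Hypothesis hom : cheng_yau Os om.
Let oOs : open Os := dual_open HO.
Let cOs : convexV Os := @dual_convex R d Om.
Let O0 : Os 0 := @dual_domain0 R d Om.
Implicit Types (y z q w : 'cV[R]_d) (g : 'M[R]_(d + 1)) (X Y P v phi : 'cV[R]_(d + 1)) (c : R).
Context {Gt : set (affmap R (d + 1))} {tau : 'M[R]_(d + 1) -> 'cV[R]_(d + 1)}.

Definition translation_part (Gt : set (affmap R (d + 1))) (G : set 'M[R]_(d + 1))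
    (tau : 'M[R]_(d + 1) -> 'cV[R]_(d + 1)) : Prop :=
  [/\ SA_subgroup Gt, forall g, G g -> Gt (g, tau g) &
      forall p, Gt p -> G p.1 /\ p.2 = tau p.1].
Hypothesis HT : translation_part Gt G tau.

Lemma tau_inv g : G g -> tau (invmx g) = - (invmx g *m tau g).
Proof.
move=> Gg; case: HT => -[_ _ _ hinv] h1 h2.
by have [_ ] := h2 _ (hinv _ (h1 _ Gg)).
Qed.

Lemma dot_aff g X y : G g -> closure Os y ->
  dot (aff_act (g, tau g) X) (xi y) = lam g y * dot X (xi (act g y)) + dot (tau g) (xi y).
Proof.
by move=> Gg cy; rewrite /aff_act /= dotDl dot_act// (lam_neq0 HO HG Gg cy).
Qed.

Lemma aff_invK g X : G g ->
  aff_act (g, tau g) (aff_act (invmx g, tau (invmx g)) X) = X.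
Proof.
move=> Gg; have gu := G_unit HG Gg; rewrite /aff_act /= tau_inv// mulmxDr mulmxN.
by rewrite !mulmxA mulmxV// !mul1mx subrK.
Qed.

Lemma ext_equivariant h g y : equivariant (Om := Om) (G := G) tau h -> extends Os h ->
  G g -> closure Os y ->
  extend Os h y = lam g y * extend Os h (act g y) + dot (tau g) (xi y).
Proof.
move=> qh eh Gg cy; have FF := within_nbhs_proper cy.
have aF : act g z @[z --> within Os (nbhs y)] --> within Os (nbhs (act g y)).
  move=> P hP.
  have h1 : nbhs y (act g @^-1` [set z | Os z -> P z]).
    exact: (act_cvg (lam_neq0 HO HG Gg cy) hP).
  apply: (@filterS _ (nbhs y) (nbhs_filter y) _ _ _ h1) => z hz Oz; apply: hz.
  exact: (act_Os HO HG Gg Oz).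
have H1 : lam g z * h (act g z) + dot (tau g) (xi z) @[z --> within Os (nbhs y)] -->
    lam g y * extend Os h (act g y) + dot (tau g) (xi y).
  have wf (f : 'cV[R]_d -> R) : {for y, continuous f} -> f z @[z --> within Os (nbhs y)] --> f y.
    by move=> cf; apply: cvg_within_filter.
  apply: (cvgD (FF := FF)); last first.
    apply: (wf (fun z => dot (tau g) (xi z))).
    by apply: (cvg_dot (FF := nbhs_filter y)); [exact: cvg_cst|exact: xi_continuous].
  apply: (cvgM (FF := FF)); first by apply: wf; exact: lam_continuous.
  exact: (cvg_comp _ h aF (eh _ (act_closure HO HG Gg cy))).
apply: (cvg_unique (F := h z @[z --> within Os (nbhs y)]) (@norm_hausdorff _ R)); first exact: eh.
apply: cvg_trans H1; apply: near_eq_cvg; rewrite near_withinE.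
by apply: nearW => z Oz; exact: (esym (qh g z Gg Oz)).
Qed.

Lemma domain_tau_convex h : equivariant (Om := Om) (G := G) tau h -> extends Os h ->
  tau_convex (cone Om) Gt (domain_of Os h).
Proof.
move=> qh eh; split; first exact: (domain_cone_convex HO eh).
have sub g X : G g -> domain_of Os h X -> domain_of Os h (aff_act (g, tau g) X).
  move=> Gg KX y cy; rewrite dot_aff// (ext_equivariant qh eh Gg cy) ltrD2r.
  rewrite ltr_pM2l; first exact: KX (act_closure HO HG Gg cy).
  exact: (lam_gt0 HO HG Gg cy).
move=> p Gp; have [_ h1 h2] := HT; have [Gg pt] := h2 p Gp.
have -> : p = (p.1, tau p.1) by rewrite -pt; case: (p).
apply/seteqP; split => [_ [X KX <-]|X KX]; first exact: sub.
exists (aff_act (invmx p.1, tau (invmx p.1)) X); last exact: aff_invK.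
by apply: sub => //; exact: (G_inv HG Gg).
Qed.

Section one_domain.
Variable K : set 'cV[R]_(d + 1).
Hypothesis HK : tau_convex (cone Om) Gt K.
Let s := support_fun K.

Lemma K_open : open K. Proof. by case: HK => -[[]]. Qed.

Lemma K_convex : convexV K.
Proof. by case: HK => -[[_ _ /convex_setP h] _ _ _] _ x y a; exact: h. Qed.

Lemma K_nonempty : K !=set0. Proof. by case: HK => -[[]]. Qed.

Lemma K_cone X v : K X -> cone Om v -> K (X + v).
Proof. by move=> KX cv; case: HK => -[_ <- _ _] _; exists X => //; exists v. Qed.

Lemma K_up X (e : R) : K X -> 0 < e -> K (X + e *: up).
Proof. by move=> KX e0; apply: K_cone => //; exists 0, e; split => //; case: HO. Qed.

(** The cone is open, so [P] may be replaced by a nearby point of [K] and the error added to [v]. *)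
Lemma closure_cone P v : closure K P -> cone Om v -> K (P + v).
Proof.
move=> cP cv; have [x [t [Ox t0 vE]]] := cv.
have ov : exists2 e : R, 0 < e & forall w : 'cV[R]_(d + 1), `|v - w| < e -> cone Om w.
  have [e e0 he] := openE_ball (omega_open HO) Ox.
  have [b b0 hb] := bounded_setE (let: And3 _ B _ := HO in B).
  have b1 : 0 < `|x| + 1 by rewrite ltr_wpDl.
  exists (Order.min (t / 2) (e * (t / 2) / (`|x| + 1 + 1))).
    have t2 : 0 < t / 2 by rewrite divr_gt0.
    by rewrite lt_min t2 divr_gt0 ?(mulr_gt0 e0 t2)// addr_gt0.
  move=> w; rewrite lt_min => /andP[]; rewrite (lift1_last w) vE lift1Z mulr1 lift1N lift1D.
  set l := last_coord w; set p := usubmx w => w1 w2.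
  have ln := norm_last (lift1 (t *: x - p) (t - l)); rewrite last_lift in ln.
  have pn := norm_usubmx (lift1 (t *: x - p) (t - l)); rewrite usubmx_lift in pn.
  have l2 : t / 2 < l by have := le_lt_trans ln w1; rewrite ltr_norml => /andP[]; lra.
  have l0 : 0 < l by apply: lt_trans l2; rewrite divr_gt0.
  exists (l^-1 *: p), l; split => //; last first.
    by rewrite lift1Z scalerA mulfV ?gt_eqF// scale1r mulr1.
  apply: he; have -> : x - l^-1 *: p = l^-1 *: ((t *: x - p) - (t - l) *: x).
    by apply/matrixP => i j; rewrite !mxE; field; rewrite gt_eqF.
  rewrite normrZ normfV (gtr0_norm l0) mulrC ltr_pdivrMr//.
  apply: le_lt_trans (ler_normB _ _) _; rewrite normrZ.
  set k := e * (t / 2) / _ in w2; have k1 := le_lt_trans pn w2.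
  have k2 : `|t - l| * `|x| <= k * `|x| by rewrite ler_wpM2r//; exact: le_trans ln (ltW w2).
  have kE : k * (`|x| + 1 + 1) = e * (t / 2) by rewrite /k divfK// gt_eqF// addr_gt0.
  have k0 : 0 < k.
    have t2 : 0 < t / 2 by rewrite divr_gt0.
    by rewrite /k divr_gt0 ?(mulr_gt0 e0 t2)// addr_gt0.
  have k3 : e * (t / 2) < e * l by rewrite ltr_pM2l.
  by lra.
have [e e0 he] := ov; have /closureE_ball /(_ e e0) [X KX PX] := cP.
have -> : P + v = X + (P + v - X) by rewrite addrCA subrr addr0.
apply: K_cone => //; apply: he.
have -> : v - (P + v - X) = X - P by rewrite opprB addrC -addrA opprD [v + _]addrC -addrA addNr addr0 || apply/matrixP => i j; rewrite !mxE; ring.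
by rewrite distrC.
Qed.

Lemma support_contact y : Os y -> exists2 P, boundary K P & forall X, K X ->
  dot X (xi y) < dot P (xi y).
Proof.
move=> Oy; case: (HK) => -[_ _ dir _] _.
have x0 : xi y != 0.
  by apply/eqP => xz; have := dot_up y; rewrite xz dot0r => /eqP; rewrite eq_sym oppr_eq0 oner_eq0.
have [|_ [c [dis [P [hP bP]]]]] := dir (xi y).
  split => //; exists 1; first exact: oner_neq0.
  by apply: (dual_cone_xi HO) => //; exact: ltr01.
have hPc : dot P (xi y) = c by rewrite dotC.
exists P => // X KX; rewrite hPc ltNge; apply/negP; rewrite le_eqVlt => /orP[/eqP cX|cX].
  by have : (hyperplane (xi y) c `&` K) X by [split => //; rewrite /hyperplane /= dotC]; rewrite dis.
(* A point of [K] on the far side of the hyperplane could be moved along [up], within [K], until it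
   meets the hyperplane. *)
have t0 : 0 < dot X (xi y) - c by rewrite subr_gt0.
have KY := K_up KX t0.
have : (hyperplane (xi y) c `&` K) (X + (dot X (xi y) - c) *: up).
  by split => //; rewrite /hyperplane /= dotC dotDl dotZl dot_up; ring.
by rewrite dis.
Qed.

Let S y := [set dot X (xi y) | X in K].

Lemma support_le y c : (forall X, K X -> dot X (xi y) <= c) -> s y <= c.
Proof.
move=> h; apply: sup_le_ub; last by move=> _ [X KX <-]; exact: h.
by have [X KX] := K_nonempty; exists (dot X (xi y)), X.
Qed.

Lemma support_ge y X : Os y -> closure K X -> dot X (xi y) <= s y.
Proof.
move=> Oy cX; have [P _ ltP] := support_contact Oy.
have hs : has_sup (S y).
  split; first by have [X0 KX0] := K_nonempty; exists (dot X0 (xi y)), X0.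
  by exists (dot P (xi y)) => _ [Y KY <-]; exact/ltW/ltP.
have cl : closed [set X | dot X (xi y) <= s y] by apply: closed_le_fun; exact: dot_continuousl.
have sub : K `<=` [set X | dot X (xi y) <= s y].
  move=> Y KY /=; by apply: ub_le_sup; [case: hs|exists Y].
by have := closureS sub cX; rewrite -(closure_id _).1.
Qed.

Lemma support_convex : convexF Os s.
Proof.
move=> y z a Oy Oz /andP[a0 a1]; apply: support_le => X KX.
rewrite xi_conv dotDr !dotZr; apply: lerD; apply: ler_wpM2l; rewrite ?subr_ge0//;
by apply: support_ge => //; exact: subset_closure.
Qed.

Lemma K_aff g X : G g -> K X -> K (aff_act (g, tau g) X).
Proof.
by move=> Gg KX; case: HK => _ h; case: HT => _ h1 _; rewrite -(h _ (h1 _ Gg)); exists X.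
Qed.

Lemma support_equivariant : equivariant (Om := Om) (G := G) tau s.
Proof.
move=> g y Gg Oy; have cy := subset_closure Oy; have Oa := act_Os HO HG Gg Oy.
have l0 := lam_gt0 HO HG Gg cy.
apply/eqP; rewrite eq_le; apply/andP; split.
  apply: support_le => X KX; rewrite -(aff_invK X Gg) dot_aff// lerD2r ler_pM2l//.
  by apply: support_ge => //; apply: subset_closure; exact: (K_aff (G_inv HG Gg)).
rewrite -lerBrDr -ler_pdivlMl//; apply: support_le => X KX.
rewrite ler_pdivlMl// lerBrDr -dot_aff//; apply: support_ge => //.
by apply: subset_closure; exact: K_aff.
Qed.

Lemma support_extends : extends Os s.
Proof. exact: (equivariant_extends HO HG hom support_convex support_equivariant). Qed.

(** Separating a point from [K] gives a direction that may be on the boundary of the dual domain,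
    where the extension is a limit and not a supremum. It is compared with the separating level
    along the segment from 0 to that direction. *)
Lemma support_domain : K = domain_of Os s.
Proof.
have es := support_extends.
have le X y : K X -> closure Os y -> dot X (xi y) <= extend Os s y.
  move=> KX cy; rewrite leNgt; apply/negP => lt.
  have e0 : 0 < (dot X (xi y) - extend Os s y) / 2 by rewrite divr_gt0// subr_gt0.
  have /cvg_withinP /(_ _ e0) [r1 r10 h1] := es y cy.
  have cX : dot X (xi z) @[z --> nbhs y] --> dot X (xi y).
    by apply: (cvg_dot (FF := nbhs_filter y)); [exact: cvg_cst|exact: xi_continuous].
  have /cvg_atP /(_ _ e0) [r2 r20 h2] := cX.
  have /closureE_ball /(_ (Order.min r1 r2)) := cy; rewrite lt_min r10 r20 => /(_ isT) [z Oz].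
  rewrite lt_min => /andP[z1 z2]; have := h1 z Oz z1; have := h2 z z2.
  have := support_ge Oz (subset_closure KX); rewrite !ltr_norml => ? /andP[? ?] /andP[? ?]; lra.
apply/seteqP; split => X KX.
  move=> y cy; have [e e0 he] := openE_ball K_open KX.
  have KY : K (X - (e / 2) *: up).
    apply: he; rewrite opprD opprK addrA subrr add0r normrZ gtr0_norm ?divr_gt0//.
    have u1 : `|up : 'cV[R]_(d + 1)| <= 1 by apply: norm_lift => //; rewrite ?normr0 ?normr1.
    have e20 : 0 < e / 2 by rewrite divr_gt0.
    have := ler_wpM2l (ltW e20) u1; lra.
  by have := le _ y KY cy; rewrite dotBl dotZl dot_up -/(xi y); lra.
have [e e0 he] := domain_gap HO es KX.
pose Y := X - (e / 2) *: up; have e20 : 0 < e / 2 by rewrite divr_gt0.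
have [cY|ncY] := pselect (closure K Y).
  have -> : X = Y + (e / 2) *: up by rewrite subrK.
  by apply: closure_cone => //; exists 0, (e / 2); split => //; case: HO.
exfalso; have [phi [c [hc lt]]] := separation K_nonempty K_convex ncY.
have [X0 KX0] := K_nonempty.
have p0 : phi != 0.
  by apply/eqP => p0; have := hc X0 KX0; move: lt; rewrite p0 !dot0l; lra.
have [v cv|a [y [a0 cy pE]]] := negative_on_cone HO p0 _.
  rewrite leNgt; apply/negP => v0.
  have t0 : 0 < (`|c - dot phi X0| + 1) / dot phi v by rewrite divr_gt0// ltr_wpDl.
  have [x [t [Ox t1 vE]]] := cv.
  have ck k : 0 < k -> cone Om (k *: v).
    by move=> k0; rewrite vE; exists x, (k * t); split; [|exact: mulr_gt0|rewrite scalerA].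
  have := K_cone KX0 (ck _ t0).
  move=> /hc; rewrite dotDr dotZr divfK; last by rewrite gt_eqF.
  by have := ler_norm (c - dot phi X0); lra.
have hy Z : K Z -> dot Z (xi y) < dot Y (xi y).
  move=> /hc; move: lt; rewrite pE !dotZl !(dotC (xi y)) => l1 l2.
  by rewrite -(ltr_pM2l a0); lra.
have Ye : dot Y (xi y) <= extend Os s y - e / 2.
  by have := he y cy; rewrite /Y dotBl dotZl dot_up; lra.
have : extend Os s y <= dot Y (xi y); last by lra.
rewrite leNgt; apply/negP => lt'.
pose k := extend Os s y - dot Y (xi y); have k0 : 0 < k / 2 by rewrite divr_gt0// subr_gt0.
have /cvg_withinP /(_ _ k0) [r r0 hr] := es y cy.
have y1 : 0 < `|y| + 1 by rewrite ltr_wpDl.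
pose B := `|s 0 - dot Y (xi y)| + 1; have B0 : 0 < B by rewrite ltr_wpDl.
pose u := Order.min (2^-1) (Order.min (r / (`|y| + 1) / 2) (k / 2 / B)).
have u0 : 0 < u by rewrite !lt_min invr_gt0 ltr0n !divr_gt0// subr_gt0.
have u1 : u <= 2^-1 by rewrite ge_min lexx.
have u2 : u * (`|y| + 1) <= r / 2.
  rewrite -ler_pdivlMr//; apply: (@le_trans _ _ (r / (`|y| + 1) / 2)).
    by rewrite !ge_min lexx !orbT.
  by rewrite le_eqVlt; apply/orP; left; apply/eqP; field; rewrite gt_eqF.
have u3 : u * B <= k / 2 by rewrite -ler_pdivlMr// !ge_min lexx !orbT.
have Ot : Os ((1 - u) *: y).
  by apply: (closure_dual_scale HO cy); apply/andP; split; lra.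
have d1 : `|y - (1 - u) *: y| < r.
  have -> : y - (1 - u) *: y = u *: y by rewrite scalerBl scale1r opprB addrC subrK.
  rewrite normrZ gtr0_norm//; apply: (@le_lt_trans _ _ (u * (`|y| + 1))).
    by rewrite ler_pM2l// lerDl.
  by apply: le_lt_trans u2 _; rewrite ltr_pdivrMr// ltr_pMr ?ltr1n.
have := hr _ Ot d1; rewrite ltr_norml => /andP[_ h1].
have h2 : s ((1 - u) *: y) <= (1 - u) * dot Y (xi y) + u * s 0.
  apply: support_le => Z KZ.
  have -> : (1 - u) *: y = (1 - u) *: y + (1 - (1 - u)) *: 0 by rewrite scaler0 addr0.
  have -> : u * s 0 = (1 - (1 - u)) * s 0 by ring.
  rewrite xi_conv dotDr !dotZr; apply: lerD; apply: ler_wpM2l; [lra|exact/ltW/hy|lra|].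
  by apply: support_ge => //; exact: subset_closure.
have h3 : u * (s 0 - dot Y (xi y)) <= u * B.
  rewrite ler_pM2l//; apply: le_trans (ler_norm _) _; rewrite lerDl//.
have kE : k = extend Os s y - dot Y (xi y) by [].
have h4 : u * (s 0 - dot Y (xi y)) <= k / 2 := le_trans h3 u3.
by move: h1 h2 h4; rewrite -/s; lra.
Qed.

End one_domain.

End support.

(** * Almost everywhere uniqueness of maximizers *)

Section borel_null.
Context {R : realType} {n : nat} (n0 : (0 < n)%N).
Implicit Types (A B : set 'cV[R]_n).

Lemma borel_bigcup (F : nat -> set 'cV[R]_n) : (forall k, borel_set (F k)) ->
  borel_set (\bigcup_k F k).
Proof. exact: (@bigcupT_measurable _ (borel R n)). Qed.

Lemma borelI A B : borel_set A -> borel_set B -> borel_set (A `&` B).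
Proof. exact: (@measurableI _ (borel R n)). Qed.

Lemma borelU A B : borel_set A -> borel_set B -> borel_set (A `|` B).
Proof. exact: (@measurableU _ (borel R n)). Qed.

Lemma borelD A B : borel_set A -> borel_set B -> borel_set (A `\` B).
Proof. exact: (@measurableD _ (borel R n)). Qed.

Lemma borelC A : borel_set A -> borel_set (~` A).
Proof. exact: (@measurableC _ (borel R n)). Qed.

Lemma borel0 : borel_set (@set0 'cV[R]_n).
Proof. exact: (@measurable0 _ (borel R n)). Qed.

Lemma vol0_sub A B : A `<=` B -> vol B = 0%E -> vol A = 0%E.
Proof. by move=> AB B0; apply/eqP; rewrite eq_le vol_ge0 andbT -B0; exact: le_vol. Qed.

Lemma vol0_bigcup (F : nat -> set 'cV[R]_n) : (forall k, vol (F k) = 0%E) ->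
  vol (\bigcup_k F k) = 0%E.
Proof.
move=> h; apply/eqP; rewrite eq_le vol_ge0 andbT.
apply: le_trans (vol_sigma_subadditive F) _.
by rewrite eseries0// => k _ _; rewrite h.
Qed.

Lemma vol0_disjoint_translates A e : borel_set A ->
  (forall x a b, A (x + a *: e) -> A (x + b *: e) -> a = b) -> vol A = 0%E.
Proof.
move=> mA inj; have -> : A = \bigcup_k (A `&` cube k%:R).
  by rewrite -setI_bigcupr cube_cover setIT.
apply: vol0_bigcup => k; apply: (@vol0_translates _ _ n0 _ e).
- exact: borelI (cube_borel _).
- by apply: (@bounded_setP _ _ _ k%:R) => x [_ /cubeE]; apply.
- by move=> x a b [h1 _] [h2 _]; exact: inj h1 h2.
Qed.

Definition rat_seq (j : nat) : R := ratr (odflt 0 (unpickle j : option rat)).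

Lemma rat_seq_between (a b : R) : a < b -> exists j, a < rat_seq j < b.
Proof.
move=> /rat_in_itvoo [q]; rewrite in_itv /= => h.
by exists (pickle q); rewrite /rat_seq pickleK.
Qed.

End borel_null.

Section argmax.
Context {R : realType} {n d : nat} (n0 : (0 < n)%N).
Variables (Y : set 'cV[R]_d) (al : 'cV[R]_d -> 'cV[R]_n) (be : 'cV[R]_d -> R).
Variable Yk : nat -> set 'cV[R]_d.
Hypothesis Ykc : forall k, compact (Yk k).
Hypothesis YkE : \bigcup_k Yk k = Y.
Hypothesis cal : {within Y, continuous al}.
Hypothesis cbe : {within Y, continuous be}.
Implicit Types (X e : 'cV[R]_n) (y z : 'cV[R]_d) (b c : set 'cV[R]_d).

(** Maximizers of a family affine in [X] are used twice: with [cal] and [cbe] on the open dual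
    domain, and with the identity and minus the extended support function on its closure. *)
Definition aval X y := dot X (al y) + be y.

Definition amax X : set 'cV[R]_d := [set y | Y y /\ forall z, Y z -> aval X z <= aval X y].

(** Where a maximizer exists, this says that none is in [c]. Phrased with a single competitor it is
    an open condition for compact [c], and the measurability and semicontinuity of maximizers rest
    on it. *)
Definition beaten c : set 'cV[R]_n :=
  [set X | exists2 y0, Y y0 & forall y, c y -> aval X y < aval X y0].

Lemma aval_within c X : c `<=` Y -> {within c, continuous (aval X)}.
Proof.
move=> cY; apply/subspace_continuousP => y cy.
have /subspace_continuousP h1 := continuous_subspaceW cY cal.
have /subspace_continuousP h2 := continuous_subspaceW cY cbe.
have FF := within_filter c (nbhs_filter y).
by apply: (cvgD (FF := FF)); [apply: (cvg_dot (FF := FF)); [exact: cvg_cst|exact: h1]|exact: h2].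
Qed.

Lemma beaten_open c : compact c -> c `<=` Y -> open (beaten c).
Proof.
move=> cc cY; apply: open_ballE => X [y0 Yy0 hX].
have [e e0 he] : exists2 e : R, 0 < e & forall y, c y -> aval X y + e <= aval X y0.
  have [c0|nc] := pselect (c !=set0); last first.
    by exists 1 => // y cy; exfalso; apply: nc; exists y.
  have [z + mx] := compact_EVT_max c0 cc (aval_within (X := X) cY).
  rewrite inE => cz; exists (aval X y0 - aval X z); first by rewrite subr_gt0 hX.
  by move=> y cy; have := mx y (mem_set cy); lra.
have [B B0 hB] := compact_boundedE (continuous_compact (continuous_subspaceW cY cal) cc).
pose L := n%:R * (B + `|al y0|); have L0 : 0 < L.
  by rewrite mulr_gt0 ?ltr0n// ltr_pwDl.
exists (e / L); first exact: divr_gt0.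
move=> X' XX'; exists y0 => // y cy.
have h1 : dot (X' - X) (al y) - dot (X' - X) (al y0) < e.
  apply: (@le_lt_trans _ _ (L * `|X' - X|)); last by rewrite mulrC -ltr_pdivlMr// distrC.
  apply: le_trans (ler_norm _) _; apply: le_trans (ler_normB _ _) _.
  have -> : L * `|X' - X| = n%:R * `|X' - X| * B + n%:R * `|X' - X| * `|al y0| by rewrite /L; ring.
  apply: lerD; apply: le_trans (dot_le _ _) _ => //.
  by apply: ler_wpM2l; [exact: mulr_ge0|apply: hB; exists y].
have := he y cy; rewrite /aval; move: h1; rewrite !dotBl; lra.
Qed.

Lemma amaxN_beaten c X : c `<=` Y -> amax X !=set0 ->
  (forall y, c y -> ~ amax X y) <-> beaten c X.
Proof.
move=> cY [y0 [Yy0 m0]]; split => [h|[y1 Yy1 h] y cy [_ m]]; last first.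
  by have := m y1 Yy1; rewrite leNgt h.
exists y0 => // y cy; rewrite ltNge; apply/negP => le; apply: (h y cy); split; first exact: cY.
by move=> z Yz; exact: le_trans (m0 z Yz) le.
Qed.

Variable Dom : set 'cV[R]_n.
Hypothesis mDom : borel_set Dom.
Hypothesis Dmax : forall X, Dom X -> amax X !=set0.
(* Translating X along e breaks the tie between maximizers on different sides
   of the level a; hence almost every X has at most one maximizer. *)
Hypothesis prefer : forall (i : 'I_d) (a : R), exists e (k : R), forall y, Y y ->
  (y i 0 < a -> dot e (al y) < k) /\ (a < y i 0 -> k < dot e (al y)).

Definition uniq_max X := forall y z, amax X y -> amax X z -> y = z.

Let lo k (i : 'I_d) (a : R) := Yk k `&` [set y | y i 0 <= a].
Let hi k (i : 'I_d) (a : R) := Yk k `&` [set y | - y i 0 <= - a].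

Let clo i a : closed [set y : 'cV[R]_d | y i 0 <= a].
Proof. by apply: closed_le_fun; exact: coord_continuous. Qed.

Let chi i a : closed [set y : 'cV[R]_d | - y i 0 <= - a].
Proof.
apply: (@closed_le_fun _ _ (fun y : 'cV[R]_d => - y i 0)) => y.
by apply: (cvgN (FF := nbhs_filter y)); exact: coord_continuous.
Qed.

Let YkY k : Yk k `<=` Y. Proof. by rewrite -YkE => y h; exists k. Qed.

Let beaten_borel k C : closed C -> borel_set (beaten (Yk k `&` C)).
Proof.
move=> cC; apply: open_borel; apply: beaten_open; last by move=> y [/YkY].
exact: compact_closedI.
Qed.

Definition nonuniq : set 'cV[R]_n := Dom `\` uniq_max.

(** Two maximizers separated in the i-th coordinate by the rationals of index j and l. Indices that
    code no coordinate, or rationals in the wrong order, give the empty set, so that unions can run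
    over all natural numbers. *)
Let Z k k' (i j l : nat) : set 'cV[R]_n :=
  if insub i is Some i' then
    if rat_seq j < rat_seq l :> R then
      (Dom `\` beaten (lo k i' (rat_seq j))) `\` beaten (hi k' i' (rat_seq l))
    else set0
  else set0.

Let ZP k k' i (a a' : R) X :
  ((Dom `\` beaten (lo k i a)) `\` beaten (hi k' i a')) X ->
  exists y z, [/\ amax X y, amax X z, y i 0 <= a & a' <= z i 0].
Proof.
move=> [[DX h1] h2].
have [y [[Yy yj] my]] : exists y, lo k i a y /\ amax X y.
  apply: contrapT => h; apply: h1; apply/(amaxN_beaten _ (Dmax DX)); first by move=> y [/YkY].
  by move=> y ly my; apply: h; exists y.
have [z [[Yz zl] mz]] : exists z, hi k' i a' z /\ amax X z.
  apply: contrapT => h; apply: h2; apply/(amaxN_beaten _ (Dmax DX)); first by move=> y' [/YkY].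
  by move=> z lz mz; apply: h; exists z.
by exists y, z; split => //; move: zl; rewrite /= lerN2.
Qed.

Let Z_borel k k' i j l : borel_set (Z k k' i j l).
Proof.
rewrite /Z; case: insubP => [i' _ _|_]; last exact: borel0.
case: ifP => _; last exact: borel0.
have h1 := beaten_borel k' (@chi i' (rat_seq l)).
have h2 := beaten_borel k (@clo i' (rat_seq j)).
by apply: borelD h1; apply: borelD h2.
Qed.

Let nonuniqE : nonuniq = \bigcup_k \bigcup_k' \bigcup_i \bigcup_j \bigcup_l Z k k' i j l.
Proof.
apply/seteqP; split => [X [DX nu]|X [k _ [k' _ [i _ [j _ [l _]]]]]]; last first.
  rewrite /Z; case: insubP => // i' _ _; case: ifP => // jl h; split; first by case: h => -[].
  move=> uX; have [y [z [my mz yj zl]]] := ZP h.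
  by have := le_trans zl (le_trans _ yj); rewrite (uX z y mz my) lexx leNgt jl => /(_ isT).
have [y [z [my mz yz]]] : exists y z, [/\ amax X y, amax X z & y <> z].
  apply: contrapT => h; apply: nu => y z my mz; apply: contrapT => yz.
  by apply: h; exists y, z.
have [y' [z' [i [my' mz' lt]]]] : exists y z (i : 'I_d), [/\ amax X y, amax X z & y i 0 < z i 0].
  have [i yzi] : exists i : 'I_d, y i 0 <> z i 0.
    apply: contrapT => h; apply: yz; apply/matrixP => i j; rewrite ord1.
    by apply: contrapT => h'; apply: h; exists i.
  have [lt|gt|//] := ltgtP (y i 0) (z i 0); first by exists y, z, i.
  by exists z, y, i.
have [l /andP[l1 l2]] := rat_seq_between lt.
have [j /andP[j1 j2]] := rat_seq_between l1.
have [ky _ Yky] : (\bigcup_k Yk k) y' by rewrite YkE; case: my'.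
have [kz _ Ykz] : (\bigcup_k Yk k) z' by rewrite YkE; case: mz'.
exists ky => //; exists kz => //; exists (val i) => //; exists j => //; exists l => //.
rewrite /Z valK j2; split; first split => //.
  move=> /(amaxN_beaten _ (Dmax DX)) h.
  by apply: (h _ y') => //; [move=> w [/YkY]|split => //; exact: ltW].
move=> /(amaxN_beaten _ (Dmax DX)) h.
by apply: (h _ z') => //; [move=> w [/YkY]|split => //=; rewrite lerN2; exact: ltW].
Qed.

Lemma nonuniq_borel : borel_set nonuniq.
Proof. by rewrite nonuniqE; do 5 (apply: borel_bigcup => ?); exact: Z_borel. Qed.

Lemma nonuniq_null : vol nonuniq = 0%E.
Proof.
rewrite nonuniqE; apply: vol0_bigcup => // k; apply: vol0_bigcup => // k'.
apply: vol0_bigcup => // i; apply: vol0_bigcup => // j; apply: vol0_bigcup => // l.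
have mZ := Z_borel k k' i j l; move: mZ; rewrite /Z.
case: insubP => [i' _ _|_]; last by rewrite vol_set0.
case: ifP => jl mZ; last by rewrite vol_set0.
pose a : R := (rat_seq j + rat_seq l) / 2.
have [e [p hp]] := prefer i' a.
apply: (vol0_disjoint_translates n0 (e := e) mZ).
(* With s < t, a maximizer above [a] at X + s e gains strictly more from the move to X + t e than a
   maximizer below [a] at X + t e, so the latter could not be maximal: a line in direction [e] meets
   the set at most once. *)
suff lt X s t : s < t -> ((Dom `\` beaten (lo k i' (rat_seq j))) `\` beaten (hi k' i' (rat_seq l))) (X + s *: e) ->
    ~ ((Dom `\` beaten (lo k i' (rat_seq j))) `\` beaten (hi k' i' (rat_seq l))) (X + t *: e).
  move=> X s t hs ht; have [/lt h|/lt h|//] := ltgtP s t.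
    by have := h _ hs ht.
  by have := h _ ht hs.
move=> st /ZP [y [z [_ [Yz mz] _ lz]]] /ZP [w [w' [[Yw mw] _ wj _]]].
have wa : w i' 0 < a by apply: le_lt_trans wj _; rewrite /a; lra.
have za : a < z i' 0 by apply: lt_le_trans lz; rewrite /a; lra.
have [h1 _] := hp w Yw; have [_ h2] := hp z Yz.
have h3 := mz w Yw; have h4 := mw z Yz.
have t0 : 0 < t - s by rewrite subr_gt0.
have h5 : (t - s) * dot e (al w) < (t - s) * dot e (al z).
  by rewrite ltr_pM2l//; exact: lt_trans (h1 wa) (h2 za).
by move: h3 h4; rewrite /aval !dotDl !dotZl; lra.
Qed.

Definition pick_max X := xget 0 (amax X).

Lemma pick_maxE X y : uniq_max X -> amax X y -> pick_max X = y.
Proof.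
by move=> uX my; apply: uX => //; rewrite /pick_max; case: xgetP => // h; have := h y.
Qed.

Lemma pick_amax X : Dom X -> amax X (pick_max X).
Proof. by move=> /Dmax [y my]; rewrite /pick_max; case: xgetP => // h; have := h y. Qed.

(** For closed [b] the set is a countable union of complements of [beaten] sets, up to the
    nonuniqueness set. The other Borel sets follow by unions and complements, where uniqueness lets
    one test any maximizer instead of the chosen one. *)
Lemma pick_borel b : borel_set b ->
  borel_set [set X | [/\ Dom X, uniq_max X & b (pick_max X)]].
Proof.
pose P (b : set 'cV[R]_d) : set 'cV[R]_n := [set X | [/\ Dom X, uniq_max X & b (pick_max X)]].
have PC c : P (~` c) = (Dom `\` nonuniq) `\` P c.
  apply/seteqP; split => X.
    by move=> [DX uX nc]; split; [split => //; case|case].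
  move=> [[DX nu] nP]; have uX : uniq_max X by apply: contrapT => h; apply: nu.
  by split => // cX; apply: nP.
have mU : borel_set (Dom `\` nonuniq) by apply: borelD => //; exact: nonuniq_borel.
have Pcl c : closed c -> borel_set (P c).
  move=> cc; have -> : P c = (Dom `\` nonuniq) `&` \bigcup_k (~` beaten (Yk k `&` c)).
    apply/seteqP; split => X.
      move=> [DX uX cX]; split; first by split => //; case.
      have mX := pick_amax DX.
      have [k _ Ykx] : (\bigcup_k Yk k) (pick_max X) by rewrite YkE; case: mX.
      exists k => //= /(amaxN_beaten _ (Dmax DX)) h.
      by apply: (h _ (pick_max X)) => //; move=> w [/YkY].
    move=> [[DX nu] [k _ nb]]; have uX : uniq_max X by apply: contrapT => h; apply: nu.
    split => //; apply: contrapT => nc; apply: nb.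
    apply/(amaxN_beaten _ (Dmax DX)); first by move=> w [/YkY].
    by move=> y [_ cy] my; apply: nc; rewrite (pick_maxE uX my).
  apply: borelI => //; apply: borel_bigcup => k; apply: borelC; exact: beaten_borel.
pose S : set (set 'cV[R]_d) := [set b | borel_set (P b)].
have sS : sigma_algebra setT S.
  split => [|c mc|F mF].
  - rewrite /S /=; have -> : P set0 = set0 by apply/seteqP; split => X // -[].
    exact: borel0.
  - by rewrite /S /= setTD PC; exact: borelD.
  - rewrite /S /=; have -> : P (\bigcup_k F k) = \bigcup_k P (F k).
      apply/seteqP; split => X; first by move=> [DX uX [k _ h]]; exists k.
      by move=> [k _ [DX uX h]]; split => //; exists k.
    exact: borel_bigcup.
move=> mb; apply: (smallest_sub sS _ mb) => c oc; rewrite /S /=.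
by rewrite -(setCK c) PC; apply: borelD => //; apply: Pcl; exact: open_closedC.
Qed.

End argmax.

(** * Contact directions *)

Lemma sublevel_compact {R : realType} {n : nat} (A : set 'cV[R]_n) (f : 'cV[R]_n -> R) (c : R) :
  compact A -> {within A, continuous f} -> compact [set y | A y /\ f y <= c].
Proof.
move=> cA cf; apply: (subclosed_compact _ cA); last by move=> y [].
move=> y cly; have Ay : A y.
  have clA : closed A := compact_closed (@norm_hausdorff _ _) cA.
  by rewrite ((closure_id A).1 clA); apply: closureS cly => z [].
split => //; rewrite leNgt; apply/negP => lt.
have e0 : 0 < f y - c by rewrite subr_gt0.
move/subspace_continuousP: cf => /(_ y Ay) /cvg_withinP /(_ _ e0) [r r0 hr].
have /closureE_ball /(_ r r0) [z [Az fz] yz] := cly.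
have : `|f y - f z| < f y - c := hr z Az yz.
by rewrite ltr_norml => /andP[_]; lra.
Qed.

Section contact.
Context {R : realType} {d : nat} {Om : set 'cV[R]_d}.
Hypothesis HO : pointed_domain Om.
Let Os := dual_domain Om.
Context {om : 'cV[R]_d -> R}.
Hypothesis hom : cheng_yau Os om.
Let oOs : open Os := dual_open HO.
Let cOs : convexV Os := @dual_convex R d Om.
Let O0 : Os 0 := @dual_domain0 R d Om.
Implicit Types (y z q w : 'cV[R]_d) (X Y P v : 'cV[R]_(d + 1)) (c : R).

Definition osk (k : nat) : set 'cV[R]_d := [set y | Os y /\ om y <= - k.+1%:R^-1].

Lemma osk_compact k : compact (osk k).
Proof.
by apply: (om_sublevel_compact hom (dual_closure_compact HO)); rewrite invr_gt0.
Qed.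

Lemma oskE : \bigcup_k osk k = Os.
Proof.
apply/seteqP; split => [y [k _ []]//|y Oy].
have o0 : 0 < - om y by rewrite oppr_gt0 (om_lt0 hom Oy).
have [k hk] : exists k : nat, k.+1%:R^-1 < - om y.
  exists (Num.bound (- om y)^-1).
  rewrite -[X in _ < X]invrK ltf_pV2 ?posrE ?invr_gt0//.
  apply: (lt_trans (archi_boundP _)); first by rewrite invr_ge0 ltW.
  by rewrite ltr_nat.
by exists k => //; split => //; rewrite lerNr ltW.
Qed.

Lemma om_boundary0 y : closure Os y -> ~ Os y -> om y = 0.
Proof. by move=> cy nO; case: hom => _ _ _ [_ ->//]; split => // /interior_subset. Qed.

Variable s : 'cV[R]_d -> R.
Hypothesis cs : forall y, Os y -> {for y, continuous s}.
Hypothesis es : extends Os s.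
Let H := extend Os s.

(* [dot X (cal y) + cbe y = (dot X (xi y) - s y) / - om y]; if it is maximal at
   y with value -t < 0, then X = P + t N(y) where P is a boundary point of K at
   which y is the direction of a supporting hyperplane. *)
Definition cal y : 'cV[R]_(d + 1) := (- om y)^-1 *: xi y.
Definition cbe y : R := s y / om y.

Local Notation cval := (aval cal cbe).
Local Notation cmax := (amax Os cal cbe).

Lemma cvalE X y : Os y -> cval X y = (dot X (xi y) - s y) / (- om y).
Proof.
move=> Oy; have o0 : om y != 0 by rewrite lt_eqF// (om_lt0 hom Oy).
by rewrite /aval /cal /cbe dotZr; field.
Qed.

Lemma cval_lt X y c : Os y -> (cval X y < c) = (dot X (xi y) < s y - c * om y).
Proof.
move=> Oy; have o0 : 0 < - om y by rewrite oppr_gt0 (om_lt0 hom Oy).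
by rewrite cvalE// ltr_pdivrMr// ltrBlDl mulrN.
Qed.

Lemma cval_le X y c : Os y -> (cval X y <= c) = (dot X (xi y) <= s y - c * om y).
Proof.
move=> Oy; have o0 : 0 < - om y by rewrite oppr_gt0 (om_lt0 hom Oy).
by rewrite cvalE// ler_pdivrMr// lerBlDl mulrN.
Qed.

Lemma cval_eq X y : Os y -> dot X (xi y) = s y - cval X y * om y.
Proof.
move=> Oy; have o0 : om y != 0 by rewrite lt_eqF// (om_lt0 hom Oy).
by rewrite cvalE//; field.
Qed.

Lemma cal_within : {within Os, continuous cal}.
Proof.
apply/subspace_continuousP => y Oy; apply: cvg_within_filter.
have o0 : - om y != 0 by rewrite oppr_eq0 lt_eqF// (om_lt0 hom Oy).
apply: (cvgZ (FF := nbhs_filter y)); last exact: xi_continuous.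
apply: cvgV => //; apply: (cvgN (FF := nbhs_filter y)); exact: (om_continuous hom Oy).
Qed.

Lemma cbe_within : {within Os, continuous cbe}.
Proof.
apply/subspace_continuousP => y Oy; apply: cvg_within_filter.
have o0 : om y != 0 by rewrite lt_eqF// (om_lt0 hom Oy).
apply: (cvgM (FF := nbhs_filter y)); first exact: cs.
by apply: cvgV => //; exact: (om_continuous hom Oy).
Qed.

Lemma cal_prefer (i : 'I_d) (a : R) : exists e (k : R), forall y, Os y ->
  (y i 0 < a -> dot e (cal y) < k) /\ (a < y i 0 -> k < dot e (cal y)).
Proof.
exists (lift1 (basis_vec R i) a), 0 => y Oy.
have o0 : 0 < (- om y)^-1 by rewrite invr_gt0 oppr_gt0 (om_lt0 hom Oy).
rewrite /cal dotZr dot_xi dotC dot_basis; split => h.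
  by rewrite pmulr_rlt0// subr_lt0.
by rewrite pmulr_rgt0// subr_gt0.
Qed.

(* This is the largest tau-convex domain when s is the support function of one of them. *)
Definition outer_domain : set 'cV[R]_(d + 1) :=
  [set X | forall y, closure Os y -> ~ Os y -> dot X (xi y) < H y].

Lemma boundary_compact : compact (closure Os `\` Os).
Proof.
apply: (subclosed_compact _ (dual_closure_compact HO)); last by move=> y [].
by rewrite setDE; apply: closedI; [exact: closed_closure|exact: open_closedC].
Qed.

Lemma boundary_gap P : outer_domain P -> exists2 e : R, 0 < e &
  forall y, closure Os y -> ~ Os y -> dot P (xi y) + e <= H y.
Proof.
move=> DP; have [ne|ne] := pselect ((closure Os `\` Os) !=set0); last first.
  by exists 1 => // y cy nO; exfalso; apply: ne; exists y.
have sub : closure Os `\` Os `<=` closure Os by move=> y [].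
have cg := continuous_subspaceW sub (gap_within es (X := P)).
have [y0 + mn] := compact_EVT_min ne boundary_compact cg.
rewrite inE => -[cy0 nO]; exists (H y0 - dot P (xi y0)); first by rewrite subr_gt0; exact: DP.
by move=> y cy ny; have := mn y (mem_set (conj cy ny)); rewrite -/H; lra.
Qed.

Lemma dot_near P (e : R) : 0 < e -> exists2 r : R, 0 < r &
  forall X y, `|X - P| < r -> closure Os y -> `|dot X (xi y) - dot P (xi y)| < e.
Proof.
move=> e0; have [b b0 hb] := xi_bound HO.
have D0 : 0 < (d + 1)%:R * b :> R by rewrite mulr_gt0// ltr0n addn1.
exists (e / ((d + 1)%:R * b)); first exact: divr_gt0.
move=> X y XP cy; rewrite -dotBl; apply: le_lt_trans (dot_le _ _) _.
apply: (@le_lt_trans _ _ ((d + 1)%:R * `|X - P| * b)); first by rewrite ler_wpM2l ?mulr_ge0// hb.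
by rewrite mulrAC mulrC -ltr_pdivlMr.
Qed.

(** Towards the boundary of the dual domain [om] tends to 0 while X . xi - s stays below a negative
    constant, so the quotient is very negative there: maximizers of all points near [P] lie in one
    compact set. *)
Lemma cmax_near P : outer_domain P -> exists Q, [/\ compact Q, Q `<=` Os &
  exists2 r : R, 0 < r & forall X, `|X - P| < r -> cmax X !=set0 /\ cmax X `<=` Q].
Proof.
move=> DP; have [e e0 he] := boundary_gap DP.
(* A level that the direction 0 reaches for all [X] near [P]: the margin 1 in the quotient is a
   margin - om(0) in the pairing, which determines [r2]. *)
pose k := cval P 0 - 1.
pose Q := [set y | closure Os y /\ - (dot P (xi y) - H y + k * om y) <= e / 2].
have QO : Q `<=` Os.
  move=> y [cy h]; apply: contrapT => nO; have := he y cy nO.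
  by move: h; rewrite om_boundary0//; lra.
have com : {within closure Os, continuous om} by case: hom => _ _ _ [].
have cQ : compact Q.
  apply: (sublevel_compact (f := fun y => - (dot P (xi y) - H y + k * om y))).
    exact: (dual_closure_compact HO).
  apply/subspace_continuousP => y cy; have FF := within_filter (closure Os) (nbhs_filter y).
  apply: (cvgN (FF := FF)); apply: (cvgD (FF := FF)).
    apply: (cvgB (FF := FF)); last exact: extends_continuous.
    apply: cvg_within_filter.
    exact: (cvg_dot (FF := nbhs_filter y) (cvg_cst P) (@xi_continuous _ _ y)).
  apply: (cvgM (FF := FF)); first exact: cvg_cst.
  by move/subspace_continuousP: com; apply.
exists Q; split => //.
have e20 : 0 < e / 2 by rewrite divr_gt0.
have [r1 r10 h1] := dot_near P e20.
have o0 : 0 < - om 0 by rewrite oppr_gt0 (om_lt0 hom O0).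
have [r2 r20 h2] := dot_near P o0.
exists (Order.min r1 r2); first by rewrite lt_min r10.
move=> X; rewrite lt_min => /andP[X1 X2].
have k0 : k <= cval X 0.
  rewrite leNgt cval_lt// /k; apply/negP => lt.
  have := h2 X 0 X2 (subset_closure O0); rewrite ltr_norml => /andP[+ _].
  have := cval_eq P O0; lra.
have big y : Os y -> k <= cval X y -> Q y.
  move=> Oy; rewrite leNgt cval_lt// -leNgt => ky; split; first exact: subset_closure.
  rewrite /H extend_in//; have := h1 X y X1 (subset_closure Oy).
  by rewrite ltr_norml => /andP[_]; lra.
have Q0 := big 0 O0 k0.
have cv := aval_within (continuous_subspaceW (fun _ h => h) cal_within) cbe_within (X := X) QO.
have [y0 + mx] := compact_EVT_max (ex_intro _ 0 Q0) cQ cv.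
rewrite inE => Qy0; have m0 : cval X 0 <= cval X y0 by apply: mx; rewrite inE.
split.
  exists y0; split; first exact: QO.
  move=> z Oz; have [kz|zk] := leP k (cval X z); first by apply: mx; rewrite inE; exact: big.
  by apply: ltW; apply: lt_le_trans zk _; exact: le_trans k0 m0.
move=> y [Oy my]; apply: big => //; exact: le_trans k0 (my 0 O0).
Qed.

Lemma cmax_nonempty P : outer_domain P -> cmax P !=set0.
Proof.
move=> /cmax_near [Q [_ _ [r r0 h]]]; have [] // := h P _.
by rewrite subrr normr0.
Qed.

(** Upper semicontinuity of the set of maximizers, from the openness of [beaten]. *)
Lemma cmax_close P (W : set 'cV[R]_d) : outer_domain P -> open W -> cmax P `<=` W ->
  exists2 r : R, 0 < r & forall X, `|X - P| < r -> cmax X !=set0 /\ cmax X `<=` W.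
Proof.
move=> DP oW PW; have [Q [cQ QO [r r0 hr]]] := cmax_near DP.
have cC : compact (Q `&` ~` W) by apply: compact_closedI => //; exact: open_closedC.
have CO : Q `&` ~` W `<=` Os by move=> y [/QO].
have d0 : (0 < d + 1)%N by rewrite addn1.
have oB := beaten_open d0 cal_within cbe_within cC CO.
have : beaten Os cal cbe (Q `&` ~` W) P.
  apply/(amaxN_beaten CO (cmax_nonempty DP)) => y [_ nW] /PW; exact: nW.
move=> /(openE_ball oB) [r1 r10 h1].
exists (Order.min r r1); first by rewrite lt_min r0.
move=> X; rewrite lt_min => /andP[Xr Xr1]; have [ne XQ] := hr X Xr.
split => // y my; apply: contrapT => nW.
have /(amaxN_beaten CO ne) h : beaten Os cal cbe (Q `&` ~` W) X by apply: h1; rewrite distrC.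
by apply: (h y) => //; split => //; exact: XQ.
Qed.

(** If the maximum m is negative then s - m om is strictly convex, and the affine function X . xi,
    which lies below it, can touch it only once. *)
Lemma cmax_unique X y z : convexF Os s -> cmax X y -> cmax X z -> cval X y < 0 -> y = z.
Proof.
move=> cvs [Oy my] [Oz mz] lt; apply/eqP; apply: contraPT lt => yz; apply/negP; rewrite -leNgt.
have e : cval X z = cval X y by apply/eqP; rewrite eq_le my//= mz.
set m := cval X y in e *; rewrite leNgt; apply/negP => m0.
have Omid : Os (2^-1 *: (y + z)).
  have -> : 2^-1 *: (y + z) = 2^-1 *: y + (1 - 2^-1) *: z.
    by apply/matrixP => i j; rewrite !mxE; field.
  by apply: cOs => //; apply/andP; split; lra.
have h1 := om_midpoint oOs hom Oy Oz; rewrite eq_sym yz in h1.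
have {}h1 := h1 isT Omid.
have h2 := my _ Omid; rewrite -/m cval_le// in h2.
have h3 := cvs y z 2^-1 Oy Oz ltac:(apply/andP; split; lra).
have eE : 2^-1 *: y + (1 - 2^-1) *: z = 2^-1 *: (y + z).
  by apply/matrixP => i j; rewrite !mxE; field.
rewrite eE in h3.
have h4 := cval_eq X Oy; have h5 := cval_eq X Oz; rewrite e -/m in h4 h5.
have h6 : dot X (xi (2^-1 *: (y + z))) = 2^-1 * dot X (xi y) + (1 - 2^-1) * dot X (xi z).
  by rewrite -eE xi_conv dotDr !dotZr.
rewrite h6 in h2.
have h7 : m * (2^-1 * (om y + om z)) < m * om (2^-1 *: (y + z)) by rewrite ltr_nM2l.
by lra.
Qed.

Section perturbed.
Variables (k : 'cV[R]_d -> R) (U : R).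
Hypothesis ck : forall y, Os y -> {for y, continuous k}.
Hypothesis kU : forall y, Os y -> `|k y| <= U * `|om y|.

Lemma perturb_extends : extends Os (fun y => s y + k y).
Proof. by have [] := extends_perturb es ck (dominated_boundary hom kU). Qed.

Lemma perturb_ext y : closure Os y ->
  extend Os (fun y => s y + k y) y = H y + (if pselect (Os y) then k y else 0).
Proof. by have [_] := extends_perturb es ck (dominated_boundary hom kU); exact. Qed.

Lemma perturb_domain X : domain_of Os (fun y => s y + k y) X <->
  outer_domain X /\ forall y, Os y -> dot X (xi y) < s y + k y.
Proof.
split => [h|[h1 h2] y cy].
  split => [y cy nO|y Oy].
    by have := h y cy; rewrite perturb_ext//; case: (pselect (Os y)) => [//|?]; rewrite addr0.
  by have := h y (subset_closure Oy); rewrite extend_in.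
rewrite -/(xi y) perturb_ext//; case: (pselect (Os y)) => [Oy|nO]; last by rewrite addr0; exact: h1.
by rewrite /H extend_in//; exact: h2.
Qed.

Lemma perturb_domain_ge X y : outer_domain X -> cmax X y ->
  ~ domain_of Os (fun y => s y + k y) X -> - U <= cval X y.
Proof.
move=> DX [Oy my] nK; rewrite leNgt; apply/negP => lt; apply: nK; apply/perturb_domain.
split => // z Oz; have := le_lt_trans (my z Oz) lt; rewrite cval_lt// => h.
apply: lt_le_trans h _; rewrite lerD2l; have := kU Oz.
rewrite (ltr0_norm (om_lt0 hom Oz)) mulrN mulNr opprK ler_norml => /andP[+ _].
by rewrite opprK.
Qed.

End perturbed.

End contact.

Arguments cal {R d} om y.
Arguments cbe {R d} om s y.

Section contact_equivariance.
Context {R : realType} {d : nat} {Om : set 'cV[R]_d} {G : set 'M[R]_(d + 1)}.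
Hypothesis (HO : pointed_domain Om) (HG : dividing_group G Om).
Let Os := dual_domain Om.
Context {om : 'cV[R]_d -> R}.
Hypothesis hom : cheng_yau Os om.
Context {Gt : set (affmap R (d + 1))} {tau : 'M[R]_(d + 1) -> 'cV[R]_(d + 1)}.
Hypothesis HT : translation_part Gt G tau.
Variable s : 'cV[R]_d -> R.
Hypothesis qs : equivariant (Om := Om) (G := G) tau s.

Lemma cval_act g X y : G g -> Os y ->
  aval (cal om) (cbe om s) (aff_act (g, tau g) X) y = aval (cal om) (cbe om s) X (act g y).
Proof.
move=> Gg Oy; have Oa := act_Os HO HG Gg Oy; have cy := subset_closure Oy.
rewrite !(cvalE hom)// (dot_aff HO HG)// (qs Gg Oy) (om_act HO HG hom Gg Oy).
have l0 := lam_neq0 HO HG Gg cy; have o0 := om_lt0 hom Oa.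
by field; rewrite l0 lt_eqF.
Qed.

Lemma cmax_act g X y : G g -> Os y ->
  amax Os (cal om) (cbe om s) (aff_act (g, tau g) X) y <->
  amax Os (cal om) (cbe om s) X (act g y).
Proof.
move=> Gg Oy; have Oa := act_Os HO HG Gg Oy; split => -[_ m]; split => // z Oz.
  have Gi := G_inv HG Gg; have Oz' := act_Os HO HG Gi Oz.
  have := m _ Oz'; rewrite !cval_act//.
  by rewrite (act_closureVK HO HG Gg (subset_closure Oz)).
by rewrite !cval_act//; apply: m; exact: (act_Os HO HG Gg Oz).
Qed.

(** Two support functions differ by an invariant function, which [om] dominates, so they have the
    same boundary values and [D] lies in the outer domain. Conversely a point of the outer domain
    belongs to the domain of s - c om as soon as [c] exceeds its maximal value. *)
Lemma tau_outer_domain K D : tau_convex (cone Om) Gt K ->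
  greatest_tau_convex (cone Om) Gt D -> D = outer_domain (Om := Om) (support_fun K).
Proof.
move=> HK [HD Dmax].
have es := support_extends HO HG hom HT HK; have eD := support_extends HO HG hom HT HD.
have qK := support_equivariant HO HG HT HK; have qD := support_equivariant HO HG HT HD.
have cK y : Os y -> {for y, continuous (support_fun K)}.
  exact: (convex_continuous (dual_open HO) (support_convex HO HK)).
have cD y : Os y -> {for y, continuous (support_fun D)}.
  exact: (convex_continuous (dual_open HO) (support_convex HO HD)).
set s0 := support_fun K in es qK cK *; set sD := support_fun D in eD qD cD *.
pose k y := sD y - s0 y.
have ck y : Os y -> {for y, continuous k}.
  by move=> Oy; apply: (cvgB (FF := nbhs_filter y)); [exact: cD|exact: cK].
have qk : equivariant (Om := Om) (G := G) (fun=> 0) k.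
  by move=> g y Gg Oy; rewrite /k (qD g y Gg Oy) (qK g y Gg Oy) dot0l; ring.
have [U U0 kU] := invariant_dominated HO HG hom ck qk.
have sE : sD = (fun y => s0 y + k y) by apply/funext => y; rewrite /k addrC subrK.
apply/seteqP; split => [X|X DX].
  rewrite (support_domain HO HG hom HT HD) -/sD sE.
  by move=> /(perturb_domain hom es ck kU) [].
have [y0 my0] := cmax_nonempty HO hom cK es DX.
pose c := aval (cal om) (cbe om s0) X y0 + 1.
pose kc y := - c * om y.
have ckc y : Os y -> {for y, continuous kc}.
  by move=> Oy; apply: (cvgM (FF := nbhs_filter y)); [exact: cvg_cst|exact: (om_continuous hom Oy)].
have qkc : equivariant (Om := Om) (G := G) tau (fun y => s0 y + kc y).
  by move=> g y Gg Oy; rewrite /kc (qK g y Gg Oy) {1}(om_act HO HG hom Gg Oy); ring.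
have kcU y : Os y -> `|kc y| <= `|c| * `|om y| by rewrite /kc normrM normrN.
have eK := perturb_extends hom es ckc kcU.
apply: (Dmax _ (domain_tau_convex HO HG HT qkc eK)).
apply/(perturb_domain hom es ckc kcU); split => // y Oy.
have [Oy0 m] := my0; have : aval (cal om) (cbe om s0) X y < c.
  by apply: le_lt_trans (m y Oy) _; rewrite ltrDl.
by rewrite (cval_lt hom)// /kc mulNr.
Qed.

End contact_equivariance.

(** * Domains as epigraphs *)

Section heights.
Context {R : realType} {d : nat} {Om : set 'cV[R]_d}.
Hypothesis HO : pointed_domain Om.
Let Os := dual_domain Om.
Context {om : 'cV[R]_d -> R}.
Hypothesis hom : cheng_yau Os om.
Let oOs : open Os := dual_open HO.
Let O0 : Os 0 := @dual_domain0 R d Om.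
Hypothesis d0 : (0 < d)%N.
Implicit Types (x y z q w v : 'cV[R]_d) (X Y P : 'cV[R]_(d + 1)) (c t : R).

Lemma outer_open h : extends Os h -> open (outer_domain (Om := Om) h).
Proof.
move=> eh; apply: open_ballE => P DP; have [e e0 he] := boundary_gap HO eh DP.
have [r r0 hr] := dot_near HO P e0; exists r => // X PX y cy nO.
have := hr X y; rewrite distrC => /(_ PX cy); rewrite ltr_norml => /andP[_].
by have := he y cy nO; lra.
Qed.

(** An affine function on the closure takes its maximum at a boundary point, and there [X] lies
    below the boundary values of [h]. *)
Lemma outer_bound h (B : R) X y : outer_domain (Om := Om) h X ->
  (forall y, closure Os y -> extend Os h y <= B) -> Os y -> dot X (xi y) <= B.
Proof.
move=> DX hB Oy.
have H v : v != 0 -> exists y0, [/\ closure Os y0, ~ Os y0 &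
    forall z, closure Os z -> dot v z <= dot v y0].
  move=> v0; have ne : closure Os !=set0 by exists 0; exact: subset_closure.
  have cv : {within closure Os, continuous (dot v)}.
    by apply: continuous_subspaceT; exact: dot_continuousr.
  have [y0 + mx] := compact_EVT_max ne (dual_closure_compact HO) cv.
  rewrite inE => cy0; exists y0; split => // [Oy0|z cz]; last by apply: mx; rewrite inE.
  have [r r0 hr] := Os_line oOs v Oy0.
  have O1 : Os (y0 + (r / 2) *: v).
    by apply: hr; rewrite gtr0_norm ?divr_gt0// ltr_pdivrMr// ltr_pMr// ltr1n.
  have := mx _ (mem_set (subset_closure O1)); rewrite dotDr dotZr gerDl leNgt.
  by rewrite mulr_gt0 ?dot_gt0// divr_gt0.
have cy := subset_closure Oy.
have [u0|u0] := eqVneq (usubmx X) 0.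
  have [y0 [cy0 nO _]] : exists y0, [/\ closure Os y0, ~ Os y0 & True].
    have b0 : basis_vec R (Ordinal d0) != 0.
      apply/eqP => /matrixP /(_ (Ordinal d0) 0); rewrite !mxE !eqxx => /eqP.
      by rewrite oner_eq0.
    by have [y0 [? ? _]] := H _ b0; exists y0.
  have := DX y0 cy0 nO; have := hB y0 cy0.
  by rewrite !dot_xiE u0 !dot0l; lra.
have [y0 [cy0 nO mx]] := H _ u0.
have := DX y0 cy0 nO; have := hB y0 cy0; have := mx y cy; rewrite !dot_xiE; lra.
Qed.

Section height.
Variable h : 'cV[R]_d -> R.
Hypothesis eh : extends Os h.
Let Hh y := - extend Os h y.

Lemma hbe_within : {within closure Os, continuous Hh}.
Proof.
apply/subspace_continuousP => y cy; have FF := within_filter (closure Os) (nbhs_filter y).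
by apply: (cvgN (FF := FF)); exact: extends_continuous.
Qed.

Lemma id_within : {within closure Os, continuous (id : 'cV[R]_d -> 'cV[R]_d)}.
Proof. by apply: continuous_subspaceT => y; exact: cvg_id. Qed.

Definition hmax x : set 'cV[R]_d := amax (closure Os) id Hh x.

Lemma hmax_nonempty x : hmax x !=set0.
Proof.
have ne : closure Os !=set0 by exists 0; exact: subset_closure.
have cv := aval_within id_within hbe_within (X := x) (fun _ h => h).
have [y0 + mx] := compact_EVT_max ne (dual_closure_compact HO) cv.
rewrite inE => cy0; exists y0; split => [//|z cz]; by apply: mx; rewrite inE.
Qed.

Definition hpick x : 'cV[R]_d := pick_max (closure Os) id Hh x.

Lemma hpick_max x : hmax x (hpick x).
Proof. exact: (@pick_amax _ _ _ _ _ _ setT (fun x _ => hmax_nonempty x)). Qed.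

(** The Legendre transform of the extended function. The maximum is over the closure, as a maximizer
    may be on the boundary. *)
Definition height x : R := dot x (hpick x) - extend Os h (hpick x).

Lemma height_ge x y : closure Os y -> dot x y - extend Os h y <= height x.
Proof. by move=> cy; have [_ m] := hpick_max x; exact: (m y cy). Qed.

Lemma height_eq x y : hmax x y -> height x = dot x y - extend Os h y.
Proof.
move=> [cy m]; have [cp _] := hpick_max x; have := m _ cp; rewrite /aval => le.
have ge := height_ge x cy; apply/eqP; rewrite eq_le.
apply/andP; split.
  exact: le.
exact: ge.
Qed.

Lemma height_max x y : closure Os y -> height x = dot x y - extend Os h y -> hmax x y.
Proof.
move=> cy e; split => [//|z cz]; have := height_ge x cz; rewrite e /aval /Hh.
by move: (dot x z) (dot x y) (extend _ _ _) (extend _ _ _) => ? ? ? ?; lra.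
Qed.

Lemma domain_slice x c : domain_of Os h (lift1 x c) <-> height x < c.
Proof.
split => [Kx|lt y cy].
  by have [cp _] := hpick_max x; have := Kx _ cp; rewrite -/(xi _) dot_xi /height; lra.
by have := height_ge x cy; rewrite -/(xi _) dot_xi; lra.
Qed.

Definition huniq x := uniq_max (closure Os) id Hh x.

Let Yk (k : nat) := closure Os.
Let Ykc k : compact (Yk k). Proof. exact: (dual_closure_compact HO). Qed.
Let YkE : \bigcup_k Yk k = closure Os.
Proof. by apply/seteqP; split => [y [k _ ]//|y cy]; exists 0%N. Qed.

Lemma hpick_borel b : borel_set b -> borel_set [set x | huniq x /\ b (hpick x)].
Proof.
move=> mb; have := pick_borel d0 Ykc YkE id_within hbe_within
  (@measurableT _ (borel R d)) (fun x _ => hmax_nonempty x) mb.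
congr borel_set; apply/seteqP; split => x; first by case.
by case.
Qed.

Lemma hnonuniq_null : borel_set (~` huniq) /\ vol (~` huniq) = 0%E.
Proof.
have mT := @measurableT _ (borel R d).
have E : nonuniq (closure Os) id Hh setT = ~` huniq by rewrite /nonuniq setTD.
split; rewrite -E.
  exact: (nonuniq_borel d0 Ykc YkE id_within hbe_within mT (fun x _ => hmax_nonempty x)).
apply: (nonuniq_null d0 Ykc YkE id_within hbe_within mT (fun x _ => hmax_nonempty x)).
by move=> i a; exists (basis_vec R i), a => y _; rewrite dotC dot_basis.
Qed.

End height.

Variable s : 'cV[R]_d -> R.
Hypothesis cs : forall y, Os y -> {for y, continuous s}.
Hypothesis es : extends Os s.
Let H := extend Os s.

(** Link between the two kinds of maximizers: at the boundary point over [x] the quotient by - om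
    has maximal value 0, and a direction where it is 0 maximizes the height, hence is [y]. *)
Lemma height_outer x y : huniq s x -> hmax s x y -> Os y ->
  outer_domain (Om := Om) s (lift1 x (height s x)) /\
  amax Os (cal om) (cbe om s) (lift1 x (height s x)) `<=` [set y].
Proof.
move=> ux my Oy; split.
  move=> z cz nO; rewrite dot_xi -/H ltrBlDl -ltrBlDr lt_neqAle height_ge// andbT.
  apply/eqP => e; apply: nO.
  by have -> := ux z y (height_max es cz (esym e)) my.
move=> z [Oz mz]; apply: (ux z y _ my); apply: (height_max es (subset_closure Oz)).
have := mz y Oy; rewrite (cvalE hom _ _ Oy) (cvalE hom _ _ Oz) !dot_xi (height_eq es my) (extend_in _ Oy).
set u := dot x y - s y.
have -> : dot x y - u - s y = 0 by rewrite /u; ring.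
rewrite mul0r => h.
have o0 : 0 < - om z by rewrite oppr_gt0 (om_lt0 hom Oz).
have h1 : 0 <= dot x z - u - s z by move: h; rewrite pmulr_lge0// invr_gt0.
have := height_ge es x (subset_closure Oz); rewrite (height_eq es my) (extend_in _ Oy) (extend_in _ Oz) -/u.
by move=> h2; apply/eqP; rewrite eq_le; apply/andP; split; lra.
Qed.

Section perturbed_height.
Variables (f : 'cV[R]_d -> R) (U : R).
Hypothesis cf : forall y, Os y -> {for y, continuous f}.
Hypothesis fU : forall y, Os y -> `|f y| <= U * `|om y|.

Definition zext y : R := if pselect (Os y) then f y else 0.

Lemma scaled_cont t y : Os y -> {for y, continuous (fun y => t * f y)}.
Proof. by move=> Oy; apply: (cvgM (FF := nbhs_filter y)); [exact: cvg_cst|exact: cf]. Qed.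

Lemma scaled_bound t y : Os y -> `|t * f y| <= `|t| * U * `|om y|.
Proof. by move=> Oy; rewrite normrM -mulrA ler_wpM2l// fU. Qed.

Let ft t y := s y + t * f y.

Lemma ft_extends t : extends Os (ft t).
Proof. exact: (perturb_extends hom es (scaled_cont (t := t)) (@scaled_bound t)). Qed.

Lemma ft_ext t y : closure Os y -> extend Os (ft t) y = H y + t * zext y.
Proof.
move=> cy; rewrite (perturb_ext hom es (scaled_cont (t := t)) (@scaled_bound t) cy) /zext.
by rewrite -/Os; case: (pselect (Os y)) => ?; rewrite ?mulr0.
Qed.

Lemma zext_within : {within closure Os, continuous zext}.
Proof.
apply/subspace_continuousP => y cy; have FF := within_filter (closure Os) (nbhs_filter y).
have h : extend Os (ft 1) z - H z @[z --> within (closure Os) (nbhs y)] -->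
    extend Os (ft 1) y - H y.
  by apply: (cvgB (FF := FF)); apply: extends_continuous => //; exact: ft_extends.
have E z : closure Os z -> extend Os (ft 1) z - H z = zext z.
  by move=> cz; rewrite ft_ext// mul1r addrAC subrr add0r.
have hz : zext z @[z --> within (closure Os) (nbhs y)] --> zext y.
  rewrite -E//; apply: cvg_trans h; apply: near_eq_cvg; rewrite near_withinE.
  by apply: nearW => z cz; rewrite E.
exact: hz.
Qed.

Lemma zext_bounded : exists2 M : R, 0 < M & forall y, closure Os y -> `|zext y| <= M.
Proof.
have /compact_bounded [M [_ hM]] := continuous_compact zext_within (dual_closure_compact HO).
exists (`|M| + 1); first by rewrite ltr_wpDl.
by move=> y cy; apply: hM; [rewrite ltr_pwDr// ler_norm|exists y].
Qed.

Lemma height_lipschitz (M : R) t x : (forall y, closure Os y -> `|zext y| <= M) ->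
  `|height (ft t) x - height s x| <= `|t| * M.
Proof.
move=> hM; have bd y : closure Os y -> `|t * zext y| <= `|t| * M.
  by move=> cy; rewrite normrM ler_wpM2l// hM.
have [cy _] := hpick_max es x; have [cz _] := hpick_max (@ft_extends t) x.
have e1 : height s x = dot x (hpick s x) - H (hpick s x) by [].
have e2 : height (ft t) x = dot x (hpick (ft t) x) - (H (hpick (ft t) x) + t * zext (hpick (ft t) x)).
  by rewrite /height ft_ext.
have g1 := height_ge (@ft_extends t) x cy; rewrite (ft_ext _ cy) in g1.
have g2 : dot x (hpick (ft t) x) - H (hpick (ft t) x) <= height s x := height_ge es x cz.
have := bd _ cy; have := bd _ cz; rewrite !ler_norml => /andP[b1 b2] /andP[b3 b4].
move: e1 e2 g1 g2 b1 b2 b3 b4.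
move: (height s x) (height (ft t) x) (hpick s x) (hpick (ft t) x) => u v p q.
move: (dot x p) (dot x q) (H p) (H q) (t * zext p) (t * zext q) (`|t| * M) => ? ? ? ? ? ? ?.
by move=> -> -> *; apply/andP; split; lra.
Qed.

(** Danskin's theorem. Away from [y] the competitors are below the maximum by a gap [m], so for
    small t a maximizer of the perturbed problem is within [r] of [y], where the perturbation
    differs from its value at [y] by at most e |t|. *)
Lemma danskin x y : huniq s x -> hmax s x y -> forall e : R, 0 < e ->
  exists2 dl : R, 0 < dl & forall t, `|t| < dl ->
    `|height (ft t) x - height s x + t * zext y| <= e * `|t|.
Proof.
move=> ux my e e0; have [cy _] := my.
have [M M0 hM] := zext_bounded.
move/subspace_continuousP: zext_within => /(_ y cy) /cvg_withinP /(_ e e0) [r r0 hr].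
pose C := closure Os `&` [set z | - `|y - z| <= - r].
have cC : compact C.
  apply: compact_closedI; first exact: (dual_closure_compact HO).
  apply: (@closed_le_fun _ _ (fun z : 'cV[R]_d => - `|y - z|)) => z.
  apply: (cvgN (FF := nbhs_filter z)).
  by apply: (continuous_comp (f := fun z => y - z)); [exact: subl_cvec_continuous|exact: norm_continuous].
have {}hr z : closure Os z -> `|y - z| < r -> `|zext y - zext z| < e := hr z.
have [m m0 hm] : exists2 m : R, 0 < m & forall z, C z -> dot x z - H z <= height s x - m.
  have [ne|ne] := pselect (C !=set0); last first.
    by exists 1 => // z Cz; exfalso; apply: ne; exists z.
  have CO : C `<=` closure Os by move=> z [].
  have cv := aval_within id_within (hbe_within es) (X := x) CO.
  have [z0 + mx] := compact_EVT_max ne cC cv.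
  rewrite inE => -[cz0 rz0]; exists (height s x - (dot x z0 - H z0)); last first.
    by move=> z Cz; have := mx z (mem_set Cz); rewrite /aval -/H; lra.
  rewrite subr_gt0 lt_neqAle height_ge// andbT; apply/eqP => ez.
  have zy := ux z0 y (height_max es cz0 (esym ez)) my.
  by move: rz0; rewrite /= zy subrr normr0 lerN2 leNgt r0.
exists (m / (2 * M + 1)); first by rewrite divr_gt0// addr_gt0// mulr_gt0.
move=> t; rewrite ltr_pdivlMr; last by rewrite addr_gt0// mulr_gt0.
move=> tm.
have bd z : closure Os z -> `|t * zext z| <= `|t| * M.
  by move=> cz; rewrite normrM ler_wpM2l// hM.
have h1 : height s x - t * zext y <= height (ft t) x.
  have := height_ge (@ft_extends t) x cy; rewrite (ft_ext _ cy) (height_eq es my) -/H.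
  by move: (dot x y) (H y) (t * zext y) (height _ _) => ? ? ? ?; lra.
have [cz _] := hpick_max (@ft_extends t) x; set z := hpick (ft t) x in cz.
have zE : height (ft t) x = dot x z - H z - t * zext z by rewrite /height ft_ext// -/z; ring.
have by1 := bd y cy; have bz := bd z cz.
have yz : `|y - z| < r.
  rewrite ltNge; apply/negP => le; have := hm z (conj cz _); rewrite /= lerN2 => /(_ le).
  move: by1 bz; rewrite !ler_norml => /andP[_ b1] /andP[b2 _].
  have := normr_ge0 t; move: h1 tm b1 b2; rewrite zE.
  move: (height s x) (t * zext y) (dot x z) (H z) (t * zext z) `|t| => ? ? ? ? ? ?; lra.
have : `|zext y - zext z| < e := hr z cz yz.
move=> h2; have h3 : `|t * (zext y - zext z)| <= e * `|t|.
  by rewrite normrM mulrC ler_wpM2r// ltW.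
have h4 := height_ge es x cz; rewrite -/H in h4.
move: h3; rewrite mulrBr !ler_norml => /andP[_ h6]; apply/andP; split.
  apply: (@le_trans _ _ 0); first by rewrite oppr_le0 mulr_ge0// ltW.
  by move: h1; rewrite lerBlDr -subr_ge0 addrAC.
apply: le_trans h6; rewrite zE -subr_ge0; move: h4; rewrite -subr_ge0.
move: (height s x) (dot x z) (H z) (t * zext y) (t * zext z) => a p q u v.
by congr (0 <= _); ring.
Qed.

End perturbed_height.

End heights.

(** * The first variation of volumes *)

Section section_limit.
Context {R : realType} {n : nat} (n0 : (0 < n)%N).
Local Notation V := 'cV[R]_n.
Implicit Types (A : set 'cV[R]_(n + 1)) (x : V) (C M : R).

Definition section_length A x : \bar R :=
  lebesgue_measure [set z : measurableTypeR R | A (lift1 x z)].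

Lemma section_length_fin A x C : borel_set A -> (forall X, A X -> `|X| <= C) -> 0 < C ->
  (section_length A x <= (2 * C)%:E)%E /\ (C < `|x| -> section_length A x = 0%E).
Proof.
move=> mA hC C0; split.
  apply: (@le_trans _ _ (lebesgue_measure `[(- C), C]%classic)); last first.
    rewrite lebesgue_measure_itv /= lte_fin gtrN// lee_fin; lra.
  apply: le_measure; rewrite ?inE//; first exact: (measurable_section x mA).
  move=> a /hC h; rewrite /= in_itv /= -ler_norml; apply: le_trans h.
  by have := norm_last (lift1 x a); rewrite last_lift.
move=> Cx; rewrite /section_length (_ : [set _ | _] = set0) ?measure0//.
apply/seteqP; split => // a /hC h.
have := norm_usubmx (lift1 x a); rewrite usubmx_lift => h2.
by have := le_lt_trans (le_trans h2 h) Cx; rewrite ltxx.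
Qed.

Lemma section_length_integrable A C : borel_set A -> (forall X, A X -> `|X| <= C) -> 0 < C ->
  (forall x, section_length A x \is a fin_num) /\
  (lebn n0).-integrable [set: borel R n] (section_length A).
Proof.
move=> mA hC C0; have b x := section_length_fin x mA hC C0.
have fin x : section_length A x \is a fin_num.
  by rewrite ge0_fin_numE ?measure_ge0//; apply: le_lt_trans (b x).1 (ltry _).
split => //; apply/integrableP; split; first exact: measurable_section_fun.
have mc : measurable ((@cube R n C) : set (borel R n)) := @cube_borel R n C.
apply: (@le_lt_trans _ _ (\int[lebn n0]_x ((2 * C)%:E * (\1_(@cube R n C) x)%:E))%E).
  apply: ge0_le_integral => //.
  - by apply: measurableT_comp => //; exact: measurable_section_fun.
  - by apply: measurable_funeM; exact/measurable_EFinP.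
  - move=> x _; rewrite gee0_abs ?measure_ge0// -EFinM indicE.
    have [xc|xc] := leP `|x| C.
      by rewrite mem_set ?mulr1; [exact: (b x).1|exact/(cubeE x (ltW C0))].
    by rewrite (b x).2// lee_fin mulr_ge0// ?mulr_ge0// ltW.
rewrite ge0_integralZl_EFin//; last 2 first.
  exact/measurable_EFinP.
  by rewrite mulr_ge0// ltW.
rewrite integral_indic// setIT lte_mul_pinfty//; first by rewrite lee_fin mulr_ge0// ltW.
exact: (cube_vol n0 (ltW C0)).
Qed.

Lemma vol_section_length A : borel_set A -> vol A = (\int[lebn n0]_x section_length A x)%E.
Proof. exact: vol_fubini. Qed.

(** Fubini's theorem and dominated convergence: the difference quotients of the section lengths are
    bounded by [M] and vanish outside the cube of size [C], which gives the integrable majorant. *)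
Lemma section_volume_limit (E : nat -> set 'cV[R]_(n + 1)) (F : set 'cV[R]_(n + 1))
    (tn : nat -> R) (h : borel R n -> R) C M (N : set V) :
  (forall k, borel_set (E k)) -> borel_set F ->
  (forall k X, E k X -> `|X| <= C) -> (forall X, F X -> `|X| <= C) -> 0 < C ->
  (forall k, tn k != 0) ->
  (forall k x, `|fine (section_length (E k) x) - fine (section_length F x)| <= `|tn k| * M) ->
  measurable_fun [set: borel R n] h -> borel_set N -> vol N = 0%E ->
  (forall x, ~ N x -> (fine (section_length (E k) x) - fine (section_length F x)) / tn k
     @[k --> \oo] --> h x) ->
  (lebn n0).-integrable [set: borel R n] (EFin \o h) /\
  ((vol (E k) - vol F) * ((tn k)^-1)%:E)%E @[k --> \oo] --> (\int[lebn n0]_x (h x)%:E)%E.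
Proof.
move=> mE mF hE hF C0 tn0 lip mh mN N0 lim.
have iE k := section_length_integrable (mE k) (hE k) C0.
have iF := section_length_integrable mF hF C0.
have M0 : 0 <= M.
  have := le_trans (normr_ge0 _) (lip 0%N 0).
  by rewrite pmulr_rge0// normr_gt0.
pose q k (x : borel R n) : \bar R := ((section_length (E k) x - section_length F x) * ((tn k)^-1)%:E)%E.
have iq k : (lebn n0).-integrable [set: borel R n] (fun x => (section_length (E k) x - section_length F x)%E).
  exact: (integrableB measurableT (iE k).2 iF.2).
have qE k x : q k x = ((fine (section_length (E k) x) - fine (section_length F x)) / tn k)%:E.
  by rewrite /q -(fineK ((iE k).1 x)) -(fineK (iF.1 x)) -EFinB -EFinM.
have volE k : ((vol (E k) - vol F) * ((tn k)^-1)%:E)%E = (\int[lebn n0]_x q k x)%E.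
  rewrite (vol_section_length (mE k)) (vol_section_length mF).
  rewrite -(integralB measurableT (iE k).2 iF.2); exact/esym/(integralZr measurableT (iq k)).
have mc : measurable ((@cube R n C) : set (borel R n)) := @cube_borel R n C.
pose G (x : borel R n) : \bar R := (M%:E * (\1_(@cube R n C) x)%:E)%E.
have iG : (lebn n0).-integrable [set: borel R n] G.
  apply/integrableP; split; first by apply: measurable_funeM; exact/measurable_EFinP.
  under eq_integral do rewrite /G -EFinM gee0_abs ?EFinM ?lee_fin ?mulr_ge0//.
  rewrite ge0_integralZl_EFin//; last exact/measurable_EFinP.
  rewrite integral_indic// setIT lte_mul_pinfty//; exact: (cube_vol n0 (ltW C0)).
have aeN : {ae lebn n0, forall x, [set: borel R n] x -> q k x @[k --> \oo] --> (EFin \o h) x}.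
  exists N; split => // x /= nlim; apply: contrapT => nN; apply: nlim => _.
  apply: cvg_EFin; first by near=> k; rewrite qE.
  by under eq_fun do rewrite /= qE /=; exact: lim.
have aeG : {ae lebn n0, forall x k, [set: borel R n] x -> (`|q k x| <= G x)%E}.
  exists set0; split => // x /= [] k _; rewrite qE /= /G -EFinM lee_fin indicE.
  have t0 : 0 < `|tn k| by rewrite normr_gt0.
  have [xc|xc] := leP `|x| C.
    rewrite mem_set ?mulr1; last exact/(cubeE x (ltW C0)).
    by rewrite normrM normfV (ler_pdivrMr _ _ t0) mulrC.
  rewrite (section_length_fin x (mE k) (hE k) C0).2// (section_length_fin x mF hF C0).2//.
  by rewrite subrr mul0r normr0 mulr_ge0.
have mq k : measurable_fun [set: borel R n] (q k).
  exact: measurable_int (integrableZr measurableT (tn k)^-1 (iq k)).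
have mh' : measurable_fun [set: borel R n] (EFin \o h) by exact/measurable_EFinP.
have [ih _ hl] := dominated_convergence measurableT mq mh' aeN iG aeG.
by split => //; under eq_fun do rewrite volE; exact: hl.
Unshelve. all: by end_near. Qed.

End section_limit.

Section interval_sections.
Context {R : realType}.
Local Notation leb := (@lebesgue_measure R).
Variables (S N : set (measurableTypeR R)).
Hypothesis (mS : measurable S) (mN : measurable N) (N0 : leb N = 0%E).

Definition below (a : R) : set (measurableTypeR R) := S `&` [set z | z <= a].

Lemma below_measurable a : measurable (below a).
Proof.
apply: measurableI => //.
by rewrite (_ : [set z | z <= a] = [set` `]-oo, a]])//; apply/seteqP; split => z /=; rewrite in_itv.
Qed.

Lemma below_diff a b : a <= b -> leb (below b) = (leb (below a) + leb (S `&` `]a, b]%classic))%E.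
Proof.
move=> ab; rewrite -measureU//.
- congr leb; apply/seteqP; split => z; rewrite /below /=.
    move=> [Sz zb]; have [za|az] := leP z a; first by left.
    by right; split => //; rewrite /= in_itv /= az.
  by move=> [[Sz za]|[Sz]]; [split => //; exact: le_trans za ab|rewrite /= in_itv /= => /andP[_ ?]].
- exact: below_measurable.
- exact: measurableI.
- apply/seteqP; split => // z [[_ za] [_]]; rewrite /= in_itv /= => /andP[az _].
  by move: za; rewrite /= leNgt az.
Qed.

Lemma itv_le a b : a <= b -> (leb (S `&` `]a, b]%classic) <= (b - a)%:E)%E.
Proof.
move=> ab; apply: (@le_trans _ _ (leb `]a, b]%classic)).
  by apply: le_measure; rewrite ?inE//; exact: measurableI.
rewrite lebesgue_measure_itv /= lte_fin; case: ifP => // _.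
by rewrite lee_fin subr_ge0.
Qed.

Let le_case a b : a <= b -> (leb (below a) < +oo)%E -> (leb (below b) < +oo)%E ->
  [/\ 0 <= fine (leb (below b)) - fine (leb (below a)) <= b - a,
   (forall z, a < z <= b -> S z \/ N z) ->
     fine (leb (below b)) - fine (leb (below a)) = b - a &
   (forall z, a < z <= b -> ~ S z) ->
     fine (leb (below b)) - fine (leb (below a)) = 0].
Proof.
move=> ab fa fb; have e := below_diff ab; have i := itv_le ab.
have fin A : (leb A < +oo)%E -> leb A \is a fin_num by move=> h; rewrite ge0_fin_numE.
have fi : leb (S `&` `]a, b]%classic) \is a fin_num by apply: fin; apply: le_lt_trans i (ltry _).
have E : fine (leb (below b)) - fine (leb (below a)) = fine (leb (S `&` `]a, b]%classic)).
  by rewrite e (fineD (fin _ fa) fi) addrAC subrr add0r.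
rewrite E; split.
- by rewrite fine_ge0//= -lee_fin fineK.
- move=> h; apply/eqP; rewrite eq_le -!lee_fin fineK// i /=.
  apply: (@le_trans _ _ (leb ((S `&` `]a, b]%classic) `|` N))).
    apply: (@le_trans _ _ (leb `]a, b]%classic)).
      rewrite lebesgue_measure_itv /= lte_fin; case: ifP => //.
      by rewrite lee_fin subr_le0 => /negbT; rewrite -leNgt.
    apply: le_measure; rewrite ?inE//; first by apply: measurableU => //; exact: measurableI.
    move=> z zab; have : a < z <= b by move: zab; rewrite /= in_itv.
    by move=> /h [Sz|Nz]; [left|right].
  rewrite (le_trans (measureU2 _ _ _))//; [exact: measurableI|].
  by rewrite [X in (_ + X)%E](_ : _ = 0%E) ?adde0//; exact: N0.
- move=> h; have -> : S `&` `]a, b]%classic = set0.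
    by apply/seteqP; split => // z [Sz]; rewrite /= in_itv /= => /h.
  by rewrite measure0.
Qed.

(** Made for the section of [outside], a fixed set cut at a varying height: the length follows the
    height when the swept interval is in [S] up to the null set [N], and is constant when the
    interval misses [S]. *)
Lemma below_change a b : (leb (below a) < +oo)%E -> (leb (below b) < +oo)%E ->
  [/\ `|fine (leb (below b)) - fine (leb (below a))| <= `|b - a|,
   (forall z : R, Order.min a b < z <= Order.max a b -> S z \/ N z) ->
     fine (leb (below b)) - fine (leb (below a)) = b - a &
   (forall z : R, Order.min a b < z <= Order.max a b -> ~ S z) ->
     fine (leb (below b)) - fine (leb (below a)) = 0].
Proof.
move=> fa fb; have [ab|ba] := leP a b.
  have [/andP[h1 h2] h3 h4] := le_case ab fa fb; split => //.
  by rewrite !ger0_norm// subr_ge0.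
have [/andP[h1 h2] h3 h4] := le_case (ltW ba) fb fa; split.
- by rewrite distrC (distrC b) !ger0_norm// subr_ge0 ltW.
- by move=> /h3 h; rewrite -[LHS]opprB h opprB.
- by move=> /h4 h; rewrite -[LHS]opprB h oppr0.
Qed.

End interval_sections.

Lemma between_dist {R : realType} (a b z : R) :
  Order.min a b < z <= Order.max a b -> `|z - a| <= `|b - a|.
Proof.
have [ab|ba] := leP a b => /andP[z1 z2].
  by rewrite !ger0_norm ?subr_ge0 ?lerD2r// ltW.
by rewrite distrC (distrC b) !ger0_norm ?subr_ge0 ?(ltW ba)// lerD2l lerN2 ltW.
Qed.

Lemma zext_in {R : realType} {d : nat} {Om : set 'cV[R]_d} (f : 'cV[R]_d -> R) y :
  dual_domain Om y -> zext (Om := Om) f y = f y.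
Proof. by rewrite /zext; case: (pselect (dual_domain Om y)). Qed.

Lemma zext_out {R : realType} {d : nat} {Om : set 'cV[R]_d} (f : 'cV[R]_d -> R) y :
  ~ dual_domain Om y -> zext (Om := Om) f y = 0.
Proof. by rewrite /zext; case: (pselect (dual_domain Om y)). Qed.

Section main_volume.
Context {R : realType} {d : nat} {Om : set 'cV[R]_d}.
Hypothesis HO : pointed_domain Om.
Let Os := dual_domain Om.
Context {om : 'cV[R]_d -> R}.
Hypothesis hom : cheng_yau Os om.
Let oOs : open Os := dual_open HO.
Let O0 : Os 0 := @dual_domain0 R d Om.
Hypothesis d0 : (0 < d)%N.
Implicit Types (x y z q w v : 'cV[R]_d) (X Y P : 'cV[R]_(d + 1)) (t : R).
Variable s : 'cV[R]_d -> R.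
Hypothesis cs : forall y, Os y -> {for y, continuous s}.
Hypothesis es : extends Os s.
Let D := outer_domain (Om := Om) s.
Let d1 : (0 < d + 1)%N. Proof. by rewrite addn1. Qed.

Definition cuniq X := uniq_max Os (cal om) (cbe om s) X.
Definition cpick X := pick_max Os (cal om) (cbe om s) X.

Let mD : borel_set D. Proof. by apply: open_borel; exact: (outer_open HO). Qed.
Let Dne X : D X -> amax Os (cal om) (cbe om s) X !=set0.
Proof. exact: (cmax_nonempty HO hom cs es). Qed.

(** Points with several maximizers are left out, because for them [cpick] is an arbitrary choice
    that need not be equivariant. *)
Definition region (c : set 'cV[R]_d) : set 'cV[R]_(d + 1) :=
  [set X | [/\ D X, cuniq X & c (cpick X)]].

Lemma region_borel c : borel_set c -> borel_set (region c).
Proof.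
exact: (pick_borel d1 (osk_compact HO hom) (oskE hom) (cal_within hom) (cbe_within hom cs) mD Dne).
Qed.

Definition cnonuniq : set 'cV[R]_(d + 1) := nonuniq Os (cal om) (cbe om s) D.

Lemma cnonuniq_borel : borel_set cnonuniq.
Proof.
exact: (nonuniq_borel d1 (osk_compact HO hom) (oskE hom) (cal_within hom) (cbe_within hom cs) mD Dne).
Qed.

Lemma cnonuniq_null : vol cnonuniq = 0%E.
Proof.
exact: (nonuniq_null d1 (osk_compact HO hom) (oskE hom) (cal_within hom) (cbe_within hom cs) mD Dne (cal_prefer hom)).
Qed.

Variables (f : 'cV[R]_d -> R) (U : R).
Hypothesis cf : forall y, Os y -> {for y, continuous f}.
Hypothesis fU : forall y, Os y -> `|f y| <= U * `|om y|.
Let ft t y := s y + t * f y.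
Let Kt t := domain_of Os (ft t).

Variables (c Q : set 'cV[R]_d).
Hypotheses (mc : borel_set c) (cQ : compact Q) (QO : Q `<=` Os) (cQs : c `<=` Q).

Definition outside t : set 'cV[R]_(d + 1) := (D `\` Kt t) `&` region c.

Lemma outside_borel t : borel_set (outside t).
Proof.
apply: borelI; last exact: region_borel.
apply: borelD => //; apply: open_borel; apply: (domain_open HO).
exact: (ft_extends hom es cf fU).
Qed.

(** Outside the perturbed domain the maximal value is at least - |t| U, which bounds X . xi from
    below at the contact direction. The boundary values bound it from above, and [slope_bound]
    applies because that direction is in [Q]. *)
Lemma outside_bounded : exists2 C : R, 0 < C &
  forall t X, `|t| <= 1 -> outside t X -> `|X| <= C.
Proof.
have [B B0 hB] := ext_bounded HO es.
have com : {within Q, continuous om}.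
  by apply/subspace_continuousP => y /QO Oy; apply: cvg_within_filter; exact: (om_continuous hom Oy).
have /compact_bounded [M [_ hM]] := continuous_compact com cQ.
have U0 : 0 <= U.
  have := fU O0; have o0 : 0 < `|om 0| by rewrite normr_gt0 lt_eqF// (om_lt0 hom O0).
  by move=> /(le_trans (normr_ge0 _)); rewrite pmulr_lge0.
have [C hC] := slope_bound HO (B + U * (`|M| + 1)) cQ QO.
exists (`|C| + 1); first by rewrite ltr_wpDl.
move=> t X t1 [[DX nK] [_ uX cX]].
have mX : amax Os (cal om) (cbe om s) X (cpick X).
  by have [y my] := Dne DX; rewrite /cpick (pick_maxE uX my).
set y := cpick X in cX mX; have Qy := cQs cX; have Oy := QO Qy.
have r0 : - (`|t| * U) <= aval (cal om) (cbe om s) X y.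
  exact: (perturb_domain_ge hom es (@scaled_cont R d Om f cf t) (@scaled_bound R d Om om f U fU t) DX mX nK).
have oM : `|om y| <= `|M| + 1.
  by apply: hM; [rewrite ltr_pwDr// ler_norm|exists y].
have hb z : closure Os z -> extend Os s z <= B.
  by move=> cz; apply: le_trans (ler_norm _) _; exact: hB.
apply: le_trans (ler_norm _) _; apply: (@le_trans _ _ (`|C|)); last by rewrite lerDl.
rewrite normr_id; apply: le_trans (ler_norm C); apply: (hC X y Qy) => [|z Oz]; last first.
  apply: le_trans (outer_bound HO d0 DX hb Oz) _; rewrite lerDl; exact: mulr_ge0 U0 (addr_ge0 (normr_ge0 _) ler01).
rewrite (cval_eq hom s X Oy); have oy := om_lt0 hom Oy.
have h1 : - B <= s y.
  by have := hB y (subset_closure Oy); rewrite extend_in// ler_norml => /andP[].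
have h2 : - (U * (`|M| + 1)) <= - (aval (cal om) (cbe om s) X y * om y).
  rewrite lerN2; have [a0|a0] := leP 0 (aval (cal om) (cbe om s) X y).
    by apply: (@le_trans _ _ 0); [rewrite mulr_ge0_le0// ltW|rewrite mulr_ge0// addr_ge0].
  rewrite -mulrNN; apply: ler_pM.
  - by rewrite oppr_ge0 ltW.
  - by rewrite oppr_ge0 ltW.
  - by rewrite lerNl; apply: le_trans r0; rewrite lerN2 ler_piMl.
  - by rewrite ltr0_norm in oM.
by rewrite opprD; exact: lerD.
Qed.

Let sec x : set (measurableTypeR R) := [set a | region c (lift1 x a)].
Let secN x : set (measurableTypeR R) := [set a | cnonuniq (lift1 x a)].

Lemma outside_section t x :
  [set a : measurableTypeR R | outside t (lift1 x a)] = below (sec x) (height (Om := Om) (ft t) x).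
Proof.
have eft : extends Os (ft t) := @ft_extends R d Om om hom s es f U cf fU t.
apply/seteqP; split => a.
  move=> [[Da nK] ra]; split => //=; rewrite leNgt; apply/negP => lt; apply: nK.
  exact/(domain_slice HO eft).
move=> [ra /= le]; split => //; split; first by case: ra.
by move=> /(domain_slice HO eft); rewrite ltNge le.
Qed.

Definition outside_length t x : \bar R := section_length (outside t) x.

Definition density x : R :=
  if pselect (huniq (Om := Om) s x /\ c (hpick (Om := Om) s x)) then - f (hpick (Om := Om) s x) else 0.

Lemma density_in x : huniq (Om := Om) s x -> c (hpick (Om := Om) s x) ->
  density x = - f (hpick (Om := Om) s x).
Proof.
move=> ux cx; rewrite /density.
by case: (pselect (huniq s x /\ c (hpick s x))) => [//|h]; exfalso; apply: h.
Qed.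

Lemma density_out x : ~ c (hpick (Om := Om) s x) -> density x = 0.
Proof.
move=> ncx; rewrite /density.
by case: (pselect (huniq s x /\ c (hpick s x))) => [h|//]; case: ncx; case: h.
Qed.

(** The points between the two heights over [x] are close to the boundary point [P] of [K], so their
    contact directions are close to [y]. Up to nonuniqueness, either all of them are in [region c]
    or none is, according to the position of [y]. *)
Lemma density_limit x : (forall t, `|t| <= 1 -> (outside_length t x < +oo)%E) ->
  huniq (Om := Om) s x -> lebesgue_measure (secN x) = 0%E ->
  (Os (hpick (Om := Om) s x) -> c° (hpick (Om := Om) s x) \/ ~ closure c (hpick (Om := Om) s x)) ->
  forall e : R, 0 < e -> exists2 dl : R, 0 < dl & forall t, `|t| < dl -> t != 0 ->
    `|(fine (outside_length t x) - fine (outside_length 0 x)) / t - density x| <= e.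
Proof.
move=> fin ux n0 bd e e0; set y := hpick s x in bd *.
have my : hmax (Om := Om) s x y := hpick_max HO es x.
have [dl1 dl10 hd] := danskin HO hom es cf fU ux my e0.
have h0E : height (Om := Om) (ft 0) x = height (Om := Om) s x.
  by congr (height _ _); apply/funext => w; rewrite /ft mul0r addr0.
have mS : measurable (sec x) := measurable_section x (region_borel mc).
have mN : measurable (secN x) := measurable_section x cnonuniq_borel.
have ch t : `|t| <= 1 -> [/\ `|fine (outside_length t x) - fine (outside_length 0 x)| <= `|height (Om := Om) (ft t) x - height (Om := Om) s x|,
   (forall z : R, Order.min (height (Om := Om) s x) (height (Om := Om) (ft t) x) < z <= Order.max (height (Om := Om) s x) (height (Om := Om) (ft t) x) ->
      sec x z \/ secN x z) ->
     fine (outside_length t x) - fine (outside_length 0 x) = height (Om := Om) (ft t) x - height (Om := Om) s x &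
   (forall z : R, Order.min (height (Om := Om) s x) (height (Om := Om) (ft t) x) < z <= Order.max (height (Om := Om) s x) (height (Om := Om) (ft t) x) ->
      ~ sec x z) ->
     fine (outside_length t x) - fine (outside_length 0 x) = 0].
  move=> t1; rewrite -h0E /outside_length /section_length !outside_section.
  have z1 : `|0 : R| <= 1 by rewrite normr0.
  by apply: (below_change mS mN n0); rewrite -outside_section; [exact: fin 0 z1|exact: fin t t1].
have [M M0 hM] := zext_bounded HO hom es cf fU.
have lip t := height_lipschitz HO hom es cf fU t x hM.
(* If [y] is on the boundary the perturbation vanishes there, so the heights differ by o(t) and
   nothing has to be known about the region. *)
have [Oy|nO] := pselect (Os y); last first.
  have d00 : density x = 0.
    apply: density_out => cy; apply: nO; exact: QO (cQs cy).
  exists (Order.min dl1 1); first by rewrite lt_min dl10 ltr01.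
  move=> t; rewrite lt_min => /andP[t1 t2] tn; rewrite d00 subr0.
  have tp : 0 < `|t| by rewrite normr_gt0.
  have [h1 _ _] := ch t (ltW t2); rewrite normrM normfV (ler_pdivrMr _ _ tp).
  apply: le_trans h1 _; have := hd t t1; rewrite (zext_out _ nO) mulr0 addr0.
  exact.
have [DP PW] := height_outer HO hom es ux my Oy.
set P := lift1 x _ in DP PW.
have nearP (W : set 'cV[R]_d) : open W -> W y -> exists2 dl : R, 0 < dl & forall t, `|t| < dl ->
    forall z : R, Order.min (height (Om := Om) s x) (height (Om := Om) (ft t) x) < z <= Order.max (height (Om := Om) s x) (height (Om := Om) (ft t) x) ->
    D (lift1 x z) /\ (cuniq (lift1 x z) -> W (cpick (lift1 x z))).
  move=> oW Wy.
  have [r1 r10 hr1] := cmax_close HO hom cs es DP oW (fun z (h : _) => eq_ind_r W Wy (PW z h)).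
  have [r2 r20 hr2] := openE_ball (outer_open HO es) DP.
  pose r := Order.min r1 r2; have r0 : 0 < r by rewrite lt_min r10.
  have M1 : 0 < M + 1 by rewrite addr_gt0.
  exists (r / (M + 1)); first exact: divr_gt0.
  move=> t; rewrite (ltr_pdivlMr _ _ M1) => tr z zb.
  have zF : `|z - height (Om := Om) s x| < r.
    apply: le_lt_trans tr; apply: le_trans (between_dist zb) _; apply: le_trans (lip t) _.
    by apply: (ler_wpM2l (normr_ge0 t)); rewrite lerDl ler01.
  have zP : `|lift1 x z - P| < r.
    rewrite /P lift1N lift1D subrr; apply: le_lt_trans zF.
    by apply: norm_lift; rewrite ?normr0.
  move: zP; rewrite lt_min => /andP[p1 p2]; split; first by apply: hr2; rewrite distrC.
  move=> uz; have [[w mw] sub] := hr1 _ p1; apply: sub.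
  by rewrite /cpick (pick_maxE uz mw).
have [iy|ncy] := bd Oy.
  have [dl2 dl20 h2] := nearP c° (@open_interior _ c) iy.
  have dE : density x = - zext (Om := Om) f y.
    rewrite (density_in ux (interior_subset iy)).
    by rewrite (zext_in _ Oy).
  exists (Order.min dl1 (Order.min dl2 1)); first by rewrite !lt_min dl10 dl20 ltr01.
  move=> t; rewrite !lt_min => /andP[t1 /andP[t2 t3]] tn.
  have [_ h3 _] := ch t (ltW t3); rewrite h3; last first.
    move=> z /(h2 t t2) [Dz uz]; have [u|nu] := pselect (cuniq (lift1 x z)); [left|right; exact: (conj Dz nu)].
    exact: (And3 Dz u (interior_subset (uz u))).
  have tp : 0 < `|t| by rewrite normr_gt0.
  rewrite dE opprK -(ler_pM2r tp) -normrM mulrDl (divfK tn).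
  by rewrite [zext _ _ * t]mulrC; exact: hd.
have ocy : open (~` closure c) by apply: closed_openC; exact: closed_closure.
have [dl2 dl20 h2] := nearP _ ocy ncy.
have dE : density x = 0.
  by apply: density_out => cy; apply: ncy; exact: subset_closure.
exists (Order.min dl2 1); first by rewrite lt_min dl20 ltr01.
move=> t; rewrite lt_min => /andP[t2 t3] tn.
have [_ _ h3] := ch t (ltW t3).
have h4 (z : R) : Order.min (height (Om := Om) s x) (height (Om := Om) (ft t) x) < z <= Order.max (height (Om := Om) s x) (height (Om := Om) (ft t) x) -> ~ sec x z.
  by move=> /(h2 t t2) [Dz uz] [_ u cz]; apply: (uz u); exact: subset_closure.
by rewrite (h3 h4) mul0r dE subr0 normr0; exact: ltW.
Qed.

End main_volume.

Lemma vol0_setU {R : realType} {n : nat} (A B : set 'cV[R]_n) :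
  vol A = 0%E -> vol B = 0%E -> vol (A `|` B) = 0%E.
Proof.
move=> A0 B0; apply: (@vol0_sub _ _ _ (\bigcup_k (if k is 0%N then A else B))).
  by move=> x [Ax|Bx]; [exists 0%N|exists 1%N].
by apply: (@vol0_bigcup R n (fun k : nat => if k is 0%N then A else B)) => -[].
Qed.

(** Dominated convergence is about sequences. A neighborhood of [l] that is missed arbitrarily close
    to 0 would produce a sequence of size at most 1 / (k + 1) that contradicts the hypothesis. *)
Lemma dnbhs_sequentially {R : realType} {T : topologicalType} (F : R -> T) (l : T) :
  (forall tn : nat -> R, (forall k, tn k != 0 /\ `|tn k| <= 1) -> tn k @[k --> \oo] --> (0 : R) ->
     F (tn k) @[k --> \oo] --> l) ->
  F t @[t --> (0 : R)^'] --> l.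
Proof.
move=> h A nA; apply: contrapT => nF.
have ex (k : nat) : exists t : R, [/\ t != 0, `|t| <= k.+1%:R^-1 & ~ A (F t)].
  apply: contrapT => ne; apply: nF.
  have k0 : (0 : R) < k.+1%:R^-1 by rewrite invr_gt0.
  have : \forall t \near (0 : R)^', A (F t); last by [].
  near=> t; apply: contrapT => nt; apply: ne; exists t; split => //.
    by near: t; exact: nbhs_dnbhs_neq.
  by near: t; exact: dnbhs0_le.
have [tn htn] := choice ex.
have t0 : tn k @[k --> \oo] --> (0 : R).
  apply/norm_cvg0P; apply: (squeeze_cvgr _ (cvg_cst 0) (@cvg_harmonic R)).
  by near=> k; rewrite normr_ge0 /=; have [_ ] := htn k.
have t1 k : tn k != 0 /\ `|tn k| <= 1.
  by have [a b _] := htn k; split => //; apply: le_trans b _; rewrite invf_le1// ler1n.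
have [N _ hN] := h tn t1 t0 A nA.
by have [_ _] := htn N; apply; exact: (hN N (leqnn N)).
Unshelve. all: by end_near. Qed.

Lemma open_continuous_borel {R : realType} {n : nat} (U A : set 'cV[R]_n) (f : 'cV[R]_n -> R) :
  open U -> (forall y, U y -> {for y, continuous f}) -> borel_set A -> A `<=` U ->
  measurable_fun (A : set (borel R n)) (f : borel R n -> measurableTypeR R).
Proof.
move=> oU cf mA AU.
apply: (measurability _ (RGenOInfty.measurableE R)) => _ [_ [r ->] <-].
have -> : A `&` f @^-1` `]r, +oo[%classic = A `&` (U `&` f @^-1` `]r, +oo[%classic).
  by apply/seteqP; split => z; [move=> [Az fz]; split => //; split => //; exact: AU|move=> [Az []]].
apply: borelI => //; apply: open_borel; rewrite openE => y [Uy fy].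
have h1 : nbhs y U by exact: open_nbhs_nbhs.
have h2 : nbhs y (f @^-1` `]r, +oo[%classic).
  by apply: (cf y Uy); apply: open_nbhs_nbhs; split => //; exact: interval_open.
exact: filterI h1 h2.
Qed.

Section volume_limit.
Context {R : realType} {d : nat} {Om : set 'cV[R]_d}.
Hypothesis HO : pointed_domain Om.
Let Os := dual_domain Om.
Context {om : 'cV[R]_d -> R}.
Hypothesis hom : cheng_yau Os om.
Hypothesis d0 : (0 < d)%N.
Implicit Types (x y z : 'cV[R]_d) (X : 'cV[R]_(d + 1)) (t : R).
Variable s : 'cV[R]_d -> R.
Hypothesis cs : forall y, Os y -> {for y, continuous s}.
Hypothesis es : extends Os s.
Variables (f : 'cV[R]_d -> R) (U : R).
Hypothesis cf : forall y, Os y -> {for y, continuous f}.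
Hypothesis fU : forall y, Os y -> `|f y| <= U * `|om y|.
Variables (c Q : set 'cV[R]_d).
Hypotheses (mc : borel_set c) (cQ : compact Q) (QO : Q `<=` Os) (cQs : c `<=` Q).
Local Notation hu := (huniq (Om := Om) s).
Local Notation hp := (hpick (Om := Om) s).
Local Notation dens := (density (Om := Om) s f c).
Local Notation out := (outside (Om := Om) (om := om) s f c).

Let fpre (B : set R) : measurable (B : set (measurableTypeR R)) ->
  borel_set (c `&` [set y | B (- f y)]).
Proof.
move=> mB.
have mf := open_continuous_borel (dual_open HO) cf mc (subset_trans cQs QO).
have mg : measurable_fun (c : set (borel R d)) (fun y : borel R d => - f y : measurableTypeR R).
  by apply: measurableT_comp mf; exact: oppr_measurable.
exact: (mg mc B mB).
Qed.

Lemma density_measurable : measurable_fun [set: borel R d] (dens : borel R d -> measurableTypeR R).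
Proof.
move=> _ B mB; rewrite setTI.
have hin x : hu x -> c (hp x) -> dens x = - f (hp x) by exact: density_in.
have hout x : ~ (hu x /\ c (hp x)) -> dens x = 0.
  by rewrite /density; case: (pselect (hu x /\ c (hp x))).
(* [dens] is 0 wherever [hpick] is not controlled; if 0 is in [B] it is therefore the complement of
   the preimage that is described by [hpick]. *)
have [B0|B0] := pselect (B 0).
  rewrite (_ : _ @^-1` _ = ~` [set x | hu x /\ (c `&` [set y | (~` B) (- f y)]) (hp x)]).
    apply: borelC; apply: (hpick_borel HO d0 es); apply: fpre; exact: measurableC.
  apply/seteqP; split => x /=.
    by move=> Bx [ux [cx nx]]; apply: nx; rewrite -(hin x ux cx).
  move=> nx; have [h|h] := pselect (hu x /\ c (hp x)); last by rewrite hout.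
  case: h => ux cx; rewrite (hin x ux cx); apply: contrapT => nB; exact: nx.
rewrite (_ : _ @^-1` _ = [set x | hu x /\ (c `&` [set y | B (- f y)]) (hp x)]).
  by apply: (hpick_borel HO d0 es); exact: fpre.
apply/seteqP; split => x /=.
  have [h|h] := pselect (hu x /\ c (hp x)); last by rewrite hout.
  by case: h => ux cx; rewrite (hin x ux cx).
by move=> [ux [cx Bx]]; rewrite (hin x ux cx).
Qed.

Lemma volume_limit :
  vol [set x | hu x /\ (closure c `\` c°) (hp x)] = 0%E ->
  (lebn d0).-integrable [set: borel R d] (EFin \o dens) /\
  ((vol (out t) - vol (out 0)) * (t^-1)%:E)%E @[t --> (0 : R)^'] --> (\int[lebn d0]_x (dens x)%:E)%E.
Proof.
move=> b0.
have [C C0 hC] := outside_bounded HO hom d0 cs es cf fU cQ QO cQs.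
have mout t : borel_set (out t) by exact: (outside_borel HO hom cs es cf fU mc).
have [M M0 hM] := zext_bounded HO hom es cf fU.
pose secN x := section_length (cnonuniq (om := om) (Om := Om) s) x.
have mcn : borel_set (cnonuniq (om := om) (Om := Om) s) by exact: (cnonuniq_borel HO hom cs es).
have msecN : measurable_fun [set: borel R d] (secN : borel R d -> \bar R).
  exact: measurable_section_fun.
(* Three exceptional sets: several maximizers of the height, a contact direction on the boundary of
   [c], and vertical lines that meet the nonuniqueness set in positive length. The last one is null
   by Fubini's theorem. *)
pose N := (~` hu `|` [set x | hu x /\ (closure c `\` c°) (hp x)]) `|` [set x | secN x != 0%E].
have mN3 : borel_set [set x | secN x != 0%E].
  rewrite (_ : [set x | secN x != 0%E] = ~` (secN @^-1` [set 0%E])); last first.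
    by apply/seteqP; split => x /= /eqP.
  by apply: borelC; rewrite -[X in borel_set X]setTI; apply: (msecN measurableT); exact: emeasurable_set1.
have mb : borel_set (closure c `\` c°).
  by apply: borelD; [apply: closed_borel; exact: closed_closure|apply: open_borel; exact: open_interior].
have mN2 := hpick_borel HO d0 es mb.
have [mN1 N10] := hnonuniq_null HO d0 es.
have mN : borel_set N by apply: borelU => //; exact: borelU.
have N30 : vol [set x | secN x != 0%E] = 0%E.
  have /(ae_eq_integral_abs (lebn d0) measurableT msecN) : (\int[lebn d0]_x `|secN x|)%E = 0%E.
    under eq_integral do rewrite gee0_abs ?measure_ge0//.
    rewrite -vol_section_length//; exact: (cnonuniq_null HO hom cs es).
  move=> [A [mA A0 sA]]; apply: (vol0_sub _ A0); apply: subset_trans sA => x /= x0 /(_ I) /eqP.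
  by rewrite (negbTE x0).
have N0 : vol N = 0%E.
  exact: (vol0_setU (vol0_setU N10 b0) N30).
have z1 : `|0 : R| <= 1 by rewrite normr0.
have fin x t : `|t| <= 1 -> (outside_length (Om := Om) (om := om) s f c t x < +oo)%E.
  by move=> t1; apply: le_lt_trans (section_length_fin x (mout t) (fun X => hC t X t1) C0).1 (ltry _).
have key (tn : nat -> R) : (forall k, tn k != 0 /\ `|tn k| <= 1) -> tn k @[k --> \oo] --> (0 : R) ->
    (lebn d0).-integrable [set: borel R d] (EFin \o dens) /\
    ((vol (out (tn k)) - vol (out 0)) * ((tn k)^-1)%:E)%E @[k --> \oo] --> (\int[lebn d0]_x (dens x)%:E)%E.
  move=> tn1 tnz.
  apply: (@section_volume_limit R d d0 (fun k => out (tn k)) (out 0) tn dens C M N) => //.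
  - by move=> k X; apply: hC; have [] := tn1 k.
  - by move=> X; exact: hC.
  - by move=> k; have [] := tn1 k.
  - move=> k x; have [_ k1] := tn1 k.
    apply: le_trans (height_lipschitz HO hom es cf fU (tn k) x hM).
    have h0E : height (Om := Om) (fun y => s y + 0 * f y) x = height (Om := Om) s x.
      by congr (height _ _); apply/funext => w; rewrite mul0r addr0.
    have f1 := fin x _ k1; have f0 := fin x 0 z1.
    rewrite -h0E; move: f1 f0; rewrite /outside_length /section_length.
    rewrite (outside_section HO hom es cf fU c (tn k) x) (outside_section HO hom es cf fU c 0 x) => f1 f0.
    have mS : measurable [set a : measurableTypeR R | region s c (lift1 x a)] := measurable_section x (region_borel HO hom cs es mc).
    have [h _ _] := below_change (N := set0) mS measurable0 (measure0 lebesgue_measure) f0 f1.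
    exact: h.
  - exact: density_measurable.
  - move=> x nN; have ux : hu x by apply: contrapT => nu; apply: nN; left; left.
    have nb : ~ (closure c `\` c°) (hp x) by move=> hb; apply: nN; left; right.
    have n0 : secN x = 0%E by apply: contrapT => /eqP h; apply: nN; right.
    have bd : Os (hp x) -> c° (hp x) \/ ~ closure c (hp x).
      move=> _; have [?|ni] := pselect (c° (hp x)); [by left|right => cx; exact: nb].
    have lim := density_limit HO hom cs es cf fU mc QO cQs (fin x) ux n0 bd.
    apply/cvgrPdist_le => e e0; have [dl dl0 hdl] := lim e e0.
    have : \forall k \near \oo, `|tn k| < dl.
      have := cvgr0_norm_lt tn tnz dl dl0; exact.
    apply: filterS => k kd; rewrite distrC; apply: hdl => //.
    by have [] := tn1 k.
split.
  have [] := key (fun k => k.+1%:R^-1).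
  - move=> k; split; first by rewrite gt_eqF// invr_gt0.
    by rewrite ger0_norm// invf_le1// ler1n.
  - exact: cvg_harmonic.
  - by [].
by apply: dnbhs_sequentially => tn h1 h2; exact: (key tn h1 h2).2.
Qed.

End volume_limit.

(** * Normal neighborhoods *)

Section normal_neighborhoods.
Context {R : realType} {d : nat} {Om : set 'cV[R]_d} {G : set 'M[R]_(d + 1)}.
Hypothesis (HO : pointed_domain Om) (HG : dividing_group G Om).
Let Os := dual_domain Om.
Context {om : 'cV[R]_d -> R}.
Hypothesis hom : cheng_yau Os om.
Let oOs : open Os := dual_open HO.
Let cOs : convexV Os := @dual_convex R d Om.
Implicit Types (x y z : 'cV[R]_d) (X P : 'cV[R]_(d + 1)) (t e r : R) (b c : set 'cV[R]_d).
Local Notation N := (affine_normal om).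

(** A deficit of the convex function [phi] below the tangent of - r om would grow linearly along the
    segment from [y] to [z], while - r om leaves its tangent only quadratically; [phi] would get
    below - r om near [y]. *)
Lemma convex_tangent (phi : 'cV[R]_d -> R) y z r : convexF Os phi -> Os y -> Os z ->
  (forall w, Os w -> - (r * om w) <= phi w) -> phi y = - (r * om y) ->
  - (r * dot (N y) (xi z)) <= phi z.
Proof.
move=> cphi Oy Oz le e; rewrite (normalE hom z Oy).
set D := 'D_(z - y) om y.
rewrite leNgt; apply/negP => lt.
have [r1 r10 ht] := om_taylor oOs hom (z - y) Oy ltr01.
pose q := qform (hessian om y) (z - y) / 2.
pose C := `|r| * (`|q| + 1) + 1.
have C0 : 0 < C by rewrite ltr_wpDl// mulr_ge0// addr_ge0.
pose gap := - (r * (om y + D)) - phi z.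
have gap0 : 0 < gap by rewrite subr_gt0.
pose t := Order.min (r1 / 2) (Order.min 1 (gap / (2 * C))).
have t0 : 0 < t by rewrite !lt_min ltr01 !divr_gt0// mulr_gt0.
have t1 : t <= 1 by rewrite /t !ge_min lexx !orbT.
have tr : `|t| < r1.
  rewrite gtr0_norm//; apply: (@le_lt_trans _ _ (r1 / 2)); first by rewrite /t ge_min lexx.
  by rewrite ltr_pdivrMr// ltr_pMr// ltr1n.
have tg : t * C <= gap / 2.
  have : t <= gap / (2 * C) by rewrite /t !ge_min lexx !orbT.
  by move=> /(ler_wpM2r (ltW C0)); rewrite invfM mulrA divfK// gt_eqF.
have lw := ht t tr; rewrite scale0r addr0 mul1r -/D -/q in lw.
have tz : y + t *: (z - y) = t *: z + (1 - t) *: y.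
  by rewrite scalerBr scalerBl scale1r addrCA addrA addrC addrA.
have t01 : 0 <= t <= 1 by rewrite ltW.
have Ow : Os (y + t *: (z - y)) by rewrite tz; exact: cOs.
have h1 := le _ Ow; have h2 := cphi z y t Oz Oy t01; rewrite -tz e in h2.
have h3 : r * (om (y + t *: (z - y)) - (om y + D * t)) <= `|r| * (`|q| + 1) * t ^+ 2.
  apply: le_trans (ler_norm _) _; rewrite normrM -mulrA ler_wpM2l//.
  rewrite mulrDl mul1r.
  rewrite (_ : _ - _ = om (y + t *: (z - y)) - (om y + D * t + q * t ^+ 2) + q * t ^+ 2); last by ring.
  apply: le_trans (ler_normD _ _) _; rewrite addrC lerD//.
  by rewrite normrM (ger0_norm (sqr_ge0 t)).
have h4 : t * gap <= `|r| * (`|q| + 1) * t ^+ 2.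
  rewrite /gap; move: h1 h2 h3; set W := om _; set B := `|r| * _ => h1 h2 h3.
  have -> : t * (- (r * (om y + D)) - phi z) =
    - (t * phi z + (1 - t) * - (r * om y)) - r * (om y + D * t) by ring.
  have := le_trans h1 h2; move: h3; rewrite mulrBr.
  set k := r * W; set l := r * (om y + D * t); set m := t * phi z + _; lra.
have h5 : gap <= `|r| * (`|q| + 1) * t.
  by move: h4; rewrite expr2 mulrA [X in _ <= X]mulrC (ler_pM2l t0).
have h6 : gap < t * C.
  apply: le_lt_trans h5 _; rewrite (_ : t * C = `|r| * (`|q| + 1) * t + t) ?ltrDl//; rewrite /C; ring.
have := lt_le_trans h6 tg; lra.
Qed.

Context {Gt : set (affmap R (d + 1))} {tau : 'M[R]_(d + 1) -> 'cV[R]_(d + 1)}.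
Hypothesis HT : translation_part Gt G tau.
Variable K : set 'cV[R]_(d + 1).
Hypothesis HK : tau_convex (cone Om) Gt K.
Let s := support_fun K.
Let es : extends Os s := support_extends HO HG hom HT HK.
Let vs : convexF Os s := support_convex HO HK.
Let KE : K = domain_of Os s := support_domain HO HG hom HT HK.
Local Notation cval := (aval (cal om) (cbe om s)).
Local Notation cmax := (amax Os (cal om) (cbe om s)).

Lemma support_continuous y : Os y -> {for y, continuous s}.
Proof. exact: (convex_continuous oOs vs). Qed.

Lemma K_lt X y : K X -> Os y -> dot X (xi y) < s y.
Proof. by rewrite KE => h Oy; have := h y (subset_closure Oy); rewrite extend_in. Qed.

Lemma cval_lt0 X y : K X -> Os y -> cval X y < 0.
Proof. by move=> KX Oy; rewrite (cval_lt hom s X _ Oy) mul0r subr0; exact: K_lt. Qed.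

(** For X = P + t N(y), the inequality N(y) . xi <= om gives X . xi <= s + t om, with equality at
    [y]; so the maximal value is - t and [y] realizes it. *)
Lemma normal_nbhd_cmax e b X : b `<=` Os -> normal_nbhd om K e b X ->
  K X /\ exists y, [/\ b y, cmax X y & - e < cval X y].
Proof.
move=> bO [P [y [t [by_ /andP[t0 te] bP [HK0 _] XE]]]]; have Oy := bO _ by_.
have lt X0 : K X0 -> dot X0 (xi y) < dot P (xi y).
  move=> KX0; rewrite ltNge; apply/negP; rewrite le_eqVlt => /orP[/eqP h|h].
    have : (hyperplane (lift1 y (-1)) (dot (lift1 y (-1)) P) `&` K) X0 by split => //; rewrite /hyperplane /= !(dotC (lift1 y _)).
    by rewrite HK0.
  have : (hyperplane (lift1 y (-1)) (dot (lift1 y (-1)) P) `&` K) (X0 + (dot X0 (xi y) - dot P (xi y)) *: up).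
    split; last by apply: (K_up HO HK) => //; rewrite subr_gt0.
    rewrite /hyperplane /= !(dotC (lift1 y _)) -/(xi y) dotDl dotZl dot_up; ring.
  by rewrite HK0.
have cP : closure K P by case: bP.
have Ps : dot P (xi y) = s y.
  apply/eqP; rewrite eq_le (support_ge HO HK Oy cP) /=; apply: (support_le HK) => X0 /lt; exact: ltW.
have coneN : cone Om (t *: N y).
  rewrite (normal_dirE HO hom Oy) scalerA; exists (normal_dir (om := om) y), (t * last_coord (N y)); split => //.
    exact: (normal_dir_Om HO hom Oy).
  by rewrite mulr_gt0// (normal_last_gt0 HO hom Oy).
have le z : Os z -> dot X (xi z) <= s z + t * om z.
  move=> Oz; rewrite XE dotDl dotZl; apply: lerD; first exact: (support_ge HO HK Oz cP).
  by rewrite (ler_pM2l t0); exact: (normal_le HO hom Oy Oz).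
have ey : dot X (xi y) = s y + t * om y by rewrite XE dotDl dotZl Ps (normal_eq hom Oy).
have vy : cval X y = - t.
  apply/eqP; rewrite eq_le (cval_le hom s X _ Oy) mulNr opprK ey lexx /= leNgt.
  by rewrite (cval_lt hom s X _ Oy) mulNr opprK ey ltxx.
split; first by rewrite XE; exact: (closure_cone HO HK).
exists y; split => //; last by rewrite vy ltrN2.
by split => // z Oz; rewrite vy (cval_le hom s X _ Oz) mulNr opprK le.
Qed.

(** The foot point is X - r N(y), with - r the maximal value. [convex_tangent] replaces r om by r
    times its tangent at [y], which shows that the foot point lies below [s] in every direction. *)
Lemma cmax_normal_nbhd e b X y : b `<=` Os -> K X -> b y -> cmax X y -> - e < cval X y ->
  normal_nbhd om K e b X.
Proof.
move=> bO KX by_ [Oy my] ey; set r := - cval X y.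
have r0 : 0 < r by rewrite oppr_gt0 cval_lt0.
pose P := X - r *: N y.
have vr : cval X y = - r by rewrite opprK.
have Xy : dot X (xi y) = s y + r * om y by rewrite (cval_eq hom s X Oy) vr mulNr opprK.
have le z : Os z -> dot P (xi z) <= s z.
  move=> Oz; rewrite dotBl dotZl.
  suff : - (r * dot (N y) (xi z)) <= s z - dot X (xi z) by lra.
  apply: (convex_tangent (phi := fun w => s w - dot X (xi w)) _ Oy Oz).
  - move=> u w a Ou Ow a01; rewrite xi_conv dotDr !dotZr.
    have := vs Ou Ow a01; set A := s (_ + _); lra.
  - move=> w Ow; have := my w Ow; rewrite vr (cval_le hom s X _ Ow) mulNr; lra.
  - rewrite Xy; ring.
have Py : dot P (xi y) = s y by rewrite dotBl dotZl Xy (normal_eq hom Oy); ring.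
have leH z : closure Os z -> dot P (xi z) <= extend Os s z.
  move=> cz; have pz : ProperFilter (within Os (nbhs z)) := within_nbhs_proper cz.
  apply: (ler_cvg_to _ (es cz)); last first.
    by near=> w; apply: le; near: w; exact: withinT.
  apply: cvg_dot; first exact: cvg_cst.
  apply: cvg_within_filter; exact: xi_continuous.
have cP : closure K P.
  apply/closureE_ball => e0 e00.
  have u0 : 0 < `|@up R d| + 1 by rewrite ltr_wpDl.
  exists (P + (e0 / (`|@up R d| + 1)) *: up).
    rewrite KE; exact: (domain_up (divr_gt0 e00 u0) leH).
  rewrite opprD addrA subrr sub0r normrN normrZ gtr0_norm ?divr_gt0//.
  by rewrite mulrAC ltr_pdivrMr// ltr_pM2l// ltrDl.
have nP : ~ K P by move=> /K_lt /(_ Oy); rewrite Py ltxx.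
have bP : boundary K P.
  split => //; rewrite (_ : K° = K)//; apply/interior_id; exact: (K_open HK).
exists P, y, r; split => //.
- by rewrite r0 /= ltrNl.
- split; last by exists P.
  apply/seteqP; split => // Z [hZ KZ]; have := K_lt KZ Oy.
  by rewrite -Py [X in X < _]dotC [X in _ < X]dotC [X in X < _](hZ : _ = _) ltxx.
- by rewrite /P subrK.
Unshelve. all: by end_near. Qed.

Lemma cmax_uniq X : K X -> uniq_max Os (cal om) (cbe om s) X.
Proof.
move=> KX y z my mz; apply: (cmax_unique HO hom vs my mz); apply: cval_lt0 => //; by case: my.
Qed.

Let omU y : Os y -> `|om y| <= 1 * `|om y|. Proof. by rewrite mul1r. Qed.
Let com y : Os y -> {for y, continuous om}. Proof. exact: (om_continuous hom). Qed.
Local Notation out e c := (outside (Om := Om) (om := om) s om c e).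

Lemma K0E : domain_of Os (fun y => s y + 0 * om y) = K.
Proof. by rewrite KE; congr domain_of; apply/funext => y; rewrite mul0r addr0. Qed.

Let KD : K `<=` outer_domain (Om := Om) s.
Proof.
move=> X; rewrite -K0E => /(perturb_domain hom es (@scaled_cont R d Om om com 0)
  (@scaled_bound R d Om om om 1 omU 0)) [].
by [].
Qed.

Lemma normal_nbhd_outside e c : c `<=` Os ->
  normal_nbhd om K e c `<=` out e c `\` out 0 c.
Proof.
move=> cO X /(normal_nbhd_cmax cO) [KX [y [cy my ye]]]; split; last first.
  by move=> [[_ nK] _]; apply: nK; rewrite K0E.
have uX := cmax_uniq KX.
split; last by split; [exact: KD|exact: uX|rewrite /cpick (pick_maxE uX my)].
split; first exact: KD.
move=> /(perturb_domain hom es (@scaled_cont R d Om om com e) (@scaled_bound R d Om om om 1 omU e)) [_ h].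
have [Oy _] := my; have := h y Oy; rewrite -[X in s y + X]opprK -mulNr -(cval_lt hom s X _ Oy).
by move=> /(lt_trans ye); rewrite ltxx.
Qed.

(** The larger [e'] is there because being outside of a perturbed domain allows the maximal value -
    e, whereas the width of a normal neighborhood is a strict bound. *)
Lemma outside_normal_nbhd e e' c : c `<=` Os -> 0 < e < e' ->
  out e c `\` out 0 c `<=` normal_nbhd om K e' c.
Proof.
move=> cO /andP[e0 ee] X [[[DX nK] rX] nO].
have KX : K X by apply: contrapT => nX; apply: nO; rewrite /outside K0E.
have [_ uX cX] := rX; have [y my] := cmax_nonempty HO hom support_continuous es DX.
rewrite /cpick (pick_maxE uX my) in cX.
apply: (cmax_normal_nbhd cO KX cX my).
apply: lt_le_trans (perturb_domain_ge hom es (@scaled_cont R d Om om com e)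
  (@scaled_bound R d Om om om 1 omU e) DX my nK).
by rewrite ltrN2 mulr1 gtr0_norm.
Qed.

End normal_neighborhoods.

(** * The area measure *)

Section measure_lemmas.
Context {R : realType}.

(** Only finitely many disjoint subsets of [Q] can have measure at least 1 / (n + 1). *)
Lemma disjoint_levels_countable {d : measure_display} {T : measurableType d}
    (mu : {measure set T -> \bar R}) (L : R -> set T) (Q : set T) :
  measurable Q -> (mu Q < +oo)%E -> (forall r, measurable (L r)) -> (forall r, L r `<=` Q) ->
  (forall r r' x, L r x -> L r' x -> r = r') -> countable [set r | mu (L r) != 0%E].
Proof.
move=> mQ fQ mL LQ dL.
pose A (n : nat) : set R := [set r | (n.+1%:R^-1%:E <= mu (L r))%E].
apply: (@sub_countable _ _ _ (\bigcup_n A n)).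
  apply: subset_card_le => r /= r0.
  have fL : mu (L r) \is a fin_num.
    rewrite ge0_fin_numE//; apply: le_lt_trans fQ; apply: le_measure; rewrite ?inE//; exact: LQ.
  have p0 : 0 < fine (mu (L r)).
    by rewrite lt_neqAle fine_ge0// andbT eq_sym; apply: contraNneq r0 => h; rewrite -(fineK fL) h.
  exists (Num.truncn (fine (mu (L r)))^-1) => //; rewrite /A /= -[X in (_ <= X)%E]fineK// lee_fin.
  rewrite invf_ple ?posrE//; apply/ltW; exact: truncnS_gt.
apply: bigcup_countable => // n _; apply: finite_set_countable.
apply: contrapT => /infiniteP /pcard_leP [g].
have inj k k' : g k = g k' -> k = k' by move=> h; apply: (@inj _ _ _ g) => //; rewrite inE.
have gA k : A n (g k) by exact: (@funS _ _ _ _ g).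
pose F k := L (g k).
have tF : trivIset setT F.
  by move=> i j _ _ [x [Fi Fj]]; apply: inj; exact: (dL _ _ x).
have mF k : measurable (F k) by exact: mL.
have sub : \bigcup_k F k `<=` Q by move=> x [k _ /LQ].
have mUF : measurable (\bigcup_k F k) := bigcupT_measurable _ mF.
have le : (mu (\bigcup_k F k) <= mu Q)%E by apply: le_measure; rewrite ?inE.
have sumF := @measure_semi_bigcup _ _ _ mu F mF tF mUF.
have sum_le N : ((N%:R / n.+1%:R)%:E <= mu Q)%E.
  apply: le_trans le; rewrite sumF.
  apply: (@le_trans _ _ (\sum_(0 <= k < N) mu (F k))%E); last first.
    by apply: nneseries_lim_ge => k *; exact: measure_ge0.
  rewrite -(subn0 N) -[X in (X%:R / _)]/(N - 0)%N.
  elim: N => [|N IH]; first by rewrite big_nil mul0r.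
  rewrite big_nat_recr//= subn0 -natr1 mulrDl EFinD; rewrite subn0 in IH.
  by apply: leeD => //; rewrite div1r; exact: gA.
have fin : mu Q \is a fin_num by rewrite ge0_fin_numE.
have := sum_le (Num.truncn (fine (mu Q) * n.+1%:R)).+1.
rewrite -(fineK fin) lee_fin ler_pdivrMr// leNgt => /negP; apply.
exact: truncnS_gt.
Qed.

(** The exceptional levels are countable, hence of Lebesgue measure 0, and cannot fill an
    interval. *)
Lemma null_level {d : measure_display} {T : measurableType d}
    (mu : {measure set T -> \bar R}) (L : R -> set T) (Q : set T) (a b : R) :
  measurable Q -> (mu Q < +oo)%E -> (forall r, measurable (L r)) -> (forall r, L r `<=` Q) ->
  (forall r r' x, L r x -> L r' x -> r = r') -> a < b -> exists2 r, a < r < b & mu (L r) = 0%E.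
Proof.
move=> mQ fQ mL LQ dL ab; apply: contrapT => ne.
have c := countable_lebesgue_measure0 (disjoint_levels_countable mQ fQ mL LQ dL).
have : (lebesgue_measure `]a, b[%classic <= (0 : \bar R))%E.
  rewrite -c; apply: le_outer_measure => r; rewrite /= in_itv /= => rab.
  by apply/eqP => h; apply: ne; exists r.
by rewrite lebesgue_measure_itv /= lte_fin ab -EFinB lee_fin subr_le0 leNgt ab.
Qed.

Lemma weighted_image {d d' : measure_display} {X : measurableType d} {Y : measurableType d'}
    (mu : {measure set X -> \bar R}) (S : set X) (phi : X -> Y) (w : X -> \bar R) :
  (forall b, measurable b -> measurable [set x | S x /\ b (phi x)]) ->
  measurable_fun S w -> (forall x, S x -> (0 <= w x)%E) ->
  exists m : {measure set Y -> \bar R}, forall b,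
    m b = (\int[mu]_(x in [set x | S x /\ b (phi x)]) w x)%E.
Proof.
move=> mS mw w0; pose m b := (\int[mu]_(x in [set x | S x /\ b (phi x)]) w x)%E.
have m0 : m set0 = 0%E by rewrite /m (_ : [set x | _] = set0) ?integral_set0//; apply/seteqP; split => // x [].
have mge0 b : (0 <= m b)%E by apply: integral_ge0 => x [/w0].
have msum : semi_sigma_additive m.
  move=> F mF tF mUF.
  have -> : m (\bigcup_n F n) = (\sum_(0 <= i <oo) m (F i))%E.
    rewrite /m -ge0_integral_bigcup//.
    - by congr integral; apply/seteqP; split => x; [move=> [Sx [k _ Fk]]; exists k|move=> [k _ [Sx Fk]]; split => //; exists k].
    - by move=> k; exact: mS.
    - apply: (measurable_funS _ _ mw) => //.
        rewrite -[X in measurable X](_ : [set x | S x /\ setT (phi x)] = _); first exact: mS.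
        by apply/seteqP; split => x // [].
      by move=> x [k _ []].
    - by move=> x [k _ [/w0]].
    - by move=> i j _ _ [x [[_ Fi] [_ Fj]]]; apply: tF => //; exists (phi x).
  by apply: is_cvg_nneseries => k _ _; exact: mge0.
pose mm : {measure set Y -> \bar R} := HB.pack m (isMeasure.Build _ _ _ m m0 mge0 msum).
by exists mm.
Qed.

(** Cutting [b] into levels of [u] of thickness [e] and adding up gives |D b| <= e A(b). This
    compares two integrals over different spaces when all that is known is that both lie between the
    same multiples of A. *)
Lemma thin_level_zero {d : measure_display} {T : measurableType d} (D : set T -> R) (A : set T -> R)
    (b : set T) (u : T -> R) (U : R) : measurable b -> measurable_fun b u ->
  (forall x, b x -> `|u x| <= U) ->
  (forall c c', measurable c -> measurable c' -> c `|` c' `<=` b -> c `&` c' = set0 ->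
     D (c `|` c') = D c + D c' /\ A (c `|` c') = A c + A c') ->
  (forall c m M, measurable c -> c `<=` b -> (forall x, c x -> m <= u x <= M) ->
     `|D c| <= (M - m) * A c) ->
  D b = 0.
Proof.
move=> mb mu bU add thin.
suff small (e : R) : 0 < e -> `|D b| <= e * A b.
  apply/eqP; rewrite -normr_le0 leNgt; apply/negP => p.
  have A0 : 0 < A b.
    have := small 1 ltr01; rewrite mul1r; exact: lt_le_trans.
  have e0 : 0 < `|D b| / (2 * A b) by rewrite divr_gt0// mulr_gt0.
  have := small _ e0; rewrite invfM mulrA mulfVK ?gt_eqF// => h; lra.
move=> e0; pose T_ (j : nat) := b `&` [set x | u x < - U + e * j%:R].
have mT j : measurable (T_ j).
  rewrite /T_ (_ : [set x | u x < _] = u @^-1` `]-oo, - U + e * j%:R[%classic); first by apply: mu.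
  by apply/seteqP; split => x /=; rewrite in_itv.
have D0 : D set0 = 0 /\ A set0 = 0.
  have [] := add set0 set0 measurable0 measurable0; rewrite ?setU0 ?setI0//.
  by rewrite -[LHS]addr0 => /addrI <-; rewrite -[LHS]addr0 => /addrI <-.
have step j : `|D (T_ j)| <= e * A (T_ j).
  elim: j => [|j IH].
    rewrite (_ : T_ 0%N = set0); first by rewrite !D0.1 D0.2 normr0 mulr0.
    apply/seteqP; split => // x [bx] /=; rewrite mulr0 addr0 => h.
    by have := bU x bx; rewrite ler_norml leNgt h.
  pose c := T_ j.+1 `\` T_ j.
  have mc : measurable c by exact: measurableD.
  have jj : - U + e * j.+1%:R - (- U + e * j%:R) = e by rewrite -natr1; ring.
  have E : T_ j.+1 = T_ j `|` c.
    apply/seteqP; split => x.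
      by have [h|h] := pselect (T_ j x); [left|right].
    move=> [[bx h]|[]//]; split => //=; apply: lt_le_trans h _; rewrite -subr_ge0 jj; exact: ltW.
  have cb : T_ j `|` c `<=` b by move=> x [[]//|[[]]].
  have [eD eA] : D (T_ j `|` c) = D (T_ j) + D c /\ A (T_ j `|` c) = A (T_ j) + A c.
    by apply: add => //; apply/seteqP; split => // x [h [_ ]].
  rewrite E eD eA mulrDr; apply: le_trans (ler_normD _ _) _; apply: lerD => //.
  rewrite -[X in X * A c]jj; apply: thin => // [x [[]]//|x [[bx h] nj]].
  rewrite (ltW h) andbT leNgt; apply/negP => h'; exact: nj.
pose n := (Num.truncn ((2 * U + 1) / e)).+1.
have <- : T_ n = b; last exact: step.
apply/seteqP; split => [x []//|x bx]; split => //=.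
have := truncnS_gt ((2 * U + 1) / e); rewrite ltr_pdivrMr// => h.
have := bU x bx; rewrite ler_norml => /andP[_ h2].
by rewrite mulrC; move: h h2; rewrite -/n; set v := _ * e; move: (u x) => w; lra.
Qed.

End measure_lemmas.

Lemma compact_thickening {R : realType} {n : nat} (c U : set 'cV[R]_n) : compact c -> open U ->
  c `<=` U -> exists2 r : R, 0 < r & forall p y, c p -> `|y - p| <= r -> U y.
Proof.
move=> cc oU cU.
have [q cq|M M' z _|r [_ [r0 h]]] := compact_uniform (P := fun _ y => U y) cc => //.
  have [e e0 he] := openE_ball oU (cU q cq); exists (e / 2), 0; split; first exact: divr_gt0.
  by move=> z hz; apply: he; rewrite distrC; apply: le_lt_trans hz _; rewrite ltr_pdivrMr// ltr_pMr// ltr1n.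
by exists r.
Qed.

Definition thickening {R : realType} {n : nat} (c : set 'cV[R]_n) (r : R) : set 'cV[R]_n :=
  [set y | exists2 p, c p & `|y - p| < r].

Section thickenings.
Context {R : realType} {n : nat}.
Implicit Types (c : set 'cV[R]_n) (r : R).

Lemma thickening_open c r : open (thickening c r).
Proof.
apply: open_ballE => y [p cp h]; exists (r - `|y - p|); first by rewrite subr_gt0.
move=> z hz; exists p => //; rewrite -(subrK y z) -addrA.
by apply: le_lt_trans (ler_normD _ _) _; rewrite -ltrBrDr distrC.
Qed.

Lemma closure_thickening c r r' : r < r' -> closure (thickening c r) `<=` thickening c r'.
Proof.
move=> rr y /closureE_ball cy; have e0 : 0 < r' - r by rewrite subr_gt0.
have [z [p cp zp] yz] := cy _ e0; exists p => //.
rewrite -(subrK z y) -addrA; apply: le_lt_trans (ler_normD _ _) _; lra.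
Qed.

Lemma thickening_bigcap c (rn : nat -> R) : closed c -> (forall k, 0 < rn k) ->
  rn k @[k --> \oo] --> (0 : R) -> \bigcap_k thickening c (rn k) = c.
Proof.
move=> cc r0 rl; apply/seteqP; split => y; last first.
  by move=> cy k _; exists y => //; rewrite subrr normr0.
move=> h; rewrite (closure_id c).1//; apply/closureE_ball => e e0.
have [k _ hk] := cvgr0_norm_lt _ rl e e0.
have [p cp yp] := h k I; exists p => //; apply: lt_trans yp _.
by have := hk k (leqnn k); rewrite /= ger0_norm// ltW.
Qed.

End thickenings.

(** [v] is the volume of the normal neighborhood, a e + O(e^2), and e w(e) that of the region
    between two domains. They interlace only for e < e', and the choice e' = (1 + eta) e costs a
    factor that tends to 1. *)
Lemma area_squeeze {R : realType} (a i B : R) (v w : R -> R) : 0 <= B ->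
  (forall e, 0 < e <= 1 -> `|v e / e - a| <= e * B) ->
  (forall e, 0 < e <= 1 -> v e <= e * w e) ->
  (forall e e', 0 < e <= 1 -> e < e' -> e * w e <= v e') ->
  w t @[t --> (0 : R)^'+] --> i -> a = i.
Proof.
move=> B0 hB vw wv lim.
have key (eta : R) : 0 < eta -> eta < 1 -> a <= i + 2 * eta /\ i <= a + eta * (`|a| + 3).
  move=> h0 h1; have B1 : 0 < 2 * B + 1 by rewrite ltr_wpDl// mulr_ge0.
  have wl := (cvgrPdist_le _ _).1 lim eta h0.
  have : \forall e \near (0 : R)^'+, [/\ 0 < e, e < 2^-1, e < eta / (2 * B + 1) & `|i - w e| <= eta].
    near=> e; have e0 : 0 < e by near: e; exact: nbhs_right_gt.
    have e2 : e < 2^-1 by near: e; apply: nbhs_right_lt; rewrite invr_gt0.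
    have e3 : e < eta / (2 * B + 1) by near: e; apply: nbhs_right_lt; exact: divr_gt0.
    by split => //; near: e; exact: wl.
  move=> /filter_ex [e [e0 e2 e3 ie]].
  have e1 : 0 < e <= 1 by rewrite e0 /=; apply: ltW; apply: lt_trans e2 _; rewrite invf_lt1// ltr1n//.
  pose e' := e * (1 + eta).
  have h2 : 1 < 1 + eta by rewrite ltrDl.
  have p0 : 0 < 1 + eta := lt_trans ltr01 h2.
  have ee : e < e' by rewrite ltr_pMr.
  have ee2 : e' < 2 * e by rewrite /e' [X in _ < X]mulrC ltr_pM2l//; move: h1; lra.
  have e1' : 0 < e' <= 1.
    rewrite (lt_trans e0 ee) /=; apply: ltW; apply: lt_trans ee2 _.
    by rewrite -ltr_pdivlMl// mulr1.
  have eB : 2 * e * B <= eta.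
    have : e * (2 * B + 1) < eta by rewrite -ltr_pdivlMr.
    move: e0 B0; nra.
  have b1 : a - eta <= v e / e.
    have := hB e e1; rewrite ler_norml => /andP[h _].
    have : e * B <= eta by apply: le_trans eB; rewrite -mulrA ler_peMl ?mulr_ge0 ?(ltW e0)// ler1n.
    by move: h; lra.
  have b2 : v e' / e' <= a + eta.
    have := hB e' e1'; rewrite ler_norml => /andP[_ h].
    have : e' * B <= eta by apply: le_trans eB; rewrite ler_wpM2r// ltW.
    by move: h; lra.
  have c1 : v e / e <= w e by rewrite ler_pdivrMr// mulrC; exact: vw.
  have c2 : w e <= (1 + eta) * (v e' / e').
    have : w e <= v e' / e by rewrite ler_pdivlMr// mulrC; exact: wv.
    congr (_ <= _); rewrite /e' invfM; field.
    by rewrite !gt_eqF.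
  move: ie; rewrite ler_norml => /andP[i1 i2]; split; first by move: b1 c1 i1; lra.
  have : w e <= (1 + eta) * (a + eta) by apply: le_trans c2 _; rewrite ler_wpM2l// ltW.
  have := ler_norm a; move: i2 h0 h1; nra.
apply/eqP; rewrite eq_le; apply/andP; split; apply/ler_addgt0Pr => eps eps0.
  pose eta := Order.min 2^-1 (eps / 2).
  have h0 : 0 < eta by rewrite lt_min invr_gt0 ltr0n divr_gt0.
  have h1 : eta < 1 by rewrite gt_min invf_lt1// ltr1n.
  have [h _] := key eta h0 h1; apply: le_trans h _; rewrite lerD2l -ler_pdivlMl// mulrC.
  by rewrite ge_min lexx orbT.
pose eta := Order.min 2^-1 (eps / (`|a| + 3)).
have a3 : 0 < `|a| + 3 by rewrite ltr_wpDl.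
have h0 : 0 < eta by rewrite lt_min invr_gt0 ltr0n divr_gt0.
have h1 : eta < 1 by rewrite gt_min invf_lt1// ltr1n.
have [_ h] := key eta h0 h1; apply: le_trans h _; rewrite lerD2l -ler_pdivlMr//.
by rewrite ge_min lexx orbT.
Unshelve. all: by end_near. Qed.

Section area_measures.
Context {R : realType} {d : nat} {Om : set 'cV[R]_d} {G : set 'M[R]_(d + 1)}.
Hypothesis (HO : pointed_domain Om) (HG : dividing_group G Om).
Let Os := dual_domain Om.
Context {om : 'cV[R]_d -> R}.
Hypothesis hom : cheng_yau Os om.
Hypothesis d0 : (0 < d)%N.
Let oOs : open Os := dual_open HO.
Implicit Types (x y z : 'cV[R]_d) (X P : 'cV[R]_(d + 1)) (t e r : R) (b c Q : set 'cV[R]_d).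
Context {Gt : set (affmap R (d + 1))} {tau : 'M[R]_(d + 1) -> 'cV[R]_(d + 1)}.
Hypothesis HT : translation_part Gt G tau.
Variable K : set 'cV[R]_(d + 1).
Hypothesis HK : tau_convex (cone Om) Gt K.
Let s := support_fun K.
Let es : extends Os s := support_extends HO HG hom HT HK.
Let cs y : Os y -> {for y, continuous s} := support_continuous HO HK (y := y).
Let omU y : Os y -> `|om y| <= 1 * `|om y|. Proof. by rewrite mul1r. Qed.
Let com y : Os y -> {for y, continuous om}. Proof. exact: (om_continuous hom). Qed.
Local Notation hu := (huniq (Om := Om) s).
Local Notation hp := (hpick (Om := Om) s).
Local Notation dens f c := (density (Om := Om) s f c).
Local Notation out e c := (outside (Om := Om) (om := om) s om c e).

Lemma compact_neighborhood c : compact c -> c `<=` Os -> exists W Q,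
  [/\ open W, c `<=` W, W `<=` Q, compact Q & Q `<=` Os].
Proof.
move=> cc cO.
have [[y1 cy1]|nc] := pselect (c !=set0); last first.
  exists set0, set0; split.
  - exact: open0.
  - by move=> y cy; case: nc; exists y.
  - by [].
  - exact: compact0.
  - by [].
have co : {within c, continuous om}.
  by apply/subspace_continuousP => y /cO Oy; apply: cvg_within_filter; exact: (om_continuous hom).
have [y0 + hy0] := compact_EVT_max (ex_intro _ y1 cy1) cc co.
rewrite inE => /cO /(om_lt0 hom) oy0.
pose k := Num.truncn (- om y0)^-1.
have hk : k.+1%:R^-1 < - om y0.
  rewrite invf_plt ?posrE ?oppr_gt0//; exact: truncnS_gt.
exists (Os `&` om @^-1` `]-oo, - k.+1%:R^-1[%classic), (osk (Om := Om) (om := om) k); split.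
- rewrite openE => y [Oy oy].
  have h1 : nbhs y Os by exact: open_nbhs_nbhs.
  have h2 : nbhs y (om @^-1` `]-oo, - k.+1%:R^-1[%classic).
    by apply: (om_continuous hom Oy); apply: open_nbhs_nbhs; split => //; exact: interval_open.
  exact: filterI h1 h2.
- move=> y cy; split; first exact: cO.
  rewrite /= in_itv /=; apply: le_lt_trans (hy0 y (mem_set cy)) _; by rewrite ltrNr.
- by move=> y [Oy]; rewrite /= in_itv /= => h; split => //; exact: ltW.
- exact: (osk_compact HO hom).
- by move=> y [].
Qed.

Lemma hpick_bounded Q : compact Q -> Q `<=` Os ->
  exists2 C : R, 0 < C & forall x, Q (hp x) -> `|x| <= C.
Proof.
move=> cQ QO; have [B B0 hB] := ext_bounded HO es.
have [C hC] := slope_bound HO B cQ QO.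
exists (`|C| + 1); first by rewrite ltr_wpDl.
move=> x Qx; have Ox := QO _ Qx.
have := hC (lift1 x (height (Om := Om) s x)) _ Qx.
rewrite /height dot_xi subKr; have cx := subset_closure Ox => h.
have : `|lift1 x (height (Om := Om) s x)| <= C.
  apply: h; first by have := hB _ cx; rewrite ler_norml => /andP[].
  move=> z Oz; rewrite dot_xi; have cz := subset_closure Oz.
  have h1 := height_ge HO es x cz; rewrite /height in h1.
  have := hB _ cz; rewrite ler_norml => /andP[_ h2].
  rewrite lerBlDr; rewrite lerBlDr in h1; apply: le_trans h1 _.
  by rewrite addrC lerD2r.
move=> hX; have := norm_usubmx (lift1 x (height (Om := Om) s x)); rewrite usubmx_lift => h2.
apply: le_trans h2 _; apply: le_trans hX _; apply: le_trans (ler_norm _) _; by rewrite lerDl.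
Qed.

Lemma hpick_fun_measurable (u : 'cV[R]_d -> R) (b : set 'cV[R]_d) : borel_set b -> b `<=` Os ->
  (forall y, Os y -> {for y, continuous u}) ->
  measurable_fun ([set x | hu x /\ b (hp x)] : set (borel R d)) (fun x : borel R d => u (hp x) : measurableTypeR R).
Proof.
move=> mb bO cu _ B mB.
have mu := open_continuous_borel oOs cu mb bO mb mB.
rewrite (_ : _ `&` _ = [set x | hu x /\ (b `&` u @^-1` B) (hp x)]); first exact: (hpick_borel HO d0 es).
by apply/seteqP; split => [x [[ux bx] Bx]|x [ux [bx Bx]]].
Qed.

Let densE f c x : dens f c x = if pselect (hu x /\ c (hp x)) then - f (hp x) else 0.
Proof. by []. Qed.

Lemma density_integral f c : borel_set c ->
  (\int[lebn d0]_x (dens f c x)%:E)%E =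
  (\int[lebn d0]_(x in [set x | hu x /\ c (hp x)]) (- f (hp x))%:E)%E.
Proof.
move=> mc; rewrite [RHS]integral_mkcond; apply: eq_integral => x _.
rewrite /patch densE; case: pselect => h; first by rewrite mem_set.
by rewrite memNset.
Qed.

(** The image under x |-> y(x) of - om(y(x)) dx, later identified with the area measure. It is
    written with [dens om] since this is the limit that [volume_limit] delivers for f = om. *)
Lemma contact_measure : exists m : {measure set (borel R d) -> \bar R},
  (forall c, borel_set c -> c `<=` Os -> m c = (\int[lebn d0]_x (dens om c x)%:E)%E) /\
  (forall Q, compact Q -> Q `<=` Os -> (m Q < +oo)%E).
Proof.
pose S : set (borel R d) := [set x | hu x /\ Os (hp x)].
have mOs : borel_set Os by exact: open_borel.
have mw : measurable_fun S (fun x : borel R d => (- om (hp x))%:E).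
  apply/measurable_EFinP; apply: measurableT_comp; first exact: oppr_measurable.
  exact: hpick_fun_measurable.
have w0 (x : borel R d) : S x -> (0 <= (- om (hp x))%:E)%E.
  by move=> [_ Ox]; rewrite lee_fin oppr_ge0 ltW// (om_lt0 hom).
have mS (b : set (borel R d)) : measurable b -> measurable ([set x | S x /\ b (hp x)] : set (borel R d)).
  move=> mb; rewrite (_ : [set x | _] = [set x | hu x /\ (b `&` Os) (hp x)]).
    by apply: (hpick_borel HO d0 es); exact: borelI.
  by apply/seteqP; split => x /=; [move=> [[ux Ox] bx]|move=> [ux [bx Ox]]].
have [m hm] := weighted_image (lebn d0) mS mw w0.
have mE c : c `<=` Os -> m c = (\int[lebn d0]_(x in [set x | hu x /\ c (hp x)]) (- om (hp x))%:E)%E.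
  move=> cO; rewrite hm; congr integral; apply/seteqP; split => x /=; first by move=> [[]].
  by move=> [ux cx]; split => //; split => //; exact: cO.
exists m; split => [c mc cO|Q cQ QO]; first by rewrite (density_integral om mc) mE.
have mQ : borel_set Q by apply: closed_borel; apply: compact_closed.
have [C C0 hC] := hpick_bounded cQ QO.
have co : {within Q, continuous om}.
  by apply/subspace_continuousP => y /QO Oy; apply: cvg_within_filter; exact: com.
have /compact_bounded [M [_ hM]] := continuous_compact co cQ.
rewrite mE//; have mSQ := hpick_borel HO d0 es mQ.
apply: (@le_lt_trans _ _ (\int[lebn d0]_(x in [set x | hu x /\ Q (hp x)]) (cst (`|M| + 1)%:E x))%E).
  apply: ge0_le_integral => //.
  - by move=> x [_ /QO Ox]; rewrite lee_fin oppr_ge0 ltW// (om_lt0 hom).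
  - apply/measurable_EFinP; apply: measurableT_comp; first exact: oppr_measurable.
    exact: hpick_fun_measurable.
  - move=> x [_ Qx]; rewrite lee_fin; apply: le_trans (ler_norm _) _; rewrite normrN.
    by apply: hM; [rewrite ltr_pwDr// ler_norm|exists (hp x)].
rewrite integral_cst//; apply: lte_mul_pinfty => //.
apply: le_lt_trans (cube_vol d0 (ltW C0)); apply: le_vol => x [_ Qx]; apply/(cubeE x (ltW C0)).
exact: hC.
Qed.

Variable S : 'I_d.+1 -> {measure set (borel R d) -> \bar R}.
Hypothesis hS : steiner_measures Os om K S.
Let A := S ord_max.

(** For the top index the binomial coefficient d + 1 cancels the factor 1 / (d + 1) and the power of
    e is 1. All lower indices carry at least e^2, whence the error e B for e <= 1. *)
Lemma area_limit c Q : borel_set c -> compact Q -> Q `<=` Os -> c `<=` Q ->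
  (forall e, 0 < e -> vol (normal_nbhd om K e c) \is a fin_num) /\
  exists2 B : R, 0 <= B & forall e, 0 < e <= 1 ->
    `|fine (vol (normal_nbhd om K e c)) / e - fine (A c)| <= e * B.
Proof.
move=> mc cQ QO cQs; have [fin st] := hS.
have mQ : borel_set Q by apply: closed_borel; apply: compact_closed.
have fc i : S i c \is a fin_num.
  by rewrite ge0_fin_numE//; apply: le_lt_trans (fin i Q cQ QO); apply: le_measure; rewrite ?inE.
pose a i := fine (S i c).
pose k (i : 'I_d.+1) : R := 'C(d.+1, i)%:R.
have E e : 0 < e -> vol (normal_nbhd om K e c) =
    (d.+1%:R^-1 * \sum_(i < d.+1) (e ^+ (d.+1 - i) * k i * a i))%:E.
  move=> e0; rewrite (st e c e0 mc (subset_trans cQs QO)) EFinM -sumEFin; congr (_ * _)%E.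
  by apply: eq_bigr => i _; rewrite (EFinM _ (a i)) fineK.
split; first by move=> e e0; rewrite E.
pose kk (i : 'I_d) : R := k (widen_ord (leqnSn d) i) * `|a (widen_ord (leqnSn d) i)|.
exists (d.+1%:R^-1 * \sum_(i < d) kk i).
  by rewrite mulr_ge0// ?invr_ge0// sumr_ge0// => i _; rewrite mulr_ge0// ler0n.
move=> e /andP[e0 e1]; rewrite (E e e0) /= big_ord_recr /= /k subSnn expr1 binSn.
have n0 : (d.+1%:R : R) != 0 by rewrite pnatr_eq0.
have -> : d.+1%:R^-1 * (\sum_(i < d) e ^+ (d.+1 - i) * 'C(d.+1, i)%:R * a (widen_ord (leqnSn d) i) +
      e * d.+1%:R * a ord_max) / e - fine (A c) =
    d.+1%:R^-1 * \sum_(i < d) e ^+ (d - i) * 'C(d.+1, i)%:R * a (widen_ord (leqnSn d) i).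
  rewrite -/(a ord_max).
  have -> : \sum_(i < d) e ^+ (d.+1 - i) * 'C(d.+1, i)%:R * a (widen_ord (leqnSn d) i) =
      e * \sum_(i < d) e ^+ (d - i) * 'C(d.+1, i)%:R * a (widen_ord (leqnSn d) i).
    rewrite mulr_sumr; apply: eq_bigr => i _; rewrite subSn ?(ltnW (ltn_ord i))// exprS; ring.
  field; apply/andP; split => //; exact: lt0r_neq0.
rewrite normrM ger0_norm ?invr_ge0// mulrCA ler_wpM2l ?invr_ge0// mulr_sumr.
apply: le_trans (ler_norm_sum _ _ _) _; apply: ler_sum => i _.
rewrite !normrM (ger0_norm (ler0n _ _)) /kk /k /= mulrA ler_wpM2r// ler_wpM2r//.
rewrite ger0_norm ?exprn_ge0 ?(ltW e0)//.
have : (0 < d - i)%N by rewrite subn_gt0.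
case: (d - i)%N => // j _; rewrite exprS; apply: ler_piMr; first exact: ltW.
by apply: exprn_ile1; [exact: ltW|].
Qed.


Let out_fin c Q : borel_set c -> compact Q -> Q `<=` Os -> c `<=` Q ->
  forall t, `|t| <= 1 -> vol (out t c) \is a fin_num.
Proof.
move=> mc cQ QO cQs t t1; have [C C0 hC] := outside_bounded HO hom d0 cs es com omU cQ QO cQs.
have d1 : (0 < d + 1)%N by rewrite addn1.
rewrite ge0_fin_numE ?vol_ge0//; apply: le_lt_trans (cube_vol d1 (ltW C0)); apply: le_vol => X oX.
by apply/(cubeE X (ltW C0)); exact: hC oX.
Qed.

Let out0 c e : 0 < e -> out 0 c `<=` out e c.
Proof.
move=> e0 X [[DX nK] rX]; split => //; split => // KX; apply: nK.
have pd t := perturb_domain hom es (@scaled_cont R d Om om com t) (@scaled_bound R d Om om om 1 omU t) X.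
apply/(pd 0); have [_ h] := (pd e).1 KX; split => // y Oy.
apply: lt_trans (h y Oy) _; rewrite mul0r ltrD2l pmulr_rlt0//; exact: (om_lt0 hom).
Qed.

Lemma area_null_boundary c Q : borel_set c -> compact Q -> Q `<=` Os -> c `<=` Q ->
  vol [set x | hu x /\ (closure c `\` c°) (hp x)] = 0%E ->
  A c = (\int[lebn d0]_x (dens om c x)%:E)%E.
Proof.
move=> mc cQ QO cQs b0; have cO := subset_trans cQs QO.
have [id lim] := volume_limit HO hom d0 cs es com omU mc cQ QO cQs b0.
have [fN [B B0 hB]] := area_limit mc cQ QO cQs.
have [fin _] := hS.
have mQ : borel_set Q by apply: closed_borel; apply: compact_closed.
have fA : A c \is a fin_num.
  by rewrite ge0_fin_numE//; apply: le_lt_trans (fin _ Q cQ QO); apply: le_measure; rewrite ?inE.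
have fI := integrable_fin_num measurableT id.
rewrite -(fineK fA) -(fineK fI); congr EFin.
move: (fine (A c)) hB => a hB; set i := fine _.
have fo := out_fin mc cQ QO cQs.
have z1 : `|0 : R| <= 1 by rewrite normr0.
have mo t : borel_set (out t c) := outside_borel HO hom cs es com omU mc t.
have d1 : (0 < d + 1)%N by rewrite addn1.
pose v e := fine (vol (normal_nbhd om K e c)).
pose w t := (fine (vol (out t c)) - fine (vol (out 0 c))) / t.
have wE t : `|t| <= 1 -> fine ((vol (out t c) - vol (out 0 c)) * (t^-1)%:E)%E = w t.
  by move=> t1; rewrite -(fineK (fo t t1)) -(fineK (fo 0 z1)).
have volD e : 0 < e <= 1 -> vol (out e c `\` out 0 c) = (e * w e)%:E.
  move=> /andP[e0 e1]; have e1' : `|e| <= 1 by rewrite gtr0_norm.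
  have f1 : (lebn d1 (out e c) < +oo)%E by rewrite -ge0_fin_numE ?fo// vol_ge0.
  rewrite -[LHS]/(lebn d1 _) (measureD (mo e) (mo 0) f1) setIC (setIidl (out0 e0)).
  rewrite -[X in (X - _)%E](fineK (fo e e1')) -[X in (_ - X)%E](fineK (fo 0 z1)) -EFinB.
  by congr EFin; rewrite /w mulrCA mulfV ?mulr1// gt_eqF.
have vw e : 0 < e <= 1 -> v e <= e * w e.
  move=> e1; rewrite -lee_fin -(volD e e1) /v; have /andP[e0 _] := e1.
  by rewrite (fineK (fN e e0)); apply: le_vol; exact: (normal_nbhd_outside HO HG hom HT HK cO).
have wv e e' : 0 < e <= 1 -> e < e' -> e * w e <= v e'.
  move=> e1 ee; rewrite -lee_fin -(volD e e1) /v; have /andP[e0 _] := e1.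
  rewrite (fineK (fN e' (lt_trans e0 ee))); apply: le_vol.
  by apply: (outside_normal_nbhd HO HG hom HT HK cO); rewrite e0.
apply: (area_squeeze B0 hB vw wv).
have lim' : (fun t : R => ((vol (out t c) - vol (out 0 c)) * (t^-1)%:E)%E) t @[t --> (0:R)^'+] --> i%:E.
  by apply: cvg_dnbhs_at_right; rewrite /i (fineK fI).
apply: cvg_trans (fine_cvg lim'); apply: near_eq_cvg; near=> t; rewrite /= wE// gtr0_norm.
  by near: t; apply: nbhs_right_le.
by near: t; exact: nbhs_right_gt.
Unshelve. all: by end_near. Qed.

(** Open thickenings decrease to [c]. The boundaries of two thickenings of different radius are
    disjoint, so radii tending to 0 exist for which the boundary is negligible and
    [area_null_boundary] applies. *)
Lemma area_compact (m : {measure set (borel R d) -> \bar R}) c :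
  (forall b, borel_set b -> b `<=` Os -> m b = (\int[lebn d0]_x (dens om b x)%:E)%E) ->
  (forall Q, compact Q -> Q `<=` Os -> (m Q < +oo)%E) ->
  compact c -> c `<=` Os -> A c = m c.
Proof.
move=> hm fm cc cO; have [fin _] := hS.
have [W [Q [oW cW WQ cQ QO]]] := compact_neighborhood cc cO.
have [r1 r10 hr1] := compact_thickening cc oW cW.
have mQ : borel_set Q by apply: closed_borel; apply: compact_closed.
have tQ r : r <= r1 -> thickening c r `<=` Q.
  by move=> rr y [p cp h]; apply: WQ; apply: (hr1 p) => //; apply: ltW; exact: lt_le_trans h rr.
have ctQ r : r < r1 -> closure (thickening c r) `<=` Q.
  by move=> rr; apply: subset_trans (closure_thickening rr) _; exact: tQ.
have mT r : borel_set (thickening c r) by apply: open_borel; exact: thickening_open.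
pose L r : set (borel R d) := [set x | hu x /\ ((closure (thickening c r) `\` thickening c r) `&` Q) (hp x)].
have mL r : measurable (L r).
  apply: (hpick_borel HO d0 es); apply: borelI => //; apply: borelD => //.
  apply: closed_borel; exact: closed_closure.
have mQQ := hpick_borel HO d0 es mQ.
have fQQ : (vol [set x | hu x /\ Q (hp x)] < +oo)%E.
  have [C C0 hC] := hpick_bounded cQ QO.
  apply: le_lt_trans (cube_vol d0 (ltW C0)); apply: le_vol => x [_ Qx]; apply/(cubeE x (ltW C0)).
  exact: hC.
have lev n : exists r, [/\ r1 / n.+2%:R < r, r < r1 / n.+1%:R & lebn d0 (L r) = 0%E].
  have ab : r1 / n.+2%:R < r1 / n.+1%:R.
    by rewrite ltr_pM2l// ltf_pV2 ?posrE// ltr_nat.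
  have [||r /andP[h1 h2] h3] := @null_level R _ (borel R d) (lebn d0) L _ _ _ mQQ fQQ mL _ _ ab.
  - by move=> r x [ux [_ Qx]].
  - move=> r r' x [_ [[a1 a2] _]] [_ [[a3 a4] _]].
    by apply/eqP; rewrite eq_le !leNgt; apply/andP; split; apply/negP => h;
       [apply: a2; exact: (closure_thickening h)|apply: a4; exact: (closure_thickening h)].
  - by exists r.
have [rn hrn] := choice lev.
have rpos n : 0 < rn n.
  by have [h _ _] := hrn n; apply: lt_trans h; exact: divr_gt0.
have rlt n : rn n < r1.
  have [_ h _] := hrn n; apply: lt_le_trans h _; rewrite ler_pdivrMr// ler_peMr ?ler1n//; exact: ltW.
have rdec n : rn n.+1 < rn n.
  by have [h _ _] := hrn n; have [_ h' _] := hrn n.+1; exact: lt_trans h' h.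
have rhomo n n' : (n <= n')%N -> rn n' <= rn n.
  by apply: (nonincreasing_seqP _).1 => k'; exact: ltW.
have rlim : rn n @[n --> \oo] --> (0 : R).
  have h0 : (r1 * harmonic n : R) @[n --> \oo] --> r1 * 0.
    by apply: cvgM; [exact: cvg_cst|exact: cvg_harmonic].
  rewrite mulr0 in h0; apply: (squeeze_cvgr _ (cvg_cst 0) h0).
  by near=> n; have [_ h _] := hrn n; rewrite (ltW (rpos n)) /= ltW.
pose F n := thickening c (rn n) : set (borel R d).
have FE : \bigcap_n F n = c by apply: thickening_bigcap => //; apply: compact_closed.
have mF n : measurable (F n) by exact: mT.
have mFc : measurable (\bigcap_n F n) by rewrite FE; apply: closed_borel; apply: compact_closed.
have Fh : {homo F : n m / (n <= m)%N >-> (m <= n)%O}.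
  move=> n n' nn; apply/subsetPset => y [p cp h]; exists p => //.
  exact: lt_le_trans h (rhomo _ _ nn).
have FQ n : F n `<=` Q by apply: tQ; exact: ltW.
have AF n : A (F n) = m (F n).
  rewrite (hm _ (mT _) (subset_trans (FQ n) QO)).
  apply: (area_null_boundary (mT _) cQ QO (FQ n)).
  have [_ _ l0] := hrn n; apply: vol0_sub l0 => x [ux [cx nx]]; split => //.
  split; last by apply: ctQ cx; exact: rlt.
  split => // h; apply: nx; rewrite (interior_id _).1//; exact: thickening_open.
have lA : A (F n) @[n --> \oo] --> A c.
  rewrite -FE; apply: (nonincreasing_cvg_mu (mu := A)) => //.
  apply: le_lt_trans (fin _ Q cQ QO); apply: le_measure; rewrite ?inE//; exact: FQ.
have lm : m (F n) @[n --> \oo] --> m c.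
  rewrite -FE; apply: (nonincreasing_cvg_mu (mu := m)) => //.
  apply: le_lt_trans (fm Q cQ QO); apply: le_measure; rewrite ?inE//; exact: FQ.
have lA' : m (F n) @[n --> \oo] --> A c by under eq_fun do rewrite -AF; exact: lA.
exact: (cvg_unique _ lA' lm).
Unshelve. all: by end_near. Qed.

(** The two measures agree on compact sets, hence by complement on the traces of open sets on [Q];
    open sets are stable under intersection and generate the Borel sets. *)
Lemma area_contact c Q : borel_set c -> compact Q -> Q `<=` Os -> c `<=` Q ->
  A c = (\int[lebn d0]_x (dens om c x)%:E)%E /\ A c \is a fin_num.
Proof.
move=> mc cQ QO cQs; have [fin _] := hS.
have mQ : borel_set Q by apply: closed_borel; apply: compact_closed.
have [m [hm fm]] := contact_measure.
have fQ : A Q \is a fin_num by rewrite ge0_fin_numE//; exact: fin.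
have AQ : A Q = m Q by exact: area_compact.
split; last by rewrite ge0_fin_numE//; apply: le_lt_trans (fin _ Q cQ QO); apply: le_measure; rewrite ?inE.
rewrite -(hm _ mc (subset_trans cQs QO)).
pose mQ' : measurable (Q : set (borel R d)) := mQ.
have h := @measure_unique _ R (borel R d) (@open 'cV[R]_d) (fun=> setT) erefl (@openI _)
  (fun _ => openT) _ (mrestr A mQ') (mrestr m mQ') _ _ c mc.
have cI : c `&` Q = c by apply/setIidPl.
suff : mrestr A mQ' c = mrestr m mQ' c by rewrite /mrestr cI.
apply: h.
- by apply/seteqP; split => // x _; exists 0%N.
- move=> O oO /=; rewrite /mrestr.
  have mO : measurable (O : set (borel R d)) by exact: open_borel.
  have cD : compact (Q `\` O) by apply: compact_closedI => //; exact: open_closedC.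
  have DQ : Q `\` O `<=` Q by move=> x [].
  have e : A (Q `\` O) = m (Q `\` O) by apply: area_compact => //; exact: subset_trans QO.
  have D1 : (A Q = A (Q `\` O) + A (Q `&` O))%E := measureDI A mQ' mO.
  have D2 : (m Q = m (Q `\` O) + m (Q `&` O))%E := measureDI m mQ' mO.
  have f1 : A (Q `\` O) \is a fin_num.
    rewrite ge0_fin_numE//; apply: le_lt_trans (fin _ Q cQ QO); apply: le_measure; rewrite ?inE//.
    exact: measurableD.
  rewrite setIC -[LHS](addeK _ f1) -[RHS](addeK _ f1) {3}e.
  by congr (_ - _)%E; rewrite [LHS]addeC [RHS]addeC -D1 -D2.
- move=> k; suff : (A ([set: borel R d] `&` Q) < +oo)%E by exact.
  by rewrite setTI; exact: fin.
Qed.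

End area_measures.

Lemma dist_interval {R : realDomainType} (p q x y : R) : p <= x <= q -> p <= y <= q ->
  `|x - y| <= q - p.
Proof. by move=> /andP[? ?] /andP[? ?]; rewrite ler_norml; apply/andP; split; lra. Qed.

Section area_transfer.
Context {R : realType} {d : nat} {Om : set 'cV[R]_d} {G : set 'M[R]_(d + 1)}.
Hypothesis (HO : pointed_domain Om) (HG : dividing_group G Om).
Let Os := dual_domain Om.
Context {om : 'cV[R]_d -> R}.
Hypothesis hom : cheng_yau Os om.
Hypothesis d0 : (0 < d)%N.
Let oOs : open Os := dual_open HO.
Implicit Types (x y z : 'cV[R]_d) (b c Q : set 'cV[R]_d).
Context {Gt : set (affmap R (d + 1))} {tau : 'M[R]_(d + 1) -> 'cV[R]_(d + 1)}.
Hypothesis HT : translation_part Gt G tau.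
Variable K : set 'cV[R]_(d + 1).
Hypothesis HK : tau_convex (cone Om) Gt K.
Let s := support_fun K.
Let es : extends Os s := support_extends HO HG hom HT HK.
Let com y : Os y -> {for y, continuous om}. Proof. exact: (om_continuous hom). Qed.
Local Notation hu := (huniq (Om := Om) s).
Local Notation hp := (hpick (Om := Om) s).
Local Notation dens f c := (density (Om := Om) s f c).
Variable S : 'I_d.+1 -> {measure set (borel R d) -> \bar R}.
Hypothesis hS : steiner_measures Os om K S.
Let A := S ord_max.
Variables (f : 'cV[R]_d -> R) (U : R).
Hypothesis cf : forall y, Os y -> {for y, continuous f}.
Hypothesis fU : forall y, Os y -> `|f y| <= U * `|om y|.
Let Sp c : set (borel R d) := [set x | hu x /\ c (hp x)].
Let u y := f y / om y.

Lemma ratio_continuous y : Os y -> {for y, continuous (fun y => f y / om y)}.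
Proof.
move=> Oy; apply: (cvgM (FF := nbhs_filter y)); first exact: cf.
by apply: (cvgV (FF := nbhs_filter y)); [rewrite lt_eqF// (om_lt0 hom)|exact: com].
Qed.

Lemma ratio_bounded y : Os y -> `|f y / om y| <= U.
Proof.
move=> Oy; have o0 : 0 < `|om y| by rewrite normr_gt0 lt_eqF// (om_lt0 hom).
by rewrite normrM normfV ler_pdivrMr// fU.
Qed.

Let integrable_hpick (g : 'cV[R]_d -> R) c Q : (forall y, Os y -> {for y, continuous g}) ->
  borel_set c -> compact Q -> Q `<=` Os -> c `<=` Q ->
  (lebn d0).-integrable (Sp c) (EFin \o (fun x => - g (hp x))).
Proof.
move=> cg mc cQ QO cQs; have cO := subset_trans cQs QO.
have mS := hpick_borel HO d0 es mc.
have [C C0 hC] := hpick_bounded HO HG hom HT HK cQ QO.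
have co : {within Q, continuous g}.
  by apply/subspace_continuousP => y /QO Oy; apply: cvg_within_filter; exact: cg.
have /compact_bounded [M [_ hM]] := continuous_compact co cQ.
apply: measurable_bounded_integrable => //.
- apply: le_lt_trans (cube_vol d0 (ltW C0)); apply: le_vol => x [_ cx]; apply/(cubeE x (ltW C0)).
  by apply: hC; exact: cQs.
- apply: measurableT_comp; first exact: oppr_measurable.
  exact: (hpick_fun_measurable HO HG hom d0 HT HK mc cO cg).
- exists M; split; first exact: num_real.
  by move=> N MN x [_ cx]; rewrite /= normrN; apply: (hM N MN); exists (hp x) => //; exact: cQs.
Qed.

(** On a set where f / om is between m and M, both integrals are between m A and M A, by
    [area_contact] and the identity - f = (f / om)(- om); [thin_level_zero] concludes. *)
Lemma area_transfer c Q : borel_set c -> compact Q -> Q `<=` Os -> c `<=` Q ->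
  (\int[A]_(y in c) (f y / om y)%:E)%E = (\int[lebn d0]_x (dens f c x)%:E)%E.
Proof.
move=> mc cQ QO cQs; have cO := subset_trans cQs QO.
have mu b : borel_set b -> b `<=` c -> measurable_fun (b : set (borel R d)) (u : borel R d -> measurableTypeR R).
  move=> mb bc; apply: (open_continuous_borel oOs) => //; last exact: subset_trans cO.
  exact: ratio_continuous.
have Afin b : borel_set b -> b `<=` c -> (A b = (\int[lebn d0]_(x in Sp b) (- om (hp x))%:E)%E) /\ A b \is a fin_num.
  move=> mb bc; have [e fA] := area_contact HO HG hom d0 HT HK hS mb cQ QO (subset_trans bc cQs).
  split => //; rewrite /A e; exact: density_integral.
have iA b : borel_set b -> b `<=` c -> A.-integrable (b : set (borel R d)) (EFin \o u).
  move=> mb bc; apply: measurable_bounded_integrable => //.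
  - by rewrite -ge0_fin_numE ?measure_ge0//; case: (Afin b mb bc).
  - exact: mu.
  - exists U; split; first exact: num_real.
    move=> N UN y by_; apply: ltW; apply: le_lt_trans UN; apply: ratio_bounded; exact/cO/bc.
have iS g b : (forall y, Os y -> {for y, continuous g}) -> borel_set b -> b `<=` c ->
    (lebn d0).-integrable (Sp b) (EFin \o (fun x => - g (hp x))).
  by move=> cg mb bc; apply: (integrable_hpick cg mb cQ QO); exact: subset_trans cQs.
have mSp b : borel_set b -> borel_set (Sp b) := hpick_borel HO d0 es (b := b).
rewrite (_ : (\int[lebn d0]_x _)%E = (\int[lebn d0]_(x in Sp c) (- f (hp x))%:E)%E); last exact: density_integral.
rewrite -[LHS](fineK (integrable_fin_num mc (iA c mc (@subset_refl _ c)))).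
rewrite -[RHS](fineK (integrable_fin_num (mSp c mc) (iS f c cf mc (@subset_refl _ c)))).
congr EFin; apply/eqP; rewrite -subr_eq0; apply/eqP.
pose D b := \int[A]_(y in b) u y - \int[lebn d0]_(x in Sp b) (- f (hp x)).
pose A' b := fine (A b).
have disj (T : choiceType) (B C : set T) : B `&` C = set0 -> [disjoint B & C] by move=> h; apply/disj_setPS; rewrite h.
apply: (@thin_level_zero R _ (borel R d) D A' c u U mc (mu c mc (@subset_refl _ c))).
- by move=> y cy; apply: ratio_bounded; exact: cO.
- move=> b b' mb mb' sub dis.
  have [sb sb'] : b `<=` c /\ b' `<=` c by split => y ?; apply: sub; [left|right].
  have mU : borel_set (b `|` b') by exact: borelU.
  have SU : Sp (b `|` b') = Sp b `|` Sp b'.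
    by apply/seteqP; split => x; [move=> [ux [bx|bx]]; [left|right]|move=> [[ux bx]|[ux bx]]; split => //; [left|right]].
  have SI : Sp b `&` Sp b' = set0.
    by apply/seteqP; split => // x [[_ bx] [_ bx']]; rewrite -[set0 x]/(set0 (hp x)) -dis.
  have [[_ f1] [_ f2]] := (Afin b mb sb, Afin b' mb' sb').
  split; last by rewrite /A' measureU// fineD.
  rewrite /D (Rintegral_setU mb mb' (iA _ mU sub) (disj _ _ _ dis)).
  have iU := iS f _ cf mU sub; rewrite SU in iU *.
  rewrite (Rintegral_setU (mSp b mb) (mSp b' mb') iU (disj _ _ _ SI)); ring.
move=> b m M mb bc mM.
have [e fA] := Afin b mb bc.
have A'E : A' b = \int[lebn d0]_(x in Sp b) (- om (hp x)) by rewrite /A' e.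
have cst_int (k : R) : \int[A]_(y in b) k = k * A' b.
  exact: Rintegral_cst.
have bA (k : R) : A.-integrable (b : set (borel R d)) (EFin \o cst k).
  apply: measurable_bounded_integrable => //; first by rewrite -ge0_fin_numE.
  by exists `|k|; split; rewrite ?num_real// => N MN y _; rewrite /cst /=; exact: ltW.
have I1 : m * A' b <= \int[A]_(y in b) u y <= M * A' b.
  rewrite -!cst_int; apply/andP; split; apply: le_Rintegral => //.
  - exact: bA.
  - exact: iA.
  - by move=> y by_; have /andP[] := mM y by_.
  - exact: iA.
  - exact: bA.
  - by move=> y by_; have /andP[] := mM y by_.
have io := iS om b com mb bc; have iff := iS f b cf mb bc.
have I2 : m * A' b <= \int[lebn d0]_(x in Sp b) (- f (hp x)) <= M * A' b.
  have pt x : Sp b x -> m * - om (hp x) <= - f (hp x) <= M * - om (hp x).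
    move=> [_ bx]; have o0 := om_lt0 hom (cO _ (bc _ bx)).
    have -> : - f (hp x) = u (hp x) * - om (hp x) by rewrite /u mulrN divfK ?lt_eqF.
    have p0 : 0 <= - om (hp x) by rewrite oppr_ge0 ltW.
    by have /andP[h1 h2] := mM _ bx; rewrite !ler_wpM2r.
  rewrite A'E -!RintegralZl//; try exact: mSp.
  have iZ (k : R) : (lebn d0).-integrable (Sp b) (EFin \o (fun x => k * - om (hp x))).
    exact: (integrableZl (mSp b mb) k io).
  apply/andP; split; apply: le_Rintegral => //; try exact: mSp.
  - by move=> x /pt /andP[].
  - by move=> x /pt /andP[].
by rewrite mulrBl; exact: dist_interval.
Qed.

End area_transfer.

(** * Fundamental domains *)

Lemma filter_finite {T : Type} {I : eqType} {F : set_system T} {FF : Filter F} (D : set I)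
    (P : I -> T -> Prop) : finite_set D -> (forall i, D i -> F (P i)) ->
  F (fun x => forall i, D i -> P i x).
Proof.
move=> /finite_seqP [s ->] h.
elim: s h => [_|i s IH h]; first by apply: filterS filterT => x _ i.
have h1 : F (P i) by apply: h; rewrite /= mem_head.
have h2 : F (fun x => forall j, [set` s] j -> P j x).
  by apply: IH => j js; apply: h; rewrite /= in_cons js orbT.
apply: filterS (filterI h1 h2) => x [a b] j; rewrite /= in_cons => /orP[/eqP ->//|js].
exact: b.
Qed.

Lemma continuous_preimage_borel {R : realType} {n m : nat} (U : set 'cV[R]_n)
    (f : 'cV[R]_n -> 'cV[R]_m) (B : set 'cV[R]_m) :
  open U -> (forall y, U y -> {for y, continuous f}) -> borel_set B -> borel_set (U `&` f @^-1` B).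
Proof.
move=> oU cf mB; have mU : borel_set U by exact: open_borel.
suff mf : measurable_fun (U : set (borel R n)) (f : borel R n -> borel R m) by exact: mf.
apply: (@measurability _ _ (borel R n) (borel R m) U f (@open 'cV[R]_m) erefl) => _ [W oW <-].
apply: open_borel; rewrite openE => y [Uy fy].
have h1 : nbhs y U by exact: open_nbhs_nbhs.
have h2 : nbhs y (f @^-1` W) by apply: (cf y Uy); exact: open_nbhs_nbhs.
exact: filterI h1 h2.
Qed.

Section orbits.
Context {R : realType} {d : nat} {Om : set 'cV[R]_d} {G : set 'M[R]_(d + 1)}.
Hypothesis (HO : pointed_domain Om) (HG : dividing_group G Om).
Let Os := dual_domain Om.
Context {om : 'cV[R]_d -> R}.
Hypothesis hom : cheng_yau Os om.
Let oOs : open Os := dual_open HO.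
Implicit Types (y z q : 'cV[R]_d) (g h : 'M[R]_(d + 1)) (E Q : set 'cV[R]_d) (r : R).
Local Notation orb := (group_orbit G (@dual_act R d)).

Lemma actVK g y : G g -> Os y -> act g (act (invmx g) y) = y.
Proof. by move=> Gg Oy; exact: (act_closureVK HO HG Gg (subset_closure Oy)). Qed.

Lemma actKV g y : G g -> Os y -> act (invmx g) (act g y) = y.
Proof. by move=> Gg Oy; case: (act_closureV HO HG Gg (subset_closure Oy)). Qed.

Lemma orbitP y z : orb y z <-> exists2 g, G g & z = act g y.
Proof.
split => [[g Gg <-]|[g Gg ->]].
  by exists (invmx g); [exact: (G_inv HG Gg)|rewrite /act invmxK].
by exists (invmx g); [exact: (G_inv HG Gg)|].
Qed.

Lemma orbit_refl y : orb y y.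
Proof. by apply/orbitP; exists 1%:M; [exact: (G_1 HG)|rewrite act1]. Qed.

Lemma orbit_act g y : G g -> Os y -> orb (act g y) = orb y.
Proof.
move=> Gg Oy; apply/seteqP; split => z /orbitP [h Gh ->]; apply/orbitP.
  exists (g *m h); first exact: (G_mul HG).
  by rewrite (act_mul HO HG Gg Gh (subset_closure Oy)).
exists (invmx g *m h); first by apply: (G_mul HG) => //; exact: (G_inv HG).
rewrite (act_mul HO HG (G_inv HG Gg) Gh); first by rewrite actKV.
by apply: subset_closure; exact: (act_Os HO HG).
Qed.

Lemma orbit_eq y z : orb y = orb z -> exists2 g, G g & z = act g y.
Proof. by move=> e; apply/orbitP; rewrite e; exact: orbit_refl. Qed.

Lemma act_continuous g y : G g -> Os y -> {for y, continuous (act g)}.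
Proof.
move=> Gg Oy; apply: act_cvg; apply: (lam_neq0 HO HG Gg); exact: subset_closure.
Qed.

Definition saturation E : set 'cV[R]_d := [set y | Os y /\ exists2 g, G g & E (act g y)].

(** By properness only finitely many elements of the group bring a point of a given compact set into
    [Q], so on each set of the exhaustion the union over the group is finite. *)
Lemma saturation_borel E Q : borel_set E -> compact Q -> Q `<=` Os -> E `<=` Q ->
  borel_set (saturation E).
Proof.
move=> mE cQ QO EQ.
pose C k := Q `|` osk (Om := Om) (om := om) k.
have cC k : compact (C k) by apply: compactU => //; exact: (osk_compact HO hom).
have CO k : C k `<=` Os by move=> y [/QO|[]].
pose F k := [set g | G g /\ exists2 y, C k y & C k (act g y)].
have fF k : finite_set (F k) by exact: (act_proper HO HG hom (cC k) (@CO k)).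
have -> : saturation E = \bigcup_k (osk (Om := Om) (om := om) k `&` \bigcup_(g in F k) (Os `&` act g @^-1` E)).
  apply/seteqP; split => y.
    move=> [Oy [g Gg Eg]]; have : (\bigcup_k osk (Om := Om) (om := om) k) y by rewrite (oskE hom).
    move=> [k _ ky]; exists k => //; split => //; exists g => //; split => //; exists y; first by right.
    by left; exact: EQ.
  by move=> [k _ [_ [g [Gg _] [Oy Eg]]]]; split => //; exists g.
apply: borel_bigcup => k; apply: borelI.
  by apply: closed_borel; apply: compact_closed => //; exact: (osk_compact HO hom).
apply: (@fin_bigcup_measurable _ (borel R d)) => // g [Gg _].
exact: (continuous_preimage_borel oOs (fun y Oy => act_continuous Gg Oy) mE).
Qed.

Lemma saturation_act E g y : G g -> saturation E y -> saturation E (act g y).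
Proof.
move=> Gg [Oy [h Gh Eh]]; split; first exact: (act_Os HO HG).
exists (invmx g *m h); first by apply: (G_mul HG) => //; exact: (G_inv HG).
rewrite (act_mul HO HG (G_inv HG Gg) Gh); first by rewrite actKV.
by apply: subset_closure; exact: (act_Os HO HG).
Qed.

Lemma saturation_act_inv E g y : G g -> Os y -> saturation E (act g y) -> saturation E y.
Proof. by move=> Gg Oy /(saturation_act (G_inv HG Gg)); rewrite actKV. Qed.

(** Properness leaves finitely many group elements that return some point of a fixed ball to it. By
    freeness each nontrivial one moves [q], so a smaller radius excludes it. *)
Lemma small_ball q : Os q -> exists2 r : R, 0 < r & (forall y, `|y - q| <= r -> Os y) /\
  forall g y, G g -> `|y - q| <= r -> `|act g y - q| <= r -> g = 1%:M.
Proof.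
move=> Oq; have [e e0 he] := openE_ball oOs Oq.
pose r1 := e / 2; have r10 : 0 < r1 by exact: divr_gt0.
have r1O y : `|y - q| <= r1 -> Os y.
  by move=> h; apply: he; rewrite distrC; apply: le_lt_trans h _; rewrite ltr_pdivrMr// ltr_pMr// ltr1n.
pose Q := [set y | `|q - y| <= r1].
have cQ : compact Q.
  apply: cV_compact; last exact: closed_ball_cV.
  apply: (@bounded_setP _ _ _ (`|q| + r1)) => y Qy.
  by rewrite -(subrK q y); apply: le_trans (ler_normD _ _) _; rewrite addrC lerD2l distrC.
have QO : Q `<=` Os by move=> y Qy; apply: r1O; rewrite distrC.
have fF := act_proper HO HG hom cQ QO.
have loc g : G g -> g <> 1%:M -> \forall r \near (0 : R)^'+, forall y, `|y - q| <= r -> `|act g y - q| <= r -> False.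
  move=> Gg g1; have gq : 0 < `|act g q - q|.
    rewrite normr_gt0 subr_eq0; apply/eqP => h; apply: g1; exact: (act_free HO HG hom Gg Oq h).
  set D := `|act g q - q| in gq.
  have [a a0 ha] : exists2 a : R, 0 < a & forall y, `|y - q| < a -> `|act g y - act g q| < D / 2.
    have /cvgr_distC_lt /(_ _ (divr_gt0 gq (ltr0n _ 2))) := act_continuous Gg Oq.
    move=> /nbhs_ballP [a /= a0 h]; exists a => // y ya.
    have yb : ball q a y by rewrite -ball_normE /= distrC.
    exact: (h y yb).
  near=> r => y yr gyr.
  have ra : r < a by near: r; exact: nbhs_right_lt.
  have rD : r < D / 2 by near: r; apply: nbhs_right_lt; exact: divr_gt0.
  have := ha y (le_lt_trans yr ra) => h.
  have : D < D / 2 + D / 2.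
    rewrite {1}/D -(subrK (act g y) (act g q)) -addrA; apply: le_lt_trans (ler_normD _ _) _.
    by apply: ltrD; [rewrite distrC|exact: le_lt_trans gyr rD].
  by rewrite -mulrDr -div1r -mulrDl divff ?mulr1 ?ltxx// pnatr_eq0.
have nP := filter_finite (F := (0 : R)^'+) (P := fun g (r : R) => g <> 1%:M ->
  forall y, `|y - q| <= r -> `|act g y - q| <= r -> False) fF.
have : \forall r \near (0 : R)^'+, [/\ 0 < r, r <= r1 & forall g, (G g /\ exists2 y, Q y & Q (act g y)) ->
    g <> 1%:M -> forall y, `|y - q| <= r -> `|act g y - q| <= r -> False].
  near=> r; split; [near: r; exact: nbhs_right_gt|near: r; exact: nbhs_right_le|].
  near: r; apply: nP => g [Gg _]; have [->|/eqP g1] := eqVneq g 1%:M; first by near=> r => /(_ erefl).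
  by apply: filterS (loc g Gg g1) => r h _.
move=> /filter_ex [r [r0 rr1 Pr]]; exists r => //; split.
  by move=> y yr; apply: r1O; exact: le_trans rr1.
move=> g y Gg yr gyr; apply: contrapT => g1; apply: (Pr g _ g1 y yr gyr).
split => //; exists y; rewrite /Q /= distrC; exact: le_trans rr1.
Unshelve. all: by end_near. Qed.

End orbits.

Lemma finite_null {d : measure_display} {T : measurableType d} {R : realType} {I : eqType}
    (mu : {measure set T -> \bar R}) (D : set I) (N : I -> set T) : finite_set D ->
  (forall i, D i -> measurable (N i) /\ mu (N i) = 0%E) -> mu (\bigcup_(i in D) N i) = 0%E.
Proof.
move=> /finite_seqP [s ->]; elim: s => [_|i s IH h].
  by rewrite (_ : \bigcup_(i in _) _ = set0) ?measure0//; apply/seteqP; split => // x [].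
have hs j : [set` s] j -> measurable (N j) /\ mu (N j) = 0%E.
  by move=> js; apply: h; rewrite /= in_cons js orbT.
have [mi i0] := h i (mem_head i s).
have ms : measurable (\bigcup_(j in [set` s]) N j).
  by apply: fin_bigcup_measurable => // j /hs [].
have -> : \bigcup_(j in [set` i :: s]) N j = N i `|` \bigcup_(j in [set` s]) N j.
  apply/seteqP; split => x.
    by move=> [j]; rewrite /= in_cons => /orP[/eqP ->|js] Nx; [left|right; exists j].
  by move=> [Nx|[j js Nx]]; [exists i; rewrite //= mem_head|exists j; rewrite //= in_cons js orbT].
have le : (mu (N i `|` \bigcup_(j in [set` s]) N j) <= mu (N i) + mu (\bigcup_(j in [set` s]) N j))%E.
  exact: measureU2.
by apply/eqP; rewrite eq_le measure_ge0 andbT; apply: le_trans le _; rewrite i0 add0e IH.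
Qed.

Section fundamental_domain.
Context {R : realType} {d : nat} {Om : set 'cV[R]_d} {G : set 'M[R]_(d + 1)}.
Hypothesis (HO : pointed_domain Om) (HG : dividing_group G Om).
Let Os := dual_domain Om.
Context {om : 'cV[R]_d -> R}.
Hypothesis hom : cheng_yau Os om.
Let oOs : open Os := dual_open HO.
Implicit Types (y z q : 'cV[R]_d) (g h : 'M[R]_(d + 1)) (E Q c : set 'cV[R]_d) (r : R).
Local Notation orb := (group_orbit G (@dual_act R d)).
Variable A : {measure set (borel R d) -> \bar R}.
Hypothesis fA : forall Q, compact Q -> Q `<=` Os -> (A Q < +oo)%E.
Variable AK : {measure set (quotient_space G (@dual_act R d) Os) -> \bar R}.
Hypothesis hAK : descends A AK.

Lemma orbit_measure E : borel_set E -> E `<=` Os ->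
  (forall g y, G g -> E y -> E (act g y) -> g = 1%:M) -> AK (orb @` E) = A E.
Proof.
move=> mE EO inj; apply: hAK => // y z /[!inE] Ey Ez e.
have [g Gg zg] := orbit_eq HG e; move: Ez; rewrite zg => Ez.
by rewrite (inj g y Gg Ey Ez) act1.
Qed.

(** A set and its translate have the same image in the quotient, so [descends] yields the invariance
    of [A] on sets that are injective modulo the group. *)
Lemma translate_measure g E : G g -> borel_set E -> E `<=` Os ->
  (forall h y, G h -> E y -> E (act h y) -> h = 1%:M) ->
  A (Os `&` act g @^-1` E) = A E.
Proof.
move=> Gg mE EO inj.
have mg := continuous_preimage_borel oOs (fun y Oy => act_continuous HO HG Gg Oy) mE.
have mO : Os `&` act g @^-1` E `<=` Os by move=> y [].
rewrite -(orbit_measure mE EO inj) -(orbit_measure mg mO); last first.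
  move=> h y Gh [Oy Ey] [Ohy Ehy].
  have Gi := G_inv HG Gg.
  have e : invmx g *m (h *m g) = 1%:M.
    apply: (inj _ (act g y) (G_mul HG Gi (G_mul HG Gh Gg)) Ey).
    rewrite (act_mul HO HG Gi (G_mul HG Gh Gg) (subset_closure (act_Os HO HG Gg Oy))).
    by rewrite (actKV HO HG Gg Oy) (act_mul HO HG Gh Gg (subset_closure Oy)).
  have ug := G_unit HG Gg.
  have : h *m g = g by rewrite -[LHS]mul1mx -(mulmxV ug) -mulmxA e mulmx1.
  by move=> /(congr1 (mulmx^~ (invmx g))); rewrite -mulmxA mulmxV// mulmx1.
have -> : orb @` (Os `&` act g @^-1` E) = orb @` E; last by [].
apply/seteqP; split => o.
  by move=> [y [Oy Ey] <-]; exists (act g y) => //; rewrite (orbit_act HO HG Gg Oy).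
move=> [y Ey <-]; have Oy := EO _ Ey; have Gi := G_inv HG Gg.
exists (act (invmx g) y); last by rewrite (orbit_act HO HG Gi Oy).
by split; [exact: (act_Os HO HG Gi Oy)|rewrite /preimage /= (actVK HO HG Gg Oy)].
Qed.

Definition admissible (p : 'cV[R]_d * R) : Prop :=
  [/\ 0 < p.2, forall y, `|y - p.1| <= p.2 -> Os y,
      forall g y, G g -> `|y - p.1| <= p.2 -> `|act g y - p.1| <= p.2 -> g = 1%:M &
      A [set y | `|y - p.1| = p.2] = 0%E].

Let cell (p : 'cV[R]_d * R) : set 'cV[R]_d := [set y | `|y - p.1| < p.2].
Let ccell (p : 'cV[R]_d * R) : set 'cV[R]_d := [set y | `|y - p.1| <= p.2].

Let norm_sub_continuous q : continuous (fun y => `|y - q|).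
Proof.
move=> y; apply: (@continuous_comp _ _ _ (fun y : 'cV[R]_d => y - q) (fun v : 'cV[R]_d => `|v|)).
  exact: subr_cvec_continuous.
exact: norm_continuous.
Qed.

Let ccell_compact p : compact (ccell p).
Proof.
apply: cV_compact.
  apply: (@bounded_setP _ _ _ (`|p.1| + p.2)) => y Qy.
  by rewrite -(subrK p.1 y); apply: le_trans (ler_normD _ _) _; rewrite addrC lerD2l.
exact: (closed_le_fun (f := fun y => `|y - p.1|)).
Qed.

Let cell_open p : open (cell p).
Proof.
apply: open_ballE => y py; exists (p.2 - `|y - p.1|); first by rewrite subr_gt0.
move=> z hz; rewrite /cell /= -(subrK y z) -addrA.
by apply: le_lt_trans (ler_normD _ _) _; rewrite -ltrBrDr distrC.
Qed.

Let cell_borel p : borel_set (cell p). Proof. exact: (open_borel (@cell_open p)). Qed.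

Let sphere_borel q r : borel_set [set y | `|y - q| = r].
Proof.
have -> : [set y | `|y - q| = r] = ccell (q, r) `\` cell (q, r).
  apply/seteqP; split => y; rewrite /ccell /cell /=; first by move=> ->; rewrite lexx ltxx.
  by move=> [a /negP]; rewrite -leNgt => b; apply: le_anti; rewrite a.
apply: borelD; last exact: cell_borel.
by apply: closed_borel; apply: compact_closed => //; exact: ccell_compact.
Qed.

(** Spheres around [q] of different radius are disjoint, so a null one can be found below any
    radius; this is why the cells are balls. *)
Lemma admissible_exists q : Os q -> exists r, admissible (q, r).
Proof.
move=> Oq; have [r0 r00 [rO rinj]] := small_ball HO HG hom Oq.
have mQ : borel_set (ccell (q, r0)) by apply: closed_borel; apply: compact_closed.
have fQ : (A (ccell (q, r0)) < +oo)%E by apply: fA => // y; exact: rO.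
have [||||r /andP[rp rr] l0] := @null_level R _ (borel R d) A
  (fun r => [set y | `|y - q| = r] `&` ccell (q, r0)) _ 0 r0 mQ fQ _ _ _ _.
- by move=> r; apply: borelI; [exact: sphere_borel|exact: mQ].
- by move=> r y [].
- by move=> r r' y [<- _] [].
- by [].
exists r; split => //=.
- by move=> y h; apply: rO; exact: le_trans (ltW rr).
- by move=> g y Gg h1 h2; apply: (rinj g y Gg); [exact: le_trans (ltW rr)|exact: le_trans (ltW rr)].
- rewrite -[RHS]l0; congr (A _); apply/seteqP; split => y; last by case.
  by move=> h; split => //; rewrite /ccell /= h ltW.
Qed.

(** Says that the boundary of [E] is [A]-null inside [Q], in a form that passes directly to
    complements, unions and differences. *)
Definition almost_clopen Q E : Prop := exists N, [/\ borel_set N, A N = 0%E &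
  forall y, Q y -> ~ N y -> (\near y, E y) \/ (\near y, ~ E y)].

Lemma almost_clopenU Q E E' : almost_clopen Q E -> almost_clopen Q E' -> almost_clopen Q (E `|` E').
Proof.
move=> [N [mN N0 hN]] [N' [mN' N0' hN']]; exists (N `|` N'); split.
- exact: borelU.
- have le : (A (N `|` N') <= A N + A N')%E by exact: measureU2.
  by apply/eqP; rewrite eq_le measure_ge0 andbT; apply: le_trans le _; rewrite N0 N0' adde0.
move=> y Qy nN; have n1 : ~ N y by move=> h; apply: nN; left.
have n2 : ~ N' y by move=> h; apply: nN; right.
case: (hN y Qy n1) => [h|h]; first by left; apply: filterS h => z; left.
case: (hN' y Qy n2) => [h'|h']; first by left; apply: filterS h' => z; right.
by right; apply: filterS (filterI h h') => z [a b] [].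
Qed.

Lemma almost_clopenC Q E : almost_clopen Q E -> almost_clopen Q (~` E).
Proof.
move=> [N [mN N0 hN]]; exists N; split => // y Qy nN.
by case: (hN y Qy nN) => h; [right; apply: filterS h => z Ez; apply|left].
Qed.

Lemma almost_clopenD Q E E' : almost_clopen Q E -> almost_clopen Q E' -> almost_clopen Q (E `\` E').
Proof.
move=> h h'; rewrite -(setCK (E `\` E')) setCD; apply: almost_clopenC.
by apply: almost_clopenU => //; exact: almost_clopenC.
Qed.

Let near_lt (f : 'cV[R]_d -> R) y (k : R) : {for y, continuous f} -> f y < k -> \near y, f y < k.
Proof.
move=> cf h; have : nbhs y (f @^-1` `]-oo, k[%classic).
  by apply: cf; apply: open_nbhs_nbhs; split; [exact: interval_open|rewrite /= in_itv].
by apply: filterS => z; rewrite /= in_itv.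
Qed.

Let near_gt (f : 'cV[R]_d -> R) y (k : R) : {for y, continuous f} -> k < f y -> \near y, k < f y.
Proof.
move=> cf h; have : nbhs y (f @^-1` `]k, +oo[%classic).
  by apply: cf; apply: open_nbhs_nbhs; split; [exact: interval_open|rewrite /= in_itv /= h].
by apply: filterS => z; rewrite /= in_itv /= andbT.
Qed.

Lemma cell_almost_clopen Q p : admissible p -> almost_clopen Q (cell p).
Proof.
move=> [p0 pO pinj pA]; exists [set y | `|y - p.1| = p.2]; split => // y Qy ne.
have [h|h|h] := ltgtP `|y - p.1| p.2; last by case: ne.
  by left; exact: (near_lt (@norm_sub_continuous p.1 y) h).
right; apply: filterS (near_gt (@norm_sub_continuous p.1 y) h) => z a b.
by move: (lt_trans a b); rewrite ltxx.
Qed.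

(** Near [Q] only finitely many translates of the cell occur, and the boundary of their union lies
    in the translated spheres, which are null by [translate_measure]. *)
Lemma saturation_almost_clopen Q p : compact Q -> Q `<=` Os -> admissible p ->
  almost_clopen Q (saturation (Om := Om) (G := G) (cell p)).
Proof.
move=> cQ QO [p0 pO pinj pA].
have [W [Q' [oW QW WQ' cQ' QO']]] := compact_neighborhood HO hom cQ QO.
pose C := ccell p `|` Q'.
have cC : compact C by apply: compactU.
have CO : C `<=` Os by move=> y [/pO|/QO'].
pose F := [set g | G g /\ exists2 y, C y & C (act g y)].
have fF : finite_set F := act_proper HO HG hom cC CO.
pose sph := [set y | `|y - p.1| = p.2].
have sphO : sph `<=` Os by move=> y h; apply: pO; rewrite (h : _ = _).
pose N := \bigcup_(g in F) (Os `&` act g @^-1` sph).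
have mN g : G g -> borel_set (Os `&` act g @^-1` sph).
  by move=> Gg; exact: (continuous_preimage_borel oOs (fun y Oy => act_continuous HO HG Gg Oy) (@sphere_borel _ _)).
exists N; split.
- by apply: (@fin_bigcup_measurable _ (borel R d)) => // g [Gg _]; exact: mN.
- apply: finite_null => // g [Gg _]; split; first exact: mN.
  rewrite (translate_measure Gg (@sphere_borel _ _) sphO)//.
  by move=> h y Gh h1 h2; apply: (pinj h y Gh); rewrite ((h1,h2) : (_ = _) * (_ = _)).
move=> y Qy nN; have Oy := QO _ Qy.
have cont g : G g -> {for y, continuous (fun z => `|act g z - p.1|)}.
  move=> Gg; apply: (@continuous_comp _ _ _ (act g) (fun v => `|v - p.1|)).
    exact: (act_continuous HO HG Gg Oy).
  exact: norm_sub_continuous.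
have nO : \near y, Os y by exact: open_nbhs_nbhs.
have [[g [Fg hg]]|none] := pselect (exists g, F g /\ `|act g y - p.1| < p.2).
  have [Gg _] := Fg; left; apply: filterS (filterI nO (near_lt (cont g Gg) hg)) => z [Oz hz].
  by split => //; exists g.
right.
have nW : \near y, W y by apply: open_nbhs_nbhs; split => //; exact: QW.
have nF : \near y, forall g, F g -> p.2 < `|act g y - p.1|.
  apply: (filter_finite (P := fun g z => p.2 < `|act g z - p.1|) fF) => g Fg; have [Gg _] := Fg.
  apply: (near_gt (cont g Gg)); have [h|h|h] := ltgtP `|act g y - p.1| p.2 => //.
    by case: none; exists g.
  by case: nN; exists g.
apply: filterS (filterI nW nF) => z [Wz hz] [Oz [g Gg gz]].
have Fg : F g by split => //; exists z; [right; exact: WQ'|left; exact: ltW].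
by have := lt_trans (hz g Fg) gz; rewrite ltxx.
Qed.

(* Each cell is injective modulo G, so removing the orbits of the previous cells
   leaves exactly one representative of every orbit that meets the list. *)
Fixpoint fund (l : seq ('cV[R]_d * R)) : set 'cV[R]_d :=
  if l is p :: l' then cell p `|` (fund l' `\` saturation (Om := Om) (G := G) (cell p)) else set0.

Let eq_pair_in (p : 'cV[R]_d * R) l (P : 'cV[R]_d * R -> Prop) :
  (forall p', p' \in p :: l -> P p') -> P p /\ forall p', p' \in l -> P p'.
Proof.
by move=> h; split => [|p' pl]; apply: h; [exact: mem_head|rewrite in_cons pl orbT].
Qed.

Lemma fund_compact l : (forall p, p \in l -> admissible p) ->
  exists Q, [/\ compact Q, Q `<=` Os & fund l `<=` Q].
Proof.
elim: l => [_|p l IH /eq_pair_in [[p0 pO _ _] /IH [Q [cQ QO fQ]]]].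
  by exists set0; split => //; exact: compact0.
exists (ccell p `|` Q); split; first exact: compactU.
- by move=> y [/pO|/QO].
- by move=> y [h|[/fQ h _]]; [left; exact: ltW|right].
Qed.

Let cell_sat_borel p : admissible p -> borel_set (saturation (Om := Om) (G := G) (cell p)).
Proof.
move=> [p0 pO _ _]; apply: (saturation_borel HO HG hom (@cell_borel p) (@ccell_compact p) pO).
by move=> y; exact: ltW.
Qed.

Lemma fund_borel l : (forall p, p \in l -> admissible p) -> borel_set (fund l).
Proof.
elim: l => [_|p l IH /eq_pair_in [hp /IH ml]]; first exact: borel0.
by apply: borelU; [exact: cell_borel|apply: borelD => //; exact: cell_sat_borel].
Qed.

Lemma fund_almost_clopen l Q : (forall p, p \in l -> admissible p) ->
  compact Q -> Q `<=` Os -> almost_clopen Q (fund l).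
Proof.
move=> + cQ QO; elim: l => [_|p l IH /eq_pair_in [hp /IH ml]].
  exists set0; split; [exact: borel0|exact: measure0|].
  by move=> y _ _; right; apply: filterS filterT => z _ [].
apply: almost_clopenU; first exact: cell_almost_clopen.
by apply: almost_clopenD => //; exact: saturation_almost_clopen.
Qed.

Lemma fund_inj l g y : (forall p, p \in l -> admissible p) ->
  G g -> fund l y -> fund l (act g y) -> g = 1%:M.
Proof.
move=> hl Gg; have Oy : fund l y -> Os y.
  by have [Q [_ QO fQ]] := fund_compact hl; move=> /fQ /QO.
move: hl Oy; elim: l => [_ _ []|p l IH hl Oy fy fgy]; have {}Oy := Oy fy.
have [[p0 pO pinj _] hl'] := eq_pair_in hl.
case: fy fgy => [cy|[fy ny]] [cgy|[fgy ngy]].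
- by apply: (pinj g y Gg); exact: ltW.
- case: ngy; split; first exact: (act_Os HO HG).
  by exists (invmx g); [exact: (G_inv HG)|rewrite (actKV HO HG Gg Oy)].
- by case: ny; split => //; exists g.
- exact: IH.
Qed.

Lemma fund_cover l p y : (forall p, p \in l -> admissible p) -> p \in l -> Os y -> cell p y ->
  exists2 g, G g & fund l (act g y).
Proof.
move=> hl pl Oy cy.
have {cy} sy : saturation (Om := Om) (G := G) (cell p) y.
  by split => //; exists 1%:M; [exact: (G_1 HG)|rewrite act1].
elim: l hl pl => // p' l IH hl; have [_ hl'] := eq_pair_in hl.
have [[_ [g Gg gy]] _|ns] := pselect (saturation (Om := Om) (G := G) (cell p') y).
  by exists g => //; left.
rewrite in_cons => /orP[/eqP e|pl]; first by move: sy; rewrite e.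
have [g Gg gy] := IH hl' pl; exists g => //; right; split => // h; apply: ns.
exact: (saturation_act_inv HO HG Gg Oy h).
Qed.

(** Finitely many admissible cells cover a compact sublevel set that meets every orbit; [fund] makes
    them disjoint modulo the group. *)
Lemma fund_exists : exists b Q, [/\ borel_set b, [/\ compact Q, Q `<=` Os & b `<=` Q],
  forall g y, G g -> b y -> b (act g y) -> g = 1%:M,
  forall y, Os y -> exists2 g, G g & b (act g y) &
  exists2 N, borel_set N & closure b `\` b° `<=` N /\ A N = 0%E].
Proof.
have [e e0 he] := act_cocompact HO HG hom.
have cQ0 := om_sublevel_compact hom (dual_closure_compact HO) e0.
set Q0 := [set y | _] in cQ0.
have ex q : exists r, Os q -> admissible (q, r).
  have [Oq|nO] := pselect (Os q); last by exists 0.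
  by have [r hr] := admissible_exists Oq; exists r.
have [rad hrad] := choice ex.
have [D DQ cov] : finite_subset_cover Q0 (fun q => cell (q, rad q)) Q0.
  move: cQ0; rewrite compact_cover; apply.
    by move=> q _; exact: cell_open.
  move=> q Qq; exists q => //; rewrite /cell /= subrr normr0.
  by case: Qq => /hrad [].
have /finite_seqP [sq sE] := finite_fset D.
pose l := [seq (q, rad q) | q <- sq].
have hl p : p \in l -> admissible p.
  move=> /mapP [q qs ->]; apply: hrad; have : [set` sq] q by [].
  by rewrite -sE => /DQ; rewrite inE => -[].
have [Q [cQ QO fQ]] := fund_compact hl.
exists (fund l), Q; split => //.
- exact: fund_borel.
- by move=> g y; exact: fund_inj.
- move=> y Oy; have [g Gg gy] := he y Oy; have Ogy := act_Os HO HG Gg Oy.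
  have [q qD cq] := cov (act g y) (conj Ogy gy).
  have ql : (q, rad q) \in l.
    by apply: map_f; have : [set` sq] q by rewrite -sE.
  have [h Gh hy] := fund_cover hl ql Ogy cq.
  exists (g *m h); first exact: (G_mul HG).
  by rewrite (act_mul HO HG Gg Gh (subset_closure Oy)).
have [N [mN N0 hN]] := fund_almost_clopen hl cQ QO.
exists N => //; split => // y [cy ny]; apply: contrapT => nN.
have clQ : closed Q by apply: compact_closed.
have Qy : Q y by rewrite ((closure_id Q).1 clQ); exact: (closureS fQ cy).
case: (hN y Qy nN) => [h|h]; first exact: ny.
by have [z [fz]] := cy _ h; apply.
Qed.

End fundamental_domain.

(** * Integration on quotients *)

Section quotient_integral.
Context {R : realType} {d : nat} {Om : set 'cV[R]_d} {G : set 'M[R]_(d + 1)}.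
Hypothesis (HO : pointed_domain Om) (HG : dividing_group G Om).
Hypothesis d0 : (0 < d)%N.
Let Os := dual_domain Om.
Context {om : 'cV[R]_d -> R}.
Hypothesis hom : cheng_yau Os om.
Let oOs : open Os := dual_open HO.
Implicit Types (y z q : 'cV[R]_d) (g h : 'M[R]_(d + 1)) (c : set 'cV[R]_d).
Local Notation orb := (group_orbit G (@dual_act R d)).
Local Notation QS := (quotient_set G (@dual_act R d) Os).
Local Notation qspace := (quotient_space G (@dual_act R d) Os).
Variable A : {measure set (borel R d) -> \bar R}.
Hypothesis fA : forall Q, compact Q -> Q `<=` Os -> (A Q < +oo)%E.
Variable AK : {measure set qspace -> \bar R}.
Hypothesis hAK : descends A AK.
Variables (b Q : set 'cV[R]_d).
Hypotheses (mb : borel_set b) (cQ : compact Q) (QO : Q `<=` Os) (bQ : b `<=` Q).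
Hypothesis binj : forall g y, G g -> b y -> b (act g y) -> g = 1%:M.
Hypothesis bcov : forall y, Os y -> exists2 g, G g & b (act g y).
Let bO : b `<=` Os := subset_trans bQ QO.

Let orbit_image_measurable c : borel_set c -> c `<=` b ->
  measurable (orb @` c : set qspace).
Proof.
move=> mc cb; apply: sub_sigma_algebra; rewrite /=.
rewrite (_ : _ `&` _ = saturation (Om := Om) (G := G) c).
  exact: (saturation_borel HO HG hom mc cQ QO (subset_trans cb bQ)).
apply/seteqP; split => y.
  move=> [Oy [z cz e]]; split => //.
  by have [g Gg zg] := orbit_eq HG (esym e); exists g => //; rewrite -zg.
move=> [Oy [g Gg cg]]; split => //; exists (act g y) => //.
exact: (orbit_act HO HG Gg Oy).
Qed.

Let QSE : QS = orb @` b.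
Proof.
apply/seteqP; split => o [y].
  move=> Oy <-; have [g Gg bg] := bcov Oy; exists (act g y) => //.
  exact: (orbit_act HO HG Gg Oy).
by move=> /bO Oy <-; exists y.
Qed.

Lemma quotient_integral (u : 'cV[R]_d -> R) : (forall y, Os y -> {for y, continuous u}) ->
  (forall g y, G g -> Os y -> u (act g y) = u y) ->
  (\int[AK]_(o in QS) (quotient_fun u o)%:E)%E = (\int[A]_(y in b) (u y)%:E)%E.
Proof.
move=> cu inv.
have [p nOp] : exists p, ~ Os p.
  have [B B0 hB] := dual_bound HO; exists ((B + 1) *: basis_vec R (Ordinal d0)) => /hB.
  apply/negP; rewrite -ltNge; apply: lt_le_trans (norm_coord _ (Ordinal d0)).
  by rewrite !mxE !eqxx mulr1 ger0_norm ?ltrDl// addr_ge0// ltW.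
have nbp : ~ b p by move=> /bO.
(* The section of the quotient map with values in [b]. Elements of the quotient type are arbitrary
   sets of points; those that are not orbits go to [p], outside of [b], so that preimages of subsets
   of [b] consist of orbits. *)
pose rho (o : qspace) : borel R d := if pselect (QS o) then xget 0 (o `&` b) else p.
have rhoP o : QS o -> b (rho o) /\ orb (rho o) = o.
  move=> Qo; rewrite /rho; case: (pselect (QS o)) => [h|//] /=; case: Qo {h} => y Oy <-.
  have [g Gg bg] := bcov Oy.
  case: xgetP => [z _ [oz bz]|/(_ (act g y)) []]; last by split => //; apply/(orbitP HG); exists g.
  split => //; have [h Gh ->] := (orbitP HG y z).1 oz.
  exact: (orbit_act HO HG Gh Oy).
have rhoN o : ~ QS o -> rho o = p by move=> nQ; rewrite /rho; case: (pselect (QS o)).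
have rhoE z : b z -> rho (orb z) = z.
  move=> bz; have [br e] := rhoP (orb z) (ex_intro2 _ _ z (bO bz) erefl).
  have [g Gg zg] := orbit_eq HG (esym e); rewrite zg in br *.
  by rewrite (binj Gg bz br) act1.
have pre c : c `<=` b -> rho @^-1` c = orb @` c.
  move=> cb; apply/seteqP; split => o.
    have [Qo|nQ] := pselect (QS o); last by rewrite /preimage /= (rhoN _ nQ) => /cb.
    by have [_ e] := rhoP o Qo; move=> cr; exists (rho o).
  by move=> [z cz <-]; rewrite /preimage /= (rhoE _ (cb _ cz)).
have mrho : measurable_fun [set: qspace] rho.
  move=> _ c mc; rewrite setTI.
  have mcb : borel_set (c `&` b) by exact: borelI.
  have E : rho @^-1` c = (orb @` (c `&` b)) `|` (~` QS `&` [set _ | c p]).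
    apply/seteqP; split => o.
      have [Qo|nQ] := pselect (QS o); rewrite /preimage /=.
        by have [br e] := rhoP o Qo; move=> cr; left; exists (rho o).
      by rewrite (rhoN _ nQ) => cp; right.
    move=> [[z [cz bz] <-]|[nQ cp]]; rewrite /preimage /=; first by rewrite (rhoE _ bz).
    by rewrite (rhoN _ nQ).
  rewrite E; apply: measurableU.
    by apply: orbit_image_measurable => // y [].
  apply: measurableI; first by apply: measurableC; rewrite QSE; exact: orbit_image_measurable.
  have [cp|ncp] := pselect (c p).
    have -> : [set _ : qspace | c p] = setT by apply/seteqP; split.
    exact: measurableT.
  have -> : [set _ : qspace | c p] = set0 by apply/seteqP; split.
  exact: measurable0.
have Eb : rho @^-1` b = QS by rewrite pre// QSE.
(* [u] is only known to be continuous on the dual domain; the cutoff by 0 outside of [b] makes it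
   measurable everywhere, as the change of variables along [rho] requires. *)
pose u' (y : borel R d) : R := if pselect (b y) then u y else 0.
have u'E y : b y -> u' y = u y by rewrite /u'; case: (pselect (b y)).
have mu' : measurable_fun [set: borel R d] (u' : borel R d -> measurableTypeR R).
  have mu := open_continuous_borel oOs cu mb bO.
  move=> _ B mB; rewrite setTI.
  have E : u' @^-1` B = (b `&` u @^-1` B) `|` (~` b `&` [set _ | B 0]).
    apply/seteqP; split => y; rewrite /preimage /= /u'.
      by case: (pselect (b y)) => by_ Bu; [left|right].
    by case: (pselect (b y)) => by_ [[]|[]].
  rewrite E; apply: measurableU; first exact: mu.
  apply: measurableI; first exact: measurableC.
  have [cp|ncp] := pselect (B 0).
    have -> : [set _ : borel R d | B 0] = setT by apply/seteqP; split.
    exact: measurableT.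
  have -> : [set _ : borel R d | B 0] = set0 by apply/seteqP; split.
  exact: measurable0.
have AKm c : borel_set c -> c `<=` b -> AK (rho @^-1` c) = A c.
  move=> mc cb; rewrite (pre _ cb).
  apply: (orbit_measure HG hAK mc (subset_trans cb bO)) => g y Gg cy cgy.
  exact: (binj Gg (cb _ cy) (cb _ cgy)).
have Afin : (A b < +oo)%E.
  by apply: le_lt_trans (fA cQ QO); apply: le_measure; rewrite ?inE//; apply: closed_borel; apply: compact_closed.
have mEb : measurable (rho @^-1` b) by rewrite -[X in measurable X]setTI; exact: mrho.
have iu : AK.-integrable (rho @^-1` b) ((EFin \o u') \o rho).
  apply: (measurable_bounded_integrable (f := u' \o rho)) => //.
  - by rewrite AKm.
  - apply: (measurable_funS measurableT) => //; exact: measurableT_comp mu' mrho.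
  - have co : {within Q, continuous u}.
      by apply/subspace_continuousP => y /QO Oy; apply: cvg_within_filter; exact: cu.
    have /compact_bounded [M [_ hM]] := continuous_compact co cQ.
    exists M; split; first exact: num_real.
    move=> N MN o bo; rewrite /= (u'E _ bo); apply: (hM N MN); exists (rho o) => //.
    exact: bQ.
have mEu : measurable_fun [set: borel R d] (EFin \o u') by exact/measurable_EFinP.
transitivity (\int[AK]_(o in rho @^-1` b) ((EFin \o u') \o rho) o)%E.
  rewrite Eb; apply: eq_integral => o; rewrite inE => Qo.
  have [br e] := rhoP o Qo; rewrite /= (u'E _ br) /quotient_fun; congr EFin.
  have : o (rho o) by rewrite -{1}e; exact: (orbit_refl HG).
  case: xgetP => [z _ oz _|/(_ (rho o)) //].
  by move: oz; rewrite -{1}e => /(orbitP HG) [g Gg ->]; exact: (inv g _ Gg (bO br)).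
rewrite -(integral_pushforward mrho mEu iu mb).
transitivity (\int[A]_(y in b) (EFin \o u') y)%E.
  apply: eq_measure_integral => c mc cb; exact: AKm.
by apply: eq_integral => y; rewrite inE => by_; rewrite /= u'E.
Qed.

End quotient_integral.

(** * The covolume *)

Section covolumes.
Context {R : realType} {d : nat} {Om : set 'cV[R]_d} {G : set 'M[R]_(d + 1)}.
Hypothesis (HO : pointed_domain Om) (HG : dividing_group G Om).
Let Os := dual_domain Om.
Context {om : 'cV[R]_d -> R}.
Hypothesis hom : cheng_yau Os om.
Implicit Types (y z : 'cV[R]_d) (X Y : 'cV[R]_(d + 1)) (E : set 'cV[R]_(d + 1)) (g : 'M[R]_(d + 1)).
Context {Gt : set (affmap R (d + 1))} {tau : 'M[R]_(d + 1) -> 'cV[R]_(d + 1)}.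
Hypothesis HT : translation_part Gt G tau.
Local Notation aff := (@aff_act R (d + 1)).
Local Notation orb := (group_orbit Gt aff).
Variable D : set 'cV[R]_(d + 1).
Hypothesis hD : greatest_tau_convex (cone Om) Gt D.
Variable volD : {measure set (quotient_space Gt aff D) -> \bar R}.
Hypothesis hvolD : descends (@vol R (d + 1)) volD.
Variable b : set 'cV[R]_d.
Hypothesis mb : borel_set b.
Hypothesis binj : forall g y, G g -> b y -> b (act g y) -> g = 1%:M.
Hypothesis bcov : forall y, Os y -> exists2 g, G g & b (act g y).

Definition affine_invariant E : Prop := forall g X, G g -> E X -> E (aff (g, tau g) X).

Let tau1 : tau 1%:M = 0.
Proof. by case: HT => -[_ h1 _ _] _ /(_ _ h1) []. Qed.

Let aff1 X : aff (1%:M, tau 1%:M) X = X.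
Proof. by rewrite /aff_act /= mul1mx tau1 addr0. Qed.

Let affVK g X : G g -> aff (invmx g, tau (invmx g)) (aff (g, tau g) X) = X.
Proof.
move=> Gg; have Gi := G_inv HG Gg.
by have := aff_invK HG HT X Gi; rewrite invmxK.
Qed.

Let orbP X Y : orb X Y <-> exists2 g, G g & Y = aff (g, tau g) X.
Proof.
have [_ h2 h3] := HT; split => [[p Gp <-]|[g Gg ->]].
  have [Gp1 e] := h3 _ Gp; exists p.1 => //; rewrite -e; by case: (p).
by exists (g, tau g) => //; exact: h2.
Qed.

Let orb_refl X : orb X X.
Proof. by apply/orbP; exists 1%:M; [exact: (G_1 HG)|rewrite aff1]. Qed.

Let orb_eq X Y : orb X = orb Y -> exists2 g, G g & Y = aff (g, tau g) X.
Proof. by move=> e; apply/orbP; rewrite e; exact: orb_refl. Qed.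

Let tau_mul g h : G g -> G h -> tau (g *m h) = g *m tau h + tau g.
Proof.
move=> Gg Gh; have [[_ _ h1 _] h2 h3] := HT.
by have [_ /= <-] := h3 _ (h1 _ _ (h2 _ Gg) (h2 _ Gh)).
Qed.

Let orb_aff g X : G g -> orb (aff (g, tau g) X) = orb X.
Proof.
have sub h Y : G h -> orb (aff (h, tau h) Y) `<=` orb Y.
  move=> Gh Z /orbP [k Gk ->]; apply/orbP; exists (k *m h); first exact: (G_mul HG).
  by rewrite /aff_act /= (tau_mul Gk Gh) mulmxDr mulmxA addrA.
move=> Gg; apply/seteqP; split; first exact: sub.
by rewrite -{1}(affVK X Gg); apply: sub; exact: (G_inv HG).
Qed.

Let D_invariant : affine_invariant D.
Proof.
have [[_ inv] _] := hD; have [_ h2 _] := HT.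
by move=> g X Gg DX; rewrite -(inv _ (h2 _ Gg)); exists X.
Qed.

Let orbit_image_measurable E : borel_set E -> E `<=` D -> affine_invariant E ->
  measurable (orb @` E : set (quotient_space Gt aff D)).
Proof.
move=> mE ED inv; apply: sub_sigma_algebra; rewrite /=.
rewrite (_ : _ `&` _ = E)//; apply/seteqP; split => X; last by move=> EX; split; [exact: ED|exists X].
by move=> [DX [Y EY /orb_eq [g Gg ->]]]; exact: inv.
Qed.

Section one_support.
Variable s : 'cV[R]_d -> R.
Hypothesis cs : forall y, Os y -> {for y, continuous s}.
Hypothesis es : extends Os s.
Hypothesis qs : equivariant (Om := Om) (G := G) tau s.
Hypothesis DE : D = outer_domain (Om := Om) s.
Local Notation cmax := (amax Os (cal om) (cbe om s)).
Local Notation reg := (region (Om := Om) (om := om) s b).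
Local Notation cu := (cuniq (Om := Om) (om := om) s).

Let cmax_aff g X y : G g -> Os y -> cmax (aff (g, tau g) X) y <-> cmax X (act g y).
Proof. exact: (cmax_act HO HG hom qs). Qed.

Lemma cuniq_invariant g X : G g -> cu X -> cu (aff (g, tau g) X).
Proof.
move=> Gg uX y z my mz; have [[Oy _] [Oz _]] := (my, mz).
move/(cmax_aff X Gg Oy): my => my; move/(cmax_aff X Gg Oz): mz => mz.
by rewrite -(actKV HO HG Gg Oy) (uX _ _ my mz) (actKV HO HG Gg Oz).
Qed.

(** Maximizers are equivariant and unique on [E], so each orbit in [E] meets the region of [b]
    exactly once, and [descends] applies to that part. *)
Lemma invariant_volume E : borel_set E -> E `<=` D -> affine_invariant E ->
  E `<=` cu -> volD (orb @` E) = vol (E `&` reg).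
Proof.
move=> mE ED inv Eu.
have pk X : E X -> cmax X (cpick (Om := Om) (om := om) s X).
  move=> EX; have [y my] : cmax X !=set0.
    by apply: (cmax_nonempty HO hom cs es); rewrite -DE; exact: ED.
  by rewrite /cpick (pick_maxE (Eu _ EX) my).
have -> : orb @` E = orb @` (E `&` reg).
  apply/seteqP; split => o; last by move=> [X [EX _] <-]; exists X.
  move=> [X EX <-]; have my := pk X EX; set y := cpick s X in my; have [Oy _] := my.
  have [g Gg bg] := bcov Oy; have Gi := G_inv HG Gg; have Og := act_Os HO HG Gg Oy.
  pose Y := aff (invmx g, tau (invmx g)) X.
  have EY : E Y by exact: inv.
  have mY : cmax Y (act g y).
    by apply/(cmax_aff X Gi Og); rewrite (actKV HO HG Gg Oy).
  exists Y; last exact: orb_aff.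
  split => //; split; [by rewrite -DE; exact: ED|exact: Eu|].
  by rewrite /cpick (pick_maxE (Eu _ EY) mY).
apply: hvolD.
- apply: borelI => //; exact: (region_borel HO hom cs es mb).
- by move=> X [/ED].
- move=> X Y /[!inE] -[EX [_ uX bX]] [EY [_ uY bY]] /orb_eq [g Gg YE].
  have mX := pk X EX; have mY := pk Y EY; have [Oy _] := mY.
  have := mY; rewrite {1}YE => /(cmax_aff X Gg Oy) mX'.
  have e : act g (cpick s Y) = cpick s X := uX _ _ mX' mX.
  have g1 : g = 1%:M by apply: (binj Gg bY); rewrite e.
  by rewrite YE g1 aff1.
Qed.

End one_support.

Variable K : set 'cV[R]_(d + 1).
Hypothesis HK : tau_convex (cone Om) Gt K.
Let s := support_fun K.
Let es : extends Os s := support_extends HO HG hom HT HK.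
Let cs y : Os y -> {for y, continuous s} := support_continuous HO HK (y := y).

(** The region of [b] represents every orbit only where the maximizer is unique. The exceptional set
    is null in [D], but its image in the quotient must be shown null as well, and [descends] sees
    only sets that are injective modulo the group. *)
Lemma covolume_region (K' : set 'cV[R]_(d + 1)) : borel_set K' -> K' `<=` D ->
  affine_invariant K' ->
  covolume volD K' = vol ((D `\` K') `&` region (Om := Om) (om := om) s b).
Proof.
move=> mK' KD inv'.
have DE : D = outer_domain (Om := Om) s := tau_outer_domain HO HG hom HT HK hD.
have qs := support_equivariant HO HG HT HK.
have [HD _] := hD.
pose sD := support_fun D.
have DE' : D = outer_domain (Om := Om) sD := tau_outer_domain HO HG hom HT HD hD.
have esD : extends Os sD := support_extends HO HG hom HT HD.
have csD y : Os y -> {for y, continuous sD} := support_continuous HO HD (y := y).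
have qsD := support_equivariant HO HG HT HD.
have mD : borel_set D by rewrite DE; apply: open_borel; exact: (outer_open HO es).
pose E := D `\` K'.
have mE : borel_set E by exact: borelD.
have invE : affine_invariant E.
  move=> g X Gg [DX nX]; split; first exact: D_invariant.
  by move=> /(inv' _ _ (G_inv HG Gg)); rewrite (affVK X Gg).
pose NU := cnonuniq (Om := Om) (om := om) s.
have mNU : borel_set NU by exact: (cnonuniq_borel HO hom cs es).
have u_inv g X : G g -> ~ cuniq (Om := Om) (om := om) s X -> ~ cuniq (Om := Om) (om := om) s (aff (g, tau g) X).
  by move=> Gg nu /(cuniq_invariant qs (G_inv HG Gg)); rewrite (affVK X Gg).
have NUP X : D X -> NU X <-> ~ cuniq (Om := Om) (om := om) s X.
  by move=> DX; split => [[]//|nu]; split => //; rewrite -/(outer_domain s) -DE.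
pose E1 := E `\` NU; pose E2 := E `&` NU.
have mE1 : borel_set E1 by exact: borelD.
have mE2 : borel_set E2 by exact: borelI.
have uE1 : E1 `<=` cuniq (Om := Om) (om := om) s.
  by move=> X [[DX _] nN]; apply: contrapT => nu; apply: nN; exact/(NUP X DX).
have invE1 : affine_invariant E1.
  move=> g X Gg hX; have [EX _] := hX; have EgX := invE g X Gg EX; split => //.
  have [DgX _] := EgX; move/(NUP _ DgX); apply; exact: (cuniq_invariant qs Gg (uE1 _ hX)).
have invE2 : affine_invariant E2.
  move=> g X Gg [EX NX]; have EgX := invE g X Gg EX; split => //.
  have [[DX _] [DgX _]] := (EX, EgX); apply/(NUP _ DgX); apply: u_inv => //; exact/(NUP X DX).
have E1D : E1 `<=` D by move=> X [[]].
have E2D : E2 `<=` D by move=> X [[]].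
have QE : quotient_set Gt aff D `\` quotient_set Gt aff K' = orb @` E1 `|` orb @` E2.
  apply/seteqP; split => o.
    move=> [[X DX <-] nK]; have EX : E X by split => // KX; apply: nK; exists X.
    by have [NX|NX] := pselect (NU X); [right|left]; exists X.
  have key X : E X -> (quotient_set Gt aff D `\` quotient_set Gt aff K') (orb X).
    move=> [DX nX]; split; first by exists X.
    by move=> [Y KY /orb_eq [g Gg XE]]; apply: nX; rewrite XE; exact: inv'.
  by move=> [[X [EX _] <-]|[X [EX _] <-]]; exact: key.
have disj : orb @` E1 `&` orb @` E2 = set0.
  apply/seteqP; split => // o [[X hX <-] [Y hY /orb_eq [g Gg XE]]].
  have [_ nN] := hX; apply: nN; rewrite XE; by have [_] := invE2 g Y Gg hY.
have m1 := orbit_image_measurable mE1 E1D invE1.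
have m2 := orbit_image_measurable mE2 E2D invE2.
rewrite /covolume QE (_ : volD _ = (volD (orb @` E1) + volD (orb @` E2))%E); last exact: measureU.
rewrite (invariant_volume cs es qs DE mE1 E1D invE1 uE1).
(* For the support function of [D] itself all maximal values on [D] are negative, so maximizers are
   unique everywhere. Its region thus represents the orbits of the exceptional set by a subset of a
   null set. *)
have uD : E2 `<=` cuniq (Om := Om) (om := om) sD.
  by move=> X /E2D DX; exact: (cmax_uniq HO HG hom HT HD DX).
rewrite (invariant_volume csD esD qsD DE' mE2 E2D invE2 uD).
have -> : vol (E2 `&` region (Om := Om) (om := om) sD b) = 0%E.
  by apply: vol0_sub (cnonuniq_null HO hom cs es) => X [[_ NX] _].
rewrite adde0; congr vol; apply/seteqP; split => X.
  by move=> [[EX _] rX].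
by move=> [EX rX]; split => //; split => // -[_ nu]; apply: nu; case: rX.
Qed.

End covolumes.

Lemma translation_part_exists {R : realType} {d : nat} {Gt : set (affmap R (d + 1))}
    {G : set 'M[R]_(d + 1)} : affine_deformation Gt G -> exists tau, translation_part Gt G tau.
Proof.
move=> [sGt [fG inj sur]]; exists (fun g => xget 0 [set v | Gt (g, v)]).
have lift g : G g -> Gt (g, xget 0 [set v | Gt (g, v)]).
  move=> /sur [p Gp pg]; case: xgetP => [v _ //|/(_ p.2)].
  by case; rewrite /= -pg; case: (p) Gp.
split => // p Gp; have Gp1 : G p.1 by exact: fG.
split => //; have e := inj p (p.1, xget 0 [set v | Gt (p.1, v)]).
by rewrite {1}(e _ _ erefl)// inE//; exact: lift.
Qed.

Section contact_null.
Context {R : realType} {d : nat} {Om : set 'cV[R]_d} {G : set 'M[R]_(d + 1)}.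
Hypothesis (HO : pointed_domain Om) (HG : dividing_group G Om).
Let Os := dual_domain Om.
Context {om : 'cV[R]_d -> R}.
Hypothesis hom : cheng_yau Os om.
Hypothesis d0 : (0 < d)%N.
Context {Gt : set (affmap R (d + 1))} {tau : 'M[R]_(d + 1) -> 'cV[R]_(d + 1)}.
Hypothesis HT : translation_part Gt G tau.
Context {K : set 'cV[R]_(d + 1)}.
Hypothesis HK : tau_convex (cone Om) Gt K.
Let s := support_fun K.
Context {S : 'I_d.+1 -> {measure set (borel R d) -> \bar R}}.
Hypothesis hS : steiner_measures Os om K S.

(** The area is the integral of - om(y(x)), which is positive, so it vanishes only if the domain of
    integration is null. *)
Lemma contact_null (c Q : set 'cV[R]_d) : borel_set c -> compact Q -> Q `<=` Os -> c `<=` Q ->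
  S ord_max c = 0%E ->
  vol [set x | huniq (Om := Om) s x /\ c (hpick (Om := Om) s x)] = 0%E.
Proof.
move=> mc cQ QO cQs; have cO := subset_trans cQs QO.
have es : extends Os s := support_extends HO HG hom HT HK.
have [-> _] := area_contact HO HG hom d0 HT HK hS mc cQ QO cQs.
set E : set (borel R d) := [set x | _].
have -> : (\int[lebn d0]_x (density (Om := Om) s om c x)%:E)%E =
    (\int[lebn d0]_(x in E) (- om (hpick (Om := Om) s x))%:E)%E by exact: density_integral.
have mE : measurable E := hpick_borel HO d0 es mc.
have mw : measurable_fun E (fun x : borel R d => (- om (hpick (Om := Om) s x))%:E).
  apply/measurable_EFinP; apply: measurableT_comp; first exact: oppr_measurable.
  exact: (hpick_fun_measurable HO HG hom d0 HT HK mc cO (fun y Oy => om_continuous hom Oy)).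
have pos x : E x -> 0 < - om (hpick (Om := Om) s x).
  by move=> [_ cx]; rewrite oppr_gt0 (om_lt0 hom (cO _ cx)).
move=> i0.
have : (\int[lebn d0]_(x in E) `|(- om (hpick (Om := Om) s x))%:E|)%E = 0%E.
  rewrite -[RHS]i0; apply: eq_integral => x; rewrite inE => Ex.
  by rewrite gee0_abs// lee_fin ltW// pos.
move=> /(ae_eq_integral_abs (lebn d0) mE mw) [N [mN N0 sub]].
apply: (vol0_sub _ N0); apply: subset_trans sub => x Ex /= /(_ Ex) [] /eqP.
by rewrite gt_eqF// pos.
Qed.

End contact_null.


Theorem theorem3 (R : realType) (d : nat) (hd : (2 <= d)%N)
  (Omega : set 'cV[R]_d)
  (hOmega : convex_domain Omega) (hbounded : bounded_set Omega) (h0 : Omega 0)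
  (Gamma : set 'M[R]_(d + 1))
  (hGamma : SL_subgroup Gamma) (hdiv : divides Gamma Omega)
  (Gammat : set (affmap R (d + 1)))
  (hGammat : affine_deformation Gammat Gamma)
  (omega : 'cV[R]_d -> R) (homega : cheng_yau (dual_domain Omega) omega)
  (D : set 'cV[R]_(d + 1))
  (hD : greatest_tau_convex (cone Omega) Gammat D)
  (volD : {measure set (quotient_space Gammat (@aff_act R (d + 1)) D) -> \bar R})
  (hvolD : descends (@vol R (d + 1)) volD)
  (K : set 'cV[R]_(d + 1)) (hK : tau_convex (cone Omega) Gammat K)
  (A : {measure set (borel R d) -> \bar R})
  (hA : area_measure (dual_domain Omega) omega K A)
  (AK : {measure set (quotient_space Gamma (@dual_act R d) (dual_domain Omega))
         -> \bar R})
  (hAK : descends A AK)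
  (f : 'cV[R]_d -> R)
  (hfc : {within dual_domain Omega, continuous f})
  (hfe : tau_equivariant (dual_domain Omega) omega Gamma (fun=> 0) f) :
  (((covolume volD (domain_of (dual_domain Omega)
                     (fun y => (support_fun K y + t * f y)%R))
     - covolume volD K) * (t^-1)%:E)%E @[t --> (0 : R)^'])
  --> (\int[AK]_(o in quotient_set Gamma (@dual_act R d) (dual_domain Omega))
        (quotient_fun (fun y => f y / omega y) o)%:E)%E.

Proof.
have HO : pointed_domain Omega by [].
have HG : dividing_group Gamma Omega by [].
have d0 : (0 < d)%N := ltnW hd.
have [tau HT] := translation_part_exists hGammat.
have [S hS AE] := hA.
rewrite {}AE {hA A} in hAK.
set Os := dual_domain Omega.
have es : extends Os (support_fun K) := support_extends HO HG homega HT hK.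
have cs y : Os y -> {for y, continuous (support_fun K)} := support_continuous HO hK (y := y).
have qs := support_equivariant HO HG HT hK.
have cf y : Os y -> {for y, continuous f}.
  by move=> Oy; move: hfc; rewrite (continuous_open_subspace f (dual_open HO)); apply; rewrite inE.
have ef := (equivariantP HO HG homega (fun=> 0) f).1 hfe.
have [U U0 fU] := invariant_dominated HO HG homega cf ef.
have fA Q : compact Q -> Q `<=` Os -> (S ord_max Q < +oo)%E by case: hS => h _; exact: h.
(* The boundary of [b] is made null for the area measure, which is the measure that [descends]
   controls; [contact_null] then converts this into the Lebesgue statement that [volume_limit] asks
   for. *)
have [b [Q [mb [cQ QO bQ] binj bcov [N mN [bN N0]]]]] := fund_exists HO HG homega fA hAK.
have mQ : borel_set Q by apply: closed_borel; apply: compact_closed.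
have clQ : closed Q by apply: compact_closed.
have bdQ : closure b `\` b° `<=` Q.
  by move=> y [cy _]; rewrite ((closure_id Q).1 clQ); exact: (closureS bQ cy).
have mbd : borel_set (closure b `\` b°).
  by apply: borelD; [apply: closed_borel; exact: closed_closure|apply: open_borel; exact: open_interior].
have bd0 : S ord_max (closure b `\` b°) = 0%E.
  by apply/eqP; rewrite eq_le measure_ge0 andbT -N0; apply: le_measure; rewrite ?inE.
have null := contact_null HO HG homega d0 HT hK hS mbd cQ QO bdQ bd0.
have [_ lim] := volume_limit HO homega d0 cs es cf fU mb cQ QO bQ null.
have DE : D = outer_domain (Om := Omega) (support_fun K) := tau_outer_domain HO HG homega HT hK hD.
have cov t : covolume volD (domain_of Os (fun y => support_fun K y + t * f y)) =
    vol (outside (Om := Omega) (om := omega) (support_fun K) f b t).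
  have et : extends Os (fun y => support_fun K y + t * f y).
    exact: (@ft_extends R d Omega omega homega (support_fun K) es f U cf fU t).
  have qt : equivariant (Om := Omega) (G := Gamma) tau (fun y => support_fun K y + t * f y).
    move=> g y Gg Oy; rewrite {1}(qs g y Gg Oy) {1}(ef g y Gg Oy) dot0l addr0; ring.
  have [_ inv] := domain_tau_convex HO HG HT qt et; have [_ h2 _] := HT.
  rewrite (covolume_region HO HG homega HT hD hvolD mb binj bcov hK).
  - by rewrite DE.
  - by apply: open_borel; exact: (domain_open HO et).
  - move=> X; rewrite DE => /(perturb_domain homega es (@scaled_cont R d Omega f cf t)
      (@scaled_bound R d Omega omega f U fU t)) [].
    by [].
  - by move=> g X Gg KX; rewrite -(inv _ (h2 _ Gg)); exists X.
have cov0 : covolume volD K = vol (outside (Om := Omega) (om := omega) (support_fun K) f b 0).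
  rewrite -cov; congr covolume; rewrite {1}(support_domain HO HG homega HT hK).
  by congr domain_of; apply/funext => y; rewrite mul0r addr0.
have iE := quotient_integral HO HG d0 homega fA hAK mb cQ QO bQ binj bcov
  (u := fun y => f y / omega y) (ratio_continuous homega cf).
rewrite iE; last first.
  move=> g y Gg Oy; have Og := act_Os HO HG Gg Oy.
  have o1 : omega y != 0 by rewrite lt_eqF// (om_lt0 homega Oy).
  have o2 : omega (act g y) != 0 by rewrite lt_eqF// (om_lt0 homega Og).
  rewrite (hfe g y Gg Oy) dot0l addr0 -/(act g y); field.
  by rewrite o1 o2.
rewrite (area_transfer HO HG homega d0 HT hK hS cf fU mb cQ QO bQ).
under eq_fun do rewrite cov cov0.
exact: lim.
Qed.
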